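(* Let $k\ge 2$ be an integer, let $(S,H)$ be a generalized Fermat pair of type $(k,\infty)$ and let $\Gamma<{\rm PSL}_2({\mathbb R})$ be a Fuchsian group such that ${\mathbb H}^2/\Gamma=S/H$ (as orbifolds). Let $\Gamma'$ be the commutator subgroup of $\Gamma$, let $\Gamma^k$ be the subgroup generated by the $k$-powers of the elements of $\Gamma$, and let $\Gamma_k=\langle\Gamma',\Gamma^k\rangle$. Then there is a biholomorphism $\varphi:S\to{\mathbb H}^2/\Gamma_k$ such that $\varphi H\varphi^{-1}=\Gamma/\Gamma_k$.
   Context: ${\mathbb Z}_k$ is the cyclic group of order $k$, and ${\mathbb Z}_k^{\mathbb N}$ denotes the direct sum of countably infinitely many copies of ${\mathbb Z}_k$. ${\rm Aut}(S)$ is the group of conformal automorphisms of a Riemann surface $S$. Let $S$ be a non-compact connected Riemann surface and $H<{\rm Aut}(S)$. The pair $(S,H)$ is a generalized Fermat pair of type $(k,\infty)$ if: (i) $H\cong{\mathbb Z}_k^{\mathbb N}$; (ii) there is an infinite discrete set ${\mathcal B}\subset\widehat{\mathbb C}$ such that its set of limit (accumulation) points ${\mathcal B}'\neq\emptyset$ satisfies that $\widehat{\mathbb C}\setminus{\mathcal B}'$ is connected; (iii) there is a Galois branched covering $\pi:S\to\widehat{\mathbb C}\setminus{\mathcal B}'$ with deck group $H$, whose set of branch values is ${\mathcal B}$, each branch value having order $k$; (iv) (maximality) for every Riemann surface $R$ admitting a group of automorphisms ${\mathbb Z}_k^{\mathbb N}\cong G<{\rm Aut}(R)$ such that there is a Galois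 branched covering $P:R\to\widehat{\mathbb C}\setminus{\mathcal B}'$ with deck group $G$, whose branch value set is ${\mathcal B}$, each branch value of order $k$, there is a subgroup $J<H$ acting freely on $S$ such that, up to biholomorphisms, $R=S/J$ and $G=H/J$. The quotient orbifold $S/H$ has underlying Riemann surface $\widehat{\mathbb C}\setminus{\mathcal B}'$ and its cone points are the points of ${\mathcal B}$, each of order $k$. The group $\Gamma/\Gamma_k$ acts on ${\mathbb H}^2/\Gamma_k$ in the natural way. *)

(* Defs.v *)
(* MathComp-Analysis, over an arbitrary realType R; complex numbers are R[i]. *)
From HB Require Import structures.
From mathcomp Require Import all_boot all_order all_algebra complex.
From mathcomp Require Import all_classical all_reals all_analysis.

Set Implicit Arguments.
Unset Strict Implicit.
Unset Printing Implicit Defensive.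

Import Order.TTheory GRing.Theory Num.Theory.
Import numFieldNormedType.Exports.

Local Open Scope classical_set_scope.
Local Open Scope ring_scope.
Local Open Scope complex_scope.
Local Open Scope quotient_scope.

Record selfbij (T : Type) := SelfBij {
  bij_fun :> T -> T;
  bij_inv : T -> T;
  bij_funK : cancel bij_fun bij_inv;
  bij_invK : cancel bij_inv bij_fun }.

Section BijGroup.
Variable T : Type.

HB.instance Definition _ := gen_eqMixin (selfbij T).
HB.instance Definition _ := gen_choiceMixin (selfbij T).

Lemma bijP (f g : selfbij T) : f =1 g -> f = g.
Proof.
case: f g => f f' fK f'K [g g' gK g'K] /= /funext fg; subst g.
have fg' : f' = g' by apply/funext => x; rewrite -[LHS]gK f'K.
subst g'; congr SelfBij; exact: Prop_irrelevance.
Qed.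

Definition bij1 : selfbij T :=
  @SelfBij T id id (fun=> erefl) (fun=> erefl).
Definition bijV (f : selfbij T) : selfbij T := SelfBij (@bij_invK T f) (@bij_funK T f).
Definition bijM (f g : selfbij T) : selfbij T :=
  SelfBij (can_comp (@bij_funK T f) (@bij_funK T g))
      (can_comp (@bij_invK T g) (@bij_invK T f)).

Fact bijMA : associative bijM. Proof. by move=> f g h; exact: bijP. Qed.
Fact bij1M : left_id bij1 bijM. Proof. by move=> f; exact: bijP. Qed.
Fact bijM1 : right_id bij1 bijM. Proof. by move=> f; exact: bijP. Qed.
Fact bijVM : left_inverse bij1 bijV bijM.
Proof. by move=> f; apply: bijP => x /=; rewrite bij_funK. Qed.
Fact bijMV : right_inverse bij1 bijV bijM.
Proof. by move=> f; apply: bijP => x /=; rewrite bij_invK. Qed.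

(* (f * g)%g x = f (g x) *)
HB.instance Definition _ := isGroup.Build (selfbij T) bijMA bij1M bijM1 bijVM bijMV.

End BijGroup.

Section Groups.
Variable gT : groupType.
Implicit Types (A : set gT) (H : groupClosed gT) (k : nat).

Definition generated_subgroup A : {pred gT} :=
  fun g => `[< forall K : groupClosed gT, (forall a, A a -> a \in K) -> g \in K >].

Fact generated1 A : 1%g \in generated_subgroup A.
Proof. by apply/asboolP => K _; exact: gpred1. Qed.
Fact generatedM A : mulg_closed (generated_subgroup A).
Proof.
move=> f g /asboolP Af /asboolP Ag; apply/asboolP => K AK.
by apply: gpredM; [exact: Af | exact: Ag].
Qed.
Fact generatedV A : invg_closed (generated_subgroup A).
Proof.
by move=> f /asboolP Af; apply/asboolP => K AK; rewrite gpredVr //; exact: Af.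
Qed.
HB.instance Definition _ A := isMulClosed.Build gT (generated_subgroup A) (@generatedM A).
HB.instance Definition _ A :=
  isMul1Closed.Build gT (generated_subgroup A) (@generated1 A).
HB.instance Definition _ A := isInvClosed.Build gT (generated_subgroup A) (@generatedV A).

Definition commutator_subgroup H : groupClosed gT :=
  generated_subgroup [set g | exists x y, [/\ x \in H, y \in H & g = [~ x, y]%g]].

Definition power_subgroup k H : groupClosed gT :=
  generated_subgroup [set g | exists2 x, x \in H & g = (x ^+ k)%g].

Definition commutator_power_subgroup k H : groupClosed gT :=
  generated_subgroup [set g | (g \in commutator_subgroup H) \/ (g \in power_subgroup k H)].

(* The direct sum of countably many copies of Z_k is modelled by the finitely
   supported sequences in 'Z_k; 'Z_k is the ring of integers mod k only when
   1 < k. *)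
Definition isog_Zk_sum k H : Prop :=
  exists f : (nat -> 'Z_k) -> gT,
    set_bij [set a | finite_set [set n | a n != 0]] [set` H] f /\
    forall a b : nat -> 'Z_k,
      finite_set [set n | a n != 0] -> finite_set [set n | b n != 0] ->
      f (fun n => a n + b n) = (f a * f b)%g.

End Groups.

Section Surfaces.
Variable R : realType.
Local Notation C := (R[i]^o).

Record chart (X : topologicalType) := Chart {
  chart_dom : set X;
  chart_map :> X -> C }.

Definition is_chart (X : topologicalType) (c : chart X) : Prop :=
  [/\ open (chart_dom c),
      set_inj (chart_dom c) c,
      (forall x, chart_dom c x -> {for x, continuous c}) &
      forall U, open U -> U `<=` chart_dom c -> open (c @` U)].

(* f \o c^-1 is holomorphic on c(D); meant for charts c and open sets
   D contained in the domain of c. *)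
Definition holomorphic_through (X : topologicalType) (c : chart X) (D : set X)
    (f : X -> C) : Prop :=
  exists F : C -> C, (forall w, (c @` D) w -> derivable F w 1) /\
                     (forall x, D x -> F (c x) = f x).

Definition compatible (X : topologicalType) (c d : chart X) : Prop :=
  let D := chart_dom c `&` chart_dom d in
  holomorphic_through c D d /\ holomorphic_through d D c.

Record surface := Surface {
  surface_top :> topologicalType;
  atlas : set (chart surface_top) }.
Arguments atlas : clear implicits.

Definition riemann_surface (X : surface) : Prop :=
  [/\ hausdorff_space X,
      connected [set: X],
      (forall c, atlas X c -> is_chart c),
      (forall x : X, exists2 c, atlas X c & chart_dom c x) &
      forall c d, atlas X c -> atlas X d -> compatible c d].

Definition holomorphic_chart (X : surface) (c : chart X) : Prop :=
  is_chart c /\ forall d, atlas X d -> compatible c d.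

Definition holomorphic (X Y : surface) (f : X -> Y) : Prop :=
  continuous f /\
  forall x, exists c d, [/\ atlas X c, atlas Y d, chart_dom c x,
    chart_dom d (f x) &
    holomorphic_through c (chart_dom c `&` f @^-1` chart_dom d) (d \o f)].

Definition biholomorphism (X Y : surface) (f : X -> Y) : Prop :=
  holomorphic f /\
  exists g : Y -> X, [/\ cancel f g, cancel g f & holomorphic g].

Definition aut_surface (X : surface) : set (selfbij X) :=
  [set g | biholomorphism (g : X -> X)].

Definition open_subsurface (X : surface) (A : set X) : surface :=
  @Surface (set_type A)
    [set c | exists2 d, atlas X d &
       c = Chart (set_val @^-1` chart_dom d) (d \o set_val)].

Definition complex_plane : surface := @Surface C [set Chart setT id].

Definition upper_half_plane : surface :=
  @open_subsurface complex_plane [set z : C | 0 < complex.Im z].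

(* [None] is the point at infinity. *)
Local Notation sphere := (one_point_compactification C).
Definition sphere_chart0 : chart sphere :=
  @Chart sphere [set x : sphere | x <> None] (odflt 0).
Definition sphere_chartoo : chart sphere :=
  @Chart sphere [set x : sphere | x <> Some 0]
        (fun x => if x is Some z then (z : R[i])^-1 else 0).
Definition riemann_sphere : surface :=
  @Surface sphere [set c | c = sphere_chart0 \/ c = sphere_chartoo].

Section Quotient.
Variables (X : surface) (G : groupClosed (selfbij X)).

Definition orbit_rel : rel X := fun x y => `[< exists2 g, g \in G & g x = y >].

Fact orbit_rel_refl : reflexive orbit_rel.
Proof. by move=> x; apply/asboolP; exists 1%g => //; exact: gpred1. Qed.
Fact orbit_rel_sym : symmetric orbit_rel.
Proof.
suff H x y : orbit_rel x y -> orbit_rel y x.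
  by move=> x y; apply/idP/idP; exact: H.
move=> /asboolP[g gG <-]; apply/asboolP; exists g^-1%g; first by rewrite gpredV.
exact: bij_funK.
Qed.
Fact orbit_rel_trans : transitive orbit_rel.
Proof.
move=> y x z /asboolP[g gG <-] /asboolP[h hG <-]; apply/asboolP.
by exists (h * g)%g => //; exact: gpredM.
Qed.
Definition orbit_equiv : equiv_rel X :=
  EquivRel orbit_rel orbit_rel_refl orbit_rel_sym orbit_rel_trans.

Definition orbit_space : topologicalType :=
  quotient_topology {eq_quot orbit_equiv}.

Definition orbit_proj (x : X) : orbit_space :=
  \pi_(quotient_topology {eq_quot orbit_equiv}) x.

(* The charts are all the homeomorphisms z from an open subset U of X/G onto
   an open subset of C whose pullback to X is holomorphic. For a properly
   discontinuous group of automorphisms this is the maximal atlas of the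
   quotient Riemann surface (also at the images of points with nontrivial
   stabilizer, where the centred charts are quotients of t |-> t^n). *)
Definition quotient_surface : surface :=
  @Surface orbit_space
    [set z | is_chart z /\ forall c, atlas X c ->
       holomorphic_through c (chart_dom c `&` orbit_proj @^-1` chart_dom z)
                           (z \o orbit_proj)].

Definition stabilizer (x : X) : set (selfbij X) := [set g | g \in G /\ g x = x].

Definition acts_freely : Prop :=
  forall g x, g \in G -> g x = x -> g = 1%g.

End Quotient.

(* The group G/N, acting on X/N, for N normal in G. *)
Definition factor_group (X : surface) (G N : groupClosed (selfbij X)) :
    set (selfbij (quotient_surface N)) :=
  [set q | exists2 g, g \in G &
     forall x, q (orbit_proj N x) = orbit_proj N (g x)].
Arguments factor_group {X} G N.

(* f A f^-1, for a bijection f *)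
Definition conj_group (X Y : Type) (f : X -> Y) (A : set (selfbij X)) :
    set (selfbij Y) :=
  [set b | exists2 a, A a & forall x, b (f x) = f (a x)].

(* Isomorphism of X/G and Y/K as orbifolds: a biholomorphism of the underlying
   surfaces preserving the order of every point, which is the order of the
   stabilizer of any of its preimages (1 at a non-cone point). *)
Definition orbifold_isomorphic (X Y : surface)
    (G : groupClosed (selfbij X)) (K : groupClosed (selfbij Y)) : Prop :=
  exists2 psi : quotient_surface G -> quotient_surface K,
    biholomorphism psi &
    forall x y, psi (orbit_proj G x) = orbit_proj K y ->
      (stabilizer G x #= stabilizer K y)%card.

Definition unit_disc : set C := [set z : C | `|z| < 1].

(* Every point y has a coordinate disc U centred at y such that the map
   restricted to each component of its preimage is of the form
   t |-> t^n : unit disc -> unit disc in suitable holomorphic coordinates;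
   n may depend on the component. *)
Definition branched_covering (X Y : surface) (p : X -> Y) : Prop :=
  [/\ holomorphic p, set_surj setT setT p &
    forall y, exists w : chart Y,
      [/\ holomorphic_chart w, chart_dom w y, w y = 0,
          w @` chart_dom w = unit_disc &
        forall x, chart_dom w (p x) ->
          exists n, exists z : chart X,
            [/\ (0 < n)%N, holomorphic_chart z,
                chart_dom z = connected_component (p @^-1` chart_dom w) x,
                z @` chart_dom z = unit_disc &
                forall x', chart_dom z x' -> w (p x') = (z x' : R[i]) ^+ n]]].

(* p is t |-> t^n in some holomorphic charts centred at x and p x *)
Definition local_degree (X Y : surface) (p : X -> Y) (x : X) (n : nat) : Prop :=
  exists z : chart X, exists w : chart Y,
    [/\ holomorphic_chart z /\ holomorphic_chart w,
        chart_dom z x /\ z x = 0,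
        chart_dom w (p x) /\ w (p x) = 0 &
        forall x', chart_dom z x' ->
          chart_dom w (p x') /\ w (p x') = (z x' : R[i]) ^+ n].

Definition branch_values (X Y : surface) (p : X -> Y) : set Y :=
  [set y | exists x n, [/\ p x = y, (1 < n)%N & local_degree p x n]].

Definition deck_group (X Y : surface) (p : X -> Y) : set (selfbij X) :=
  [set g | aut_surface g /\ forall x, p (g x) = p x].

Definition galois_branched_covering (X Y : surface) (p : X -> Y)
    (G : set (selfbij X)) : Prop :=
  [/\ branched_covering p, deck_group p = G &
      forall x x', p x = p x' -> exists2 g, G g & g x = x'].

(* X is any competitor with the same base orbifold as the pair: underlying
   surface the sphere minus the accumulation points of B, and cone points of
   order k at B. *)
Definition fermat_covering (k : nat) (B : set riemann_sphere) (X : surface)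
    (G : groupClosed (selfbij X)) : Prop :=
  let Y := open_subsurface (~` limit_point B) in
  [/\ [set` G] `<=` @aut_surface X,
      isog_Zk_sum k G &
      exists p : X -> Y,
        [/\ galois_branched_covering p [set` G],
            branch_values p = set_val @^-1` B &
            forall x, B (set_val (p x)) -> local_degree p x k]].

Definition generalized_fermat_pair (k : nat) (S : surface)
    (H : groupClosed (selfbij S)) : Prop :=
  [/\ riemann_surface S, ~ compact [set: S] &
    exists B : set riemann_sphere,
      [/\ [/\ infinite_set B, B `<=` isolated B, limit_point B !=set0 &
              connected (~` limit_point B)],
          fermat_covering k B H &
          forall (T : surface) (G : groupClosed (selfbij T)),
            riemann_surface T -> fermat_covering k B G ->
            exists J : groupClosed (selfbij S),
              [/\ {subset J <= H}, acts_freely J &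
                exists2 f : T -> quotient_surface J, biholomorphism f &
                  conj_group f [set` G] = factor_group H J]]].

Local Notation HH := upper_half_plane.

Definition moebius (A : 'M[R]_2) (z : R[i]) : R[i] :=
  ((A 0 0)%:C * z + (A 0 1)%:C) / ((A 1 0)%:C * z + (A 1 1)%:C).

Definition moebius_of (A : 'M[R]_2) (g : selfbij HH) : Prop :=
  forall z : HH, set_val (g z) = moebius A (set_val z).

(* PSL_2(R), identified with the group of Moebius transformations of
   the upper half-plane *)
Definition PSL2 : set (selfbij HH) :=
  [set g | exists2 A : 'M[R]_2, \det A = 1 & moebius_of A g].

(* Discreteness refers to the quotient topology of PSL_2(R) = SL_2(R)/{1, -1}:
   every element of Gamma is isolated in Gamma. *)
Definition fuchsian (Gamma : groupClosed (selfbij HH)) : Prop :=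
  [set` Gamma] `<=` PSL2 /\
  forall (A : 'M[R]_2) g, \det A = 1 -> moebius_of A g -> g \in Gamma ->
    \forall A' \near A, forall g', \det A' = 1 -> moebius_of A' g' ->
      g' \in Gamma -> g' = g.

End Surfaces.

Arguments atlas {R} s.
Arguments factor_group {R X} G N.

(* Main.v *)
Require Import Defs.
From HB Require Import structures.
From mathcomp Require Import all_boot all_order all_algebra complex.
From mathcomp Require Import all_classical all_reals all_analysis.
From mathcomp Require Import ring lra zify.

(** Let Y be the sphere minus the limit points of B.  A Moebius transformation
    sending one of these limit points to infinity embeds Y in the plane, and so
    turns the projections of S and of the half-plane to the common quotient
    orbifold into two holomorphic functions, WS and WH, whose fibres are the
    orbits of H and of Gamma.  In suitable coordinates such a function W is
    v |-> W x + v ^+ n ([model]), with n = k over B and n = 1 elsewhere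
    ([S_model], [H_model]).  What follows uses these two functions only.

    The half-plane is star-shaped, so WH lifts to a continuous map F from the
    half-plane to S by the monodromy theorem [lift_star] ([lift_exists]).  F is
    equivariant with respect to a homomorphism theta : Gamma -> H
    ([deck_image]), which is onto ([deck_onto]).  As both sides have the same
    local degrees, F is injective near every point, so that ker theta acts
    freely ([kernel_free]).  H is abelian of exponent k, hence Gamma_k lies in
    ker theta.  Therefore Gamma_k acts freely, T = H^2 / Gamma_k is a Riemann
    surface ([T_riemann]), and T -> Y is a Galois branched covering with group
    Gamma / Gamma_k and branching of order k exactly over B ([pT_galois],
    [pT_branch_values], [pT_degree]).

    Maximality of (S, H) applies to T once Gamma / Gamma_k is known to be a
    direct sum of countably many copies of Z/k.  It is countable
    ([countable_deck]) and of infinite rank since it maps onto H; such a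
    Z/k-module is free when, for every prime p dividing k, an element whose
    images under all characters to Z/k are divisible by p is itself divisible
    by p ([free_countable_module]).  This last property expresses that Y is
    planar ([planar_divisible]).  Given a in Gamma, join a regular point x to
    a x by a path whose image under WH is an axis-parallel polygon through
    regular values.  By a discrete Stokes formula ([grid_stokes]) the class of a
    in any abelian quotient of Gamma is the sum, over the squares Q of a grid,
    of the curvature of Q multiplied by the winding number of the polygon
    around Q.  The curvature vanishes when Q consists of regular values.
    Otherwise Q contains some c which is not a regular value; WH - c then has a
    global k-th root, because all the points over c have degree k and the
    half-plane is simply connected.  The root is multiplied by a k-th root of
    unity under a, which defines a character of Gamma, and its exponent is the
    winding number modulo k ([winding_crossings]); so the winding number is
    divisible by p.

    Maximality then gives a biholomorphism f from T to S / J, with J a subgroup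
    of H acting freely.  The map H^2 -> T -> S / J lifts to E : H^2 -> S
    ([universal_lift]), equivariant with respect to a homomorphism from Gamma
    to H and hence invariant under Gamma_k; since f is injective, the fibres of
    E are the orbits of Gamma_k ([lift_kernel]).  A translate of the image of E
    by a non-trivial element of J does not meet this image, and these
    translates are open and cover the connected surface S, so E is onto
    ([universal_lift_surj]) and J is trivial.  Hence E induces a biholomorphism
    from T to S, which carries Gamma / Gamma_k to H
    ([universal_isomorphism]). *)

Set Implicit Arguments.
Unset Strict Implicit.
Unset Printing Implicit Defensive.

Import Order.TTheory GRing.Theory Num.Theory.
Import numFieldNormedType.Exports.

Local Open Scope classical_set_scope.
Local Open Scope ring_scope.
Local Open Scope complex_scope.

(** * Complex numbers: modulus, continuity, differentiability *)

Section ComplexBasics.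
Variable R : realType.
Local Notation C := (R[i]^o).
Implicit Types (z w : R[i]).

Lemma rcM (x y : R) : (x * y)%:C = x%:C * y%:C. Proof. exact: rmorphM. Qed.
Lemma rcD (x y : R) : (x + y)%:C = x%:C + y%:C. Proof. exact: rmorphD. Qed.
Lemma rcV (x : R) : (x^-1)%:C = (x%:C)^-1. Proof. exact: fmorphV. Qed.
Lemma rcX (x : R) n : (x ^+ n)%:C = x%:C ^+ n. Proof. exact: rmorphXn. Qed.

(** The norm of [R[i]] takes its values in [R[i]]; estimates are carried out
    with this real-valued modulus instead. *)
Definition nC z : R := Num.sqrt (complex.Re z ^+ 2 + complex.Im z ^+ 2).

Lemma normrC z : `|z| = (nC z)%:C.
Proof. exact: normc_def. Qed.

Lemma nC_ge0 z : 0 <= nC z. Proof. exact: sqrtr_ge0. Qed.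
Lemma nC0 : nC 0 = 0.
Proof. by apply: complexI; rewrite -normrC normr0. Qed.
Lemma nC1 : nC 1 = 1.
Proof. by apply: complexI; rewrite -normrC normr1. Qed.
Lemma nC_eq0 z : (nC z == 0) = (z == 0).
Proof. by rewrite -(normr_eq0 z) normrC eq_complex /= eqxx andbT. Qed.
Lemma nC_gt0 z : (0 < nC z) = (z != 0).
Proof. by rewrite lt_neqAle nC_ge0 andbT eq_sym nC_eq0. Qed.
Lemma nCM z w : nC (z * w) = nC z * nC w.
Proof. by apply: complexI; rewrite rcM -!normrC normrM. Qed.
Lemma nCN z : nC (- z) = nC z.
Proof. by apply: complexI; rewrite -!normrC normrN. Qed.
Lemma nCB z w : nC (z - w) = nC (w - z).
Proof. by rewrite -nCN opprB. Qed.
Lemma nCV z : nC z^-1 = (nC z)^-1.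
Proof. by apply: complexI; rewrite rcV -!normrC normfV. Qed.
Lemma nCX z n : nC (z ^+ n) = nC z ^+ n.
Proof. by apply: complexI; rewrite rcX -!normrC normrX. Qed.
Lemma nCD z w : nC (z + w) <= nC z + nC w.
Proof. by rewrite -lecR rcD -!normrC ler_normD. Qed.
Lemma nCR (x : R) : nC x%:C = `|x|.
Proof. by rewrite /nC /= expr0n /= addr0 sqrtr_sqr. Qed.
Lemma Re_le_nC z : `|complex.Re z| <= nC z.
Proof. by rewrite -sqrtr_sqr ler_wsqrtr // lerDl sqr_ge0. Qed.
Lemma Im_le_nC z : `|complex.Im z| <= nC z.
Proof. by rewrite -sqrtr_sqr ler_wsqrtr // lerDr sqr_ge0. Qed.
Lemma nC_ReIm z : nC z <= `|complex.Re z| + `|complex.Im z|.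
Proof.
rewrite -[leRHS]ger0_norm ?addr_ge0 // -sqrtr_sqr ler_wsqrtr //.
rewrite sqrrD !real_normK ?num_real // -addrA lerD2l lerDr.
by rewrite mulrn_wge0 // mulr_ge0.
Qed.
Lemma nC_dist3 w z u : nC (w - u) <= nC (w - z) + nC (z - u).
Proof. by rewrite (le_trans _ (nCD _ _)) // addrA subrK. Qed.
Lemma nC_subr z w : nC z - nC w <= nC (z - w).
Proof. by rewrite lerBlDr (le_trans _ (nCD _ _)) // subrK. Qed.

Lemma nbhsC (z : C) (A : set C) :
  nbhs z A <-> exists2 e : R, 0 < e & forall w : C, nC (w - z) < e -> A w.
Proof.
rewrite nbhs_ballP; split=> [[e /= e0] eA|[e e0 eA]].
  have er : e = (complex.Re e)%:C.
    by rewrite RRe_real // gtr0_real.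
  exists (complex.Re e); first by rewrite -ltcR -er.
  move=> w wz; apply: eA; rewrite -ball_normE /= er normrC nCB ltcR //.
exists e%:C => /=; first by rewrite ltcR.
by move=> w; rewrite -ball_normE /= normrC ltcR nCB; exact: eA.
Qed.

Lemma cvgCP (T : Type) (F : set_system T) {FF : Filter F} (f : T -> C) (l : C) :
  f @ F --> l <-> forall e : R, 0 < e -> \forall x \near F, nC (f x - l) < e.
Proof.
split=> [fl e e0|H A /nbhsC[e e0 eA]]; last first.
  by apply: filterS (H e e0) => x /eA.
apply: (fl [set w | nC (w - l) < e]).
by apply/nbhsC; exists e.
Qed.

Lemma continuousCP (f : C -> C) (z : C) : continuous_at z f <->
  forall e : R, 0 < e -> exists2 d : R, 0 < d &
    forall w, nC (w - z) < d -> nC (f w - f z) < e.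
Proof.
split=> [/cvgCP H e /H /nbhsC //|H].
by apply: (iffRL (@cvgCP C (nbhs z) _ f (f z))) => e /H ?; exact/nbhsC.
Qed.

(** A box around continuity, which keeps unification from unfolding the
    filter inclusion behind it. *)
Variant ccont (f : C -> C) (z : C) : Prop := CCont of continuous_at z f.
Lemma ccontP (f : C -> C) (z : C) : ccont f z <->
  forall e : R, 0 < e -> exists2 d : R, 0 < d &
    forall w, nC (w - z) < d -> nC (f w - f z) < e.
Proof. by split=> [[/continuousCP]|H]; last by split; exact/continuousCP. Qed.

Lemma continuousCRP (f : C -> R) (z : C) : continuous_at z f <->
  forall e : R, 0 < e -> exists2 d : R, 0 < d &
    forall w, nC (w - z) < d -> `|f w - f z| < e.
Proof.
split=> [H e e0|H A /nbhs_ballP[e e0 eA]].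
  have /nbhsC[d d0 dH] : nbhs z (f @^-1` ball (f z) e) by apply/H/nbhsx_ballx.
  by exists d => // w /dH; rewrite /ball /= distrC.
have [d d0 dH] := H e e0; apply/nbhsC; exists d => // w wz; apply: eA.
by rewrite /ball /= distrC; exact: dH.
Qed.

Lemma continuous_Re (z : C) : continuous_at z (@complex.Re R : C -> R).
Proof.
apply/continuousCRP => e e0; exists e => // w wz.
by rewrite (le_lt_trans _ wz) // (le_trans _ (Re_le_nC _)) // raddfB.
Qed.
Lemma continuous_Im (z : C) : continuous_at z (@complex.Im R : C -> R).
Proof.
apply/continuousCRP => e e0; exists e => // w wz.
by rewrite (le_lt_trans _ wz) // (le_trans _ (Im_le_nC _)) // raddfB.
Qed.
Lemma cvg_Complex (T : Type) (F : set_system T) {FF : Filter F} (f g : T -> R) a b :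
  f @ F --> a -> g @ F --> b -> (fun x => (f x +i* g x : C)) @ F --> (a +i* b : C).
Proof.
move=> /cvgrPdist_lt fa /cvgrPdist_lt gb; apply/cvgCP => e e0.
have e2 : 0 < e / 2 by rewrite divr_gt0.
move: (fa _ e2) (gb _ e2); apply: filterS2 => x.
rewrite distrC => h1; rewrite distrC => h2.
apply: le_lt_trans (nC_ReIm _) _ => /=.
by rewrite [ltRHS]splitr ltrD.
Qed.

Lemma complex_eq (z w : R[i]) : complex.Re z = complex.Re w -> complex.Im z = complex.Im w -> z = w.
Proof. by case: z w => ? ? [? ?] /= -> ->. Qed.

Lemma openC (A : set C) : open A <->
  forall z, A z -> exists2 e : R, 0 < e & forall w : C, nC (w - z) < e -> A w.
Proof. by rewrite openE; split=> H z Az; have := H z Az; rewrite /= /interior nbhsC. Qed.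

Definition disc (z : C) (r : R) : set C := [set w | nC (w - z) < r].
Lemma disc_center z r : 0 < r -> disc z r z.
Proof. by rewrite /disc /= subrr nC0. Qed.
Lemma open_disc z r : open (disc z r).
Proof.
apply/openC => w wz; exists (r - nC (w - z)); first by rewrite subr_gt0.
move=> u; rewrite ltrBrDr => h; apply: le_lt_trans h.
exact: nC_dist3.
Qed.

(** Caratheodory's form of complex differentiability: the slope function
    [phi] is continuous at z. It makes the chain rule and the product rule
    one-line computations, and the slope function is itself the object to
    which Goursat's theorem is applied later. *)
Definition cdiff (f : C -> C) (z : C) := exists phi : C -> C,
  ccont phi z /\ forall u, f u = f z + phi u * (u - z).

Lemma cdiffP (f : C -> C) (z : C) : derivable f z 1 <-> cdiff f z.
Proof.
split.
- move=> /cvg_ex[l /cvgCP H].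
  pose phi u := if u == z then l else (f u - f z) / (u - z) : C.
  exists phi; split; last first.
    move=> u; rewrite /phi; case: eqVneq => [->|uz]; first by rewrite subrr mulr0 addr0.
    by rewrite mulfVK ?subr_eq0 // addrC subrK.
  apply/ccontP => e e0; have /nbhsC[d d0 dH] := H e e0; exists d => // w wz.
  rewrite {2}/phi eqxx /phi; case: eqVneq => [_|wz']; first by rewrite subrr nC0.
  have := dH (w - z); rewrite subr0 => /(_ wz) /=.
  rewrite subr_eq0 => /(_ wz'); rewrite /GRing.scale /= mulr1 subrK mulrC; apply.
- move=> [phi [/ccontP ct H]]; apply/cvg_ex; exists (phi z); apply/cvgCP => e /ct[d d0 dH].
  apply/nbhsC; exists d => // w; rewrite subr0 => wd /= w0.
  have := dH (z + w); rewrite addrAC subrr add0r => /(_ wd).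
  rewrite /GRing.scale /= mulr1 (H (w + z)) addrAC subrr add0r addrK mulrCA mulVf // mulr1.
  by rewrite [w + z]addrC.
Qed.

Lemma contM (f g : C -> C) (z : C) : ccont f z -> ccont g z -> ccont (fun u => f u * g u : C) z.
Proof. by move=> [cf] [cg]; split; exact: (cvgM cf cg). Qed.
Lemma contD (f g : C -> C) (z : C) : ccont f z -> ccont g z -> ccont (fun u => f u + g u : C) z.
Proof. by move=> [cf] [cg]; split; exact: (cvgD cf cg). Qed.
Lemma contN (f : C -> C) (z : C) : ccont f z -> ccont (fun u => - f u : C) z.
Proof. by move=> [cf]; split; exact: (cvgN cf). Qed.
Lemma contB (f g : C -> C) (z : C) : ccont f z -> ccont g z -> ccont (fun u => f u - g u : C) z.
Proof. by move=> [cf] [cg]; split; exact: (cvgB cf cg). Qed.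
Lemma contV (f : C -> C) (z : C) : ccont f z -> f z != 0 -> ccont (fun u => (f u)^-1 : C) z.
Proof. by move=> [cf] fz; split; exact: (cvgV fz cf). Qed.
Lemma contc (c z : C) : ccont (fun=> c : C) z.
Proof. by split; exact: (@cst_continuous C C c). Qed.
Lemma conti (z : C) : ccont (fun u => u : C) z.
Proof. by split; exact: cvg_id. Qed.
Lemma cont_comp (f g : C -> C) (z : C) : ccont f z -> ccont g (f z) -> ccont (fun u => g (f u)) z.
Proof.
move=> /ccontP cf /ccontP cg; apply/ccontP => e /cg[d /cf[d' d'0 fd] gd].
by exists d' => // w /fd /gd.
Qed.
Lemma cont_near (f g : C -> C) (z : C) : (\forall u \near z, f u = g u) -> ccont f z -> ccont g z.
Proof.
move=> /nbhsC[r r0 fg] /ccontP cf; have fgz : f z = g z by apply: fg; rewrite subrr nC0.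
apply/ccontP => e /cf[d d0 H]; exists (Num.min r d); first by rewrite lt_min r0.
by move=> w; rewrite lt_min => /andP[/fg <- /H]; rewrite fgz.
Qed.

Lemma cdiff_cont (f : C -> C) (z : C) : cdiff f z -> ccont f z.
Proof.
move=> [phi [ct H]]; rewrite (_ : f = (fun u => f z + phi u * (u - z))); last exact/funext.
apply: contD; first exact: contc.
by apply: contM => //; apply: contB; [exact: conti|exact: contc].
Qed.

Lemma cdiff_cst (c z : C) : cdiff (cst c) z.
Proof. by exists (cst 0); split=> [|u]; [exact: contc|rewrite /= mul0r addr0]. Qed.
Lemma cdiff_id (z : C) : cdiff id z.
Proof. by exists (cst 1); split=> [|u]; [exact: contc|rewrite /= mul1r addrC subrK]. Qed.
Lemma cdiffD (f g : C -> C) (z : C) : cdiff f z -> cdiff g z -> cdiff (fun u => f u + g u) z.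
Proof.
move=> [a [ca fa]] [b [cb gb]]; exists (fun u => a u + b u); split.
  exact: contD.
by move=> u; rewrite fa gb; ring.
Qed.
Lemma cdiffN (f : C -> C) (z : C) : cdiff f z -> cdiff (fun u => - f u) z.
Proof.
move=> [a [ca fa]]; exists (fun u => - a u); split; first exact: contN.
by move=> u; rewrite fa; ring.
Qed.
Lemma cdiffM (f g : C -> C) (z : C) : cdiff f z -> cdiff g z -> cdiff (fun u => f u * g u) z.
Proof.
move=> df dg; have cg := cdiff_cont dg.
case: df dg => [a [ca fa]] [b [cb gb]].
exists (fun u => a u * g u + f z * b u); split.
  apply: contD; first exact: contM.
  by apply: contM => //; exact: contc.
by move=> u; rewrite fa {2}gb (gb u); ring.
Qed.
Lemma cdiff_comp (f g : C -> C) (z : C) : cdiff f z -> cdiff g (f z) -> cdiff (g \o f) z.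
Proof.
move=> df; have cf := cdiff_cont df; case: df => a [ca fa] [b [cb gb]].
exists (fun u => b (f u) * a u); split.
  by apply: (@contM (b \o f)) => //; apply: cont_comp.
by move=> u /=; rewrite gb; congr (_ + _); rewrite (fa u); ring.
Qed.
Lemma cdiffV (f : C -> C) (z : C) : cdiff f z -> f z != 0 -> cdiff (fun u => (f u)^-1) z.
Proof.
move=> df fz; have cf := cdiff_cont df; case: df => a [ca fa].
(* off the zeros of f the slope function is - a / (f f(z)); at the zeros it
   is given its only possible value *)
exists (fun u => if f u == 0 then ((f u)^-1 - (f z)^-1) / (u - z) else - a u / (f u * f z)); split.
  have /ccontP/(_ _ (_ : 0 < nC (f z))) := cf.
  rewrite nC_gt0 => /(_ fz)[d d0 dH].
  have near0 : \forall u \near z, f u != 0.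
    apply/nbhsC; exists d => // w /dH; apply: contraTneq => ->.
    by rewrite sub0r nCN ltxx.
  have : ccont (fun u => - a u / (f u * f z)) z.
    apply: contM; first exact: contN.
    apply: contV; first by apply: contM => //; exact: contc.
    by rewrite mulf_neq0.
  apply: cont_near; apply: filterS near0 => u /negPf -> //.
move=> u; case: eqVneq => [fu|fu]; last by rewrite fa; have := fu; rewrite fa => h; field; rewrite h fz.
case: (eqVneq u z) => [->|uz]; first by rewrite !subrr mulr0 addr0.
by rewrite mulfVK ?subr_eq0 // addrC subrK.
Qed.
Lemma cdiffX (f : C -> C) n (z : C) : cdiff f z -> cdiff (fun u => f u ^+ n) z.
Proof.
move=> df; elim: n => [|n IH]; first exact: (cdiff_cst 1).
rewrite (_ : (fun u => _) = (fun u => f u * f u ^+ n)); first exact: cdiffM.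
by apply/funext => u; rewrite exprS.
Qed.
Lemma cdiff_near (f g : C -> C) (z : C) : (\forall u \near z, f u = g u) -> cdiff f z -> cdiff g z.
Proof.
move=> fg [a [ca fa]]; have fgz := nbhs_singleton fg.
exists (fun u => if u == z then a z else (g u - g z) / (u - z)); split; last first.
  move=> u; case: eqVneq => [->|uz]; first by rewrite subrr mulr0 addr0.
  by rewrite mulfVK ?subr_eq0 // addrC subrK.
apply: cont_near ca; apply: filterS fg => u; case: eqVneq => [->//|uz].
by rewrite fa -fgz => <-; rewrite addrAC subrr add0r mulfK ?subr_eq0.
Qed.
End ComplexBasics.

(** * Locally constant properties on convex and star-shaped sets *)

Section LocallyConstant.
Variable R : realType.
Local Notation C := (R[i]^o).

(** The supremum of the t such that Q holds on [0, t] is reached, and cannot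
    be less than 1. *)
Lemma lc_interval (Q : R -> Prop) :
  (forall t, 0 <= t <= 1 -> exists2 e : R, 0 < e &
     forall s, 0 <= s <= 1 -> `|s - t| < e -> (Q s <-> Q t)) -> Q 0 -> Q 1.
Proof.
move=> H Q0; pose A := [set t : R | 0 <= t <= 1 /\ forall s, 0 <= s <= t -> Q s].
have A0 : A 0.
  split; first by rewrite lexx ler01.
  by move=> s; rewrite -eq_le => /eqP <-.
have Aub : ubound A 1 by move=> t [/andP[]].
have hA : has_sup A by split; [exists 0|exists 1].
have x0 : 0 <= sup A by apply: ub_le_sup => //; exists 1.
have x1 : sup A <= 1 by apply: ge_sup => //; exists 0.
have x01 : 0 <= sup A <= 1 by rewrite x0.
have [e e0 He] := H _ x01.
have [t [t01 At] xt] := sup_adherent e0 hA.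
have tx : t <= sup A by apply: ub_le_sup => //; exists 1.
have Qx : Q (sup A).
  apply/(He t) => //; first by rewrite distrC ger0_norm ?subr_ge0 // ltrBlDr -ltrBlDl; lra.
  by apply: At; case/andP: t01 => -> _ /=.
have Qnear s : 0 <= s -> s <= 1 -> s < sup A + e -> Q s.
  move=> s0 s1 sx; case: (leP s t) => [st|ts]; first by apply: At; rewrite s0.
  by apply/(He s) => //; [rewrite s0|rewrite ltr_norml; apply/andP; split; lra].
apply: (Qnear) => //; rewrite ?ler01 //; rewrite ltNge; apply/negP => xe.
suff : sup A + e / 2 <= sup A by lra.
apply: ub_le_sup; first by exists 1.
split; first by apply/andP; split; lra.
by move=> s /andP[s0 s1]; apply: Qnear => //; lra.
Qed.

Definition starC (z0 : C) (D : set C) := D z0 /\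
  forall (b : C) (t : R), D b -> 0 <= t <= 1 -> D (z0 + t%:C * (b - z0)).
Definition convexC (D : set C) := forall z, D z -> starC z D.

Lemma lc_star z0 (D : set C) (Q : C -> Prop) : starC z0 D ->
  (forall z, D z -> exists2 e : R, 0 < e & forall w, D w -> nC (w - z) < e -> (Q w <-> Q z)) ->
  forall z, D z -> (Q z0 <-> Q z).
Proof.
move=> [Dz0 star] H z Dz.
have dist (a s t : R) : nC (z0 + s%:C * (z - z0) - (z0 + t%:C * (z - z0))) = `|s - t| * nC (z - z0).
  by rewrite -nCR -nCM rmorphB; congr nC; rewrite /=; ring.
have key (P : C -> Prop) : (forall z, D z -> exists2 e : R, 0 < e & forall w, D w -> nC (w - z) < e -> (P w <-> P z)) -> P z0 -> P z.
  move=> HP P0; suff : P (z0 + (1 : R)%:C * (z - z0)) by rewrite mul1r addrC subrK.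
  apply: (@lc_interval (fun t => P (z0 + t%:C * (z - z0)))); last by rewrite mul0r addr0.
  move=> t t01; have [e e0 He] := HP _ (star z t Dz t01).
  have h : 0 < nC (z - z0) + 1 by rewrite ltr_wpDl ?nC_ge0.
  exists (e / (nC (z - z0) + 1)); first by rewrite divr_gt0.
  move=> s s01 st; apply: He; first exact: star.
  rewrite dist //; move: st; rewrite ltr_pdivlMr //; apply: le_lt_trans.
  by rewrite ler_wpM2l // lerDl.
split; first exact: key.
apply: contraPP => nQ0; apply: (key (fun z => ~ Q z)) => // w Dw.
have [e e0 He] := H w Dw; exists e => // u Du uw.
by have := He u Du uw; tauto.
Qed.

Lemma convexI (D E : set C) : convexC D -> convexC E -> convexC (D `&` E).
Proof.
by move=> cD cE z [Dz Ez]; split=> // b t [Db Eb] t01; split; [apply: (cD z Dz).2|apply: (cE z Ez).2].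
Qed.

Lemma convex_disc z r : convexC (disc z r : set C).
Proof.
move=> a az; split=> // b t; rewrite /disc /= => bz t01.
have -> : a + t%:C * (b - a) - z = (1 - t)%:C * (a - z) + t%:C * (b - z).
  by rewrite rmorphB /=; ring.
apply: le_lt_trans (nCD _ _) _; rewrite !nCM !nCR.
rewrite !ger0_norm; try lra.
move: az bz; rewrite /disc /= => az bz.
case/andP: t01 => t0 t1; have [->|tn0] := eqVneq t 0; first by rewrite mul0r addr0 subr0 mul1r.
have : t * nC (b - z) < t * r by rewrite ltr_pM2l // lt_neqAle eq_sym tn0.
have : (1 - t) * nC (a - z) <= (1 - t) * r by rewrite ler_wpM2l ?subr_ge0 // ltW.
by lra.
Qed.

Lemma convex_half (a b c : R) : convexC [set w : C | c < a * complex.Re w + b * complex.Im w].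
Proof.
move=> [x y] /= h; split=> // [[x' y']] t /= h' /andP[t0 t1].
have -> : a * (x + (t * (x' - x) - 0 * (y' - y))) + b * (y + (t * (y' - y) + 0 * (x' - x))) =
  (1 - t) * (a * x + b * y) + t * (a * x' + b * y') by ring.
have [->|tn0] := eqVneq t 0; first by rewrite mul0r addr0 subr0 mul1r.
have : t * c < t * (a * x' + b * y') by rewrite ltr_pM2l // lt_neqAle eq_sym tn0.
have : (1 - t) * c <= (1 - t) * (a * x + b * y) by rewrite ler_wpM2l ?subr_ge0 // ltW.
by lra.
Qed.

Lemma lc_convex (D : set C) (Q : C -> Prop) : convexC D ->
  (forall z, D z -> exists2 e : R, 0 < e & forall w, nC (w - z) < e -> (Q w <-> Q z)) ->
  forall u v, D u -> D v -> (Q u <-> Q v).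
Proof.
move=> cD H u v Du Dv; apply: (lc_star (cD u Du)) => // z /H[e e0 He].
by exists e => // w _; exact: He.
Qed.

(** The punctured disc is covered by half-discs, which are convex, and any
    two of its points are linked by half-discs which overlap. *)
Lemma lc_punctured (z : C) (r : R) (Q : C -> Prop) : 0 < r ->
  (forall w, disc z r w -> w <> z -> exists2 e : R, 0 < e & forall u, nC (u - w) < e -> (Q u <-> Q w)) ->
  forall u v, disc z r u -> u <> z -> disc z r v -> v <> z -> (Q u <-> Q v).
Proof.
move=> r0 H.
have half a b u v : let D := disc z r `&` [set w : C | a * complex.Re z + b * complex.Im z < a * complex.Re w + b * complex.Im w] in
  D u -> D v -> (Q u <-> Q v).
  move=> D; apply: lc_convex; first by apply: convexI; [exact: convex_disc|exact: convex_half].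
  by move=> w [wz /= h]; apply: H => // wz'; move: h; rewrite wz' ltxx.
pose p (x y : R) : C := z + ((x * r) +i* (y * r)).
have dp x y : `|x| <= 1/3 -> `|y| <= 1/3 -> disc z r (p x y).
  move=> hx hy; rewrite /disc /= /p addrAC subrr add0r.
  apply: le_lt_trans (nC_ReIm _) _ => /=; rewrite !normrM (gtr0_norm r0) -mulrDl.
  rewrite -[ltRHS]mul1r ltr_pM2r //; lra.
have Rp x y : complex.Re (p x y) = complex.Re z + x * r by rewrite /p; case: (z).
have Ip x y : complex.Im (p x y) = complex.Im z + y * r by rewrite /p; case: (z).
have hlf : `|1/3 : R| <= 1/3 by rewrite ger0_norm //; lra.
have hlfN : `|- (1/3) : R| <= 1/3 by rewrite normrN.
have r3 : 0 < 1/3 * r by rewrite mulr_gt0 //; lra.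
have dp1 := dp _ _ hlf hlf; have dp2 := dp _ _ hlf hlfN; have dp3 := dp _ _ hlfN hlf.
have link u : disc z r u -> u <> z -> (Q u <-> Q (p (1/3) (1/3))).
  move=> du uz; have [hR|hR|hR] := ltrgtP (complex.Re u) (complex.Re z).
  - apply: (iff_trans (half (-1) 0 u (p (-(1/3)) (1/3)) _ _)); try (by split => //=; rewrite ?Rp ?Ip; lra).
    by apply: (half 0 1); split => //=; rewrite ?Rp ?Ip; lra.
  - by apply: (half 1 0); split => //=; rewrite ?Rp ?Ip; lra.
  - have [hI|hI|hI] := ltrgtP (complex.Im u) (complex.Im z).
    + apply: (iff_trans (half 0 (-1) u (p (1/3) (-(1/3))) _ _)); try (by split => //=; rewrite ?Rp ?Ip; lra).
      by apply: (half 1 0); split => //=; rewrite ?Rp ?Ip; lra.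
    + by apply: (half 0 1); split => //=; rewrite ?Rp ?Ip; lra.
    + by case: uz; exact: (@complex_eq R u z).
move=> u v du uz dv vz; apply: (iff_trans (link u du uz) (iff_sym (link v dv vz))).
Qed.

(** This says that E is closed in D as well as discrete: the condition is
    imposed at all the points z of D, those outside E included. *)
Definition discreteC (D E : set C) := forall z, D z ->
  exists2 e : R, 0 < e & forall w, nC (w - z) < e -> E w -> w = z.

(** Around a point of E the property is constant on a punctured disc; its
    value there extends it over E to a locally constant property on all of D,
    to which convexity applies. *)
Lemma lc_discrete (D E : set C) (Q : C -> Prop) : open D -> convexC D -> discreteC D E ->
  (forall z, D z -> ~ E z -> exists2 e : R, 0 < e & forall w, nC (w - z) < e -> (Q w <-> Q z)) ->
  forall u v, D u -> ~ E u -> D v -> ~ E v -> (Q u <-> Q v).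
Proof.
move=> /openC oD cD dE H.
pose Q' (z : C) := exists2 e : R, 0 < e & forall w, nC (w - z) < e -> w <> z -> Q w.
have good z : D z -> exists2 e : R, 0 < e & ((forall w, disc z e w -> w <> z -> Q w) \/ (forall w, disc z e w -> w <> z -> ~ Q w)).
  move=> Dz; have [e1 e10 h1] := oD z Dz; have [e2 e20 h2] := dE z Dz.
  exists (Num.min e1 e2); first by rewrite lt_min e10.
  have all_iff u v : disc z (Num.min e1 e2) u -> u <> z -> disc z (Num.min e1 e2) v -> v <> z -> (Q u <-> Q v).
    apply: lc_punctured; first by rewrite lt_min e10.
    move=> w; rewrite /disc /= lt_min => /andP[w1 w2] wz.
    by apply: H; [exact: h1|move=> Ew; exact: wz (h2 w w2 Ew)].
  case: (pselect (exists w, [/\ disc z (Num.min e1 e2) w, w <> z & Q w])) => [[w [wd wz Qw]]|no].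
    by left=> u du uz; apply/(all_iff u w).
  by right=> u du uz Qu; apply: no; exists u.
have two (z : C) (e : R) : 0 < e -> exists2 w : C, nC (w - z) < e & w <> z.
  move=> e0; have h : nC (z + (e / 2)%:C - z) = e / 2.
    by rewrite addrAC subrr add0r nCR ger0_norm; lra.
  exists (z + (e / 2)%:C); first by rewrite h; lra.
  by move=> E'; move: h; rewrite E' subrr nC0; lra.
have Q'lc z : D z -> exists2 e : R, 0 < e & forall w, nC (w - z) < e -> (Q' w <-> Q' z).
  move=> Dz; have [e e0 he] := good z Dz; exists e => // w wz.
  have sub u : nC (u - w) < e - nC (w - z) -> disc z e u.
    by rewrite ltrBrDr; apply: le_lt_trans; exact: nC_dist3.
  have en : 0 < e - nC (w - z) by rewrite subr_gt0.
  case: he => he.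
    have Qz : Q' z by exists e.
    split=> // _.
    have [->//|wz'] := eqVneq w z.
    exists (Num.min (e - nC (w - z)) (nC (w - z))); first by rewrite lt_min en nC_gt0 subr_eq0.
    move=> u; rewrite lt_min => /andP[uw1 uw2] uw; apply: he; first exact: sub.
    by move=> uz; move: uw2; rewrite uz nCB ltxx.
  split=> -[d d0 hd]; exfalso.
    have [wz'|wz'] := eqVneq w z.
      rewrite wz' in hd.
      have [|u] := two z (Num.min d e); [by rewrite lt_min d0|rewrite lt_min] => /andP[u1 u2] uz.
      by apply: (he u) => //; exact: hd.
    have [|u] := two w (Num.min d (Num.min (e - nC (w - z)) (nC (w - z)))).
      by rewrite !lt_min d0 en nC_gt0 subr_eq0.
    rewrite !lt_min => /and3P[u1 u2 u3] uw; apply: (he u); [exact: sub| |exact: hd].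
    by move=> uz; move: u3; rewrite uz nCB ltxx.
  have [|u] := two z (Num.min d e); [by rewrite lt_min d0|rewrite lt_min] => /andP[u1 u2] uz.
  by apply: (he u) => //; exact: hd.
have QQ' u : D u -> ~ E u -> (Q u <-> Q' u).
  move=> Du Eu; have [e e0 he] := H u Du Eu; split=> [Qu|[d d0 hd]].
    by exists e => // w wu _; apply/(he w).
  have [|w] := two u (Num.min d e); [by rewrite lt_min d0|rewrite lt_min] => /andP[w1 w2] wu.
  by apply/(he w w2); exact: hd.
move=> u v Du Eu Dv Ev; rewrite QQ' //; apply: iff_trans (iff_sym (QQ' v Dv Ev)).
exact: (lc_convex cD Q'lc).
Qed.

End LocallyConstant.

(** * The monodromy theorem *)

Lemma hausdorffP (X : topologicalType) : hausdorff_space X <->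
  forall x y : X, x <> y -> exists A B, [/\ open A, open B, A x, B y & forall z, A z -> ~ B z].
Proof.
rewrite open_hausdorff; split=> H x y xy.
  have /eqP/H[[A B] /=] := xy; rewrite !inE => -[Ax By] [oA oB AB].
  exists A, B; split=> // z Az Bz.
  have ABz : (A `&` B) z by [].
  by move: ABz; rewrite AB.
have [A [B [oA oB Ax By AB]]] := H x y (elimN eqP xy).
exists (A, B) => /=; first by rewrite !inE.
split=> //; apply/eqP/seteqP; split=> // z [Az Bz]; exact: AB Bz.
Qed.

Lemma continuous_at_near (X Y : topologicalType) (f g : X -> Y) (x : X) (A : set X) :
  nbhs x A -> (forall y, A y -> f y = g y) -> continuous_at x f -> continuous_at x g.
Proof.
move=> nA fg cf B nB; have gx : f x = g x by apply: fg; exact: nbhs_singleton.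
have : nbhs x (A `&` f @^-1` B) by apply: filterI => //; apply: cf; rewrite gx.
by apply: filterS => y [/fg /= ->].
Qed.

Section Lifting.
Variables (R : realType) (X : topologicalType) (Z : Type).
Local Notation C := (R[i]^o).
Variables (Phi : X -> Z) (Psi : C -> Z) (G : set (X -> X)) (D E : set C).
Hypothesis hX : hausdorff_space X.
Hypothesis Gcont : forall g, G g -> continuous g.
Hypothesis GPhi : forall g, G g -> forall x, Phi (g x) = Phi x.
Hypothesis Gtrans : forall x x', Phi x = Phi x' -> exists2 g, G g & g x = x'.
Hypothesis dE : discreteC D E.
Hypothesis linj : forall z x, D z -> ~ E z -> Phi x = Psi z ->
  exists2 U, nbhs x U & forall a b, U a -> U b -> Phi a = Phi b -> a = b.

(** The setting of this section generalizes coverings: [Phi] is the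
    projection, its fibres are the orbits of G, and [Phi] is locally
    injective except over the image of the discrete set E. Lifts through
    branched coverings, continuous k-th roots and sections over convex
    domains are all instances. *)
Definition lift_on (f : C -> X) (V : set C) :=
  forall u, V u -> continuous_at u f /\ Phi (f u) = Psi u.

Lemma lift_onS f V W : W `<=` V -> lift_on f V -> lift_on f W.
Proof. by move=> WV fV u /WV; exact: fV. Qed.

Lemma lift_on_comp g f V : G g -> lift_on f V -> lift_on (g \o f) V.
Proof.
move=> Gg fV u /fV[cf Pf]; split; last by rewrite /= GPhi.
by apply: continuous_comp => //; exact: Gcont.
Qed.

Lemma not_discrete (V : set C) (u : C) : open V -> V `<=` D -> V u -> exists2 w, V w & ~ E w.
Proof.
move=> /openC oV VD Vu; have [e1 e10 h1] := oV u Vu; have [e2 e20 h2] := dE (VD _ Vu).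
have h : nC (u + (Num.min e1 e2 / 2)%:C - u) = Num.min e1 e2 / 2.
  by rewrite addrAC subrr add0r nCR gtr0_norm // divr_gt0 // lt_min e10.
have m0 : 0 < Num.min e1 e2 by rewrite lt_min e10.
exists (u + (Num.min e1 e2 / 2)%:C).
  apply: h1; rewrite h; have : Num.min e1 e2 <= e1 by rewrite ge_min lexx.
  by lra.
move=> /h2; rewrite h => H; have := h; rewrite H ?subrr ?nC0; first by lra.
have : Num.min e1 e2 <= e2 by rewrite ge_min lexx orbT.
by lra.
Qed.

(** Outside E two lifts agree or disagree on a neighbourhood of each point,
    so they agree outside E by [lc_discrete], and everywhere by continuity. *)
Lemma lift_eq (V : set C) f f' (u : C) : open V -> convexC V -> V `<=` D ->
  lift_on f V -> lift_on f' V -> V u -> ~ E u -> f u = f' u ->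
  forall v : C, V v -> f v = f' v.
Proof.
move=> oV cV VD fV f'V Vu Eu fu.
have ne v : V v -> f v <> f' v -> exists2 e : R, 0 < e & forall w, nC (w - v) < e -> f w <> f' w.
  move=> Vv /((hausdorffP X).1 hX)[A [B [oA oB Af Bf AB]]].
  have nA : nbhs v (f @^-1` A) by apply: (fV v Vv).1; exact: open_nbhs_nbhs.
  have nB : nbhs v (f' @^-1` B) by apply: (f'V v Vv).1; exact: open_nbhs_nbhs.
  have /nbhsC[e e0 he] : nbhs v ((f @^-1` A) `&` (f' @^-1` B)) by exact: filterI.
  exists e => // w /he[/= Aw Bw] eqw.
  by apply: AB Aw _; rewrite eqw.
have loc v : V v -> ~ E v -> exists2 e : R, 0 < e & forall w, nC (w - v) < e -> (f w = f' w <-> f v = f' v).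
  move=> Vv Ev; case: (pselect (f v = f' v)) => [efv|nfv]; last first.
    by have [e e0 he] := ne v Vv nfv; exists e => // w /he; tauto.
  have [U nU Uinj] := linj (VD _ Vv) Ev (fV v Vv).2.
  have nA : nbhs v (f @^-1` U) by apply: (fV v Vv).1.
  have nB : nbhs v (f' @^-1` U) by apply: (f'V v Vv).1; rewrite -efv.
  have nV : nbhs v V by exact: open_nbhs_nbhs.
  have /nbhsC[e e0 he] : nbhs v (V `&` ((f @^-1` U) `&` (f' @^-1` U))) by apply: filterI => //; exact: filterI.
  exists e => // w /he[/= Vw [Aw Bw]].
  split=> // _; apply: Uinj => //.
  by rewrite (fV w Vw).2 (f'V w Vw).2.
have dEV : discreteC V E by move=> z /VD; exact: dE.
have key v : V v -> ~ E v -> f v = f' v.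
  by move=> Vv Ev; apply/(lc_discrete oV cV dEV loc Vv Ev Vu Eu).
move=> v Vv; apply: contrapT => nfv.
have [e e0 he] := ne v Vv nfv.
have oW : open (V `&` disc v e) by apply: openI => //; exact: open_disc.
have [||w [Vw vw] Ew] := @not_discrete _ v oW; first by move=> w [/VD].
  by split=> //; exact: disc_center.
exact: he vw (key w Vw Ew).
Qed.

(** An element of G matches the two lifts at one point outside E, and
    uniqueness of lifts does the rest. *)
Lemma lift_G (V : set C) f f' (u : C) : open V -> convexC V -> V `<=` D -> V u ->
  lift_on f V -> lift_on f' V -> exists2 g, G g & forall v, V v -> f' v = g (f v).
Proof.
move=> oV cV VD Vu fV f'V; have [w Vw Ew] := not_discrete oV VD Vu.
have [|g Gg gf] := @Gtrans (f w) (f' w); first by rewrite (fV w Vw).2 (f'V w Vw).2.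
exists g => // v Vv; apply/esym; move: v Vv.
exact: (lift_eq oV cV VD (lift_on_comp Gg fV) f'V Vw Ew).
Qed.

Section Tube.
Variables (z0 z1 : C).
Let ga (t : R) : C := z0 + t%:C * (z1 - z0).
Let tube (s e : R) : set C := [set w | exists2 r : R, 0 <= r <= s & nC (w - ga r) < e].

Let ga_dist r t : nC (ga r - ga t) = `|r - t| * nC (z1 - z0).
Proof. by rewrite -nCR -nCM rmorphB; congr nC; rewrite /ga /=; ring. Qed.

Let tube_open s e : open (tube s e).
Proof.
apply/openC => w [r rs we]; exists (e - nC (w - ga r)); first by rewrite subr_gt0.
move=> u uw; exists r => //; move: uw; rewrite ltrBrDr; apply: le_lt_trans; exact: nC_dist3.
Qed.

Let tube_convex s e : convexC (tube s e).
Proof.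
move=> a [r rs ar]; split=> [|b t [r' rs' br'] t01]; first by exists r.
exists ((1 - t) * r + t * r').
  case/andP: rs => r0 rs; case/andP: rs' => r'0 rs'; case/andP: t01 => t0 t1.
  apply/andP; split; first by rewrite addr_ge0 // mulr_ge0 // subr_ge0.
  have h1 : (1 - t) * r <= (1 - t) * s by rewrite ler_wpM2l // subr_ge0.
  have h2 : t * r' <= t * s by rewrite ler_wpM2l.
  by apply: le_trans (lerD h1 h2) _; rewrite -mulrDl subrK mul1r.
have -> : a + t%:C * (b - a) - ga ((1 - t) * r + t * r') =
  (a - ga r) + t%:C * ((b - ga r') - (a - ga r)).
  by rewrite /ga rcD !rcM rmorphB /=; ring.
have h x : nC x < e -> disc (0 : C) e x by rewrite /disc /= subr0.
have := (convex_disc (h _ ar)).2 _ _ (h _ br') t01.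
by rewrite /disc /= subr0.
Qed.

Hypothesis oD : open D.
Hypothesis sD : starC z0 D.
Hypothesis Dz1 : D z1.
Hypothesis locallift : forall z, D z -> exists2 e : R, 0 < e & exists f, lift_on f (disc z e).
Variables (f0 : C -> X) (e0 : R).
Hypothesis e0_gt0 : 0 < e0.
Hypothesis f0P : lift_on f0 (disc z0 e0).

(** The bound by [e0] keeps the continuation equal to [f0] near the starting
    point. *)
Let reach (t : R) := exists e : R, [/\ 0 < e, e <= e0, tube t e `<=` D &
  exists2 f, lift_on f (tube t e) & forall w, disc z0 e w -> f w = f0 w].

Let D_ga t : 0 <= t <= 1 -> D (ga t).
Proof. by move=> t01; exact: sD.2. Qed.

Let tubeS s t e e' : s <= t -> e <= e' -> tube s e `<=` tube t e'.
Proof.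
move=> st ee w [r /andP[r0 rs] rw]; exists r; last exact: lt_le_trans ee.
by rewrite r0 (le_trans rs).
Qed.

Let disc0_tube t e : 0 <= t -> disc z0 e `<=` tube t e.
Proof.
move=> t0 w we; exists 0; first by rewrite lexx.
by rewrite /ga mul0r addr0.
Qed.

Let reach_dec s t : s <= t -> reach t -> reach s.
Proof.
move=> st [e [e0' ee tD [f fl ff]]]; exists e; split=> //.
  by apply: subset_trans tD; exact: tubeS.
by exists f => //; apply: lift_onS fl; exact: tubeS.
Qed.

Let reach_step c e F s t : 0 < e -> disc (ga c) e `<=` D -> lift_on F (disc (ga c) e) ->
  0 <= s -> s <= t -> nC (ga s - ga c) < e / 2 -> nC (ga t - ga c) < e / 2 ->
  reach s -> reach t.
Proof.
move=> e_gt0 eD Fl s0 st sc tc [d [d0 de0 tD [f fl ff]]].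
have incl : tube t (Num.min d (e / 2)) `<=` tube s d `|` disc (ga c) e.
  move=> w [r /andP[r0 rt]]; rewrite lt_min => /andP[rd re].
  case: (leP r s) => rs; first by left; exists r => //; rewrite r0.
  right; rewrite /disc /=; apply: le_lt_trans (nC_dist3 _ (ga r) _) _.
  suff : nC (ga r - ga c) < e / 2 by lra.
  move: sc tc; rewrite !ga_dist; have := nC_ge0 (z1 - z0); set L := nC _ => L0 sc tc.
  case: (leP c r) => cr.
    apply: le_lt_trans tc; rewrite ler_wpM2r // !ger0_norm ?subr_ge0 //; lra.
  apply: le_lt_trans sc; rewrite ler_wpM2r // !ler0_norm ?subr_le0 //; lra.
have d'0 : 0 < Num.min d (e / 2) by rewrite lt_min d0 divr_gt0.
exists (Num.min d (e / 2)); split=> //.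
- by rewrite ge_min de0.
- by move=> w /incl[/tD|/eD].
have [||||||g Gg gF] := @lift_G (tube s d `&` disc (ga c) e) F f (ga s).
- by apply: openI; [exact: tube_open|exact: open_disc].
- by apply: convexI; [exact: tube_convex|exact: convex_disc].
- by move=> w [/tD].
- split; last by rewrite /disc /=; lra.
  by exists s; rewrite ?subrr ?nC0 // s0 lexx.
- by apply: lift_onS Fl => w [].
- by apply: lift_onS fl => w [].
have [fE gE] : (forall w, tube s d w -> (if `[< tube s d w >] then f w else g (F w)) = f w) /\
    (forall w, disc (ga c) e w -> (if `[< tube s d w >] then f w else g (F w)) = g (F w)).
  split=> w; first by move=> /asboolT ->.
  by move=> cw; case: asboolP => // tw; exact: gF.
exists (fun w => if `[< tube s d w >] then f w else g (F w)); last first.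
  by move=> w wd; rewrite fE ?ff //; [|apply: disc0_tube]; move: wd; rewrite /disc /= lt_min => /andP[].
move=> w /incl[ws|wc].
- split; last by rewrite fE // (fl w ws).2.
  apply: (@continuous_at_near _ _ f _ _ (tube s d)); last exact: (fl w ws).1.
    by apply: open_nbhs_nbhs; split=> //; exact: tube_open.
  by move=> v /fE ->.
- have gFl := lift_on_comp Gg Fl.
  split; last by rewrite gE // (gFl w wc).2.
  apply: (@continuous_at_near _ _ (g \o F) _ _ (disc (ga c) e)); last exact: (gFl w wc).1.
    by apply: open_nbhs_nbhs; split=> //; exact: open_disc.
  by move=> v /gE ->.
Qed.

(** Continuation along the segment from z0 to z1. A neighbourhood of the
    segment, rather than the segment itself, carries the lift, so that the
    lifts along nearby segments can be compared by [lift_eq]. *)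
Lemma lift_tube : exists e : R, [/\ 0 < e, tube 1 e `<=` D &
  exists2 f, lift_on f (tube 1 e) & forall w, disc z0 e w -> f w = f0 w].
Proof.
suff : reach 1 by move=> [e [? ? ? ?]]; exists e.
apply: (@lc_interval R reach) => [t t01|].
  have [e1 e10 [F Fl]] := locallift (D_ga t01).
  have [e2 e20 eD] := (openC D).1 oD _ (D_ga t01).
  pose e := Num.min e1 e2.
  have e_gt0 : 0 < e by rewrite lt_min e10.
  have eD' : disc (ga t) e `<=` D.
    by move=> w; rewrite /disc /= lt_min => /andP[_]; exact: eD.
  have Fl' : lift_on F (disc (ga t) e).
    by apply: lift_onS Fl => w; rewrite /disc /= lt_min => /andP[].
  have h : 0 < nC (z1 - z0) + 1 by rewrite ltr_wpDl ?nC_ge0.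
  exists (e / 2 / (nC (z1 - z0) + 1)); first by rewrite !divr_gt0.
  move=> s /andP[s0 s1] st.
  have sd : nC (ga s - ga t) < e / 2.
    rewrite ga_dist; move: st; rewrite ltr_pdivlMr //; apply: le_lt_trans.
    by rewrite ler_wpM2l // lerDl.
  have td : nC (ga t - ga t) < e / 2 by rewrite subrr nC0 divr_gt0.
  case/andP: t01 => t0 t1; case: (leP s t) => ts.
    by split; [exact: reach_step Fl' _ _ _ _|exact: reach_dec].
  by split; [apply: reach_dec; exact: ltW|apply: (reach_step e_gt0 eD' Fl') => //; exact: ltW].
have [e1 e10 eD] := (openC D).1 oD _ sD.1.
have t0 e w : tube 0 e w -> nC (w - z0) < e.
  by move=> [r]; rewrite -eq_le => /eqP <-; rewrite /ga mul0r addr0.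
exists (Num.min e0 e1); split.
- by rewrite lt_min e0_gt0.
- by rewrite ge_min lexx.
- by move=> w /t0; rewrite lt_min => /andP[_ /eD].
exists f0 => //; apply: lift_onS f0P => w /t0.
by rewrite /disc /= lt_min => /andP[].
Qed.

(** This constant and the lemmas after it export, for use outside the
    section, what is needed about the neighbourhoods of segments. *)
Definition tube1 (e : R) : set C := tube 1 e.
Lemma tube1_open (e : R) : open (tube1 e). Proof. exact: tube_open. Qed.
Lemma tube1_convex (e : R) : convexC (tube1 e). Proof. exact: tube_convex. Qed.
Lemma tube1_end (e : R) (w : C) : nC (w - z1) < e -> tube1 e w.
Proof. by exists 1; rewrite ?ler01 ?lexx // /ga mul1r [z0 + _]addrC subrK. Qed.
Lemma tube1_start (e : R) (w : C) : nC (w - z0) < e -> tube1 e w.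
Proof. by exists 0; rewrite ?lexx ?ler01 // /ga mul0r addr0. Qed.
End Tube.

(** The lift at z is obtained by continuation along the segment from the
    centre. Neighbourhoods of two segments from the centre meet in a convex
    set containing the centre, where the two continuations agree; hence the
    values at the end points fit together. *)
Theorem lift_star z0 f0 e0 : open D -> starC z0 D ->
  (forall z, D z -> exists2 e : R, 0 < e & exists f, lift_on f (disc z e)) ->
  0 < e0 -> lift_on f0 (disc z0 e0) ->
  exists f, lift_on f D /\ \forall w \near z0, f w = f0 w.
Proof.
move=> oD sD loc e0_gt0 f0P.
have H (z1 : C) : exists ef : R * (C -> X), D z1 ->
    [/\ 0 < ef.1, tube1 z0 z1 ef.1 `<=` D, lift_on ef.2 (tube1 z0 z1 ef.1) &
        forall w, disc z0 ef.1 w -> ef.2 w = f0 w].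
  case: (pselect (D z1)) => [Dz1|]; last by exists (0, f0).
  have [e [e_gt0 tD [f fl ff]]] := lift_tube oD sD Dz1 loc e0_gt0 f0P.
  by exists (e, f).
have [ef efP] := choice H.
pose F z := (ef z).2 z.
have Fnear z : D z -> forall w, disc z (ef z).1 w -> F w = (ef z).2 w.
  move=> Dz w wz; have [ez tz lz fz] := efP z Dz.
  have tw : tube1 z0 z (ef z).1 w by exact: tube1_end.
  have Dw := tz _ tw; have [ew tw' lw fw] := efP w Dw.
  pose V := tube1 z0 w (ef w).1 `&` tube1 z0 z (ef z).1.
  pose m := Num.min (ef w).1 (ef z).1.
  have m0 : 0 < m by rewrite lt_min ew.
  have [|||u um Eu] := @not_discrete (disc z0 m `&` D) z0.
  - by apply: openI => //; exact: open_disc.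
  - by move=> v [].
  - by split; [exact: disc_center|exact: sD.1].
  have [u1 u2] : nC (u - z0) < (ef w).1 /\ nC (u - z0) < (ef z).1.
    by move: um => [+ _]; rewrite /disc /= lt_min => /andP.
  apply: (@lift_eq V (ef w).2 (ef z).2 u) => //.
  - by apply: openI; exact: tube1_open.
  - by apply: convexI; exact: tube1_convex.
  - by move=> v [/tw'].
  - by apply: lift_onS lw => v [].
  - by apply: lift_onS lz => v [].
  - by split; exact: tube1_start.
  - by rewrite fw // fz.
  - by split=> //; apply: tube1_end; rewrite subrr nC0.
exists F; split.
  move=> z Dz; have [ez tz lz fz] := efP z Dz.
  have tz' : tube1 z0 z (ef z).1 z by apply: tube1_end; rewrite subrr nC0.
  split; last exact: (lz z tz').2.
  apply: (@continuous_at_near _ _ (ef z).2 _ _ (disc z (ef z).1)); last exact: (lz z tz').1.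
    by apply/nbhsC; exists (ef z).1.
  by move=> w /(Fnear z Dz) ->.
have [ez tz lz fz] := efP z0 sD.1.
apply/nbhsC; exists (ef z0).1 => // w wz.
by rewrite (Fnear z0 sD.1) // fz.
Qed.

End Lifting.

(** * Integrals along rectangles and Goursat's theorem *)

Section Primitive.
Variable R : realType.
Local Notation mu := (@lebesgue_measure R).

Lemma is_derive_cst_eq (F : R -> R) (a b : R) : a <= b ->
  (forall x, a <= x <= b -> is_derive x 1 F 0) -> F a = F b.
Proof.
move=> ab H; have [||c _] := @MVT_segment R F (fun=> 0) a b ab.
- by move=> x; rewrite in_itv /= => /andP[h1 h2]; apply: H; rewrite !ltW.
- apply: derivable_within_continuous => x; rewrite in_itv /= => h.
  by have := H x h; case.
- by rewrite mul0r => /subr0_eq.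
Qed.

Lemma primitive_exists (f : R -> R) (a0 : R) : continuous f ->
  exists F : R -> R, forall x, a0 < x -> is_derive x 1 F (f x).
Proof.
move=> cf; exists (fun x => \int[mu]_(t in `[a0, x]) f t)%R.
move=> x ax; have [||||D1 D2] := @continuous_FTC1_closed R f a0 x (x + 1).
- by rewrite ltrDl.
- apply: continuous_compact_integrable; first exact: segment_compact.
  exact: continuous_subspaceT.
- by [].
- exact: cf.
- by split; [exact: D1|rewrite -derive1E; exact: D2].
Qed.

Definition isprim (f : R -> R) (a b : R) (F : R -> R) := forall x, a <= x <= b -> is_derive x 1 F (f x).

(** The integral of a continuous function of a real variable, as the
    increment of a chosen primitive. This keeps measure theory out of the
    estimates; it enters only through the existence of primitives. *)
Definition J (f : R -> R) (a b : R) : R :=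
  let F := xget (fun=> 0) [set F | isprim f a b F] in F b - F a.

Lemma JE f a b F : a <= b -> isprim f a b F -> J f a b = F b - F a.
Proof.
move=> ab PF; rewrite /J; case: xgetP => [G _ PG|/(_ F)//].
apply/eqP; rewrite -subr_eq0; apply/eqP.
have -> : G b - G a - (F b - F a) = (G b - F b) - (G a - F a) by ring.
apply/eqP; rewrite subr_eq0; apply/eqP/esym.
apply: (@is_derive_cst_eq (fun x => G x - F x)) => // x xab.
by have -> : 0 = f x - f x by [rewrite subrr]; apply: is_deriveB; [exact: PG|exact: PF].
Qed.

Lemma isprim_exists f a b : continuous f -> exists F, isprim f a b F.
Proof.
move=> cf; have [F HF] := primitive_exists (a - 1) cf.
by exists F => x /andP[ax _]; apply: HF; lra.
Qed.

Lemma isprimS f a b a' b' F : a <= a' -> b' <= b -> isprim f a b F -> isprim f a' b' F.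
Proof. by move=> aa bb PF x /andP[h1 h2]; apply: PF; apply/andP; split; lra. Qed.

Lemma J_split f a m b : continuous f -> a <= m -> m <= b -> J f a b = J f a m + J f m b.
Proof.
move=> cf am mb; have [F PF] := isprim_exists a b cf.
rewrite (JE _ PF) ?(le_trans am) // (JE am (isprimS _ _ PF)) // (JE mb (isprimS _ _ PF)) //.
by ring.
Qed.

Lemma continuous_lin (f g : R -> R) (s t : R) : continuous f -> continuous g ->
  continuous (fun x => s * f x + t * g x).
Proof.
move=> cf cg x; apply: (@cvgD _ R^o).
  by apply: (@cvgM R) (cf x); exact: cvg_cst.
by apply: (@cvgM R) (cg x); exact: cvg_cst.
Qed.

Lemma J_lin f g (s t a b : R) : continuous f -> continuous g -> a <= b ->
  J (fun x => s * f x + t * g x) a b = s * J f a b + t * J g a b.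
Proof.
move=> cf cg ab; have [F PF] := isprim_exists a b cf; have [G PG] := isprim_exists a b cg.
rewrite (JE ab PF) (JE ab PG) (@JE _ a b (fun x => s * F x + t * G x)) //; first by ring.
move=> x xab; have := PF x xab; have := PG x xab => dG dF.
by apply: is_deriveD; apply: is_deriveZ.
Qed.

Lemma J_le f (a b M : R) : continuous f -> a <= b -> (forall x, a <= x <= b -> f x <= M) ->
  J f a b <= M * (b - a).
Proof.
move=> cf ab fM; have [F PF] := isprim_exists a b cf; rewrite (JE ab PF).
have [||c cab ->] := @MVT_segment R F f a b ab.
- by move=> x; rewrite in_itv /= => /andP[h1 h2]; apply: PF; rewrite !ltW.
- apply: derivable_within_continuous => x; rewrite in_itv /= => h.
  by have := PF x h; case.
by rewrite ler_wpM2r ?subr_ge0 // fM //; move: cab; rewrite in_itv.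
Qed.

Lemma J_bound f (a b M : R) : continuous f -> a <= b -> (forall x, a <= x <= b -> `|f x| <= M) ->
  `|J f a b| <= M * (b - a).
Proof.
move=> cf ab fM; rewrite ler_norml; apply/andP; split.
  have : J (fun x => -1 * f x + 0 * f x) a b <= M * (b - a).
    apply: J_le => // [|x xab].
      exact: continuous_lin.
    by rewrite mul0r addr0 mulN1r lerNl; have := fM x xab; rewrite ler_norml => /andP[].
  rewrite J_lin // mul0r addr0 mulN1r; lra.
by apply: J_le => // x /fM; rewrite ler_norml => /andP[].
Qed.
End Primitive.

Section ComplexIntegral.
Variable R : realType.
Local Notation C := (R[i]^o).
Implicit Types (f g : R -> R[i]) (a b m : R).

Definition rcont f := continuous ((fun x => complex.Re (f x))) /\ continuous ((fun x => complex.Im (f x))).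
Definition JC f a b : R[i] := J ((fun x => complex.Re (f x))) a b +i* J ((fun x => complex.Im (f x))) a b.

Lemma JC_split f a m b : rcont f -> a <= m -> m <= b -> JC f a b = JC f a m + JC f m b.
Proof. by move=> [c1 c2] am mb; rewrite /JC (J_split c1 am mb) (J_split c2 am mb). Qed.

Lemma JC_lin f g (c d : R[i]) a b : rcont f -> rcont g -> a <= b ->
  JC (fun x => c * f x + d * g x) a b = c * JC f a b + d * JC g a b.
Proof.
move=> [f1 f2] [g1 g2] ab.
have split4 (p q r t : R) : J (fun x => (p * complex.Re (f x) + q * complex.Im (f x)) + (r * complex.Re (g x) + t * complex.Im (g x))) a b =
  (p * J ((fun x => complex.Re (f x))) a b + q * J ((fun x => complex.Im (f x))) a b) + (r * J ((fun x => complex.Re (g x))) a b + t * J ((fun x => complex.Im (g x))) a b).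
  have -> : (fun x => (p * complex.Re (f x) + q * complex.Im (f x)) + (r * complex.Re (g x) + t * complex.Im (g x))) =
    (fun x => 1 * (p * complex.Re (f x) + q * complex.Im (f x)) + 1 * (r * complex.Re (g x) + t * complex.Im (g x))).
    by apply/funext => x; rewrite !mul1r.
  rewrite J_lin ?mul1r //; try exact: (@continuous_lin R).
  by rewrite !J_lin.
case: c d => c1 c2 [d1 d2]; rewrite /JC; apply: complex_eq => /=.
  rewrite (_ : (fun x => _) = (fun x => (c1 * complex.Re (f x) + (- c2) * complex.Im (f x)) + (d1 * complex.Re (g x) + (- d2) * complex.Im (g x)))).
    by rewrite split4; ring.
  by apply/funext => x /=; case: (f x) => ? ?; case: (g x) => ? ? /=; ring.
rewrite (_ : (fun x => _) = (fun x => (c2 * complex.Re (f x) + c1 * complex.Im (f x)) + (d2 * complex.Re (g x) + d1 * complex.Im (g x)))).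
  by rewrite split4; ring.
by apply/funext => x /=; case: (f x) => ? ?; case: (g x) => ? ? /=; ring.
Qed.

Lemma JC_bound f a b (M : R) : rcont f -> a <= b -> (forall x, a <= x <= b -> nC (f x) <= M) ->
  nC (JC f a b) <= 2 * M * (b - a).
Proof.
move=> [f1 f2] ab fM; apply: le_trans (nC_ReIm _) _ => /=.
have -> : 2 * M * (b - a) = M * (b - a) + M * (b - a) by ring.
apply: lerD; apply: J_bound => // x /fM; apply: le_trans; [exact: Re_le_nC|exact: Im_le_nC].
Qed.

Lemma rcont_comp (g : C -> C) (p : R -> C) : (forall z, ccont g z) ->
  continuous p -> rcont (fun t => g (p t)).
Proof.
move=> cg cp.
have h t : continuous_at t (g \o p).
  by have [cgp] := cg (p t); exact: (@continuous_comp R C C p g t (cp t) cgp).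
split=> t.
  exact: (@continuous_comp R C R (g \o p) (fun z => complex.Re z) t (h t) (continuous_Re (z := _))).
exact: (@continuous_comp R C R (g \o p) (fun z => complex.Im z) t (h t) (continuous_Im (z := _))).
Qed.

Lemma continuous_hor (c : R) : continuous (fun t : R => (t +i* c : C)).
Proof. by move=> t; apply: (@cvg_Complex R R (nbhs t) _ id); [exact: cvg_id|exact: cvg_cst]. Qed.
Lemma continuous_ver (c : R) : continuous (fun t : R => (c +i* t : C)).
Proof. by move=> t; apply: (@cvg_Complex R R (nbhs t) _ (fun=> c)); [exact: cvg_cst|exact: cvg_id]. Qed.

Let ii : R[i] := 0 +i* 1.

(** The boundary of the rectangle is traversed counterclockwise. *)
Definition rect_int (g : C -> C) (a b c d : R) : R[i] :=
  JC (fun t => g (t +i* c)) a b + ii * JC (fun t => g (b +i* t)) c d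
  - JC (fun t => g (t +i* d)) a b - ii * JC (fun t => g (a +i* t)) c d.

Section Rect.
Variable g : C -> C.
Hypothesis cg : forall z, ccont g z.
Let rh c : rcont (fun t => g (t +i* c)). Proof. exact: rcont_comp (@continuous_hor c). Qed.
Let rv c : rcont (fun t => g (c +i* t)). Proof. exact: rcont_comp (@continuous_ver c). Qed.

Lemma rect_int_splitx a m b c d : a <= m -> m <= b ->
  rect_int g a b c d = rect_int g a m c d + rect_int g m b c d.
Proof.
move=> am mb; rewrite /rect_int (JC_split (rh c) am mb) (JC_split (rh d) am mb); ring.
Qed.
Lemma rect_int_splity a b c m d : c <= m -> m <= d ->
  rect_int g a b c d = rect_int g a b c m + rect_int g a b m d.
Proof.
move=> cm md; rewrite /rect_int (JC_split (rv a) cm md) (JC_split (rv b) cm md); ring.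
Qed.
Lemma rect_int_bound a b c d M : a <= b -> c <= d ->
  (forall x y, a <= x <= b -> c <= y <= d -> nC (g (x +i* y)) <= M) ->
  nC (rect_int g a b c d) <= 4 * M * ((b - a) + (d - c)).
Proof.
move=> ab cd gM; rewrite /rect_int.
have h1 : nC (JC (fun t => g (t +i* c)) a b) <= 2 * M * (b - a).
  by apply: JC_bound => // x xab; apply: gM => //; rewrite lexx cd.
have h2 : nC (JC (fun t => g (t +i* d)) a b) <= 2 * M * (b - a).
  by apply: JC_bound => // x xab; apply: gM => //; rewrite lexx cd.
have h3 : nC (JC (fun t => g (a +i* t)) c d) <= 2 * M * (d - c).
  by apply: JC_bound => // x xab; apply: gM => //; rewrite lexx ab.
have h4 : nC (JC (fun t => g (b +i* t)) c d) <= 2 * M * (d - c).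
  by apply: JC_bound => // x xab; apply: gM => //; rewrite lexx ab.
have i1 : nC ii = 1 by rewrite /nC /= expr0n add0r expr1n sqrtr1.
apply: le_trans (nCD _ _) _; rewrite nCN nCM i1 mul1r.
have := nCD (JC (fun t => g (t +i* c)) a b + ii * JC (fun t => g (b +i* t)) c d) (- JC (fun t => g (t +i* d)) a b).
have := nCD (JC (fun t => g (t +i* c)) a b) (ii * JC (fun t => g (b +i* t)) c d).
rewrite nCN nCM i1 mul1r => t1 t2.
have -> : 4 * M * (b - a + (d - c)) = 2 * (2 * M * (b - a)) + 2 * (2 * M * (d - c)) by ring.
lra.
Qed.
End Rect.

Lemma rect_int_lin (f g : C -> C) (s t : C) a b c d : (forall z, ccont f z) -> (forall z, ccont g z) ->
  a <= b -> c <= d ->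
  rect_int (fun z => s * f z + t * g z) a b c d = s * rect_int f a b c d + t * rect_int g a b c d.
Proof.
move=> cf cg ab cd; rewrite /rect_int.
rewrite !(@JC_lin (fun x => f (x +i* _)) (fun x => g (x +i* _))) //;
  try by apply: (rcont_comp (p := fun x => (x +i* _))) => //; exact: continuous_hor.
rewrite !(@JC_lin (fun x => f (_ +i* x)) (fun x => g (_ +i* x))) //;
  try by apply: (rcont_comp (p := fun x => (_ +i* x))) => //; exact: continuous_ver.
by ring.
Qed.

Lemma J_cst (k a b : R) : a <= b -> J (fun=> k) a b = k * (b - a).
Proof.
move=> ab; rewrite (@JE _ _ a b (fun x => k * x)) //; first by ring.
move=> x _; have {2}-> : k = k *: (1 : R) by rewrite /GRing.scale /= mulr1.
exact: (@is_deriveZ _ R^o R^o id k x 1 1).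
Qed.
Lemma J_id (a b : R) : a <= b -> J id a b = (b ^+ 2 - a ^+ 2) / 2.
Proof.
move=> ab; rewrite (@JE _ _ a b (fun x => 2^-1 * (x * x))) //; first by field.
move=> x _; have {2}-> : id x = 2^-1 *: (x *: (1 : R) + x *: (1 : R)) by rewrite /GRing.scale /=; field.
apply: (@is_deriveZ _ R^o R^o (fun x => x * x) 2^-1 x 1).
Qed.

Lemma rect_int_cst (k : C) a b c d : a <= b -> c <= d -> rect_int (fun=> k) a b c d = 0.
Proof.
move=> ab cd; rewrite /rect_int /JC /= !J_cst //.
by apply: complex_eq; rewrite /ii /=; ring.
Qed.
Lemma rect_int_id a b c d : a <= b -> c <= d -> rect_int id a b c d = 0.
Proof.
move=> ab cd; rewrite /rect_int /JC /= !J_cst // !J_id //.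
by apply: complex_eq; rewrite /ii /=; field.
Qed.

Lemma archi_pow2 (L d : R) : 0 < d -> exists n : nat, L / 2 ^+ n < d.
Proof.
move=> d0; exists (Num.bound `|L / d|).
have h : L / d < (Num.bound `|L / d|)%:R by apply: le_lt_trans (ler_norm _) _; exact: archi_boundP.
rewrite ltr_pdivrMr ?exprn_gt0 // mulrC -ltr_pdivrMr //; apply: lt_le_trans h _.
rewrite -natrX ler_nat; apply: ltnW; exact: ltn_expl.
Qed.

(** A nested sequence of quarters on which P fails shrinks to a point, where
    the local hypothesis is contradicted. Used both for Goursat's theorem and
    as a compactness principle for rectangles. *)
Lemma bisection (P : R -> R -> R -> R -> Prop) (a b c d : R) : a <= b -> c <= d ->
  (forall a b c d, a <= b -> c <= d ->
     P a ((a + b) / 2) c ((c + d) / 2) -> P ((a + b) / 2) b c ((c + d) / 2) ->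
     P a ((a + b) / 2) ((c + d) / 2) d -> P ((a + b) / 2) b ((c + d) / 2) d -> P a b c d) ->
  (forall x y, a <= x <= b -> c <= y <= d -> exists2 e : R, 0 < e &
     forall a' b' c' d', a' <= x <= b' -> c' <= y <= d' -> b' - a' < e -> d' - c' < e -> P a' b' c' d') ->
  P a b c d.
Proof.
move=> ab cd quarter local; apply: contrapT => nP.
pose T := (R * R * (R * R))%type.
pose ok (t : T) := [/\ t.1.1 <= t.1.2, t.2.1 <= t.2.2 & ~ P t.1.1 t.1.2 t.2.1 t.2.2].
have step (t : T) : exists t' : T, ok t -> [/\ ok t',
   t.1.1 <= t'.1.1 /\ t'.1.2 <= t.1.2, t.2.1 <= t'.2.1 /\ t'.2.2 <= t.2.2,
   t'.1.2 - t'.1.1 = (t.1.2 - t.1.1) / 2 & t'.2.2 - t'.2.1 = (t.2.2 - t.2.1) / 2].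
  case: (pselect (ok t)) => [[]|nok]; last by exists t.
  move: t => [[p q] [r s]] /= pq rs nPt.
  case: (pselect (P p ((p + q) / 2) r ((r + s) / 2))) => [h1|h]; last first.
    by exists ((p, (p + q) / 2), (r, (r + s) / 2)) => _; split=> /=; try split=> /=; try (by []); lra.
  case: (pselect (P ((p + q) / 2) q r ((r + s) / 2))) => [h2|h]; last first.
    by exists (((p + q) / 2, q), (r, (r + s) / 2)) => _; split=> /=; try split=> /=; try (by []); lra.
  case: (pselect (P p ((p + q) / 2) ((r + s) / 2) s)) => [h3|h]; last first.
    by exists ((p, (p + q) / 2), ((r + s) / 2, s)) => _; split=> /=; try split=> /=; try (by []); lra.
  case: (pselect (P ((p + q) / 2) q ((r + s) / 2) s)) => [h4|h]; last first.
    by exists (((p + q) / 2, q), ((r + s) / 2, s)) => _; split=> /=; try split=> /=; try (by []); lra.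
  by case: nPt; exact: quarter.
have [nx nxP] := choice step.
pose t n := iter n nx ((a, b), (c, d)).
have okt n : ok (t n) by elim: n => [|n /nxP[]].
have mono (n m : nat) : [/\ (t n).1.1 <= (t (m + n)%N).1.1, (t (m + n)%N).1.2 <= (t n).1.2,
     (t n).2.1 <= (t (m + n)%N).2.1 & (t (m + n)%N).2.2 <= (t n).2.2].
  elim: m => [|m [h1 h2 h3 h4]]; first by rewrite !lexx.
  have [_ [k1 k2] [k3 k4] _ _] := nxP _ (okt (m + n)%N).
  by rewrite addSn /t iterS -/(t _); split; [exact: le_trans k1|exact: le_trans h2|exact: le_trans k3|exact: le_trans h4].
have cross (n m : nat) : (t n).1.1 <= (t m).1.2 /\ (t n).2.1 <= (t m).2.2.
  have [h1 _ h3 _] := mono n m; have [_ h2 _ h4] := mono m n.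
  have [k1 k2 _] := okt (m + n)%N; rewrite addnC in h2 h4.
  by split; [apply: le_trans h1 (le_trans k1 h2)|apply: le_trans h3 (le_trans k2 h4)].
have size n : (t n).1.2 - (t n).1.1 = (b - a) / 2 ^+ n /\ (t n).2.2 - (t n).2.1 = (d - c) / 2 ^+ n.
  elim: n => [|n [h1 h2]]; first by rewrite expr0 !divr1.
  have [_ _ _ k1 k2] := nxP _ (okt n).
  by rewrite /t iterS -/(t _) k1 k2 h1 h2 exprSr invfM !mulrA.
pose x := sup [set (t n).1.1 | n in [set: nat]].
pose y := sup [set (t n).2.1 | n in [set: nat]].
have xP n : (t n).1.1 <= x <= (t n).1.2.
  apply/andP; split.
    by apply: ub_le_sup; [exists (t 0%N).1.2 => _ [m _ <-]; exact: (cross m 0%N).1|exists n].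
  by apply: ge_sup; [exists (t 0%N).1.1; exists 0%N|move=> _ [m _ <-]; exact: (cross m n).1].
have yP n : (t n).2.1 <= y <= (t n).2.2.
  apply/andP; split.
    by apply: ub_le_sup; [exists (t 0%N).2.2 => _ [m _ <-]; exact: (cross m 0%N).2|exists n].
  by apply: ge_sup; [exists (t 0%N).2.1; exists 0%N|move=> _ [m _ <-]; exact: (cross m n).2].
have [e e0 he] := local x y (xP 0%N) (yP 0%N).
have [n1 hn1] := archi_pow2 (b - a) e0; have [n2 hn2] := archi_pow2 (d - c) e0.
have [_ _ []] := okt (n1 + n2)%N; apply: he => //.
- rewrite (size _).1; apply: le_lt_trans hn1; rewrite ler_wpM2l ?subr_ge0 // lef_pV2 ?posrE ?exprn_gt0 //.
  by rewrite ler_weXn2l ?ler1n // leq_addr.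
- rewrite (size _).2; apply: le_lt_trans hn2; rewrite ler_wpM2l ?subr_ge0 // lef_pV2 ?posrE ?exprn_gt0 //.
  by rewrite ler_weXn2l ?ler1n // leq_addl.
Qed.

(** The defect is quadratic in the size of the rectangle: near a point of
    differentiability g differs from an affine function by e times the
    distance, and affine functions have integral zero. The quadratic bound is
    additive under quartering. *)
Theorem goursat (g : C -> C) a b c d : (forall z, ccont g z) -> a <= b -> c <= d ->
  (forall x y, a <= x <= b -> c <= y <= d -> cdiff g (x +i* y)) -> rect_int g a b c d = 0.
Proof.
move=> cg ab cd dg.
suff small e : 0 < e -> nC (rect_int g a b c d) <= e * ((b - a) + (d - c)) ^+ 2.
  apply/eqP; rewrite -nC_eq0 eq_le nC_ge0 andbT leNgt; apply/negP => I0.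
  set K := ((b - a) + (d - c)) ^+ 2 in small.
  have K0 : 0 <= K by rewrite sqr_ge0.
  have := small (nC (rect_int g a b c d) / 2 / (K + 1)).
  rewrite !divr_gt0 // ?ltr_wpDl // => /(_ isT).
  rewrite mulrAC ler_pdivlMr ?ltr_wpDl // mulrDr mulr1.
  have : nC (rect_int g a b c d) * K >= 0 by rewrite mulr_ge0 // nC_ge0.
  nra.
move=> e0.
pose P a b c d := a <= b -> c <= d -> nC (rect_int g a b c d) <= e * ((b - a) + (d - c)) ^+ 2.
apply: (@bisection P) => //.
  move=> {ab cd dg}a {}b {}c {}d ab cd P1 P2 P3 P4 _ _.
  set m := (a + b) / 2; set n := (c + d) / 2.
  have am : a <= m by rewrite /m; lra.
  have mb : m <= b by rewrite /m; lra.
  have cn : c <= n by rewrite /n; lra.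
  have nd : n <= d by rewrite /n; lra.
  rewrite (rect_int_splitx cg _ _ am mb) !(rect_int_splity cg _ _ cn nd).
  move: (P1 am cn) (P2 mb cn) (P3 am nd) (P4 mb nd) => {}P1 {}P2 {}P3 {}P4.
  rewrite -/m -/n in P1 P2 P3 P4.
  apply: le_trans (nCD _ _) _; apply: le_trans (lerD (nCD _ _) (nCD _ _)) _.
  have e1 : m - a = (b - a) / 2 by rewrite /m; lra.
  have e2 : b - m = (b - a) / 2 by rewrite /m; lra.
  have e3 : n - c = (d - c) / 2 by rewrite /n; lra.
  have e4 : d - n = (d - c) / 2 by rewrite /n; lra.
  rewrite e1 e3 in P1; rewrite e2 e3 in P2; rewrite e1 e4 in P3; rewrite e2 e4 in P4.
  have -> : e * (b - a + (d - c)) ^+ 2 = e * ((b - a) / 2 + (d - c) / 2) ^+ 2 +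
     e * ((b - a) / 2 + (d - c) / 2) ^+ 2 + (e * ((b - a) / 2 + (d - c) / 2) ^+ 2 + e * ((b - a) / 2 + (d - c) / 2) ^+ 2) by field.
  lra.
move=> x y xab ycd; have [phi [/ccontP cphi gphi]] := dg x y xab ycd.
set z : C := x +i* y in cphi gphi.
have e4 : 0 < e / 4 by rewrite divr_gt0.
have [r r0 hr] := cphi _ e4; exists (r / 2); first by rewrite divr_gt0.
move=> a' b' c' d' xab' ycd' ba dc ab' cd'.
(* the integral of the affine approximation at z vanishes *)
pose rem (u : C) : C := 1 * g u + (-1) * ((g z - phi z * z) * 1 + phi z * u).
have c1 w : ccont (fun u : C => (g z - phi z * z) * 1 + phi z * u) w.
  by apply: contD; apply: contM; try exact: contc; exact: conti.
have lin0 : rect_int (fun u : C => (g z - phi z * z) * 1 + phi z * u) a' b' c' d' = 0.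
  rewrite (@rect_int_lin (fun=> 1) id) //; [|by move=> w; exact: contc|by move=> w; exact: conti].
  by rewrite rect_int_cst // rect_int_id // !mulr0 addr0.
have -> : rect_int g a' b' c' d' = rect_int rem a' b' c' d'.
  by rewrite /rem (@rect_int_lin g) // lin0 mulr0 addr0 mul1r.
have crem w : ccont rem w.
  by apply: contD; apply: contM => //; exact: contc.
set L := b' - a' + (d' - c').
have bound : forall u v, a' <= u <= b' -> c' <= v <= d' -> nC (rem (u +i* v)) <= e / 4 * L.
  move=> u v uab vcd.
  have -> : rem (u +i* v) = (phi (u +i* v) - phi z) * ((u +i* v) - z) by rewrite /rem gphi; ring.
  have dist : nC ((u +i* v) - z) <= L.
    apply: le_trans (nC_ReIm _) _ => /=; apply: lerD; rewrite ler_norml.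
      by case/andP: xab' uab => ? ? /andP[? ?]; apply/andP; split; lra.
    by case/andP: ycd' vcd => ? ? /andP[? ?]; apply/andP; split; lra.
  rewrite nCM; apply: ler_pM => //; try exact: nC_ge0.
  by apply/ltW/hr; apply: le_lt_trans dist _; rewrite /L; lra.
apply: le_trans (rect_int_bound crem ab' cd' bound) _.
by rewrite le_eqVlt; apply/orP; left; apply/eqP; rewrite -/L; field.
Qed.

(** Exceptional points at which g is merely continuous do no harm, as the
    integral along a small square around one of them is small. This is what
    allows slope functions as integrands. *)
Theorem goursat_finite (g : C -> C) (E : seq C) a b c d : (forall z, ccont g z) -> a <= b -> c <= d ->
  (forall x y, a <= x <= b -> c <= y <= d -> (x +i* y : C) \notin E -> cdiff g (x +i* y)) ->
  rect_int g a b c d = 0.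
Proof.
move=> cg; elim: E a b c d => [|[p q] E IH] a b c d ab cd dg.
  by apply: goursat => // x y xab ycd; exact: dg.
(* rectangles avoiding the point p + i q are covered by the induction
   hypothesis *)
have avoid a' b' c' d' : a <= a' -> b' <= b -> c <= c' -> d' <= d -> a' <= b' -> c' <= d' ->
    ~~ ((a' <= p <= b') && (c' <= q <= d')) -> rect_int g a' b' c' d' = 0.
  move=> aa bb cc dd ab' cd' out; apply: IH => // x y xab ycd xyE; apply: dg.
  - by case/andP: xab => ? ?; apply/andP; split; lra.
  - by case/andP: ycd => ? ?; apply/andP; split; lra.
  - rewrite inE negb_or xyE andbT; apply: contra out => /eqP[<- <-].
    by rewrite xab ycd.
case: (boolP ((a <= p <= b) && (c <= q <= d))) => [/andP[/andP[ap pb] /andP[cq qd]]|]; last by apply: avoid.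
(* four such rectangles are cut off, leaving one of size at most 2 s around
   p + i q *)
suff small e : 0 < e -> nC (rect_int g a b c d) <= e.
  apply/eqP; rewrite -nC_eq0 eq_le nC_ge0 andbT leNgt; apply/negP => I0.
  by have := small (nC (rect_int g a b c d) / 2); lra.
move=> e0; have /ccontP/(_ 1 ltr01)[r r0 hr] := cg (p +i* q).
set M := nC (g (p +i* q)) + 1.
have M0 : 0 < M by rewrite ltr_wpDl // nC_ge0.
pose s := Num.min (r / 3) (e / (16 * M)).
have s0 : 0 < s by rewrite lt_min !divr_gt0 ?mulr_gt0.
have sr : s <= r / 3 by rewrite ge_min lexx.
have se : s <= e / (16 * M) by rewrite ge_min lexx orbT.
pose x1 := Num.max a (p - s); pose x2 := Num.min b (p + s).
pose y1 := Num.max c (q - s); pose y2 := Num.min d (q + s).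
have ax1 : a <= x1 by rewrite le_max lexx.
have x1p : x1 <= p by rewrite ge_max ap; lra.
have px2 : p <= x2 by rewrite le_min pb; lra.
have x2b : x2 <= b by rewrite ge_min lexx.
have cy1 : c <= y1 by rewrite le_max lexx.
have y1q : y1 <= q by rewrite ge_max cq; lra.
have qy2 : q <= y2 by rewrite le_min qd; lra.
have y2d : y2 <= d by rewrite ge_min lexx.
have x1s : p - s <= x1 by rewrite le_max lexx orbT.
have x2s : x2 <= p + s by rewrite ge_min lexx orbT.
have y1s : q - s <= y1 by rewrite le_max lexx orbT.
have y2s : y2 <= q + s by rewrite ge_min lexx orbT.
have degx u c' d' : c' <= d' -> rect_int g u u c' d' = 0.
  move=> cd'; have := rect_int_splitx cg c' d' (lexx u) (lexx u).
  by move=> /(congr1 (fun w => w - rect_int g u u c' d')); rewrite subrr addrK.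
have degy u a' b' : a' <= b' -> rect_int g a' b' u u = 0.
  move=> ab'; have := rect_int_splity cg a' b' (lexx u) (lexx u).
  by move=> /(congr1 (fun w => w - rect_int g a' b' u u)); rewrite subrr addrK.
have left0 : rect_int g a x1 c d = 0.
  rewrite /x1; case: (leP a (p - s)) => h; last exact: degx.
  by apply: avoid => //; try lra; rewrite negb_and; apply/orP; left; rewrite negb_and -!ltNge; apply/orP; right; lra.
have right0 : rect_int g x2 b c d = 0.
  rewrite /x2; case: (leP b (p + s)) => h; first exact: degx.
  by apply: avoid => //; try lra; rewrite negb_and; apply/orP; left; rewrite negb_and -!ltNge; apply/orP; left; lra.
have bot0 : rect_int g x1 x2 c y1 = 0.
  rewrite /y1; case: (leP c (q - s)) => h; last by apply: degy; lra.
  by apply: avoid => //; try lra; rewrite negb_and; apply/orP; right; rewrite negb_and -!ltNge; apply/orP; right; lra.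
have top0 : rect_int g x1 x2 y2 d = 0.
  rewrite /y2; case: (leP d (q + s)) => h; first by apply: degy; lra.
  by apply: avoid => //; try lra; rewrite negb_and; apply/orP; right; rewrite negb_and -!ltNge; apply/orP; left; lra.
have x12 : x1 <= x2 by lra.
have y12 : y1 <= y2 by lra.
rewrite (@rect_int_splitx g cg a x1 b) ?left0 ?add0r //; last by lra.
rewrite (@rect_int_splitx g cg x1 x2 b) ?right0 ?addr0 //.
rewrite (@rect_int_splity g cg x1 x2 c y1 d) ?bot0 ?add0r //; last by lra.
rewrite (@rect_int_splity g cg x1 x2 y1 y2 d) ?top0 ?addr0 //.
apply: le_trans (@rect_int_bound g cg _ _ _ _ M x12 y12 _) _.
  move=> x y /andP[xa xb] /andP[yc yd].
  have : nC (g (x +i* y) - g (p +i* q)) < 1.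
    apply: hr; apply: le_lt_trans (nC_ReIm _) _ => /=.
    have h1 : `|x - p| <= s by rewrite ler_norml; apply/andP; split; lra.
    have h2 : `|y - q| <= s by rewrite ler_norml; apply/andP; split; lra.
    lra.
  have := nC_subr (g (x +i* y)) (g (p +i* q)); rewrite /M; lra.
have : 16 * M * s <= e by move: se; rewrite ler_pdivlMr ?mulr_gt0 // mulrC.
have : (x2 - x1) + (y2 - y1) <= 4 * s by lra.
move=> h1 h2; apply: le_trans h2.
have -> : 16 * M * s = 4 * M * (4 * s) by ring.
by rewrite ler_wpM2l // mulr_ge0 // ltW.
Qed.
End ComplexIntegral.

(** * The complex exponential and the mean value estimate *)

Section ComplexExp.
Variable R : realType.
Local Notation C := (R[i]^o).

Definition cexp (z : C) : C := (expR (complex.Re z) * cos (complex.Im z)) +i* (expR (complex.Re z) * sin (complex.Im z)).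

Lemma cexpD (z w : C) : cexp (z + w) = cexp z * cexp w.
Proof.
case: z w => [a b] [c d]; rewrite /cexp /=; apply: complex_eq => /=; rewrite expRD.
  by rewrite cosD; ring.
by rewrite sinD; ring.
Qed.
Lemma cexp0 : cexp 0 = 1.
Proof. by rewrite /cexp /= expR0 cos0 sin0 !mul1r. Qed.
Lemma nC_cexp (z : C) : nC (cexp z) = expR (complex.Re z).
Proof.
rewrite /nC /cexp /= !exprMn -mulrDr cos2Dsin2 mulr1 sqrtr_sqr ger0_norm // expR_ge0.
Qed.
Lemma cexp_neq0 (z : C) : cexp z != 0.
Proof. by rewrite -nC_gt0 nC_cexp expR_gt0. Qed.

Lemma is_derive_eps (f : R -> R) (x l e : R) : is_derive x 1 f l -> 0 < e ->
  exists2 d : R, 0 < d & forall h, `|h| < d -> `|f (h + x) - f x - l * h| <= e * `|h|.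
Proof.
move=> [df <-] e0; have /cvgrPdist_le /(_ e e0) := df.
move=> [d /= d0 hd]; exists d => // h hh.
have [->|h0] := eqVneq h 0; first by rewrite add0r subrr mulr0 subrr normr0 mulr0.
have := hd h; rewrite /ball_ /= sub0r normrN => /(_ hh h0).
rewrite /GRing.scale /= mulr1 -/(derive f x 1) => H.
have -> : f (h + x) - f x - derive f x 1 * h = - ((derive f x 1 - h^-1 * (f (h + x) - f x)) * h) by field.
by rewrite normrN normrM ler_wpM2r.
Qed.

(** Differentiability of the exponential at 0, from the derivatives at 0 of
    the real functions exp, cos and sin. *)
Lemma cexp_small (e : R) : 0 < e -> exists2 d : R, 0 < d &
  forall u : C, nC u < d -> nC (cexp u - 1 - u) <= e * nC u.
Proof.
move=> e0; pose e' := Num.min 1 (e / 16).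
have e'0 : 0 < e' by rewrite lt_min ltr01 divr_gt0.
have e'1 : e' <= 1 by rewrite ge_min lexx.
have e'e : 16 * e' <= e by have : e' <= e / 16 by [rewrite ge_min lexx orbT]; lra.
clearbody e'.
have [d1 d10 h1] := is_derive_eps (is_derive_expR (0 : R)) e'0.
have [d2 d20 h2] := is_derive_eps (is_derive_cos (0 : R)) e'0.
have [d3 d30 h3] := is_derive_eps (is_derive_sin (0 : R)) e'0.
exists (Num.min e' (Num.min d1 (Num.min d2 d3))); first by rewrite !lt_min e'0 d10 d20.
move=> u; rewrite !lt_min => /and4P[u0 u1 u2 u3].
have ux := Re_le_nC u; have uy := Im_le_nC u.
case: u u0 u1 u2 u3 ux uy => x y; set N := nC _ => u0 u1 u2 u3 /= ux uy.
have {h1} := h1 x (le_lt_trans ux u1); rewrite addr0 expR0 mul1r => h1.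
have {h2} := h2 y (le_lt_trans uy u2); rewrite addr0 cos0 sin0 oppr0 mul0r subr0 => h2.
have {h3} := h3 y (le_lt_trans uy u3); rewrite addr0 cos0 sin0 subr0 mul1r => h3.
have N0 : 0 <= N by exact: nC_ge0.
have hx : e' * `|x| <= e' * N by rewrite ler_wpM2l // ltW.
have hy : e' * `|y| <= e' * N by rewrite ler_wpM2l // ltW.
have e'N : e' * N <= 1 by have : N <= 1 by [lra]; nra.
have ex3 : expR x <= 3 by move: h1 ux; rewrite !ler_norml => /andP[_ ?] /andP[_ ?]; lra.
have ex0 := expR_ge0 x.
apply: le_trans (nC_ReIm _) _ => /=; rewrite subr0.
have -> : expR x * cos y - 1 - x = expR x * (cos y - 1) + (expR x - 1 - x) by ring.
have -> : expR x * sin y - y = expR x * (sin y - y) + (expR x - 1 - x) * y + x * y by ring.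
have t1 := ler_normD (expR x * (cos y - 1)) (expR x - 1 - x).
have t2 := ler_normD (expR x * (sin y - y) + (expR x - 1 - x) * y) (x * y).
have t3 := ler_normD (expR x * (sin y - y)) ((expR x - 1 - x) * y).
rewrite !normrM (ger0_norm ex0) in t1 t2 t3.
have b1 : expR x * `|cos y - 1| <= 3 * (e' * N) by apply: ler_pM => //; exact: le_trans hy.
have b2 : expR x * `|sin y - y| <= 3 * (e' * N) by apply: ler_pM => //; exact: le_trans hy.
have b3 : `|expR x - 1 - x| * `|y| <= 1 * N by apply: ler_pM => //; apply: le_trans h1 _; lra.
have b3' : `|expR x - 1 - x| * `|y| <= e' * N.
  have : `|expR x - 1 - x| * `|y| <= (e' * N) * 1.
    by apply: ler_pM => //; [exact: le_trans hx|lra].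
  by rewrite mulr1.
have b4 : `|x| * `|y| <= e' * N by apply: ler_pM => //; lra.
have q0 : 0 <= e' * N by rewrite mulr_ge0 // ltW.
have : 16 * e' * N <= e * N by rewrite ler_wpM2r.
lra.
Qed.

Lemma cdiff_cexp (z : C) : cdiff cexp z.
Proof.
exists (fun u => if u == z then cexp z else (cexp u - cexp z) / (u - z)); split; last first.
  move=> u; case: eqVneq => [->|uz]; first by rewrite subrr mulr0 addr0.
  by rewrite mulfVK ?subr_eq0 // addrC subrK.
apply/ccontP => e e0.
have ez0 : 0 < nC (cexp z) by rewrite nC_cexp expR_gt0.
have [d d0 hd] := cexp_small (divr_gt0 (divr_gt0 e0 (ltr0Sn _ 1)) ez0).
exists d => // w wz; rewrite eqxx; case: eqVneq => [_|wz']; first by rewrite subrr nC0.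
have wz0 : w - z != 0 by rewrite subr_eq0.
have -> : (cexp w - cexp z) / (w - z) - cexp z = cexp z * ((cexp (w - z) - 1 - (w - z)) / (w - z)).
  have {1}-> : cexp w = cexp z * cexp (w - z) by rewrite -cexpD addrC subrK.
  by field.
rewrite !nCM nCV mulrA ltr_pdivrMr ?nC_gt0 //.
apply: le_lt_trans (_ : nC (cexp z) * (e / 2 / nC (cexp z) * nC (w - z)) < _).
  by rewrite ler_wpM2l ?hd // ltW.
have -> : nC (cexp z) * (e / 2 / nC (cexp z) * nC (w - z)) = e / 2 * nC (w - z).
  by field; rewrite gt_eqF.
by rewrite ltr_pM2r ?nC_gt0 //; lra.
Qed.

Lemma cont_cexp (z : C) : ccont cexp z.
Proof. exact/cdiff_cont/cdiff_cexp. Qed.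

Lemma cexp_2pi (x y : R) : cexp (x +i* (y + pi *+ 2)) = cexp (x +i* y).
Proof. by rewrite /cexp /= cosD2pi sinD2pi. Qed.

Lemma cos1_2pi (t : R) : - (pi *+ 2) <= t <= pi *+ 2 -> cos t = 1 ->
  [\/ t = 0, t = pi *+ 2 | t = - (pi *+ 2)].
Proof.
have pi0 := @pi_gt0 R.
have half (s : R) : 0 <= s <= pi *+ 2 -> cos s = 1 -> s = 0 \/ s = pi *+ 2.
  move=> /andP[s0 s2] cs; case: (leP s pi) => sp.
    by left; apply: (@cos_inj R); [rewrite in_itv /= s0|rewrite in_itv /= lexx ltW|rewrite cs cos0].
  right; have : pi *+ 2 - s = 0; last by move/subr0_eq.
  apply: (@cos_inj R); [|by rewrite in_itv /= lexx ltW|].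
    by rewrite in_itv /= subr_ge0 s2 /= mulr2n; lra.
  by rewrite cos0 -cs addrC cosD2pi cosN.
move=> /andP[h1 h2] ct; case: (leP 0 t) => t0.
  have [||->|->] := half t; rewrite ?t0 //; by [constructor 1|constructor 2].
have [||/eqP h|/eqP h] := half (- t); rewrite ?cosN //.
- by apply/andP; split; lra.
- by constructor 1; apply/eqP; rewrite -oppr_eq0.
- by constructor 3; apply/eqP; rewrite -eqr_oppLR.
Qed.

Lemma cexp_inj (z w : C) : `|complex.Im z - complex.Im w| <= pi *+ 2 -> cexp z = cexp w ->
  complex.Re z = complex.Re w /\
  [\/ complex.Im z = complex.Im w, complex.Im z = complex.Im w + pi *+ 2 | complex.Im z = complex.Im w - pi *+ 2].
Proof.
move=> d eq; have eR : complex.Re z = complex.Re w.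
  by apply: expR_inj; rewrite -!nC_cexp eq.
split=> //; have : cexp (z - w) = 1.
  apply: (mulIf (cexp_neq0 w)); rewrite -cexpD subrK mul1r; exact: eq.
move=> /(congr1 (fun u : R[i] => complex.Re u)) /=.
have -> : complex.Re (z - w) = 0 by case: (z) (w) eR => ? ? [? ?] /= ->; rewrite subrr.
have -> : complex.Im (z - w) = complex.Im z - complex.Im w by case: (z) (w) => ? ? [? ?].
rewrite expR0 mul1r => ct.
rewrite ler_norml in d; have [h|h|h] := cos1_2pi d ct.
- by constructor 1; exact: subr0_eq.
- by constructor 2; rewrite -h addrC subrK.
- by constructor 3; rewrite -h addrC subrK.
Qed.
End ComplexExp.

Section MeanValue.
Variable R : realType.
Local Notation C := (R[i]^o).

(** A strip of height 2 pi contains finitely many preimages of a point under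
    the exponential; so the exceptional points of a function are transported
    to finitely many exceptional points in logarithmic coordinates. *)
Lemma cexp_preimages (e : C) : exists l : seq C, forall x y : R,
  0 <= y <= pi *+ 2 -> cexp (x +i* y) = e -> (x +i* y : C) \in l.
Proof.
case: (pselect (exists x y : R, 0 <= y <= pi *+ 2 /\ cexp (x +i* y : C) = e)) => [[p [q [q2 pqe]]]|no]; last first.
  by exists [::] => x y yb xye; case: no; exists x, y.
exists [:: (p +i* q : C); (p +i* (q + pi *+ 2) : C); (p +i* (q - pi *+ 2) : C)] => x y yb xye.
have [||/= -> h] := @cexp_inj R (x +i* y) (p +i* q).
- by case/andP: yb q2 => ? ? /andP[? ?]; rewrite /= ler_norml; apply/andP; split; lra.
- by rewrite pqe.
by rewrite !inE; case: h => ->; rewrite eqxx ?orbT.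
Qed.

Lemma JC_cst (k : C) (a b : R) : a <= b -> JC (fun=> k) a b = k * (b - a)%:C.
Proof. by move=> ab; case: k => p q; apply: complex_eq; rewrite /= !J_cst //; ring. Qed.

(** In the coordinate w with z = z0 + cexp w, the mean of f over a circle
    becomes the integral over a vertical segment of length 2 pi, and
    Goursat's theorem on a rectangle of this height makes the mean
    independent of the radius: the horizontal sides cancel by periodicity. As
    the radius tends to 0 the mean tends to f z0. The factor 2 comes from
    bounding the real and the imaginary parts separately. This estimate plays
    the role of Cauchy's formula below. *)
Theorem centered_estimate (f : C -> C) (z0 : C) (r r1 M : R) (E : seq C) : 0 < r -> r < r1 ->
  (forall z, disc z0 r1 z -> ccont f z) ->
  (forall z, disc z0 r1 z -> z \notin E -> cdiff f z) ->
  (forall z : C, nC (z - z0) = r -> nC (f z) <= M) -> nC (f z0) <= 2 * M.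
Proof.
move=> r0 rr cf df fM; pose s2 := ln ((r + r1) / 2); pose s1 := ln r.
have rm : 0 < (r + r1) / 2 by lra.
have es2 : expR s2 = (r + r1) / 2 by rewrite lnK.
have es1 : expR s1 = r by rewrite lnK.
have s12 : s1 < s2 by rewrite -ltr_expR es1 es2; lra.
(* [cl] truncates the real part, so that g is continuous on the whole plane *)
pose cl (w : C) : C := Num.min (complex.Re w) s2 +i* complex.Im w.
have clE x y : x <= s2 -> cl (x +i* y) = x +i* y by move=> xs; rewrite /cl /= min_l.
have ccl w : ccont cl w.
  apply/ccontP => e e0; exists (e / 2); first by rewrite divr_gt0.
  move=> u uw; apply: le_lt_trans (nC_ReIm _) _ => /=.
  have h1 : `|complex.Re u - complex.Re w| < e / 2.
    by apply: le_lt_trans uw; apply: le_trans (Re_le_nC _); case: (u) (w) => ? ? [].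
  have h2 : `|complex.Im u - complex.Im w| < e / 2.
    by apply: le_lt_trans uw; apply: le_trans (Im_le_nC _); case: (u) (w) => ? ? [].
  suff : `|Num.min (complex.Re u) s2 - Num.min (complex.Re w) s2| <= `|complex.Re u - complex.Re w| by lra.
  rewrite /Num.min; case: ifP => c1; case: ifP => c2 //; rewrite ?subrr ?normr0 //.
  - move/negbT: c2; rewrite -leNgt => c2; rewrite !ltr0_norm ?ler0_norm; lra.
  - move/negbT: c1; rewrite -leNgt => c1; rewrite !ger0_norm; lra.
pose g (w : C) := f (z0 + cexp (cl w)).
have ccz w : ccont (fun w => z0 + cexp (cl w)) w.
  by apply: contD; [exact: contc|apply: cont_comp => //; exact: cont_cexp].
have in_disc w : disc z0 r1 (z0 + cexp (cl w)).
  rewrite /disc /= addrAC subrr add0r nC_cexp /cl /=.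
  apply: (@le_lt_trans _ _ (expR s2)); last by rewrite es2; lra.
  by rewrite ler_expR ge_min lexx orbT.
have cg w : ccont g w by apply: cont_comp => //; exact: cf.
have [l lP] : exists l : seq C, forall x y : R, 0 <= y <= pi *+ 2 -> z0 + cexp (x +i* y) \in E -> (x +i* y : C) \in l.
  elim: {df} E => [|e E [l IH]]; first by exists [::].
  have [l' l'P] := cexp_preimages (e - z0); exists (l' ++ l) => x y yb.
  rewrite inE mem_cat => /orP[/eqP h|h]; last by rewrite IH ?orbT.
  by rewrite l'P // -h addrAC subrr add0r.
have pi0 : 0 < (pi : R) *+ 2 by rewrite pmulrn_lgt0 // pi_gt0.
pose A s := JC (fun t => g (s +i* t)) 0 (pi *+ 2).
have Aconst s0 : s0 <= s1 -> A s0 = A s1.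
  move=> s01; have := @goursat_finite R g l s0 s1 0 (pi *+ 2) cg s01 (ltW pi0) _.
  have -> : rect_int g s0 s1 0 (pi *+ 2) = (0 +i* 1) * (A s1 - A s0).
    rewrite /rect_int -/(A s0) -/(A s1).
    have -> : (fun t => g (t +i* (pi *+ 2))) = (fun t => g (t +i* 0)).
      apply/funext => t; rewrite /g /cl /=; congr (f (_ + _)).
      by rewrite -[X in _ +i* X](add0r (pi *+ 2)) cexp_2pi.
    ring.
  move=> H; have {H} : (0 +i* 1) * (A s1 - A s0) = 0.
    apply: H => x y /andP[x0 x1] yb nl.
    have xs2 : x < s2 by exact: le_lt_trans s12.
    apply: (@cdiff_near R (fun w => f (z0 + cexp w))).
      apply/nbhsC; exists (s2 - x); first by rewrite subr_gt0.
      move=> [p q] pq; rewrite /g clE //.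
      have := le_lt_trans (Re_le_nC _) pq => /=; rewrite ltr_norml => /andP[_]; lra.
    apply: (@cdiff_comp R (fun w => z0 + cexp w) f).
      by apply: cdiffD; [exact: cdiff_cst|exact: cdiff_cexp].
    apply: df; first by rewrite -[x +i* y](clE x y) ?in_disc // ltW.
    by apply: contra nl; exact: lP.
  move/eqP; rewrite mulf_eq0 => /orP[|/eqP/subr0_eq//].
  by rewrite eq_complex /= oner_eq0 andbF.
have rc s : rcont (fun t => g (s +i* t)) by apply: (@rcont_comp R g (fun t => s +i* t)) => //; exact: continuous_ver.
have A1 : nC (A s1) <= 2 * M * (pi *+ 2).
  have := @JC_bound R _ 0 (pi *+ 2) M (rc s1) (ltW pi0); rewrite subr0; apply => t _.
  rewrite /g clE; last exact: ltW.
  apply: fM.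
  by rewrite addrAC subrr add0r nC_cexp /= es1.
suff small e : 0 < e -> nC (f z0) <= 2 * M + e.
  by rewrite leNgt; apply/negP => h; have := small ((nC (f z0) - 2 * M) / 2); lra.
move=> e0; have cfz0 : ccont f z0 by apply: cf; apply: disc_center; exact: lt_trans rr.
have /ccontP/(_ _ (divr_gt0 e0 (ltr0Sn _ 1)))[d d0 hd] := cfz0.
pose s0 := Num.min s1 (ln (d / 2)).
have s01 : s0 <= s1 by rewrite ge_min lexx.
have d2 : 0 < d / 2 by rewrite divr_gt0.
have es0 : expR s0 <= d / 2.
  by rewrite -[leRHS](@lnK R) ?posrE // ler_expR ge_min lexx orbT.
have near t : nC (g (s0 +i* t) - f z0) <= e / 2.
  apply/ltW; rewrite /g clE; last by apply: le_trans s01 (ltW s12).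
  by apply: hd; rewrite addrAC subrr add0r nC_cexp /=; lra.
have rcc : rcont (fun t : R => (1 : C) * g (s0 +i* t) + (- 1) * f z0).
  apply: (@rcont_comp R (fun w => (1 : C) * g w + (- 1) * f z0) (fun t => s0 +i* t)); last exact: continuous_ver.
  move=> w; apply: contD; apply: contM => //; exact: contc.
have := @JC_bound R _ 0 (pi *+ 2) (e / 2) rcc (ltW pi0) _.
have rcK : rcont (fun _ : R => f z0) by split; exact: cst_continuous.
rewrite (@JC_lin R (fun t => g (s0 +i* t)) (fun=> f z0) 1 (-1)) //; last exact: ltW.
rewrite (JC_cst _ (ltW pi0)) !subr0 mul1r -/(A s0) Aconst // => H.
have {H} : nC (A s1 + (-1) * (f z0 * (pi *+ 2)%:C)) <= 2 * (e / 2) * (pi *+ 2).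
  by apply: H => t _; rewrite mul1r mulN1r; exact: near.
rewrite mulN1r => H.
have h := le_trans (nC_subr (f z0 * (pi *+ 2)%:C) (A s1)) (_ : _ <= 2 * (e / 2) * (pi *+ 2)).
rewrite nCB in H; have {h} := h H.
rewrite nCM nCR (ger0_norm (ltW pi0)) => h.
rewrite -(ler_pM2r pi0) mulrDl.
have -> : e * (pi *+ 2) = 2 * (e / 2) * (pi *+ 2) by field.
lra.
Qed.
End MeanValue.

(** * Local theory of holomorphic functions *)

Section LocalTheory.
Variable R : realType.
Local Notation C := (R[i]^o).
Implicit Types (f g : C -> C) (a u v w z : C) (r : R).

Definition slope f a (phi : C -> C) := forall u, f u = f a + phi u * (u - a).

(** Differentiability with the value of the derivative, again in
    Caratheodory's form. *)
Definition cderiv f a (l : C) := exists phi, [/\ ccont phi a, slope f a phi & phi a = l].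

Lemma cderiv_cdiff f a l : cderiv f a l -> cdiff f a.
Proof. by move=> [phi [c1 sl _]]; exists phi. Qed.
Lemma cdiff_cderiv f a : cdiff f a -> exists l, cderiv f a l.
Proof. by move=> [phi [c1 sl]]; exists (phi a), phi. Qed.

Lemma slopeE f a phi u : slope f a phi -> u <> a -> phi u = (f u - f a) / (u - a).
Proof.
move=> sl /eqP ua; rewrite (sl u) [f a + _]addrC addrK mulfK //.
by rewrite subr_eq0.
Qed.

Lemma near_neq u a : u <> a -> \forall w \near u, w <> a.
Proof.
move=> ua; apply/nbhsC; exists (nC (u - a)); first by rewrite nC_gt0 subr_eq0; exact/eqP.
by move=> w + wa; rewrite wa nCB ltxx.
Qed.

Lemma slope_cont f a phi u : slope f a phi -> u <> a -> ccont f u -> ccont phi u.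
Proof.
move=> sl ua cf; apply: (@cont_near R (fun w => (f w - f a) / (w - a))).
  by near=> w; rewrite (slopeE sl) //; near: w; exact: near_neq.
apply: contM; first by apply: contB => //; exact: contc.
apply: contV; first by apply: contB; [exact: conti|exact: contc].
by rewrite subr_eq0; apply/eqP.
Unshelve. all: by end_near. Qed.

Lemma slope_cdiff f a phi u : slope f a phi -> u <> a -> cdiff f u -> cdiff phi u.
Proof.
move=> sl ua cf; apply: (@cdiff_near R (fun w => (f w - f a) / (w - a))).
  by near=> w; rewrite (slopeE sl) //; near: w; exact: near_neq.
apply: cdiffM; first by apply: cdiffD => //; exact: (cdiff_cst (- f a)).
apply: cdiffV; first by apply: cdiffD; [exact: cdiff_id|exact: (cdiff_cst (- a))].
by rewrite subr_eq0; apply/eqP.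
Unshelve. all: by end_near. Qed.

Lemma local_bound f a rho : 0 < rho -> ccont f a -> exists r M : R,
  [/\ 0 < r, r <= rho, 0 < M & forall u, disc a r u -> nC (f u) <= M].
Proof.
move=> rho0 /ccontP/(_ 1 ltr01)[d d0 hd].
exists (Num.min d rho), (nC (f a) + 1); split.
- by rewrite lt_min d0.
- by rewrite ge_min lexx orbT.
- by rewrite ltr_wpDl // nC_ge0.
move=> u; rewrite /disc /= lt_min => /andP[/hd h _].
have := nC_subr (f u) (f a); lra.
Qed.

(** Second divided differences are bounded: as a function of one variable,
    the divided difference is continuous, and differentiable outside finitely
    many points, so that [centered_estimate] bounds it at x by its values on
    a circle, where the denominators are bounded below. The estimate is
    applied twice, once for each division. *)
Lemma div_diff2 f a rho (E : seq C) : 0 < rho ->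
  (forall z, disc a rho z -> ccont f z) ->
  (forall z, disc a rho z -> z \notin E -> cdiff f z) ->
  exists d K : R, [/\ 0 < d, d <= rho, 0 < K &
    forall x y z, disc a d x -> disc a d y -> disc a d z -> y \notin E -> z \notin E ->
      x <> y -> z <> y -> x <> z ->
      nC ((f x - f y) / (x - y) - (f z - f y) / (z - y)) <= K * nC (x - z)].
Proof.
move=> rho0 cf df; have [r [M [r0 rrho M0 fM]]] := local_bound rho0 (cf a (disc_center _ rho0)).
exists (r / 16), (2 * ((2 * (2 * (2 * M / (r / 16)))) / (r / 8))).
have r16 : 0 < r / 16 by rewrite divr_gt0.
have r8 : 0 < r / 8 by rewrite divr_gt0.
split=> //; [by lra|by do ?[apply: divr_gt0|apply: mulr_gt0]|].
move=> x y z; rewrite /disc /= => xa ya za yE zE xy zy xz.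
have subrho u : nC (u - a) < r -> disc a rho u by rewrite /disc /= => ?; lra.
have tri (p q s : C) : nC (p - s) <= nC (p - q) + nC (q - s) by exact: nC_dist3.
have [phi [cphi slphi]] : cdiff f y by apply: df => //; apply: subrho; lra.
have phic u : nC (u - a) < r -> ccont phi u.
  move=> ua; have [->//|/eqP uy] := eqVneq u y.
  exact: (slope_cont slphi uy (cf _ (subrho _ ua))).
have phid u : nC (u - a) < r -> u \notin y :: E -> cdiff phi u.
  move=> ua; rewrite inE negb_or => /andP[/eqP uy uE].
  exact: (slope_cdiff slphi uy (df _ (subrho _ ua) uE)).
have M1 u : nC (u - a) < r / 3 -> nC (phi u) <= 2 * (2 * M / (r / 16)).
  move=> ua; apply: (@centered_estimate R phi u (r / 2) (r * 7 / 12) _ (y :: E)).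
  - by lra.
  - by lra.
  - by move=> w; rewrite /disc /= => wu; apply: phic; have := tri w u a; lra.
  - by move=> w; rewrite /disc /= => wu; apply: phid; have := tri w u a; lra.
  move=> w wu; have wy : r / 16 < nC (w - y).
    by have := tri w y u; have := tri y a u; rewrite (nCB a u); lra.
  have wa : nC (w - a) < r by have := tri w u a; lra.
  have wyn : w <> y by move=> e; move: wy; rewrite e subrr nC0; lra.
  rewrite (slopeE slphi wyn) nCM nCV ler_pM ?invr_ge0 ?nC_ge0 //.
    have := nCD (f w) (- f y); rewrite nCN; have := fM w wa; have := fM y; rewrite /disc /= => /(_ _).
    by have -> : nC (y - a) < r by [lra]; move=> /(_ isT); lra.
  by rewrite lef_pV2 ?posrE ?ltW //; lra.
have [psi [cpsi slpsi]] : cdiff phi z.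
  by apply: phid; [lra|rewrite inE negb_or zE andbT; apply/eqP].
have -> : (f x - f y) / (x - y) - (f z - f y) / (z - y) = psi x * (x - z).
  by rewrite -(slopeE slphi xy) -(slopeE slphi zy) (slpsi x) [phi z + _]addrC addrK.
rewrite nCM ler_wpM2r ?nC_ge0 //.
apply: (@centered_estimate R psi x (r / 4) (r / 2) _ (z :: y :: E)).
- by lra.
- by lra.
- move=> w; rewrite /disc /= => wx; have wa : nC (w - a) < r by have := tri w x a; lra.
  have [->//|/eqP wz] := eqVneq w z; exact: (slope_cont slpsi wz (phic _ wa)).
- move=> w; rewrite /disc /= => wx; have wa : nC (w - a) < r by have := tri w x a; lra.
  rewrite inE negb_or => /andP[/eqP wz wE]; exact: (slope_cdiff slpsi wz (phid _ wa wE)).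
move=> w wx; have wz : r / 8 <= nC (w - z).
  by have := tri w z x; have := tri z a x; rewrite (nCB a x); lra.
have wzn : w <> z by move=> e; move: wz; rewrite e subrr nC0; lra.
have wa : nC (w - a) < r / 3 by have := tri w x a; lra.
have za3 : nC (z - a) < r / 3 by lra.
rewrite (slopeE slpsi wzn) nCM nCV ler_pM ?invr_ge0 ?nC_ge0 //.
  by have := nCD (phi w) (- phi z); rewrite nCN; have := M1 w wa; have := M1 z za3; lra.
by rewrite lef_pV2 ?posrE //; lra.
Qed.

Lemma sup_limit (D : set C) (x : C -> R) (e : C -> R) : D !=set0 ->
  (forall h k, D h -> D k -> `|x h - x k| <= e h + e k) ->
  exists L, forall h, D h -> `|x h - L| <= e h.
Proof.
move=> [h0 Dh0] H; pose A := [set x h - e h | h in D].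
have ub k : D k -> ubound A (x k + e k).
  by move=> Dk _ [h Dh <-]; have := H h k Dh Dk; rewrite ler_norml => /andP[]; lra.
exists (sup A) => h Dh; rewrite ler_norml; apply/andP; split.
  suff : sup A <= x h + e h by lra.
  by apply: ge_sup; [exists (x h0 - e h0), h0|exact: ub].
suff : x h - e h <= sup A by lra.
by apply: ub_le_sup; [exists (x h0 + e h0); exact: ub|exists h].
Qed.

Lemma ReB z w : complex.Re (z - w) = complex.Re z - complex.Re w.
Proof. by case: z w => ? ? []. Qed.
Lemma ImB z w : complex.Im (z - w) = complex.Im z - complex.Im w.
Proof. by case: z w => ? ? []. Qed.

Lemma ex_near_neq a (d : R) : 0 < d -> exists2 w : C, disc a d w & w <> a.
Proof.
move=> d0; have h : nC (a + (d / 2)%:C - a) = d / 2.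
  by rewrite addrAC subrr add0r nCR ger0_norm; lra.
exists (a + (d / 2)%:C); first by rewrite /disc /= h; lra.
by move=> E'; move: h; rewrite E' subrr nC0; lra.
Qed.

(** By [div_diff2] the difference quotient at a is Lipschitz off a, so it has
    a limit there. *)
Theorem removable f a rho : 0 < rho -> (forall z, disc a rho z -> ccont f z) ->
  (forall z, disc a rho z -> z <> a -> cdiff f z) -> cdiff f a.
Proof.
move=> rho0 cf df.
have [|d [K [d0 drho K0 H]]] := @div_diff2 f a rho [:: a] rho0 cf.
  by move=> z zd; rewrite inE => /eqP; exact: df.
pose q h := (f h - f a) / (h - a); pose D := [set h | disc a d h /\ h <> a].
have D0 : D !=set0 by have [w wd wa] := ex_near_neq a d0; exists w.
have qq h k : D h -> D k -> nC (q h - q k) <= K * nC (h - a) + K * nC (k - a).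
  move=> [hd ha] [kd ka]; have [->|/eqP hk] := eqVneq h k.
    by rewrite subrr nC0 addr_ge0 // mulr_ge0 ?nC_ge0 ?ltW.
  have K1 := H a h k (disc_center _ d0) hd kd; have K2 := H a k h (disc_center _ d0) kd hd.
  rewrite !inE in K1 K2.
  have {}K1 := K1 (introN eqP ha) (introN eqP ka) (nesym ha) (nesym hk) (nesym ka).
  have {}K2 := K2 (introN eqP ka) (introN eqP ha) (nesym ka) hk (nesym ha).
  have sw (s t : C) : (f s - f t) / (s - t) = (f t - f s) / (t - s).
    by rewrite -[f s - f t]opprB -[s - t]opprB invrN mulrNN.
  rewrite (sw a h) (sw k h) in K1; rewrite (sw a k) in K2.
  rewrite /q.
  set s := (f h - f k) / (h - k) in K1 K2.
  have -> : (f h - f a) / (h - a) - (f k - f a) / (k - a) =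
     ((f h - f a) / (h - a) - s) - ((f k - f a) / (k - a) - s) by ring.
  apply: le_trans (nCD _ _) _; rewrite nCN.
  rewrite (nCB a k) in K1; rewrite (nCB a h) in K2; lra.
have qR h k : D h -> D k -> `|complex.Re (q h) - complex.Re (q k)| <= K * nC (h - a) + K * nC (k - a).
  by move=> Dh Dk; rewrite -ReB; apply: le_trans (Re_le_nC _) (qq h k Dh Dk).
have qI h k : D h -> D k -> `|complex.Im (q h) - complex.Im (q k)| <= K * nC (h - a) + K * nC (k - a).
  by move=> Dh Dk; rewrite -ImB; apply: le_trans (Im_le_nC _) (qq h k Dh Dk).
have [L1 hL1] := sup_limit D0 qR; have [L2 hL2] := sup_limit D0 qI.
exists (fun u => if u == a then L1 +i* L2 else q u); split; last first.
  move=> u; case: eqVneq => [->|ua]; first by rewrite subrr mulr0 addr0.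
  by rewrite /q mulfVK ?subr_eq0 // addrC subrK.
apply/ccontP => e e0; exists (Num.min d (e / (4 * K))); first by rewrite lt_min d0 divr_gt0 ?mulr_gt0.
move=> w; rewrite lt_min => /andP[wd we]; rewrite eqxx; case: eqVneq => [_|wa].
  by rewrite subrr nC0.
have Dw : D w by split=> //; exact/eqP.
apply: le_lt_trans (nC_ReIm _) _; rewrite ReB ImB /=.
have := hL1 w Dw; have := hL2 w Dw; move: we; rewrite ltr_pdivlMr ?mulr_gt0 //.
lra.
Qed.

(** The bound on second divided differences makes f strictly differentiable,
    which is what the inverse function theorem rests on. *)
Lemma strict_diff f a rho l : 0 < rho -> (forall z, disc a rho z -> cdiff f z) -> cderiv f a l ->
  exists d K : R, [/\ 0 < d, d <= rho, 0 < K & forall u v, disc a d u -> disc a d v -> u <> v ->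
    nC ((f u - f v) / (u - v) - l) <= K * (nC (u - a) + nC (v - a))].
Proof.
move=> rho0 df [phi [/ccontP cphi slphi phil]].
have [|z zd _|d [K [d0 drho K0 H]]] := @div_diff2 f a rho [::] rho0; [|exact: df|].
  by move=> z /df; exact: cdiff_cont.
have H' x y z xd yd zd := H x y z xd yd zd (isT : y \notin [::]) (isT : z \notin [::]).
have sw (s t : C) : (f s - f t) / (s - t) = (f t - f s) / (t - s).
  by rewrite -[f s - f t]opprB -[s - t]opprB invrN mulrNN.
have ad := disc_center a d0.
have qa h : disc a d h -> h <> a -> nC ((f h - f a) / (h - a) - l) <= K * nC (h - a).
  move=> hd ha; suff small e : 0 < e -> nC ((f h - f a) / (h - a) - l) <= K * nC (h - a) + e.
    rewrite leNgt; apply/negP => h1.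
    have := small ((nC ((f h - f a) / (h - a) - l) - K * nC (h - a)) / 2); lra.
  move=> e0; have e4 : 0 < e / 2 by rewrite divr_gt0.
  have [d' d'0 hd'] := cphi _ e4.
  have ha0 : 0 < nC (h - a) by rewrite nC_gt0 subr_eq0; exact/eqP.
  have m0 : 0 < Num.min (Num.min d d') (Num.min (nC (h - a)) (e / (2 * K))).
    by rewrite !lt_min d0 d'0 ha0 divr_gt0 ?mulr_gt0.
  have [k] := ex_near_neq a m0; rewrite /disc /= !lt_min => /andP[/andP[kd kd'] /andP[kh ke]] ka.
  have kh' : k <> h by move=> e'; move: kh; rewrite e' ltxx.
  have K1 := H' h a k hd ad kd ha ka (nesym kh').
  have K2 := hd' k kd'; rewrite phil (slopeE slphi ka) in K2.
  have := nC_dist3 ((f h - f a) / (h - a)) ((f k - f a) / (k - a)) l.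
  have := nC_dist3 h a k; rewrite (nCB a k) => t1.
  have t2 : K * nC (h - k) <= K * (nC (h - a) + nC (k - a)) by rewrite ler_wpM2l // ltW.
  move: ke; rewrite ltr_pdivlMr ?mulr_gt0 //; lra.
exists d, K; split=> // u v ud vd uv.
have [va|/eqP va] := eqVneq v a.
  rewrite va subrr nC0 addr0; apply: qa => // e; exact: uv (etrans e (esym va)).
have [ua|/eqP ua] := eqVneq u a.
  by rewrite ua subrr nC0 add0r sw; apply: qa.
have K1 := H' u v a ud vd ad uv (nesym va) ua.
have K2 := qa v vd va; rewrite (sw a v) in K1.
have := nC_dist3 ((f u - f v) / (u - v)) ((f v - f a) / (v - a)) l; lra.
Qed.

Lemma bilipschitz f a rho l : 0 < rho -> (forall z, disc a rho z -> cdiff f z) -> cderiv f a l -> l != 0 ->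
  exists d : R, [/\ 0 < d, d <= rho & forall u v, disc a d u -> disc a d v ->
    nC l / 2 * nC (u - v) <= nC (f u - f v)].
Proof.
move=> rho0 df dl l0; have [d [K [d0 drho K0 H]]] := strict_diff rho0 df dl.
have nl0 : 0 < nC l by rewrite nC_gt0.
have m0 : 0 < Num.min d (nC l / (4 * K)) by rewrite lt_min d0 divr_gt0 ?mulr_gt0.
exists (Num.min d (nC l / (4 * K))); split=> //; first by rewrite ge_min drho.
move=> u v; rewrite /disc /= !lt_min => /andP[ud uK] /andP[vd vK].
have [->|/eqP uv] := eqVneq u v; first by rewrite !subrr !nC0 mulr0.
have uv0 : 0 < nC (u - v) by rewrite nC_gt0 subr_eq0; exact/eqP.
have h := H u v ud vd uv.
rewrite -ler_pdivlMr // -nCV -nCM; move: uK vK; rewrite !ltr_pdivlMr ?mulr_gt0 // => uK vK.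
have := nC_subr l ((f u - f v) / (u - v)); rewrite nCB; lra.
Qed.

(** If w were not a value of f near a, the function 1 / (f - w) would be
    holomorphic; by [bilipschitz] it is small on a circle around a, but it is
    large at a when w is close to f a, against [centered_estimate]. *)
Lemma open_mapping f a rho l : 0 < rho -> (forall z, disc a rho z -> cdiff f z) -> cderiv f a l -> l != 0 ->
  exists c : R, 0 < c /\ forall w, nC (w - f a) < c -> exists2 u, disc a rho u & f u = w.
Proof.
move=> rho0 df dl l0; have [d [d0 drho H]] := bilipschitz rho0 df dl l0.
have nl0 : 0 < nC l by rewrite nC_gt0.
exists (nC l * d / 32); split; first by rewrite !(mulr_gt0, divr_gt0).
move=> w wc; apply: contrapT => no.
have fw u : disc a d u -> f u - w != 0.
  move=> ud; rewrite subr_eq0; apply/eqP => e; apply: no; exists u => //.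
  by move: ud; rewrite /disc /= => ?; lra.
have ld : 0 < nC l * d by rewrite mulr_gt0.
have H1 : nC (f a - w)^-1 <= 2 * (8 / (nC l * d)).
  apply: (@centered_estimate R (fun u => (f u - w)^-1) a (d / 2) d _ [::]); [by lra|by lra| | |].
  - move=> z zd; apply: cdiff_cont; apply: cdiffV; last exact: fw.
    by apply: cdiffD; [apply: df; apply: lt_le_trans zd _|exact: (cdiff_cst (- w))].
  - move=> z zd _; apply: cdiffV; last exact: fw.
    by apply: cdiffD; [apply: df; apply: lt_le_trans zd _|exact: (cdiff_cst (- w))].
  move=> z zd; rewrite nCV -[leRHS]invrK lef_pV2 ?posrE ?invr_gt0 ?divr_gt0 //; last first.
    by rewrite nC_gt0 fw // /disc /= zd; lra.
  rewrite invf_div.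
  have := H z a _ (disc_center _ d0); rewrite zd {1}/disc /= => /(_ _).
  have -> : nC (z - a) < d by rewrite zd; lra.
  move=> /(_ isT) h; have := nC_dist3 (f z) w (f a); lra.
rewrite nCV in H1.
have fa0 : 0 < nC (f a - w) by rewrite nC_gt0 fw //; exact: disc_center.
have : 1 <= 2 * (8 / (nC l * d)) * nC (f a - w) by rewrite -ler_pdivrMr // mul1r.
have -> : 2 * (8 / (nC l * d)) * nC (f a - w) = 16 * nC (f a - w) / (nC l * d) by field; rewrite !gt_eqF.
rewrite ler_pdivlMr // mul1r nCB; lra.
Qed.

Lemma cdiff_local f psi a : ccont psi a -> (\forall u \near a, f u = f a + psi u * (u - a)) -> cderiv f a (psi a).
Proof.
move=> cpsi eqf; exists (fun u => if u == a then psi a else (f u - f a) / (u - a)); split.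
- apply: cont_near cpsi; apply: filterS eqf => u fu; case: eqVneq => [->//|ua].
  by rewrite fu [f a + _]addrC addrK mulfK // subr_eq0.
- move=> u; case: eqVneq => [->|ua]; first by rewrite subrr mulr0 addr0.
  by rewrite mulfVK ?subr_eq0 // addrC subrK.
- by rewrite eqxx.
Qed.

Lemma cderiv_uniq f a l l' : cderiv f a l -> cderiv f a l' -> l = l'.
Proof.
move=> [p [/ccontP cp sp <-]] [q [/ccontP cq sq <-]]; apply: contrapT => /eqP pq.
have e0 : 0 < nC (p a - q a) / 2 by rewrite divr_gt0 // nC_gt0 subr_eq0.
have [d1 d10 h1] := cp _ e0; have [d2 d20 h2] := cq _ e0.
have [|w] := @ex_near_neq a (Num.min d1 d2); first by rewrite lt_min d10.
rewrite /disc /= lt_min => /andP[/h1 w1 /h2 w2] wa.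
rewrite (slopeE sp wa) nCB in w1; rewrite (slopeE sq wa) in w2.
by have := nC_dist3 (p a) ((f w - f a) / (w - a)) (q a); lra.
Qed.

Theorem local_inverse f a rho l : 0 < rho -> (forall z, disc a rho z -> cdiff f z) -> cderiv f a l -> l != 0 ->
  exists d e (s : C -> C), [/\ 0 < d, d <= rho, 0 < e,
    (forall u v, disc a d u -> disc a d v -> f u = f v -> u = v) &
    forall w, nC (w - f a) < e -> [/\ disc a d (s w), f (s w) = w & cdiff s w]].
Proof.
move=> rho0 df dl l0; have [d [d0 drho H]] := bilipschitz rho0 df dl l0.
have nl0 : 0 < nC l by rewrite nC_gt0.
have df' z : disc a d z -> cdiff f z by move=> zd; apply: df; apply: lt_le_trans zd _.
have [c [c0 hc]] := open_mapping d0 df' dl l0.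
have [w|s sP] := @choice C C (fun w u => nC (w - f a) < c -> disc a d u /\ f u = w).
  by case: (ltP (nC (w - f a)) c) => [/hc[u ? ?]|_]; [exists u|exists a].
have inj u v : disc a d u -> disc a d v -> f u = f v -> u = v.
  move=> ud vd uv; apply/eqP; rewrite -subr_eq0 -nC_eq0 eq_le nC_ge0 andbT.
  have := H u v ud vd; rewrite uv subrr nC0 => h.
  by rewrite -(ler_pM2l (divr_gt0 nl0 (ltr0Sn _ 1))) mulr0.
exists d, c, s; split=> // w wc; have [swd fsw] := sP w wc; split=> //.
have [p [cp sp]] := df' _ swd.
have cs : ccont s w.
  apply/ccontP => e e0.
  have m0 : 0 < Num.min (c - nC (w - f a)) (nC l / 2 * e).
    by rewrite lt_min subr_gt0 wc mulr_gt0 // divr_gt0.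
  exists (Num.min (c - nC (w - f a)) (nC l / 2 * e)) => // w'; rewrite lt_min => /andP[w1 w2].
  have [|sw'd fsw'] := sP w'; first by have := nC_dist3 w' w (f a); lra.
  have := H _ _ sw'd swd; rewrite fsw fsw' => h.
  by rewrite -(ltr_pM2l (divr_gt0 nl0 (ltr0Sn _ 1))); apply: le_lt_trans w2.
have pn0 : p (s w) != 0.
  apply/eqP => p0; move/ccontP/(_ (nC l / 2) (divr_gt0 nl0 (ltr0Sn _ 1))): (cp) => [r r0 hr].
  have [|v] := @ex_near_neq (s w) (Num.min r (d - nC (s w - a))).
    by rewrite lt_min r0 subr_gt0.
  rewrite /disc /= lt_min => /andP[vr vd] vsw.
  have := hr v vr; rewrite p0 subr0 => h.
  have vd' : disc a d v by rewrite /disc /=; have := nC_dist3 v (s w) a; lra.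
  have := H v (s w) vd' swd; rewrite sp [f (s w) + _]addrC addrK nCM.
  by rewrite ler_pM2r ?nC_gt0 ?subr_eq0; [lra|exact/eqP].
apply: (@cderiv_cdiff s w (p (s w))^-1).
apply: (@cdiff_local s (fun w' => (p (s w'))^-1)).
  by apply: contV => //; apply: cont_comp.
apply/nbhsC; exists (c - nC (w - f a)); first by rewrite subr_gt0.
move=> w' w'c; have [|sw'd fsw'] := sP w'; first by have := nC_dist3 w' w (f a); lra.
have := sp (s w'); rewrite fsw fsw' => e.
have [e'|/eqP ne] := eqVneq (s w') (s w).
  by rewrite e' subrr mulr0 addr0 in e; rewrite e' e subrr mulr0 addr0.
have pn : p (s w') != 0.
  apply/eqP => p0; apply: ne; apply: inj => //; rewrite fsw fsw' e p0 mul0r addr0 //.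
by rewrite [in w' - w]e [w + _]addrC addrK mulKf // addrC subrK.
Qed.

Lemma divide_zero f a rho : 0 < rho -> (forall z, disc a rho z -> cdiff f z) -> f a = 0 ->
  exists g, (forall u, f u = (u - a) * g u) /\ forall z, disc a rho z -> cdiff g z.
Proof.
move=> rho0 df fa; have [g [cg sg]] := df a (disc_center _ rho0).
exists g; split=> [u|z zr]; first by rewrite sg fa add0r mulrC.
have off u : disc a rho u -> u <> a -> cdiff g u by move=> ur ua; apply: slope_cdiff sg ua (df _ ur).
have [->|/eqP] := eqVneq z a; last exact: off.
apply: (removable rho0 _ off) => u ur.
by have [->//|/eqP ua] := eqVneq u a; exact/cdiff_cont/off.
Qed.

Lemma le_exp (x y : R) n : 0 <= x -> x <= y -> x ^+ n <= y ^+ n.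
Proof. by move=> x0 xy; rewrite lerXn2r ?nnegrE // (le_trans x0). Qed.

(** If f is divisible by all the powers of u - a, then [centered_estimate]
    applied to the quotients gives |f u| <= 2 M / 3 ^ n for all n near a. *)
Lemma zero_order f a rho : 0 < rho -> (forall z, disc a rho z -> cdiff f z) -> f a = 0 ->
  (exists2 d : R, 0 < d & forall u, disc a d u -> f u = 0) \/
  exists n g, [/\ forall u, f u = (u - a) ^+ n.+1 * g u, g a != 0 & forall z, disc a rho z -> cdiff g z].
Proof.
move=> rho0 df fa.
case: (pselect (exists n g, [/\ forall u, f u = (u - a) ^+ n.+1 * g u, g a != 0 & forall z, disc a rho z -> cdiff g z])) => no; [by right|left].
have all n : exists g, (forall u, f u = (u - a) ^+ n.+1 * g u) /\ forall z, disc a rho z -> cdiff g z.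
  elim: n => [|n [g [fg dg]]]; first exact: divide_zero.
  have ga : g a = 0 by apply/eqP/negPn/negP => ga; apply: no; exists n, g.
  have [h [gh dh]] := divide_zero rho0 dg ga; exists h; split=> // u.
  by rewrite fg gh [_ ^+ n.+2]exprSr mulrA.
have [r [M [r0 rrho M0 fM]]] := local_bound rho0 (cdiff_cont (df a (disc_center _ rho0))).
(* the circle of radius r / 2 around u stays at distance 3 r / 8 from a,
   three times the bound on the distance from u to a *)
exists (r / 8); first by rewrite divr_gt0.
move=> u; rewrite /disc /= => ud.
have small n : nC (f u) <= 2 * M / 3 ^+ n.+1.
  have [g [fg dg]] := all n.
  have r38 : 0 < r * 3 / 8 by rewrite divr_gt0 // mulr_gt0.
  have gu : nC (g u) <= 2 * (M / (r * 3 / 8) ^+ n.+1).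
    apply: (@centered_estimate R g u (r / 2) (r * 2 / 3) _ [::]); [by lra|by lra| | |].
    - move=> z; rewrite /disc /= => zu; apply/cdiff_cont/dg; rewrite /disc /=.
      by have := nC_dist3 z u a; lra.
    - move=> z; rewrite /disc /= => zu _; apply/dg; rewrite /disc /=.
      by have := nC_dist3 z u a; lra.
    move=> z zu; have za : r * 3 / 8 <= nC (z - a).
      by have := nC_dist3 z a u; rewrite (nCB a u); lra.
    have zr : nC (z - a) < r by have := nC_dist3 z u a; lra.
    have := fM z zr; rewrite fg nCM nCX ler_pdivlMr ?exprn_gt0 //.
    apply: le_trans; rewrite mulrC ler_wpM2r ?nC_ge0 //.
    by apply: le_exp => //; exact: ltW.
  rewrite fg nCM nCX.
  apply: (@le_trans _ _ ((r / 8) ^+ n.+1 * (2 * (M / (r * 3 / 8) ^+ n.+1)))).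
    by rewrite ler_pM ?exprn_ge0 ?nC_ge0 // le_exp ?nC_ge0 // ltW.
  rewrite le_eqVlt; apply/orP; left; apply/eqP.
  have -> : r * 3 / 8 = (r / 8) * 3 by ring.
  have X0 : (r / 8) ^+ n.+1 != 0 by rewrite expf_neq0 // gt_eqF // divr_gt0.
  have Y0 : (3 : R) ^+ n.+1 != 0 by rewrite expf_neq0.
  rewrite [(r / 8 * 3) ^+ _]exprMn; move: X0 Y0; set X := _ ^+ n.+1; set Y := _ ^+ n.+1 => X0 Y0.
  by field; rewrite X0 Y0.
apply/eqP; rewrite -nC_eq0 eq_le nC_ge0 andbT leNgt; apply/negP => fu0.
have [n hn] := archi_pow2 (2 * M) fu0.
have := small n; rewrite leNgt => /negP; apply; apply: le_lt_trans hn.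
rewrite ler_wpM2l ?(ltW (mulr_gt0 _ M0)) // lef_pV2 ?posrE ?exprn_gt0 //.
apply: (@le_trans _ _ (2 ^+ n.+1)); first by rewrite ler_weXn2l ?ler1n.
by rewrite le_exp // ler_nat.
Qed.

Lemma cderiv_id a : cderiv id a 1.
Proof. by exists (fun=> 1); split=> //; [exact: contc|move=> u; rewrite mul1r addrC subrK]. Qed.
Lemma cderivM f g a l m : cderiv f a l -> cderiv g a m ->
  cderiv (fun u => f u * g u) a (l * g a + f a * m).
Proof.
move=> [p [cp sp <-]] dg; have cg := cdiff_cont (cderiv_cdiff dg).
case: dg => [q [cq sq <-]].
exists (fun u => p u * g u + f a * q u); split=> //.
  by apply: contD; apply: contM => //; exact: contc.
by move=> u; rewrite sp {2}sq (sq u); ring.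
Qed.
Lemma cderivX a n : cderiv (fun u => u ^+ n.+1) a (n.+1%:R * a ^+ n).
Proof.
elim: n => [|n IH]; first by rewrite mul1r; exact: cderiv_id.
have -> : (fun u : C => u ^+ n.+2) = (fun u => u ^+ n.+1 * u) by apply/funext => u; rewrite exprSr.
have -> : n.+2%:R * a ^+ n.+1 = (n.+1%:R * a ^+ n) * a + a ^+ n.+1 * 1 by rewrite -mulrA -exprSr mulr1 -[n.+2]addn1 natrD mulrDl mul1r.
exact: (cderivM IH (cderiv_id a)).
Qed.

Lemma root_near (c : C) n : c != 0 -> exists s (e : R), 0 < e /\
  forall w, nC (w - c) < e -> (s w : C) ^+ n.+1 = w /\ cdiff s w.
Proof.
move=> c0; pose r0 : R[i] := n.+1.-root (c : R[i]).
have rc : r0 ^+ n.+1 = c by exact: rootCK.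
have r00 : r0 != 0 by apply/eqP => e; move: c0; rewrite -rc e expr0n eqxx.
have [d [e [s [_ _ e0 _ H]]]] : exists d e s, [/\ 0 < d, d <= 1, 0 < e,
    (forall u v : C, disc r0 d u -> disc r0 d v -> u ^+ n.+1 = v ^+ n.+1 -> u = v) &
    forall w, nC (w - r0 ^+ n.+1) < e -> [/\ disc r0 d (s w), s w ^+ n.+1 = w & cdiff s w]].
  apply: (@local_inverse (fun u => u ^+ n.+1) r0 1 (n.+1%:R * r0 ^+ n)) => //.
  - by move=> z _; apply: cdiffX; exact: cdiff_id.
  - exact: cderivX.
  - by rewrite mulf_neq0 ?pnatr_eq0 // expf_neq0.
by rewrite rc in H; exists s, e; split=> // w /H[].
Qed.

(** Write f u - f a = (u - a) ^ n * g u with g a != 0 and extract an n-th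
    root of g near g a; t is (u - a) times this root. *)
Theorem normal_form f a rho : 0 < rho -> (forall z, disc a rho z -> cdiff f z) ->
  ~ (exists2 d : R, 0 < d & forall u, disc a d u -> f u = f a) ->
  exists n (t : C -> C) (d : R) l, [/\ 0 < d, d <= rho,
    forall u, disc a d u -> cdiff t u /\ f u = f a + t u ^+ n.+1, t a = 0 & cderiv t a l /\ l != 0].
Proof.
move=> rho0 df nonc.
have [||[d d0 H]|[n [g [fg ga dg]]]] := @zero_order (fun u => f u - f a) a rho rho0.
- by move=> z zr; apply: cdiffD; [exact: df|exact: (cdiff_cst (- f a))].
- by rewrite subrr.
- by case: nonc; exists d => // u /H/subr0_eq.
have [s [e [e0 sP]]] := root_near n ga.
have /cdiff_cont/ccontP/(_ e e0)[r r0 hr] := dg a (disc_center _ rho0).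
have ga' : nC (g a - g a) < e by rewrite subrr nC0.
have sn0 : s (g a) != 0.
  by apply/eqP => s0; have [h _] := sP (g a) ga'; move: ga; rewrite -h s0 expr0n eqxx.
have da : cderiv (fun u => u - a) a 1.
  by exists (fun=> 1); split=> //; [exact: contc|move=> u; rewrite subrr add0r mul1r].
have ds u : disc a (Num.min r rho) u -> cdiff (fun u => s (g u)) u.
  rewrite /disc /= lt_min => /andP[/hr h1 h2].
  by apply: (@cdiff_comp R g s); [exact: dg|exact: (sP _ h1).2].
have m0 : 0 < Num.min r rho by rewrite lt_min r0.
exists n, (fun u => (u - a) * s (g u)), (Num.min r rho), (s (g a)); split=> //.
- by rewrite ge_min lexx orbT.
- move=> u ur; split.
    apply: cdiffM; last exact: ds.
    by apply: cdiffD; [exact: cdiff_id|exact: (cdiff_cst (- a))].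
  move: ur; rewrite /disc /= lt_min => /andP[/hr h1 h2].
  by rewrite exprMn (sP _ h1).1 -fg addrC subrK.
- by rewrite subrr mul0r.
split=> //; have [m dm] := cdiff_cderiv (ds a (disc_center _ m0)).
by have := cderivM da dm; rewrite subrr mul0r addr0 mul1r.
Qed.

Lemma unity_root n : (0 < n)%N -> let zeta : C := cexp (0 +i* (pi *+ 2 / n%:R)) in
  zeta ^+ n = 1 /\ forall j, (0 < j < n)%N -> zeta ^+ j != 1.
Proof.
move=> n0; set t : R := pi *+ 2 / n%:R => zeta.
have n0R : 0 < n%:R :> R by rewrite ltr0n.
have pi2 : 0 < (pi : R) *+ 2 by rewrite pmulrn_lgt0 // pi_gt0.
have pw j : cexp (0 +i* t) ^+ j = cexp (0 +i* (t *+ j)).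
  elim: j => [|j IH]; first by rewrite expr0 mulr0n cexp0.
  by rewrite exprS IH -cexpD mulrS; congr cexp; apply: complex_eq; rewrite /= ?addr0.
rewrite /zeta; split.
  rewrite pw -mulr_natr /t mulfVK ?gt_eqF // -[X in _ +i* X]add0r cexp_2pi.
  exact: cexp0.
move=> j /andP[j0 jn]; apply/eqP; rewrite pw => /(congr1 (fun u : R[i] => complex.Re u)).
rewrite /= expR0 mul1r => ct.
have j0R : 0 < j%:R :> R by rewrite ltr0n.
have tj : t *+ j = (pi *+ 2) * (j%:R / n%:R) by rewrite -mulr_natr /t; field; rewrite gt_eqF.
have jn1 : j%:R / n%:R < 1 :> R by rewrite ltr_pdivrMr // mul1r ltr_nat.
have tj0 : 0 < t *+ j by rewrite tj mulr_gt0 // divr_gt0.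
have tj1 : t *+ j < pi *+ 2 by rewrite tj -[ltRHS]mulr1 ltr_pM2l.
have [|h|h|h] := cos1_2pi _ ct; first (by apply/andP; split; lra); by lra.
Qed.

(** In the normal form f a + t ^ n the coordinate t takes both values v and
    zeta v, where zeta is a primitive n-th root of unity; so f is not
    injective unless n = 1. *)
Theorem injective_cderiv f a rho l : 0 < rho -> (forall z, disc a rho z -> cdiff f z) ->
  (forall u v, disc a rho u -> disc a rho v -> f u = f v -> u = v) -> cderiv f a l -> l != 0.
Proof.
move=> rho0 df inj dl; have [|n [t [d [m [d0 drho tP ta [dm m0]]]]]] := normal_form rho0 df.
  move=> [d d0 H]; have [|w] := @ex_near_neq a (Num.min d rho); first by rewrite lt_min d0.
  rewrite /disc /= lt_min => /andP[wd wr] wa; apply: wa; apply: inj (H _ wd) => //.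
  exact: disc_center.
have td u : disc a d u -> cdiff t u by move=> /tP[].
have [c [c0 hc]] := open_mapping d0 td dm m0.
case: n tP => [|n] tP.
  have : cderiv f a m.
    case: dm => p [cp sp <-]; apply: cdiff_local => //.
    apply/nbhsC; exists d => // u ud; rewrite (tP u ud).2 expr1 [t u]sp ta add0r //.
  by move=> /cderiv_uniq -/(_ _ dl) <-.
have [z1 zj] := @unity_root n.+2 isT; set zeta := cexp _ in z1 zj.
have {}zj : zeta != 1 by have := zj 1%N isT.
have nz : nC zeta = 1.
  apply/eqP; have : nC zeta ^+ n.+2 == 1 by rewrite -nCX z1 nC1.
  by rewrite pexprn_eq1 ?nC_ge0.
have vc : nC ((c / 2)%:C) < c by rewrite nCR ger0_norm; lra.
have [u ud tu] : exists2 u, disc a d u & t u = (c / 2)%:C by apply: hc; rewrite ta subr0.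
have [v vd tv] : exists2 u, disc a d u & t u = zeta * (c / 2)%:C.
  by apply: hc; rewrite ta subr0 nCM nz mul1r.
have uv : u = v.
  apply: inj; try by apply: lt_le_trans drho.
  by rewrite (tP u ud).2 (tP v vd).2 tu tv exprMn z1 mul1r.
have c20 : (c / 2)%:C != 0 :> R[i] by rewrite -nC_gt0 nCR ger0_norm; lra.
exfalso; move: tv; rewrite -uv tu -{1}[(c / 2)%:C]mul1r => /(mulIf c20) /esym/eqP.
by rewrite (negPf zj).
Qed.

(** The form used for changes of charts, where the inverse g is only given
    pointwise. *)
Theorem hol_injective_inverse (O : set C) f g : open O -> (forall z, O z -> cdiff f z) ->
  (forall z, O z -> g (f z) = z) ->
  forall z, O z -> nbhs (f z) (f @` O) /\ cdiff g (f z).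
Proof.
move=> /openC oO df gf z Oz; have [rho rho0 hO] := oO z Oz.
have df' u : disc z rho u -> cdiff f u by move=> /hO; exact: df.
have inj u v : disc z rho u -> disc z rho v -> f u = f v -> u = v.
  by move=> /hO/gf {2}<- /hO/gf {2}<- ->.
have [l dl] := cdiff_cderiv (df z Oz).
have l0 := injective_cderiv rho0 df' inj dl.
have [d [e [s [d0 drho e0 _ sP]]]] := local_inverse rho0 df' dl l0.
have sd w : nC (w - f z) < e -> O (s w).
  by move=> /sP[h _ _]; apply: hO; apply: lt_le_trans drho.
split.
  by apply/nbhsC; exists e => // w we; exists (s w); [exact: sd|have [] := sP w we].
apply: (@cdiff_near R s); last by have [|] := sP (f z); first by rewrite subrr nC0.
apply/nbhsC; exists e => // w we; have [_ fs _] := sP w we.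
by rewrite -[in RHS]fs gf //; exact: sd.
Qed.
End LocalTheory.

(** * Free modules over Z/k of countable rank *)

Section FreeModule.
Variables (A : zmodType) (k : nat).
Hypothesis k1 : (1 < k)%N.
Hypothesis expk : forall x : A, x *+ k = 0.

Definition additive_char (chi : A -> 'Z_k) := forall x y, chi (x + y) = chi x + chi y.

Hypothesis divisible : forall p x, prime p -> (p %| k)%N ->
  (forall chi, additive_char chi -> chi x *+ (k %/ p) = 0) -> exists y, x = y *+ p.

Let k0 : (0 < k)%N. Proof. exact: ltnW. Qed.

Lemma char0 chi : additive_char chi -> chi 0 = 0.
Proof. by move=> ac; apply: (addrI (chi 0)); rewrite -ac !addr0. Qed.
Lemma charMn chi x n : additive_char chi -> chi (x *+ n) = chi x *+ n.
Proof.
move=> ac; elim: n => [|n IH]; first by rewrite !mulr0n char0.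
by rewrite !mulrS ac IH.
Qed.
Lemma charN chi x : additive_char chi -> chi (- x) = - chi x.
Proof. by move=> ac; apply: (addrI (chi x)); rewrite -ac !subrr char0. Qed.
Lemma charB chi x y : additive_char chi -> chi (x - y) = chi x - chi y.
Proof. by move=> ac; rewrite ac charN. Qed.

(** For an element of a module over Z/k, or of Z/k itself, this is the
    condition that its order be exactly k. *)
Definition full_order (V : zmodType) (x : V) := forall p, prime p -> (p %| k)%N -> x *+ (k %/ p) != 0.

Lemma coprime_torsion (V : zmodType) (x : V) m n : coprime m n -> x *+ m = 0 -> x *+ n = 0 -> x = 0.
Proof.
case: n => [|n] cop xm xn.
  by move: cop xm; rewrite /coprime gcdn0 => /eqP ->; rewrite mulr1n.
have [u _] := Bezoutr m (ltn0Sn n); rewrite (eqP cop) => /dvdnP[q e].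
have : x *+ (1 + u * m) = 0 by rewrite e mulnC mulrnA xn mul0rn.
by rewrite mulrnDr mulr1n mulnC mulrnA xm mul0rn addr0.
Qed.

Lemma full_order_unit (u : 'Z_k) : full_order u -> u \is a GRing.unit.
Proof.
move=> fu; rewrite -[u]natr_Zp unitZpE // /coprime; apply/negPn/negP => g1.
have g0 : (0 < gcdn k u)%N by rewrite gcdn_gt0 k0.
have gp : (1 < gcdn k u)%N by rewrite ltn_neqAle eq_sym g1.
have pr := pdiv_prime gp; set p := pdiv _ in pr.
have pk : (p %| k)%N by apply: dvdn_trans (pdiv_dvd _) (dvdn_gcdl _ _).
have pu : (p %| u)%N by apply: dvdn_trans (pdiv_dvd _) (dvdn_gcdr _ _).
have := fu p pr pk; rewrite -[u]natr_Zp -mulrnA.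
have -> : (u * (k %/ p) = k * (u %/ p))%N by rewrite -{1}(divnK pu) -mulnA [(p * _)%N]mulnC divnK // mulnC.
by rewrite mulrnA pchar_Zp // mul0rn eqxx.
Qed.

(** By divisibility, for each prime p dividing k some character takes on x a
    value prime to p. A suitable combination of these finitely many
    characters takes a value prime to k, which can be normalized to 1. Hence
    an element of order k generates a direct summand. *)
Lemma split_char x : full_order x -> exists2 chi, additive_char chi & chi x = 1.
Proof.
move=> fx.
have single p : prime p -> (p %| k)%N -> exists2 chi, additive_char chi & chi x *+ (k %/ p) != 0.
  move=> pp pk; apply: contrapT => no.
  have [chi ac|y xy] := divisible pp pk (x := x).
    by apply/eqP/negPn/negP => h; apply: no; exists chi.
  by have := fx p pp pk; rewrite xy -mulrnA mulnC divnK // expk eqxx.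
have all (ps : seq nat) : uniq ps -> all prime ps -> all (fun p => p %| k)%N ps ->
    exists2 chi, additive_char chi & forall p, p \in ps -> chi x *+ (k %/ p) != 0.
  elim: ps => [|q ps IH] /=; first by exists (fun=> 0) => // ? ?; rewrite addr0.
  move=> /andP[qps ups] /andP[pq pps] /andP[qk psk].
  have [chi ac hchi] := IH ups pps psk.
  have [h|h] := eqVneq (chi x *+ (k %/ q)) 0; last first.
    by exists chi => // p; rewrite inE => /orP[/eqP ->//|]; exact: hchi.
  have [chi' ac' h'] := single q pq qk.
  (* m is prime to q and divisible by the previous primes, so adding m chi'
     provides for q and does not disturb them *)
  pose m := (\prod_(p <- ps) p)%N.
  exists (fun y => chi y + chi' y *+ m); first by move=> y z; rewrite ac ac' mulrnDl addrACA.
  move=> p; rewrite inE mulrnDl => /orP[/eqP ->|pps'].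
    rewrite h add0r -mulrnA mulnC mulrnA; apply: contra h' => /eqP hm; apply/eqP.
    apply: (@coprime_torsion _ _ q m) => //.
      rewrite /m; elim: (ps) qps pps => [|r rs IHr] /=; first by rewrite big_nil coprimen1.
      rewrite inE negb_or => /andP[qr qrs] /andP[pr prs].
      by rewrite big_cons coprimeMr IHr // andbT prime_coprime // dvdn_prime2.
    by rewrite -mulrnA divnK // -mulr_natr pchar_Zp // mulr0.
  have pm : (p %| m)%N by rewrite /m (big_rem p) //= dvdn_mulr.
  have pk : (p %| k)%N by move/allP: psk => /(_ _ pps').
  rewrite -!mulrnA -(divnK pm) -mulnA [(p * _)%N]mulnC divnK // mulnC.
  by rewrite [in X in _ + X]mulrnA -[_ *+ k]mulr_natr pchar_Zp // mulr0 mul0rn addr0; exact: hchi.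
have [||chi ac hchi] := all (primes k) (primes_uniq k).
- by apply/allP => p; rewrite mem_primes => /and3P[].
- by apply/allP => p; rewrite mem_primes => /and3P[].
have u : chi x \is a GRing.unit.
  by apply: full_order_unit => p pp pk; apply: hchi; rewrite mem_primes pp k0.
exists (fun y => (chi x)^-1 * chi y); last exact: mulVr.
by move=> y z; rewrite ac mulrDr.
Qed.

Let ex_ord (x : A) : exists n, (0 < n)%N && (x *+ n == 0).
Proof. by exists k; rewrite k0 expk eqxx. Qed.
Let ord x := ex_minn (ex_ord x).
Let ord_gt0 x : (0 < ord x)%N. Proof. by rewrite /ord; case: ex_minnP => n /andP[]. Qed.
Let mul_ord x : x *+ ord x = 0. Proof. by rewrite /ord; case: ex_minnP => n /andP[_ /eqP]. Qed.
Let ordP x n : x *+ n = 0 -> (ord x %| n)%N.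
Proof.
move=> xn; rewrite /dvdn; apply/negPn/negP; rewrite -lt0n => r0.
have : x *+ (n %% ord x) = 0.
  by have := xn; rewrite {1}(divn_eq n (ord x)) mulrnDr mulnC mulrnA mul_ord mul0rn add0r.
move=> /eqP xr; have : (n %% ord x < ord x)%N by rewrite ltn_mod.
by rewrite {2}/ord; case: ex_minnP => m _ /(_ (n %% ord x)%N); rewrite r0 xr leqNgt => /(_ isT) /negP.
Qed.
Let ord_le x : (ord x <= k)%N.
Proof. by apply: dvdn_leq => //; exact: ordP. Qed.

(** By induction on k - ord x: if x has order less than k, then x *+ (k / p)
    vanishes for some p, so x is divisible by p, say x = y *+ p. Either y has
    larger order than x, or the order of x is prime to p, and then adding to
    y an element of order p makes the order larger. The statement is relative
    to a subgroup P because it is applied to the common kernel of finitely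
    many characters. *)
Lemma multiple_of_full (P : A -> Prop) (a : A) :
  (forall x y, P x -> P y -> P (x + y)) -> (forall x, P x -> P (- x)) ->
  (forall p x, prime p -> (p %| k)%N -> P x ->
    (forall chi, additive_char chi -> chi x *+ (k %/ p) = 0) -> exists2 y, P y & x = y *+ p) ->
  P a -> full_order a ->
  forall x, P x -> exists e m, [/\ P e, full_order e & x = e *+ m].
Proof.
move=> PD PN Pdiv Pa fa.
have PMn y n : P y -> P (y *+ n).
  move=> Py; elim: n => [|n IH]; first by rewrite mulr0n -(subrr y); apply: PD => //; exact: PN.
  by rewrite mulrS; exact: PD.
suff main d x : (k - ord x <= d)%N -> P x -> exists e m, [/\ P e, full_order e & x = e *+ m].
  by move=> x; exact: (main (k - ord x)%N).
elim: d x => [|d IH] x dx Px.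
  exists x, 1%N; split=> // p pp pk; apply/eqP => /ordP h.
  have := dvdn_leq _ h; rewrite divn_gt0 ?prime_gt0 // dvdn_leq // => /(_ isT).
  have : (k %/ p < k)%N by rewrite ltn_Pdiv // prime_gt1.
  by move: dx; rewrite leqn0 subn_eq0 => h1 h2 h3; lia.
case: (pselect (full_order x)) => [fx|nfx]; first by exists x, 1%N.
have [p [pp pk xp]] : exists p, [/\ prime p, (p %| k)%N & x *+ (k %/ p) = 0].
  apply: contrapT => no; apply: nfx => p pp pk; apply/eqP => h; apply: no.
  by exists p.
have [|y Py xy] := Pdiv p x pp pk Px; first by move=> chi ac; rewrite -charMn // xp char0.
have oxy : (ord x %| ord y)%N by apply: ordP; rewrite xy -mulrnA mulnC mulrnA mul_ord mul0rn.
have p0 := prime_gt0 pp.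
have finish z : P z -> (ord x < ord z)%N -> (exists m, x = z *+ m) -> exists e m, [/\ P e, full_order e & x = e *+ m].
  move=> Pz oz [m xm]; have [|e [m' [Pe fe ze]]] := IH z _ Pz.
    by have := ord_le z; have := ord_le x; lia.
  by exists e, (m' * m)%N; split=> //; rewrite xm ze mulrnA.
have := dvdn_leq (ord_gt0 y) oxy; rewrite leq_eqVlt => /orP[/eqP oeq|olt]; last first.
  by apply: (finish y) => //; exists p.
have npo : ~~ (p %| ord x)%N.
  apply/negP => po; have : x *+ (ord x %/ p) = 0 by rewrite {1}xy -mulrnA mulnC divnK // oeq mul_ord.
  move=> /ordP/dvdn_leq; rewrite divn_gt0 // dvdn_leq // => /(_ isT).
  by rewrite leqNgt ltn_Pdiv // prime_gt1.
(* b has order p, which is prime to the order of y, so y is a multiple of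
   y + b: take n equal to 1 modulo the order of y and to 0 modulo p *)
pose b := a *+ (k %/ p).
have bp : b *+ p = 0 by rewrite -mulrnA divnK.
have Pb : P b by exact: PMn.
have cop : coprime (ord x) p by rewrite coprime_sym prime_coprime.
pose n := chinese (ord x) p 1 0.
have n1 : n = 1 %[mod ord x] by exact: chinese_modl.
have n0 : n = 0 %[mod p] by exact: chinese_modr.
have yn : (y + b) *+ n = y.
  have bn : b *+ n = 0.
    by move/eqP: n0; rewrite mod0n => /dvdnP[q ->]; rewrite mulnC mulrnA bp mul0rn.
  have yord m : y *+ m = y *+ (m %% ord x).
    by rewrite {1}(divn_eq m (ord x)) mulrnDr mulnC mulrnA oeq mul_ord mul0rn add0r.
  by rewrite mulrnDl bn addr0 (yord n) n1 -(yord 1%N) mulr1n.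
apply: (finish (y + b)); first exact: PD.
  have d1 : (ord x %| ord (y + b))%N.
    by rewrite oeq; apply: ordP; rewrite -{1}yn -mulrnA mulnC mulrnA mul_ord mul0rn.
  have := dvdn_leq (ord_gt0 _) d1; rewrite leq_eqVlt => /orP[/eqP e|//].
  have bo : b *+ ord x = 0.
    have := mul_ord (y + b); rewrite -e mulrnDl oeq mul_ord add0r -oeq; exact.
  by have := fa p pp pk; rewrite -/b (coprime_torsion cop bo bp) eqxx.
by exists (n * p)%N; rewrite mulrnA yn.
Qed.

Let mulZ (x : A) (c : 'Z_k) : A := x *+ (c : nat).
Let mulZD x c d : mulZ x (c + d) = mulZ x c + mulZ x d.
Proof.
rewrite /mulZ -mulrnDr /= [in RHS](divn_eq (c + d)%N k) mulrnDr mulnC mulrnA expk mul0rn add0r.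
by congr (_ *+ (_ %% _)); exact: Zp_cast.
Qed.
Let char_mulZ chi x c : additive_char chi -> chi (mulZ x c) = chi x * c.
Proof. by move=> ac; rewrite /mulZ charMn // -mulr_natr natr_Zp. Qed.

Hypothesis countable : exists e : nat -> A, forall x, exists n, e n = x.
Hypothesis infinite_rank : exists a : nat -> A, forall i j, (i < j)%N -> full_order (a j - a i).

Let pair := (A * (A -> 'Z_k))%type.

(** Finite families of vectors and characters dual to each other: each of
    them splits off a free summand, with projection [proj] onto the
    complement [kernel]. *)
Definition biorthogonal (s : seq pair) := forall i j, (i < size s)%N -> (j < size s)%N ->
  additive_char (nth (0, fun=> 0) s i).2 /\
  (nth (0, fun=> 0) s i).2 (nth (0, fun=> 0) s j).1 = (i == j)%:R.

Let proj (s : seq pair) (x : A) := x - \sum_(i < size s) mulZ (nth (0, fun=> 0) s i).1 ((nth (0, fun=> 0) s i).2 x).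
Let kernel (s : seq pair) (x : A) := forall i, (i < size s)%N -> (nth (0, fun=> 0) s i).2 x = 0.

Let sum_char (I : eqType) (r : seq I) (F : I -> A) chi : additive_char chi -> chi (\sum_(i <- r) F i) = \sum_(i <- r) chi (F i).
Proof. by move=> ac; apply: (big_morph chi ac); exact: char0. Qed.

Let proj_kernel s x : biorthogonal s -> kernel s (proj s x).
Proof.
move=> bs i si; have ac := (bs i i si si).1.
rewrite /proj charB // sum_char // (bigD1 (Ordinal si)) //= char_mulZ // (bs i i si si).2 eqxx mul1r.
rewrite big1 ?addr0 ?subrr // => j /= ji; rewrite char_mulZ // (bs i j si (ltn_ord j)).2.
by rewrite eq_sym -val_eqE /= in ji *; rewrite (negPf ji) mul0r.
Qed.

Let proj_id s x : kernel s x -> proj s x = x.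
Proof. by move=> kx; rewrite /proj big1 ?subr0 // => i _; rewrite kx // /mulZ mulr0n. Qed.

Let projMn s x n : biorthogonal s -> proj s (x *+ n) = proj s x *+ n.
Proof.
move=> bs; rewrite /proj mulrnBl; congr (_ - _).
rewrite -sumrMnl; apply: eq_bigr => i _; have ac := (bs i i (ltn_ord i) (ltn_ord i)).1.
rewrite charMn //; set c := (_.2 x); set y := (_.1).
elim: n => [|n IH]; first by rewrite !mulr0n /mulZ mulr0n.
by rewrite !mulrS mulZD IH.
Qed.

Let proj_add s x y : biorthogonal s -> proj s (x + y) = proj s x + proj s y.
Proof.
move=> bs; rewrite /proj addrACA -opprD -big_split; congr (_ - _) => /=.
apply: eq_bigr => i _; have ac := (bs i i (ltn_ord i) (ltn_ord i)).1.
by rewrite ac mulZD.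
Qed.

(** The projection of x on the complement of the free summand already found
    is a multiple of an element e of order k of this complement, and e splits
    off together with a character. The complement has elements of order k by
    infinite rank. *)
Lemma extend_biorthogonal s x : biorthogonal s -> exists q : pair,
  biorthogonal (rcons s q) /\ exists c : 'Z_k, proj s x = mulZ q.1 c.
Proof.
move=> bs; have [a aP] := infinite_rank.
have acs i : (i < size s)%N -> additive_char (nth (0, fun=> 0) s i).2 by move=> si; exact: (bs i i si si).1.
(* two of the infinitely many a i have the same coordinates, by the
   pigeonhole principle *)
have [i [j [ij aij]]] : exists i j, (i < j)%N /\ kernel s (a j - a i).
  pose T := {ffun 'I_(size s) -> 'Z_k}.
  pose F (i : 'I_#|T|.+1) : T := [ffun l : 'I_(size s) => (nth (0, fun=> 0) s l).2 (a i)].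
  have : ~~ injectiveb F by apply/injectiveP => /leq_card; rewrite card_ord ltnn.
  move=> /injectivePn[i [j ij Fij]].
  have key (u v : 'I_#|T|.+1) : F u = F v -> kernel s (a v - a u).
    move=> e l ls; rewrite (charB _ _ (acs l ls)); apply/eqP; rewrite subr_eq0; apply/eqP.
    by move/ffunP/(_ (Ordinal ls)): e; rewrite !ffunE.
  have [lt|lt|/val_inj e] := ltngtP i j.
  - by exists i, j; split=> //; exact: key.
  - by exists j, i; split=> //; exact: key.
  - by rewrite e eqxx in ij.
have [||p y pp pk ky hy|e [m [ke fe pe]]] := @multiple_of_full (kernel s) (a j - a i) _ _ _ aij (aP i j ij) (proj s x) (proj_kernel x bs).
- by move=> y z ky kz l ls; rewrite acs // ky // kz // addr0.
- by move=> y ky l ls; rewrite (charN _ (acs l ls)) ky // oppr0.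
- have [z yz] := divisible pp pk hy; exists (proj s z); first exact: proj_kernel.
  by rewrite -projMn // -yz proj_id.
have [chi ac chie] := split_char fe.
have ac' : additive_char (fun y => chi (proj s y)) by move=> y z; rewrite proj_add // ac.
exists (e, fun y => chi (proj s y)); split.
  have nthE l (q : pair) : nth (0, fun=> 0) (rcons s q) l = if (l < size s)%N then nth (0, fun=> 0) s l else if l == size s then q else (0, fun=> 0) by rewrite nth_rcons.
  move=> u v; rewrite size_rcons !ltnS !nthE => us vs.
  case: (ltnP u (size s)) => us'; case: (ltnP v (size s)) => vs'.
  - exact: bs.
  - have -> : v = size s by apply/eqP; rewrite eqn_leq vs.
    by rewrite eqxx /=; split; [exact: acs|rewrite ke // (ltn_eqF us')].
  - have -> : u = size s by apply/eqP; rewrite eqn_leq us.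
    rewrite eqxx /=; split=> //; rewrite gtn_eqF //.
    have -> : proj s (nth (0, fun=> 0) s v).1 = 0; last exact: char0.
    rewrite /proj (bigD1 (Ordinal vs')) //= (bs v v vs' vs').2 eqxx big1 ?addr0.
      by rewrite /mulZ [in X in _ *+ X](_ : nat_of_ord _ = 1%N) ?mulr1n ?subrr // /= modn_small // ?Zp_cast.
    move=> l /= lv; rewrite (bs l v (ltn_ord l) vs').2 -val_eqE /= in lv *.
    by rewrite (negPf lv) /mulZ mulr0n.
  - have -> : u = size s by apply/eqP; rewrite eqn_leq us.
    have -> : v = size s by apply/eqP; rewrite eqn_leq vs.
    by rewrite eqxx /=; split=> //; rewrite proj_id.
exists (m%:R); rewrite pe /mulZ /= val_Zp_nat //.
by rewrite {1}(divn_eq m k) mulrnDr mulnC mulrnA expk mul0rn add0r.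
Qed.

(** The elements of an enumeration are absorbed one at a time by
    [extend_biorthogonal]; the resulting infinite family is linearly
    independent thanks to the dual characters, and it generates A. *)
Theorem free_countable_module : exists f : (nat -> 'Z_k) -> A,
  set_bij [set a | finite_set [set n | a n != 0]] [set: A] f /\
  forall a b : nat -> 'Z_k, finite_set [set n | a n != 0] -> finite_set [set n | b n != 0] ->
    f (fun n => a n + b n) = f a + f b.
Proof.
have [en enP] := countable.
have [nx nxP] : {nx : seq pair * nat -> pair & forall sn, biorthogonal sn.1 ->
    biorthogonal (rcons sn.1 (nx sn)) /\ exists c : 'Z_k, proj sn.1 (en sn.2) = mulZ (nx sn).1 c}.
  apply: (@choice (seq pair * nat) pair (fun sn q => biorthogonal sn.1 ->
    biorthogonal (rcons sn.1 q) /\ exists c : 'Z_k, proj sn.1 (en sn.2) = mulZ q.1 c)) => -[s n] /=.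
  case: (pselect (biorthogonal s)) => [bs|nbs]; last by exists (0, fun=> 0).
  by have [q qP] := extend_biorthogonal (en n) bs; exists q.
(* step n absorbs the n-th element of the enumeration *)
pose fix S n : seq pair := if n is m.+1 then rcons (S m) (nx (S m, m)) else [::].
have sizeS n : size (S n) = n by elim: n => [|n IH] //=; rewrite size_rcons IH.
have bS n : biorthogonal (S n).
  by elim: n => [|n IH]; [move=> i j|have [] := nxP (S n, n) IH].
pose q n := nx (S n, n).
have nthS n i : (i < n)%N -> nth (0, fun=> 0) (S n) i = q i.
  elim: n => // n IH; rewrite ltnS leq_eqVlt => /orP[/eqP ->|lt] /=.
    by rewrite nth_rcons sizeS ltnn eqxx.
  by rewrite nth_rcons sizeS lt IH.
pose e n := (q n).1; pose chi n := (q n).2.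
have ac i : additive_char (chi i).
  by have [] := bS i.+1 i i; rewrite ?sizeS ?nthS.
have ortho i j : chi i (e j) = (i == j)%:R.
  have im : (i < (maxn i j).+1)%N by rewrite ltnS leq_maxl.
  have jm : (j < (maxn i j).+1)%N by rewrite ltnS leq_maxr.
  by have [||_] := bS (maxn i j).+1 i j; rewrite ?sizeS // !nthS.
pose fin (a : nat -> 'Z_k) := finite_set [set n | a n != 0].
pose psum (a : nat -> 'Z_k) N := \sum_(i < N) mulZ (e i) (a i).
have bound a : fin a -> exists N, forall n, (N <= n)%N -> a n = 0.
  move=> /finite_seqP[r ar]; exists (\max_(i <- r) i).+1 => n nN; apply/eqP/negPn/negP => an.
  have : [set n | a n != 0] n by [].
  rewrite ar /= => nr; have := @leq_bigmax_seq _ r xpredT id n nr isT.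
  by rewrite leqNgt nN.
have psum_stable a N M : (forall n, (N <= n)%N -> a n = 0) -> (N <= M)%N -> psum a M = psum a N.
  move=> aN NM; rewrite -(subnKC NM); elim: (M - N)%N => [|d IH]; first by rewrite addn0.
  rewrite addnS /psum big_ord_recr /= aN ?leq_addr // {2}/mulZ mulr0n addr0; exact: IH.
have chi_psum a N i : chi i (psum a N) = if (i < N)%N then a i else 0.
  rewrite /psum sum_char //; case: ltnP => iN.
    rewrite (bigD1 (Ordinal iN)) //= char_mulZ // ortho eqxx mul1r big1 ?addr0 // => j ji.
    by rewrite char_mulZ // ortho -val_eqE /= in ji *; rewrite eq_sym (negPf ji) mul0r.
  apply: big1 => j _; rewrite char_mulZ // ortho gtn_eqF ?mul0r //.
  exact: leq_trans (ltn_ord j) iN.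
have [Nf NfP] : {Nf : (nat -> 'Z_k) -> nat & forall a, fin a -> forall n, (Nf a <= n)%N -> a n = 0}.
  apply: (@choice _ _ (fun (a : nat -> 'Z_k) N => fin a -> forall n, (N <= n)%N -> a n = 0)) => a.
  by case: (pselect (fin a)) => [/bound[N ?]|na]; [exists N|exists 0%N].
pose f a := psum a (Nf a).
have chi_f a i : fin a -> chi i (f a) = a i.
  move=> fa; rewrite chi_psum; case: ltnP => // iN; by rewrite NfP.
have reach n : exists c, en n = psum c n.+1.
  have [_ [c pc]] := nxP (S n, n) (bS n).
  exists (fun i => if (i < n)%N then chi i (en n) else c).
  rewrite /psum big_ord_recr /= ltnn -/(q n) -pc /proj sizeS addrC.
  rewrite [X in _ - X](eq_bigr (fun i : 'I_n => mulZ (e i) (if (i < n)%N then chi i (en n) else c))) ?subrK //.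
  by move=> i _; rewrite ltn_ord nthS.
exists f; split.
  split=> [a _|a b /set_mem fa /set_mem fb fab|x _] //.
    by apply/funext => i; rewrite -(chi_f a) // -(chi_f b) // fab.
  have [n <-] := enP x; have [c ->] := reach n.
  pose c' i := if (i < n.+1)%N then c i else 0.
  have c'0 m : (n.+1 <= m)%N -> c' m = 0 by move=> nm; rewrite /c' [(m < _)%N]ltnNge nm.
  have fc' : fin c'.
    apply: (sub_finite_set _ (finite_II n.+1)) => m /=.
    by apply: contraNT; rewrite -leqNgt => /c'0 ->.
  exists c' => //.
  rewrite /f -(@psum_stable c' (Nf c') (maxn (Nf c') n.+1)) ?leq_maxl //; last exact: NfP.
  rewrite (@psum_stable c' n.+1) ?leq_maxr //.
  by apply: eq_bigr => i _; rewrite /c' ltn_ord.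
move=> a b fa fb.
pose M := maxn (Nf a) (maxn (Nf b) (Nf (fun n => a n + b n))).
have fab : fin (fun n => a n + b n).
  apply: (sub_finite_set _ (_ : finite_set ([set n | a n != 0] `|` [set n | b n != 0]))); last by rewrite finite_setU.
  move=> n /= h; apply: contrapT => /not_orP[/negP/negPn/eqP a0 /negP/negPn/eqP b0].
  by move: h; rewrite a0 b0 addr0 eqxx.
rewrite /f -(@psum_stable _ (Nf a) M) ?leq_maxl //; last exact: NfP.
rewrite -(@psum_stable _ (Nf b) M); [|exact: NfP|by rewrite /M maxnCA leq_maxl].
rewrite -(@psum_stable _ (Nf (fun n => a n + b n)) M); [|exact: NfP|by rewrite /M maxnA leq_maxr].
by rewrite /psum -big_split; apply: eq_bigr => i _ /=; rewrite mulZD.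
Qed.
End FreeModule.

(** * A discrete Stokes formula on grids *)

Ltac zmod_step := match goal with
  | |- - ?y + _ = 0 => first [rewrite (addKr y) | rewrite [_ + (y + _)]addrCA]
  | |- ?x + _ = 0 => first [rewrite (addNKr x) | rewrite [_ + (- x + _)]addrCA]
  end.

(** A normalizer for identities in abelian groups: after all terms are moved
    to one side, every term is cancelled against its opposite. *)
Ltac zmod := apply/eqP; rewrite -subr_eq0; apply/eqP;
  rewrite -[LHS]addr0 ?(opprD, opprK, oppr0, subr0, sub0r, addr0, add0r) -[LHS]addr0 -?addrA;
  repeat zmod_step; rewrite ?addr0; try reflexivity.

Section GridStokes.
Implicit Types (p q : nat * nat) (s : seq (nat * nat)).

Section Labels.
Variable B : zmodType.
Variables hp vp : nat -> nat -> B.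

(** [hp j i] and [vp i j] are to be thought of as primitives of a discrete
    one-form along the j-th horizontal and the i-th vertical line of a grid.
    The label of a step is its integral along the horizontal and then the
    vertical side from p to q; for axis-parallel steps one of the two is
    trivial. *)
Definition step_label p q : B := (hp p.2 q.1 - hp p.2 p.1) + (vp q.1 q.2 - vp q.1 p.2).
Fixpoint path_label p s : B := if s is q :: s' then step_label p q + path_label q s' else 0.

(** The integral around the unit square with lower left corner (l, m). *)
Definition curvature l m : B :=
  (hp m l.+1 - hp m l) + (vp l.+1 m.+1 - vp l.+1 m) - (hp m.+1 l.+1 - hp m.+1 l) - (vp l m.+1 - vp l m).
End Labels.

(** The signed crossings of a step with the ray going up from the inside of
    the square (l, m); their sum is the winding number of a closed path
    around it. *)
Definition step_winding p q (l m : nat) : int := ((m < p.2)%N : nat)%:Z * (((l < p.1)%N : nat)%:Z - ((l < q.1)%N : nat)%:Z).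
Fixpoint winding p s l m : int := if s is q :: s' then step_winding p q l m + winding q s' l m else 0.

Section Stokes.
Variable B : zmodType.
Variables hp vp : nat -> nat -> B.
Local Notation curv := (curvature hp vp).

Lemma curvature_sum i j : \sum_(0 <= l < i) \sum_(0 <= m < j) curv l m =
  hp 0%N i - hp 0%N 0%N - (hp j i - hp j 0%N) + (vp i j - vp i 0%N) - (vp 0%N j - vp 0%N 0%N).
Proof.
elim: i => [|i IH]; first by rewrite big_nil; zmod.
rewrite big_nat_recr //= IH.
have -> : \sum_(0 <= m < j) curv i m =
   (hp 0%N i.+1 - hp 0%N i) - (hp j i.+1 - hp j i) + (vp i.+1 j - vp i.+1 0%N) - (vp i j - vp i 0%N).
  elim: j {IH} => [|j IH]; first by rewrite big_nil; zmod.
  by rewrite big_nat_recr //= IH /curvature; zmod.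
by zmod.
Qed.

Lemma weighted_curvature N i j : (i <= N)%N -> (j <= N)%N ->
  \sum_(0 <= l < N) \sum_(0 <= m < N) curv l m *~ (((m < j)%N : nat)%:Z * ((l < i)%N : nat)%:Z) =
  \sum_(0 <= l < i) \sum_(0 <= m < j) curv l m.
Proof.
move=> iN jN; rewrite (big_cat_nat (leq0n i) iN) /= [X in _ + X]big_nat_cond [X in _ + X]big1 ?addr0; last first.
  move=> l /andP[/andP[il _] _]; apply: big1 => m _.
  by rewrite [(l < i)%N]ltnNge il mulr0 mulr0z.
apply: eq_big_nat => l /andP[_ li]; rewrite (big_cat_nat (leq0n j) jN) /= [X in _ + X]big_nat_cond [X in _ + X]big1 ?addr0; last first.
  by move=> m /andP[/andP[jm _] _]; rewrite ltnNge jm mul0r mulr0z.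
by apply: eq_big_nat => m /andP[_ mj]; rewrite mj li mulr1 mulr1z.
Qed.

(** Both sides are compared with the path from p to q which goes down to the
    bottom line, along it, and up again. *)
Lemma step_stokes N p q : (p.1 <= N)%N -> (p.2 <= N)%N -> (q.1 <= N)%N ->
  step_label hp vp p q =
  (hp 0%N q.1 + (vp q.1 q.2 - vp q.1 0%N)) - (hp 0%N p.1 + (vp p.1 p.2 - vp p.1 0%N)) +
  \sum_(0 <= l < N) \sum_(0 <= m < N) curv l m *~ step_winding p q l m.
Proof.
move=> p1 p2 q1.
have -> : \sum_(0 <= l < N) \sum_(0 <= m < N) curv l m *~ step_winding p q l m =
   \sum_(0 <= l < p.1) \sum_(0 <= m < p.2) curv l m - \sum_(0 <= l < q.1) \sum_(0 <= m < p.2) curv l m.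
  rewrite -(weighted_curvature p1 p2) -(weighted_curvature q1 p2) -sumrB.
  apply: eq_bigr => l _; rewrite -sumrB; apply: eq_bigr => m _.
  by rewrite -mulrzBr -mulrBr.
rewrite !curvature_sum /step_label; zmod.
Qed.

Theorem grid_stokes N p s : (p.1 <= N)%N -> (p.2 <= N)%N -> all (fun q => (q.1 <= N)%N && (q.2 <= N)%N) s ->
  last p s = p ->
  path_label hp vp p s = \sum_(0 <= l < N) \sum_(0 <= m < N) curv l m *~ winding p s l m.
Proof.
pose T q := hp 0%N q.1 + (vp q.1 q.2 - vp q.1 0%N).
suff main : forall p, (p.1 <= N)%N -> (p.2 <= N)%N -> all (fun q => (q.1 <= N)%N && (q.2 <= N)%N) s ->
    path_label hp vp p s = T (last p s) - T p + \sum_(0 <= l < N) \sum_(0 <= m < N) curv l m *~ winding p s l m.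
  by move=> p1 p2 ps lp; rewrite main // lp subrr add0r.
elim: s => [|q s IH] {}p p1 p2 /=.
  by rewrite subrr add0r big1 // => l _; rewrite big1 // => m _; rewrite mulr0z.
move=> /andP[/andP[q1 q2] qs]; rewrite IH // (@step_stokes N p q) // -/(T p) -/(T q).
have -> : \sum_(0 <= l < N) \sum_(0 <= m < N) curv l m *~ (step_winding p q l m + winding q s l m) =
  \sum_(0 <= l < N) \sum_(0 <= m < N) curv l m *~ step_winding p q l m +
  \sum_(0 <= l < N) \sum_(0 <= m < N) curv l m *~ winding q s l m.
  by rewrite -big_split; apply: eq_bigr => l _; rewrite -big_split; apply: eq_bigr => m _; rewrite mulrzDr.
by zmod.
Qed.
End Stokes.
End GridStokes.

(** * Continuous k-th roots in the plane *)

Section Roots.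
Variable R : realType.
Local Notation C := (R[i]^o).
Implicit Types (u v w z c : C).

Lemma hausdorffC : hausdorff_space C.
Proof. exact: norm_hausdorff. Qed.

Lemma pow_locally_injective (a : C) k : (0 < k)%N -> a != 0 ->
  exists2 d : R, 0 < d & forall u v, nC (u - a) < d -> nC (v - a) < d -> u ^+ k = v ^+ k -> u = v.
Proof.
case: k => // n _ a0.
have [d [e [s [d0 _ e0 inj _]]]] : exists d e s, [/\ 0 < d, d <= 1, 0 < e,
    (forall u v : C, disc a d u -> disc a d v -> u ^+ n.+1 = v ^+ n.+1 -> u = v) &
    forall w, nC (w - a ^+ n.+1) < e -> [/\ disc a d (s w), s w ^+ n.+1 = w & cdiff s w]].
  apply: (@local_inverse R (fun u => u ^+ n.+1) a 1 (n.+1%:R * a ^+ n)) => //.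
  - by move=> z _; apply: cdiffX; exact: cdiff_id.
  - exact: cderivX.
  - by rewrite mulf_neq0 ?pnatr_eq0 // expf_neq0.
by exists d => // u v; exact: inj.
Qed.

Definition root_on k (Psi f : C -> C) (V : set C) := forall u, V u -> ccont f u /\ f u ^+ k = Psi u.

Section RootLift.
Variables (k : nat) (Psi : C -> C) (D E : set C).
Hypothesis k0 : (0 < k)%N.
Hypothesis oD : open D.
Hypothesis dE : discreteC D E.
Hypothesis nz : forall z, D z -> ~ E z -> Psi z != 0.

Let rot : set (C -> C) := [set g | exists2 om : C, om ^+ k = 1 & g = (fun z => om * z)].
Let rot_cont g : rot g -> continuous g.
Proof.
move=> [om _ ->] z; have : ccont (fun z : C => om * z) z by apply: contM; [exact: contc|exact: conti].
by case.
Qed.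
Let rot_pow g : rot g -> forall x : C, g x ^+ k = x ^+ k.
Proof. by move=> [om omk ->] x; rewrite exprMn omk mul1r. Qed.
Let rot_trans (x x' : C) : x ^+ k = x' ^+ k -> exists2 g, rot g & g x = x'.
Proof.
move=> xx'; have [x0|x0] := eqVneq x 0.
  exists (fun z => 1 * z); first by exists 1; rewrite ?expr1n.
  have : x' ^+ k == 0 by rewrite -xx' x0 expr0n gtn_eqF.
  by rewrite expf_eq0 k0 /= => /eqP ->; rewrite mul1r.
exists (fun z => (x' / x) * z); last by rewrite divfK.
by exists (x' / x) => //; rewrite exprMn exprVn -xx' divff // expf_neq0.
Qed.
Let pow_linj z (x : C) : D z -> ~ E z -> x ^+ k = Psi z ->
  exists2 U : set C, nbhs x U & forall a b : C, U a -> U b -> a ^+ k = b ^+ k -> a = b.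
Proof.
move=> Dz Ez xz; have x0 : x != 0.
  by apply: contra (nz Dz Ez) => /eqP x0; rewrite -xz x0 expr0n gtn_eqF.
have [d d0 inj] := pow_locally_injective k0 x0.
by exists (disc x d); [apply/nbhsC; exists d|move=> a b; exact: inj].
Qed.
Let root_lift f V : root_on k Psi f V <-> lift_on (fun z : C => z ^+ k) Psi f V.
Proof. by split=> H u Vu; have [c e] := H u Vu; split=> //; case: c. Qed.

(** The monodromy theorem for v |-> v ^+ k, whose fibres are the orbits of
    the k-th roots of unity. The zeros of [Psi], where this map is not
    locally injective, are confined to the discrete set E. *)
Theorem root_exists z0 : starC z0 D ->
  (forall z, D z -> exists2 e : R, 0 < e & exists f, root_on k Psi f (disc z e)) ->
  exists f, root_on k Psi f D.
Proof.
move=> sD loc.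
have loc' z : D z -> exists2 e : R, 0 < e & exists f, lift_on (fun z : C => z ^+ k) Psi f (disc z e).
  by move=> /loc[e e0 [f /root_lift fP]]; exists e => //; exists f.
have [e e0 [f0 f0P]] := loc' z0 sD.1.
have [f [fP _]] := lift_star hausdorffC rot_cont rot_pow rot_trans dE pow_linj oD sD loc' e0 f0P.
by exists f; apply/root_lift.
Qed.
End RootLift.

Lemma root_near_cont k (Psi : C -> C) z : (0 < k)%N -> Psi z != 0 ->
  (exists2 e : R, 0 < e & forall u, disc z e u -> ccont Psi u) ->
  exists2 e : R, 0 < e & exists f, root_on k Psi f (disc z e).
Proof.
case: k => // n _ P0 [e e0 cP]; have [s [d [d0 sP]]] := root_near n P0.
have /ccontP/(_ d d0)[r r0 hr] := cP z (disc_center _ e0).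
exists (Num.min e r); first by rewrite lt_min e0.
exists (s \o Psi) => u; rewrite /disc /= lt_min => /andP[ue /hr /sP[sk ds]].
by split=> //; apply: cont_comp; [exact: cP|exact: cdiff_cont].
Qed.

(** The ratio f / g is a continuous function with values in the k-th roots of
    unity; [pow_locally_injective] makes this discreteness effective. *)
Lemma root_ratio k (f g : R -> C) : (0 < k)%N ->
  (forall t, 0 <= t <= 1 -> [/\ f t ^+ k = g t ^+ k, g t != 0 &
     forall e : R, 0 < e -> exists2 d : R, 0 < d & forall s, 0 <= s <= 1 -> `|s - t| < d ->
       nC (f s - f t) < e /\ nC (g s - g t) < e]) ->
  f 1 * g 0 = f 0 * g 1.
Proof.
move=> k0 H.
have [|_ g00 _] := H 0; first by rewrite lexx ler01.
apply: (@lc_interval R (fun t => f t * g 0 = f 0 * g t)) => // t t01.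
have [fg gt0 cont] := H t t01.
pose om := f t / g t.
have omk : om ^+ k = 1 by rewrite /om exprMn exprVn fg divff // expf_neq0.
have ft : f t = om * g t by rewrite /om divfK.
have om0 : om != 0 by apply/eqP => om0; have := @oner_neq0 R[i]; rewrite -omk om0 expr0n gtn_eqF // eqxx.
have ft0 : f t != 0 by rewrite ft mulf_neq0.
have nom : nC om = 1.
  by apply/eqP; have : nC om ^+ k == 1 by [rewrite -nCX omk nC1]; rewrite pexprn_eq1 ?nC_ge0 // gtn_eqF.
have [d d0 inj] := pow_locally_injective k0 ft0.
have [r r0 hr] := cont d d0; exists r => // s s01 st.
have [fs gs] := hr s s01 st; have [fgs gs0 _] := H s s01.
have fs' : f s = om * g s.
  apply: inj => //; last by rewrite exprMn omk mul1r.
  by rewrite ft -mulrBr nCM nom mul1r.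
rewrite fs' ft; split=> h.
  apply: (mulIf gs0); rewrite -[RHS]mulrA [g t * g s]mulrC mulrA -h; ring.
by apply: (mulIf gt0); rewrite -[RHS]mulrA [g s * g t]mulrC mulrA -h; ring.
Qed.

Lemma segment_cont (f : C -> C) (P Q : C) (t : R) : ccont f (P + t%:C * (Q - P)) ->
  forall e : R, 0 < e -> exists2 d : R, 0 < d & forall s, `|s - t| < d ->
    nC (f (P + s%:C * (Q - P)) - f (P + t%:C * (Q - P))) < e.
Proof.
move=> /ccontP cf e /cf[d d0 hd]; have h : 0 < nC (Q - P) + 1 by rewrite ltr_wpDl ?nC_ge0.
exists (d / (nC (Q - P) + 1)); first by rewrite divr_gt0.
move=> s st; apply: hd.
have -> : P + s%:C * (Q - P) - (P + t%:C * (Q - P)) = (s - t)%:C * (Q - P) by rewrite rmorphB /=; ring.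
rewrite nCM nCR; move: st; rewrite ltr_pdivlMr //; apply: le_lt_trans.
by rewrite ler_wpM2l // lerDl.
Qed.

Lemma segment_ratio k (f g Psi : C -> C) (P Q : C) (V : set C) : (0 < k)%N ->
  root_on k Psi f V -> root_on k Psi g V -> (forall z, V z -> Psi z != 0) ->
  (forall t : R, 0 <= t <= 1 -> V (P + t%:C * (Q - P))) ->
  f Q * g P = f P * g Q.
Proof.
move=> k0 fV gV nz seg.
have := @root_ratio k (fun t => f (P + t%:C * (Q - P))) (fun t => g (P + t%:C * (Q - P))) k0 _.
rewrite /= mul1r mul0r addr0 [P + _]addrC subrK; apply => t t01.
have Vt := seg t t01; have [cf ef] := fV _ Vt; have [cg eg] := gV _ Vt.
split; first by rewrite ef eg.
  by apply: contra (nz _ Vt) => /eqP g0; rewrite -eg g0 expr0n gtn_eqF.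
move=> e e0; have [d1 d10 h1] := segment_cont cf e0; have [d2 d20 h2] := segment_cont cg e0.
exists (Num.min d1 d2); first by rewrite lt_min d10.
by move=> s _; rewrite lt_min => /andP[/h1 ? /h2 ?].
Qed.

Section Slit.
Variables (k : nat) (c : C).
Hypothesis k0 : (0 < k)%N.

(** The half-turns above and below c multiply a root by exp (i pi / k) and by
    exp (- i pi / k); this is the ratio of the two. *)
Definition zetak : C := cexp (0 +i* (pi *+ 2 / k%:R)).
Lemma zetak_prim : k.-primitive_root (zetak : R[i]).
Proof.
have [zk zj] := @unity_root R k k0; rewrite -/zetak in zk zj.
apply/andP; split=> //; apply/forallP => i; rewrite unity_rootE; apply/eqP.
have [->|ne] := eqVneq i.+1 k; first by rewrite zk eqxx.
by apply/negbTE/zj; rewrite /= ltn_neqAle ne ltn_ord.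
Qed.

(** The closed ray going down from c is removed here, the one going up in
    [slit_down]. Both domains are star-shaped, and together they cover the
    plane punctured at c. *)
Definition slit_up : set C := [set w | complex.Re w = complex.Re c -> complex.Im c < complex.Im w].
Definition slit_down : set C := [set w | complex.Re w = complex.Re c -> complex.Im w < complex.Im c].

Let Psi (w : C) : C := w - c.
Let cPsi w : ccont Psi w.
Proof. by apply: contB; [exact: conti|exact: contc]. Qed.

Let ReD (a b : C) t : complex.Re (a + t%:C * (b - a)) = complex.Re a + t * (complex.Re b - complex.Re a).
Proof. by case: a b => ? ? [? ?] /=; ring. Qed.
Let ImD (a b : C) t : complex.Im (a + t%:C * (b - a)) = complex.Im a + t * (complex.Im b - complex.Im a).
Proof. by case: a b => ? ? [? ?] /=; ring. Qed.

(** One proof for both slit planes: s = 1 is the upper one, s = -1 the lower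
    one; the domain is star-shaped with respect to c + i s. *)
Lemma slit_root (s : R) : s ^+ 2 = 1 ->
  exists f, root_on k Psi f [set w | complex.Re w = complex.Re c -> 0 < s * (complex.Im w - complex.Im c)].
Proof.
move=> s2; set D : set C := [set w | _].
have s0 : s != 0 by rewrite -sqrf_eq0 s2 oner_neq0.
have s1 : `|s| = 1.
  by have /eqP := s2; rewrite sqrf_eq1 => /orP[] /eqP ->; rewrite ?normrN normr1.
have oD : open D.
  apply/openC => w Dw; have [e|ne] := eqVneq (complex.Re w) (complex.Re c).
    have h := Dw e; exists (s * (complex.Im w - complex.Im c)) => // u uw ue.
    have := le_lt_trans (Im_le_nC (u - w)) uw; rewrite ImB -[`|_|]mul1r -s1 -normrM ltr_norml => /andP[+ _].
    by rewrite mulrBr mulrBr mulrBr; lra.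
  exists `|complex.Re w - complex.Re c|; first by rewrite normr_gt0 subr_eq0.
  move=> u uw ue; have := le_lt_trans (Re_le_nC (u - w)) uw.
  by rewrite ReB ue distrC ltxx.
pose z0 : C := complex.Re c +i* (complex.Im c + s).
have sD : starC z0 D.
  split=> [_|b t Db /andP[t0 t1]] /=.
    by rewrite addrAC subrr add0r -expr2 s2.
  rewrite /D /= ReD ImD /= => eR.
  have [->|tn0] := eqVneq t 0; first by rewrite mul0r addr0 addrAC subrr add0r -expr2 s2.
  have eb : complex.Re b = complex.Re c.
    by apply/eqP; rewrite -subr_eq0 -(mulrI_eq0 _ (mulfI tn0)); apply/eqP; move: eR; lra.
  have h := Db eb.
  have -> : s * (complex.Im c + s + t * (complex.Im b - (complex.Im c + s)) - complex.Im c) =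
    (1 - t) * (s ^+ 2) + t * (s * (complex.Im b - complex.Im c)) by ring.
  have tp : 0 < t by rewrite lt_neqAle eq_sym tn0.
  by rewrite s2 mulr1; apply: ltr_wpDl; [rewrite subr_ge0|exact: mulr_gt0].
have nz z : D z -> Psi z != 0.
  move=> Dz; rewrite /Psi subr_eq0; apply/eqP => e; have := Dz; rewrite /D /= e => /(_ erefl).
  by rewrite subrr mulr0 ltxx.
apply: (@root_exists k Psi D set0 k0 oD _ _ z0 sD).
- by move=> z _; exists 1.
- by move=> z Dz _; exact: nz.
- move=> z /nz h; apply: root_near_cont => //.
  by exists 1 => // u _; exact: cPsi.
Qed.

(** The two roots are normalized to agree on the right of c. Following each
    of them along a half-circle around c gives their ratio on the left. *)
Lemma slit_roots : exists fu fd : C -> C, [/\ root_on k Psi fu slit_up, root_on k Psi fd slit_down,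
  (forall w, complex.Re c < complex.Re w -> fu w = fd w) &
  (forall w, complex.Re w < complex.Re c -> fu w = zetak * fd w)].
Proof.
have [|fu fuP] := @slit_root 1; first by rewrite expr1n.
have [|fd fdP] := @slit_root (-1); first by rewrite sqrrN expr1n.
have {}fuP : root_on k Psi fu slit_up.
  by move=> u uP; apply: fuP => /= /uP; rewrite mul1r subr_gt0.
have {}fdP : root_on k Psi fd slit_down.
  by move=> u uP; apply: fdP => /= /uP; rewrite mulN1r opprB subr_gt0.
have c1u (x : R) : x != 0 -> slit_up (c + x%:C) /\ slit_down (c + x%:C).
  move=> x0; have h : complex.Re (c + x%:C) <> complex.Re c.
    by case: (c) => a b /= /(canRL (addKr _)); rewrite addNr => /eqP; rewrite (negPf x0).
  by split.
have root_nz f V w x : root_on k Psi f V -> V w -> w = c + x%:C -> x != 0 -> f w != 0.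
  move=> fV Vw we x0; have [_ e] := fV w Vw; apply/eqP => f0.
  move: e; rewrite f0 expr0n gtn_eqF // /Psi we addrAC subrr add0r => /esym/eqP.
  by rewrite eq_complex /= (negPf x0).
have one0 : (1 : R) != 0 by exact: oner_neq0.
have m10 : (- 1 : R) != 0 by rewrite oppr_eq0.
have [u1 d1] := c1u 1 one0; have [um1 dm1] := c1u (-1) m10.
have fu1 := root_nz _ _ _ _ fuP u1 erefl one0.
have fd1 := root_nz _ _ _ _ fdP d1 erefl one0.
pose om := fu (c + 1%:C) / fd (c + 1%:C).
have omk : om ^+ k = 1 by rewrite /om exprMn exprVn (fuP _ u1).2 -(fdP _ d1).2 divff // expf_neq0.
pose gd w := om * fd w.
have gdP : root_on k Psi gd slit_down.
  move=> w /fdP[cw ew]; split; first by apply: contM => //; exact: contc.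
  by rewrite /gd exprMn omk mul1r.
have gd1 : gd (c + 1%:C) = fu (c + 1%:C) by rewrite /gd /om divfK.
exists fu, gd; split=> //.
- move=> w wc; have := @segment_ratio k fu gd Psi (c + 1%:C) w (slit_up `&` slit_down) k0 _ _ _ _.
  rewrite gd1 [fu (c + _) * gd w]mulrC => H; apply: (mulIf fu1); apply: H.
  + by move=> z [/fuP].
  + by move=> z [_ /gdP].
  + move=> z [zu zd]; rewrite /Psi subr_eq0; apply/eqP => e.
    by have := zu; rewrite /slit_up /= e ltxx => /(_ erefl).
  + move=> t /andP[t0 t1]; suff : complex.Re (c + 1%:C + t%:C * (w - (c + 1%:C))) <> complex.Re c by split.
    rewrite ReD; have -> : complex.Re (c + 1%:C) = complex.Re c + 1 by case: (c).
    move: wc; have [->|tn] := eqVneq t 0; first by lra.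
    have tp : 0 < t by rewrite lt_neqAle eq_sym tn.
    move=> wc; have : 0 < t * (complex.Re w - complex.Re c) by rewrite mulr_gt0 // subr_gt0.
    by nra.
(* continuation along the half-circle of radius 1, above c for s = 1 and
   below c for s = -1 *)
have half (s : R) f V : root_on k Psi f V -> s ^+ 2 = 1 -> 
    (forall t : R, 0 <= t <= 1 -> V (c + cexp (0 +i* (s * (pi * t))))) ->
    f (c + (-1)%:C) = f (c + 1%:C) * cexp (0 +i* (s * (pi / k%:R))).
  move=> fV s2 inV.
  have kR : (k%:R : R) != 0 by rewrite pnatr_eq0 -lt0n.
  have cexpX (x : R) : cexp (0 +i* (x / k%:R)) ^+ k = cexp (0 +i* x).
    have pw j (y : R) : cexp (0 +i* y) ^+ j = cexp (0 +i* (y *+ j)).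
      elim: j => [|j IH]; first by rewrite expr0 mulr0n cexp0.
      by rewrite exprS IH -cexpD mulrS; congr cexp; apply: complex_eq; rewrite /= ?addr0.
    by rewrite pw; congr cexp; apply: complex_eq => //=; rewrite -[LHS]mulr_natr divfK.
  have := @root_ratio k (fun t => f (c + cexp (0 +i* (s * (pi * t))))) (fun t => cexp (0 +i* (s * (pi * t) / k%:R))) k0 _.
  have e1 : cexp (0 +i* (s * pi)) = (- 1)%:C.
    have : s = 1 \/ s = -1 by move/eqP: s2; rewrite sqrf_eq1 => /orP[] /eqP; [left|right].
    rewrite /cexp /= expR0 !mul1r => -[->|->].
      by rewrite mul1r cospi sinpi.
    by rewrite mulN1r cosN sinN cospi sinpi oppr0.
  rewrite /= !mulr1 !mulr0 mul0r cexp0 mulr1 e1 mulrA; apply => t t01.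
  have [cf ef] := fV _ (inV t t01).
  split; [|exact: cexp_neq0|].
    by rewrite ef cexpX /Psi addrAC subrr add0r.
  move=> e e0.
  have lin (y a : R) : {for y, continuous (fun t : R => (0 +i* (a * t) : C))}.
    apply: (@cvg_Complex R R (nbhs y) _ (fun=> 0) (fun t => a * t)); first exact: cvg_cst.
    by apply: (@cvgM R) => //; exact: cvg_cst.
  have key (g : C -> C) (a : R) : ccont g (0 +i* (a * t)) -> exists2 d : R, 0 < d &
      forall s', `|s' - t| < d -> nC (g (0 +i* (a * s')) - g (0 +i* (a * t))) < e.
    move=> /ccontP/(_ e e0)[d d0 hd]; exists (d / (`|a| + 1)).
      by rewrite divr_gt0 // ltr_wpDl.
    move=> s' st; apply: hd.
    have -> : (0 +i* (a * s')) - (0 +i* (a * t)) = 0 +i* (a * (s' - t)) :> R[i] by apply: complex_eq => /=; ring.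
    rewrite /nC /= expr0n add0r sqrtr_sqr normrM.
    move: st; rewrite ltr_pdivlMr ?ltr_wpDl //; apply: le_lt_trans.
    by rewrite mulrC ler_wpM2l // lerDl.
  have cf' : ccont (fun z => f (c + cexp z)) (0 +i* (s * pi * t)).
    apply: (@cont_comp R (fun z => c + cexp z) f); last by rewrite -mulrA.
    by apply: contD; [exact: contc|exact: cont_cexp].
  have [d' d'0 h1] := key _ _ cf'.
  have [d2 d20 h2] := key _ (s * pi / k%:R) (cont_cexp _).
  exists (Num.min d' d2); first by rewrite lt_min d'0.
  move=> s' _; rewrite lt_min => /andP[/h1 ? /h2].
  have ee (y : R) : s * (pi * y) / k%:R = s * pi / k%:R * y by ring.
  by rewrite !ee !mulrA.
have hu : fu (c + (-1)%:C) = fu (c + 1%:C) * cexp (0 +i* (1 * (pi / k%:R))).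
  apply: half fuP _ _ => [|t /andP[t0 t1]]; first by rewrite expr1n.
  rewrite /slit_up /= mul1r; case: (c) => a b; rewrite /cexp /= expR0 !mul1r => /(canRL (addKr _)); rewrite addNr => ct.
  rewrite ltrDl; have pt : 0 <= pi * t <= pi by rewrite mulr_ge0 ?pi_ge0 //= -[leRHS]mulr1 ler_wpM2l ?pi_ge0.
  rewrite lt_neqAle sin_ge0_pi // andbT eq_sym; apply/eqP => st.
  by have := cos2Dsin2 (pi * t); rewrite ct st expr0n addr0 => /esym/eqP; rewrite oner_eq0.
have hd : gd (c + (-1)%:C) = gd (c + 1%:C) * cexp (0 +i* ((-1) * (pi / k%:R))).
  apply: half gdP _ _ => [|t /andP[t0 t1]]; first by rewrite sqrrN expr1n.
  rewrite /slit_down /= mulN1r; case: (c) => a b; rewrite /cexp /= expR0 !mul1r cosN sinN => /(canRL (addKr _)); rewrite addNr => ct.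
  rewrite -subr_gt0 opprD opprK addNKr; have pt : 0 <= pi * t <= pi by rewrite mulr_ge0 ?pi_ge0 //= -[leRHS]mulr1 ler_wpM2l ?pi_ge0.
  rewrite lt_neqAle sin_ge0_pi // andbT eq_sym; apply/eqP => st.
  by have := cos2Dsin2 (pi * t); rewrite ct st expr0n addr0 => /esym/eqP; rewrite oner_eq0.
have gdm : fu (c + (-1)%:C) = zetak * gd (c + (-1)%:C).
  rewrite hu hd gd1 mulrCA [zetak * _]mulrC -mulrA /zetak -cexpD; congr (_ * cexp _).
  by apply: complex_eq; rewrite /= ?addr0 // mulr2n; field; rewrite pnatr_eq0 -lt0n.
have gdm0 := root_nz _ _ _ _ gdP dm1 erefl m10.
move=> w wc; have := @segment_ratio k fu gd Psi (c + (-1)%:C) w (slit_up `&` slit_down) k0 _ _ _ _.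
rewrite gdm mulrAC => H; apply: (mulIf gdm0); rewrite H //.
- by move=> z [/fuP].
- by move=> z [_ /gdP].
- move=> z [zu zd]; rewrite /Psi subr_eq0; apply/eqP => e.
  by have := zu; rewrite /slit_up /= e ltxx => /(_ erefl).
- move=> t /andP[t0 t1]; suff : complex.Re (c + (-1)%:C + t%:C * (w - (c + (-1)%:C))) <> complex.Re c by split.
  rewrite ReD; have -> : complex.Re (c + (-1)%:C) = complex.Re c - 1 by case: (c).
  move: wc; have [->|tn] := eqVneq t 0; first by lra.
  have tp : 0 < t by rewrite lt_neqAle eq_sym tn.
  move=> wc; have : 0 < t * (complex.Re c - complex.Re w) by rewrite mulr_gt0 // subr_gt0.
  by nra.
Qed.

(** The change of a root r of w - c along an axis-parallel step, measured
    against the root on the upper or on the lower slit plane according to the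
    side of c on which the ends lie ([mu], [mu']). A step across the
    horizontal line through c on the left of c ([L]) picks up the factor
    [zetak], other steps do not. The weak inequalities leave the choice free
    when an end lies on a line through c. *)
Lemma slit_crossing fu fd (r : C -> C) (D : set C) (P Q : C) (L mu mu' : bool) :
  root_on k Psi fu slit_up -> root_on k Psi fd slit_down ->
  (forall w, complex.Re c < complex.Re w -> fu w = fd w) ->
  (forall w, complex.Re w < complex.Re c -> fu w = zetak * fd w) ->
  convexC D -> ~ D c -> root_on k Psi r D -> D P -> D Q ->
  (if L then complex.Re P <= complex.Re c else complex.Re c <= complex.Re P) ->
  (if mu then complex.Im c <= complex.Im P else complex.Im P <= complex.Im c) ->
  (if mu' then complex.Im c <= complex.Im Q else complex.Im Q <= complex.Im c) ->
  complex.Re P = complex.Re Q \/ (complex.Im P = complex.Im Q /\ mu = mu') ->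
  r P * (if mu' then fu Q else fd Q) * zetak ^+ (L * mu) =
  r Q * (if mu then fu P else fd P) * zetak ^+ (L * mu').
Proof.
move=> fuP fdP right left cD Dc rD DP DQ hL hmu hmu' axis.
have nzD z : D z -> Psi z != 0.
  by move=> Dz; rewrite /Psi subr_eq0; apply/eqP => e; apply: Dc; rewrite -e.
have onseg (t : R) : 0 <= t <= 1 -> D (P + t%:C * (Q - P)) by move=> t01; apply: (cD P DP).2.
have along f V : root_on k Psi f V -> (forall t : R, 0 <= t <= 1 -> V (P + t%:C * (Q - P))) ->
    r P * f Q = r Q * f P.
  move=> fV inV; have := @segment_ratio k r f Psi P Q (V `&` D) k0 _ _ _ _ => ->//.
  - by move=> z [_ /rD].
  - by move=> z [/fV].
  - by move=> z [_ /nzD].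
  - by move=> t t01; split; [exact: inV|exact: onseg].
have notc (t : R) : 0 <= t <= 1 -> complex.Re (P + t%:C * (Q - P)) = complex.Re c ->
    complex.Im (P + t%:C * (Q - P)) <> complex.Im c.
  by move=> t01 h1 h2; apply: Dc; rewrite -(complex_eq h1 h2); exact: onseg.
have [emu|nmu] := eqVneq mu mu'.
  subst mu'; congr (_ * _); case: mu hmu hmu' axis => hP hQ axis.
    apply: along fuP _ => t t01 /notc -/(_ t01)/eqP.
    case/andP: t01 => t0 t1; rewrite ImD => ne; rewrite lt_neqAle eq_sym ne /=.
    by have : 0 <= t * (complex.Im Q - complex.Im c) + (1 - t) * (complex.Im P - complex.Im c);
      [rewrite addr_ge0 // mulr_ge0 // subr_ge0|lra].
  apply: along fdP _ => t t01 /notc -/(_ t01)/eqP.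
  case/andP: t01 => t0 t1; rewrite ImD => ne; rewrite lt_neqAle ne /=.
  by have : 0 <= t * (complex.Im c - complex.Im Q) + (1 - t) * (complex.Im c - complex.Im P);
    [rewrite addr_ge0 // mulr_ge0 // subr_ge0|lra].
(* the remaining steps are vertical, with their ends on different sides of
   the horizontal line through c *)
have {axis} eRe : complex.Re P = complex.Re Q by case: axis => [|[_ e]] //; rewrite e eqxx in nmu.
have Rec (t : R) : complex.Re (P + t%:C * (Q - P)) = complex.Re P by rewrite ReD eRe; ring.
(* on the vertical line through c such a step would pass through c *)
have PcRe : complex.Re P != complex.Re c.
  apply/eqP => ePc; have PQ : complex.Im P != complex.Im Q.
    apply/eqP => e; have : 0 <= (0 : R) <= 1 by rewrite lexx ler01.
    move=> /notc; rewrite Rec ImD -e subrr mulr0 addr0 => /(_ ePc); apply.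
    by apply/eqP; rewrite eq_le; case: mu mu' hmu hmu' nmu => -[] //; rewrite -e => -> ->.
  pose t := (complex.Im c - complex.Im P) / (complex.Im Q - complex.Im P).
  have dn : complex.Im Q - complex.Im P != 0 by rewrite subr_eq0 eq_sym.
  suff /notc : 0 <= t <= 1 by rewrite Rec ImD /t divfK // => /(_ ePc); apply; ring.
  case: mu mu' hmu hmu' nmu => -[] // hP hQ _.
    have dp : 0 < complex.Im P - complex.Im Q by rewrite subr_gt0 lt_neqAle (le_trans hQ) // andbT -subr_eq0.
    have -> : t = (complex.Im P - complex.Im c) / (complex.Im P - complex.Im Q).
      by rewrite /t -[complex.Im P - complex.Im c]opprB -[complex.Im P - _]opprB invrN mulrNN.
    by apply/andP; split; [apply: divr_ge0; [rewrite subr_ge0|exact: ltW]|rewrite ler_pdivrMr // mul1r lerD2l lerN2].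
  have dp : 0 < complex.Im Q - complex.Im P by rewrite subr_gt0 lt_neqAle (le_trans hP) // andbT eq_sym -subr_eq0.
  by apply/andP; split; [apply: divr_ge0; [rewrite subr_ge0|exact: ltW]|rewrite ler_pdivrMr // mul1r lerD2r].
have key : r P * fd Q = r Q * fd P.
  by apply: along fdP _ => t _ e; move: PcRe; rewrite -e Rec eqxx.
have fuE w : complex.Re w = complex.Re P -> fu w = zetak ^+ L * fd w.
  move=> ew; case: L hL => hL.
    by rewrite expr1 left // ew lt_neqAle PcRe.
  by rewrite expr0 mul1r right // ew lt_neqAle eq_sym PcRe.
have fuP' := fuE P erefl; have fuQ := fuE Q (esym eRe).
case: mu mu' nmu {hmu hmu'} => -[] // _; rewrite ?muln1 ?muln0 expr0 mulr1.
  rewrite fuP' key; move: (zetak ^+ L) => z; ring.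
rewrite fuQ mulrCA key; move: (zetak ^+ L) => z; ring.
Qed.
End Slit.
End Roots.

(** * Abelian quotients of groups uniformizing planar orbifolds *)

Section Grid.
Variable R : realType.
Local Notation C := (R[i]^o).

(** The given numbers are sorted, and continued arbitrarily to an infinite
    increasing sequence so that grid lines may be indexed by [nat]. *)
Lemma grid_coordinates (xs : seq R) : exists (Px : nat -> R) (N : nat),
  {homo Px : i j / (i < j)%N >-> i < j} /\ forall x, x \in xs -> exists2 i, (i <= N)%N & Px i = x.
Proof.
pose s := sort <=%R (undup xs).
have us : uniq s by rewrite sort_uniq undup_uniq.
have ss : sorted <%R s by rewrite lt_sorted_uniq_le us /=; apply: sort_sorted; exact: le_total.
exists (fun i => if (i < size s)%N then nth 0 s i else last 0 s + (i - size s).+1%:R), (size s); split.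
  apply: homo_ltn => [y x z|i]; first exact: lt_trans.
  have [si|] := ltnP i.+1 (size s).
    by rewrite (ltnW si); apply: (@sorted_ltn_nth _ _ lt_trans 0 s ss); rewrite ?inE //; exact: ltnW.
  rewrite leq_eqVlt => /orP[/eqP e|si].
    by rewrite -nth_last e ltnSn /= subnn ltrDl.
  by rewrite ltnNge -ltnS si /= ltrD2l ltr_nat subSn.
move=> x; rewrite -mem_undup -(mem_sort <=%R) -/s => xin.
exists (index x s); first by rewrite ltnW // index_mem.
by rewrite index_mem xin nth_index.
Qed.

Definition rect (a b c d : R) : set C :=
  [set w | a < complex.Re w < b /\ c < complex.Im w < d].

Lemma rect_open a b c d : open (rect a b c d).
Proof.
apply/openC => w [/andP[wa wb] /andP[wc wd]].
exists (Num.min (Num.min (complex.Re w - a) (b - complex.Re w)) (Num.min (complex.Im w - c) (d - complex.Im w))).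
  by rewrite !lt_min !subr_gt0 wa wb wc wd.
move=> u; rewrite !lt_min => /andP[/andP[h1 h2] /andP[h3 h4]].
have := Re_le_nC (u - w); have := Im_le_nC (u - w); rewrite ReB ImB !ler_norml => /andP[] ? ? /andP[] ? ?.
by split; lra.
Qed.

Lemma rect_convex a b c d : convexC (rect a b c d).
Proof.
move=> w [/andP[wa wb] /andP[wc wd]]; split=> [|u t [/andP[ua ub] /andP[uc ud]] /andP[t0 t1]].
  by split; apply/andP.
have mix (l x y : R) : l < x -> l < y -> l < x + t * (y - x).
  move=> lx ly; have [->|tn] := eqVneq t 0; first by rewrite mul0r addr0.
  have tp : 0 < t by rewrite lt_neqAle eq_sym tn.
  have : 0 < t * (y - l) by rewrite mulr_gt0 // subr_gt0.
  have : 0 <= (1 - t) * (x - l) by rewrite mulr_ge0 // subr_ge0 // ltW.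
  lra.
have mix' (l x y : R) : x < l -> y < l -> x + t * (y - x) < l.
  by move=> xl yl; have := @mix (- l) (- x) (- y); rewrite !ltrN2 => /(_ xl yl); lra.
have eR : complex.Re (w + t%:C * (u - w)) = complex.Re w + t * (complex.Re u - complex.Re w).
  by case: w u {wa wb wc wd ua ub uc ud} => ? ? [? ?] /=; ring.
have eI : complex.Im (w + t%:C * (u - w)) = complex.Im w + t * (complex.Im u - complex.Im w).
  by case: w u {wa wb wc wd ua ub uc ud eR} => ? ? [? ?] /=; ring.
by split; rewrite ?eR ?eI mix // mix'.
Qed.

(** Compactness of a closed rectangle, in the form of [bisection]. *)
Lemma rect_nbhd (U : set C) (a b c d : R) : open U -> a <= b -> c <= d ->
  (forall w, a <= complex.Re w <= b -> c <= complex.Im w <= d -> U w) ->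
  exists2 e : R, 0 < e & rect (a - e) (b + e) (c - e) (d + e) `<=` U.
Proof.
move=> /openC oU ab cd.
apply: (@bisection R (fun a b c d => (forall w, a <= complex.Re w <= b -> c <= complex.Im w <= d -> U w) ->
  exists2 e : R, 0 < e & rect (a - e) (b + e) (c - e) (d + e) `<=` U)) => //.
  move=> {ab cd}a {}b {}c {}d ab cd H1 H2 H3 H4 H.
  have [|e1 e10 h1] := H1; first by move=> w /andP[? ?] /andP[? ?]; apply: H; lra.
  have [|e2 e20 h2] := H2; first by move=> w /andP[? ?] /andP[? ?]; apply: H; lra.
  have [|e3 e30 h3] := H3; first by move=> w /andP[? ?] /andP[? ?]; apply: H; lra.
  have [|e4 e40 h4] := H4; first by move=> w /andP[? ?] /andP[? ?]; apply: H; lra.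
  pose e := Num.min (Num.min e1 e2) (Num.min e3 e4).
  have [l1 l2 l3 l4] : [/\ e <= e1, e <= e2, e <= e3 & e <= e4].
    by split; rewrite /e !ge_min lexx ?orbT.
  have e0 : 0 < e by rewrite /e !lt_min e10 e20 e30 e40.
  exists e => // w [/andP[w1 w2] /andP[w3 w4]].
  have [wx|wx] := leP (complex.Re w) ((a + b) / 2); have [wy|wy] := leP (complex.Im w) ((c + d) / 2).
  - by apply: h1; split; lra.
  - by apply: h3; split; lra.
  - by apply: h2; split; lra.
  - by apply: h4; split; lra.
move=> x y xab ycd.
have [Uxy|nU] := pselect (U (x +i* y)); last first.
  by exists 1 => // a' b' c' d' h1 h2 _ _ H; exfalso; apply: nU; apply: H.
have [r r0 hr] := oU _ Uxy; exists (r / 4) => [|a' b' c' d' /andP[? ?] /andP[? ?] ? ? _]; first by rewrite divr_gt0.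
exists (r / 4) => [|w [/andP[? ?] /andP[? ?]]]; first by rewrite divr_gt0.
apply: hr; apply: le_lt_trans (nC_ReIm _) _; rewrite ReB ImB /=.
have : `|complex.Re w - x| < r / 2 by rewrite ltr_norml; lra.
have : `|complex.Im w - y| < r / 2 by rewrite ltr_norml; lra.
lra.
Qed.
End Grid.

Section Planar.
Variables (R : realType) (X : topologicalType) (Gam : groupClosed (selfbij X)).
Local Notation C := (R[i]^o).
Variables (W : X -> C) (U : set C) (k : nat).
Hypothesis k1 : (1 < k)%N.
Hypothesis hX : hausdorff_space X.
Hypothesis Gcont : forall g, g \in Gam -> continuous g.
Hypothesis GW : forall g, g \in Gam -> forall x, W (g x) = W x.
Hypothesis Gtrans : forall x x', W x = W x' -> exists2 g, g \in Gam & g x = x'.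
Hypothesis oU : open U.
Hypothesis Wcont : continuous W.
Hypothesis free : forall x g, U (W x) -> g \in Gam -> g x = x -> g = 1%g.
Hypothesis linj : forall x, U (W x) -> exists2 V, nbhs x V & forall a b, V a -> V b -> W a = W b -> a = b.
Hypothesis lsec : forall x, U (W x) -> exists2 e : R, 0 < e & exists2 s : C -> X,
  lift_on W id s (disc (W x) e) & s (W x) = x.
Hypothesis onto : forall w, U w -> exists x, W x = w.
Hypothesis conn : forall Q : X -> Prop,
  (forall x, U (W x) -> exists2 V, nbhs x V & forall y, V y -> U (W y) -> (Q y <-> Q x)) ->
  forall x y, U (W x) -> U (W y) -> Q x -> Q y.
Hypothesis roots : forall c, ~ U c -> exists2 G : X -> C, continuous G & forall x, G x ^+ k = W x - c.

Let k0 : (0 < k)%N. Proof. exact: ltnW. Qed.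
Let Gs : set (X -> X) := [set f | exists2 g : selfbij X, g \in Gam & f = bij_fun g].
Let Gs_cont f : Gs f -> continuous f. Proof. by move=> [g /Gcont gc ->]. Qed.
Let Gs_W f : Gs f -> forall x, W (f x) = W x. Proof. by move=> [g /GW gW ->]. Qed.
Let Gs_trans x x' : W x = W x' -> exists2 f, Gs f & f x = x'.
Proof. by move=> /Gtrans[g gG e]; exists g => //; exists g. Qed.
Let dU : discreteC U (set0 : set C). Proof. by move=> z _; exists 1. Qed.
Let linjU z x : U z -> ~ (set0 : set C) z -> W x = id z ->
  exists2 V, nbhs x V & forall a b, V a -> V b -> W a = W b -> a = b.
Proof. by move=> Uz _ e; apply: linj; rewrite e. Qed.

Lemma lift_disc w : U w -> exists2 e : R, 0 < e & exists f, lift_on W id f (disc w e).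
Proof.
by move=> Uw; have [x e] := onto Uw; move: Uw; rewrite -e => /lsec[d d0 [s sl _]]; exists d => //; exists s.
Qed.

(** Sections of W over a convex set of regular values: the case of
    [lift_star] in which the map to be lifted is the identity. *)
Lemma section_exists (D : set C) w : open D -> convexC D -> D `<=` U -> D w -> exists s, lift_on W id s D.
Proof.
move=> oD cD DU Dw.
have [e e0 [f fl]] := lift_disc (DU _ Dw).
have dD : discreteC D (set0 : set C) by move=> z _; exists 1.
have linjD z x : D z -> ~ (set0 : set C) z -> W x = id z ->
    exists2 V, nbhs x V & forall a b, V a -> V b -> W a = W b -> a = b.
  by move=> /DU; exact: linjU.
have [s [sl _]] := lift_star hX Gs_cont Gs_W Gs_trans dD linjD oD (cD w Dw) (fun z Dz => lift_disc (DU z Dz)) e0 fl.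
by exists s.
Qed.

(** Two points related by a step lie on one section over a convex domain,
    above the ends of an axis-parallel segment. *)
Definition axis_step (x y : X) : bool := `[< exists D s, [/\ open D /\ convexC D, D `<=` U, lift_on W id s D,
  [/\ D (W x), D (W y), s (W x) = x & s (W y) = y] &
  complex.Re (W x) = complex.Re (W y) \/ complex.Im (W x) = complex.Im (W y)] >].

Lemma axis_step_sym x y : axis_step x y -> axis_step y x.
Proof.
move=> /asboolP[D [s [oD DU sl [Dx Dy sx sy] h]]]; apply/asboolP; exists D, s; split=> //.
by case: h => ->; [left|right].
Qed.

(** Reachability by axis-parallel steps is locally constant: in a small disc
    two steps suffice. *)
Lemma axis_connected x0 y : U (W x0) -> U (W y) -> exists2 s, path axis_step x0 s & last x0 s = y.
Proof.
move=> Ux0 Uy; pose Q y := exists2 s, path axis_step x0 s & last x0 s = y.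
have ext x z : axis_step x z -> Q x -> Q z.
  by move=> st [s ps ls]; exists (rcons s z); [rewrite rcons_path ps ls|rewrite last_rcons].
apply: (conn (Q := Q)) Ux0 Uy _ => [x Ux|]; last by exists [::].
have [N nN Ninj] := linj Ux; have [e e0 [s sl sx]] := lsec Ux.
have cs := (sl _ (disc_center _ e0)).1.
have /nbhsC[r r0 hr] : nbhs (W x) (s @^-1` N) by apply: cs; rewrite sx.
have /openC/(_ _ Ux)[u u0 hu] := oU.
pose d := Num.min e (Num.min r u).
have d0 : 0 < d by rewrite !lt_min e0 r0.
have [de dr du] : [/\ d <= e, d <= r & d <= u] by split; rewrite /d !ge_min lexx ?orbT.
have sub : disc (W x) d `<=` disc (W x) e by move=> w wd; exact: lt_le_trans de.
have dU' : disc (W x) d `<=` U by move=> w wd; apply: hu; exact: lt_le_trans du.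
exists (N `&` W @^-1` (disc (W x) d)) => [|y' [Ny wy] _].
  by apply: filterI => //; apply: Wcont; apply/nbhsC; exists d.
have sy : s (W y') = y'.
  apply: Ninj => //; last by rewrite (sl _ (sub _ wy)).2.
  by apply: hr; exact: lt_le_trans dr.
pose q : C := complex.Re (W y') +i* complex.Im (W x).
have dq : disc (W x) d q.
  apply: le_lt_trans wy; rewrite /disc /= /nC ler_sqrt ?addr_ge0 ?sqr_ge0 // !ReB !ImB /=.
  by rewrite subrr expr0n addr0 lerDl sqr_ge0.
have Wq : W (s q) = q by rewrite (sl _ (sub _ dq)).2.
have st1 : axis_step x (s q).
  apply/asboolP; exists (disc (W x) d), s; split.
  - by split; [exact: open_disc|exact: convex_disc].
  - exact: dU'.
  - by apply: lift_onS sl.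
  - by rewrite Wq; split=> //; exact: disc_center.
  - by rewrite Wq; right.
have st2 : axis_step (s q) y'.
  apply/asboolP; exists (disc (W x) d), s; split.
  - by split; [exact: open_disc|exact: convex_disc].
  - exact: dU'.
  - by apply: lift_onS sl.
  - by rewrite Wq; split.
  - by rewrite Wq; left.
by split=> h; [exact: (ext _ _ (axis_step_sym st1) (ext _ _ (axis_step_sym st2) h))|exact: (ext _ _ st2 (ext _ _ st1 h))].
Qed.

Section Character.
Variables (c : C) (G : X -> C).
Hypothesis Uc : ~ U c.
Hypothesis Gc : continuous G.
Hypothesis GX : forall x, G x ^+ k = W x - c.
Local Notation zeta := (zetak R k).

Lemma root_neq0 x : U (W x) -> G x != 0.
Proof.
move=> Ux; apply/eqP => G0; have := GX x; rewrite G0 expr0n gtn_eqF // => /esym/eqP.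
by rewrite subr_eq0 => /eqP e; apply: Uc; rewrite -e.
Qed.

(** G o g and G are roots of the same function, and their ratio is locally
    constant. *)
Lemma root_character g x0 : g \in Gam -> U (W x0) -> exists n, forall x, U (W x) -> G (g x) = zeta ^+ n * G x.
Proof.
move=> gG Ux0; have eX x : G (g x) ^+ k = G x ^+ k by rewrite !GX GW.
have omk : (G (g x0) / G x0) ^+ k = 1.
  by rewrite exprMn exprVn eX divff // expf_neq0 // root_neq0.
have /(prim_rootP (zetak_prim R k0))[i iP] : (G (g x0) / G x0) ^+ k = 1 := omk.
exists i => x Ux; apply: (@conn (fun x => G (g x) = zeta ^+ i * G x) _ x0 x Ux0 Ux); last first.
  by rewrite -iP divfK // root_neq0.
move=> {Ux}x Ux; have Ugx : U (W (g x)) by rewrite GW.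
have [d d0 inj] := pow_locally_injective k0 (root_neq0 Ugx).
have zk : (zeta ^+ i) ^+ k = 1 by rewrite exprAC (prim_expr_order (zetak_prim R k0)) expr1n.
have loc j : G (g x) = zeta ^+ j * G x -> exists2 V, nbhs x V & forall y, V y -> G (g y) = zeta ^+ j * G y.
  move=> e.
  have zj : (zeta ^+ j) ^+ k = 1 by rewrite exprAC (prim_expr_order (zetak_prim R k0)) expr1n.
  have nz : nC (zeta ^+ j) = 1.
    by have /eqP := congr1 (fun u : C => nC u) zj; rewrite nCX nC1 pexprn_eq1 ?nC_ge0 // gtn_eqF //= => /eqP.
  exists ((G \o g) @^-1` (disc (G (g x)) d) `&` G @^-1` (disc (G x) d)).
    have cg : continuous_at x g by exact: (Gcont gG).
    apply: filterI; first by apply: (cg (G @^-1` (disc (G (g x)) d))); apply: Gc; apply/nbhsC; exists d.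
    by apply: Gc; apply/nbhsC; exists d.
  move=> y [y1 y2]; apply: inj => //; last by rewrite eX exprMn zj mul1r.
  by rewrite e -mulrBr nCM nz mul1r.
have /(prim_rootP (zetak_prim R k0))[j jP] : (G (g x) / G x) ^+ k = 1.
  by rewrite exprMn exprVn eX divff // expf_neq0 // root_neq0.
have ej : G (g x) = zeta ^+ j * G x by rewrite -jP divfK // root_neq0.
have [V nV VP] := loc j ej; exists V => // y Vy Uy.
rewrite ej (VP y Vy); split=> /(mulIf (root_neq0 _)) -> //.
Qed.
End Character.

Section Labels.
Variables (A : zmodType) (theta : selfbij X -> A) (x0 : X).
Hypothesis thM : forall g h, g \in Gam -> h \in Gam -> theta (g * h)%g = theta g + theta h.

Let th1 : theta 1%g = 0.
Proof.
have G1 : 1%g \in Gam by exact: gpred1.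
have := thM G1 G1; rewrite mulg1 => e.
by rewrite -[LHS](addrK (theta 1%g)) -{1}e subrr.
Qed.
Let thV g : g \in Gam -> theta g^-1%g = - theta g.
Proof.
move=> gG; have gV : g^-1%g \in Gam by rewrite gpredV.
have := thM gV gG; rewrite mulVg th1 => e.
by rewrite -[LHS](addrK (theta g)) -e sub0r.
Qed.

(** An arbitrary base point in each fibre; [x0] is a default value outside
    the image of W. *)
Definition sel (w : C) : X := xget x0 [set x | W x = w].
Lemma selP w : U w -> W (sel w) = w.
Proof. by move=> /onto[x e]; exact: (@xgetI _ x0 [set x | W x = w] x e). Qed.

(** The label of a pair (P, Q) is the image under [theta] of the element by
    which a section through the base point over P differs from the base point
    over Q. Labels form a discrete one-form with values in the abelian group
    A, closed over convex domains ([labelD]). *)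
Definition is_label (P Q : C) (t : A) := exists g D s,
  [/\ g \in Gam, open D, convexC D & D `<=` U] /\
  [/\ lift_on W id s D, D P, D Q, s P = sel P & s Q = g (sel Q) /\ t = theta g].
Definition label (P Q : C) : A := xget 0 (is_label P Q).

Lemma is_label_uniq P Q t t' : is_label P Q t -> is_label P Q t' -> t = t'.
Proof.
move=> [g [D [s [[gG oD cD DU] [sl DP DQ sP [sQ ->]]]]]].
move=> [g' [D' [s' [[gG' oD' cD' DU'] [sl' DP' DQ' sP' [sQ' ->]]]]]].
have e : s Q = s' Q.
  apply: (lift_eq (V := D `&` D') hX dU linjU _ _ _ _ _ _ _ (u := P)) => //.
  - exact: openI.
  - exact: convexI.
  - by move=> z [/DU].
  - by apply: lift_onS sl => z [].
  - by apply: lift_onS sl' => z [].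
  - by rewrite sP sP'.
have UQ := DU _ DQ; congr theta.
have : (g^-1 * g')%g = 1%g.
  apply: (@free (sel Q)); first by rewrite selP.
    by apply: gpredM => //; rewrite gpredV.
  by change (bij_inv g (g' (sel Q)) = sel Q); rewrite -sQ' -e sQ bij_funK.
by move/(congr1 (fun h => g * h)%g); rewrite mulVKg mulg1.
Qed.

(** Labels do not depend on the section, because A is abelian. *)
Lemma labelE (D : set C) s g h P Q : open D -> convexC D -> D `<=` U -> lift_on W id s D ->
  D P -> D Q -> g \in Gam -> h \in Gam -> s P = g (sel P) -> s Q = h (sel Q) ->
  label P Q = theta h - theta g.
Proof.
move=> oD cD DU sl DP DQ gG hG sP sQ.
have gV : g^-1%g \in Gam by rewrite gpredV.
have L : is_label P Q (theta h - theta g).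
  exists (g^-1 * h)%g, D, (bij_inv g \o s); split; split=> //.
  - exact: gpredM.
  - by apply: (lift_on_comp Gs_cont Gs_W) sl; exists g^-1%g.
  - by rewrite /= sP bij_funK.
  - by split; [rewrite /= sQ|rewrite thM // thV // addrC].
exact: is_label_uniq (xgetI 0 L) L.
Qed.

Lemma sel_orbit x : U (W x) -> exists2 g, g \in Gam & x = g (sel (W x)).
Proof. by move=> Ux; have [|g gG e] := @Gtrans (sel (W x)) x; [rewrite selP|exists g]. Qed.

Lemma labelD (D : set C) P Q S : open D -> convexC D -> D `<=` U -> D P -> D Q -> D S ->
  label P S = label P Q + label Q S.
Proof.
move=> oD cD DU DP DQ DS; have [s sl] := section_exists oD cD DU DP.
have orb T : D T -> exists2 g, g \in Gam & s T = g (sel T).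
  move=> DT; have WT := (sl _ DT).2; have UT := DU _ DT.
  by have [|g gG e] := @sel_orbit (s T); [rewrite WT|exists g; rewrite // WT in e *].
have [g gG sP] := orb P DP; have [h hG sQ] := orb Q DQ; have [f fG sS] := orb S DS.
rewrite (labelE oD cD DU sl DP DS gG fG) // (labelE oD cD DU sl DP DQ gG hG) //.
by rewrite (labelE oD cD DU sl DQ DS hG fG) //; zmod.
Qed.

Lemma label0 (D : set C) P : open D -> convexC D -> D `<=` U -> D P -> label P P = 0.
Proof.
move=> oD cD DU DP; have e := labelD oD cD DU DP DP DP.
by rewrite -[LHS](addrK (label P P)) -{1}e subrr.
Qed.

Lemma labelN (D : set C) P Q : open D -> convexC D -> D `<=` U -> D P -> D Q -> label Q P = - label P Q.
Proof.
move=> oD cD DU DP DQ; have := labelD oD cD DU DP DQ DP; rewrite (label0 oD) // => e.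
by apply/esym/eqP; rewrite -subr_eq0 -opprD -e oppr0.
Qed.

Section GridLabels.
Variables (Px Py : nat -> R).
Hypothesis Pxi : {homo Px : i j / (i < j)%N >-> i < j}.
Hypothesis Pyi : {homo Py : i j / (i < j)%N >-> i < j}.
Let Pt i j : C := Px i +i* Py j.
Let hp (j i : nat) : A := \sum_(0 <= t < i) label (Pt t j) (Pt t.+1 j).
Let vp (i j : nat) : A := \sum_(0 <= t < j) label (Pt i t) (Pt i t.+1).

Let Pxw i j : (i <= j)%N -> Px i <= Px j.
Proof. by rewrite leq_eqVlt => /orP[/eqP ->//|/Pxi/ltW]. Qed.
Let Pyw i j : (i <= j)%N -> Py i <= Py j.
Proof. by rewrite leq_eqVlt => /orP[/eqP ->//|/Pyi/ltW]. Qed.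

Let between (a b x : R) : a <= x <= b -> exists2 t : R, 0 <= t <= 1 & x = a + t * (b - a).
Proof.
move=> /andP[ax xb]; have [ab|ab] := eqVneq a b.
  by exists 0; rewrite ?lexx ?ler01 // mul0r addr0; apply/eqP; rewrite eq_le ax ab xb.
have ba : 0 < b - a by rewrite subr_gt0 lt_neqAle ab (le_trans ax).
exists ((x - a) / (b - a)); last by rewrite divfK ?gt_eqF //; ring.
by apply/andP; split; [apply: divr_ge0; [rewrite subr_ge0|exact: ltW]|rewrite ler_pdivrMr // mul1r lerD2r].
Qed.

Let hp_step (D : set C) j i i' : open D -> convexC D -> D `<=` U -> D (Pt i j) -> D (Pt i' j) -> (i <= i')%N ->
  hp j i' - hp j i = label (Pt i j) (Pt i' j).
Proof.
move=> oD cD DU Di Di' ii'.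
have inD t : (i <= t <= i')%N -> D (Pt t j).
  move=> /andP[it ti']; have [|r r01 e] := @between (Px i) (Px i') (Px t); first by rewrite !Pxw.
  have := (cD _ Di).2 _ _ Di' r01; congr D.
  by apply: complex_eq; rewrite /= ?e; ring.
rewrite /hp (big_cat_nat (leq0n i) ii') /= addrAC subrr add0r.
elim: i' ii' {Di'} inD => [|m IH] ii' inD.
  have i0 : i = 0%N by apply/eqP; rewrite -leqn0.
  by rewrite i0 in inD *; rewrite big_geq // (label0 oD) //; apply: inD.
move: ii'; rewrite leq_eqVlt => /orP[/eqP e|im].
  by rewrite big_geq -?e // (label0 oD) //; apply: inD; rewrite -e leqnn.
have Dt t : (i <= t <= m)%N -> D (Pt t j) by move=> /andP[it tm]; apply: inD; rewrite it ltnW.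
rewrite ltnS in im; rewrite big_nat_recr //= IH // -(labelD oD) //;
  by [apply: Dt; rewrite leqnn im|apply: inD; rewrite leqnn ltnW].
Qed.

Let vp_step (D : set C) i j j' : open D -> convexC D -> D `<=` U -> D (Pt i j) -> D (Pt i j') -> (j <= j')%N ->
  vp i j' - vp i j = label (Pt i j) (Pt i j').
Proof.
move=> oD cD DU Di Di' ii'.
have inD t : (j <= t <= j')%N -> D (Pt i t).
  move=> /andP[it ti']; have [|r r01 e] := @between (Py j) (Py j') (Py t); first by rewrite !Pyw.
  have := (cD _ Di).2 _ _ Di' r01; congr D.
  by apply: complex_eq; rewrite /= ?e; ring.
rewrite /vp (big_cat_nat (leq0n j) ii') /= addrAC subrr add0r.
elim: j' ii' {Di'} inD => [|m IH] ii' inD.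
  have j0 : j = 0%N by apply/eqP; rewrite -leqn0.
  by rewrite j0 in inD *; rewrite big_geq // (label0 oD) //; apply: inD.
move: ii'; rewrite leq_eqVlt => /orP[/eqP e|im].
  by rewrite big_geq -?e // (label0 oD) //; apply: inD; rewrite -e leqnn.
have Dt t : (j <= t <= m)%N -> D (Pt i t) by move=> /andP[it tm]; apply: inD; rewrite it ltnW.
rewrite ltnS in im; rewrite big_nat_recr //= IH // -(labelD oD) //;
  by [apply: Dt; rewrite leqnn im|apply: inD; rewrite leqnn ltnW].
Qed.

(** A closed square of regular values has a rectangular neighbourhood of
    regular values, where the one-form of labels is exact. *)
Lemma grid_curvature0 l m : (forall w, Px l <= complex.Re w <= Px l.+1 -> Py m <= complex.Im w <= Py m.+1 -> U w) ->
  curvature hp vp l m = 0.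
Proof.
move=> sq; have xl : Px l <= Px l.+1 by exact: Pxw. have ym : Py m <= Py m.+1 by exact: Pyw.
have [e e0 DU] := rect_nbhd oU xl ym sq.
have oD := @rect_open R (Px l - e) (Px l.+1 + e) (Py m - e) (Py m.+1 + e).
have cD := @rect_convex R (Px l - e) (Px l.+1 + e) (Py m - e) (Py m.+1 + e).
have D1 : rect (Px l - e) (Px l.+1 + e) (Py m - e) (Py m.+1 + e) (Pt l m) by split=> /=; lra.
have D2 : rect (Px l - e) (Px l.+1 + e) (Py m - e) (Py m.+1 + e) (Pt l.+1 m) by split=> /=; lra.
have D3 : rect (Px l - e) (Px l.+1 + e) (Py m - e) (Py m.+1 + e) (Pt l m.+1) by split=> /=; lra.
have D4 : rect (Px l - e) (Px l.+1 + e) (Py m - e) (Py m.+1 + e) (Pt l.+1 m.+1) by split=> /=; lra.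
rewrite /curvature (hp_step oD cD DU D1 D2) // (hp_step oD cD DU D3 D4) //.
rewrite (vp_step oD cD DU D2 D4) // (vp_step oD cD DU D1 D3) //.
rewrite -(labelD oD cD DU D1 D2 D4) [label (Pt l m) _](labelD oD cD DU D1 D3 D4); zmod.
Qed.

Lemma grid_step_label (D : set C) p q : open D -> convexC D -> D `<=` U -> D (Pt p.1 p.2) -> D (Pt q.1 q.2) ->
  p.1 = q.1 \/ p.2 = q.2 -> step_label hp vp p q = label (Pt p.1 p.2) (Pt q.1 q.2).
Proof.
move=> oD cD DU Dp Dq; case: p q Dp Dq => i j [i' j'] /= Dp Dq; rewrite /step_label /= => -[] e; subst.
  rewrite subrr add0r; have [jj|/ltnW jj] := leqP j j'; first exact: (vp_step oD).
  by rewrite (labelN oD cD DU Dq Dp) -(vp_step oD cD DU Dq Dp jj) opprB.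
rewrite subrr addr0; have [jj|/ltnW jj] := leqP i i'; first exact: (hp_step oD).
by rewrite (labelN oD cD DU Dq Dp) -(hp_step oD cD DU Dq Dp jj) opprB.
Qed.
End GridLabels.
End Labels.

(** The exponent of the factor by which g in [Gam] multiplies a root of W - c
    is a character with values in Z/k. *)
Lemma character_divisible c a p : ~ U c -> (exists x, U (W x)) -> a \in Gam -> prime p -> (p %| k)%N ->
  (forall chi : selfbij X -> 'Z_k, (forall g h, g \in Gam -> h \in Gam -> chi (g * h)%g = chi g + chi h) ->
     chi a *+ (k %/ p) = 0) ->
  exists G : X -> C, [/\ continuous G, forall x, G x ^+ k = W x - c &
    exists2 n, (p %| n)%N & forall x, U (W x) -> G (a x) = zetak R k ^+ n * G x].
Proof.
move=> Uc [x0 Ux0] aG pp pk hchi; have [G Gc GX] := roots Uc; exists G; split=> //.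
have /choice[n nP] g : exists n, g \in Gam -> forall x, U (W x) -> G (g x) = zetak R k ^+ n * G x.
  case: (boolP (g \in Gam)) => [gG|_]; last by exists 0%N.
  by have [n nP] := root_character Uc Gc GX gG Ux0; exists n.
have zp : k.-primitive_root (zetak R k : R[i]) by exact: zetak_prim.
exists (n a); last exact: nP.
have hh : forall g h, g \in Gam -> h \in Gam -> ((n (g * h)%g)%:R : 'Z_k) = (n g)%:R + (n h)%:R.
  move=> g h gG hG; have ghG : (g * h)%g \in Gam by exact: gpredM.
  have Uhx : U (W (h x0)) by rewrite GW.
  have : zetak R k ^+ n (g * h)%g = zetak R k ^+ (n g + n h) :> R[i].
    apply: (mulIf (root_neq0 Uc GX Ux0)).
    have e1 := nP _ ghG _ Ux0; have e2 := nP _ gG _ Uhx; have e3 := nP _ hG _ Ux0.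
    by rewrite exprD -mulrA -e3 -e2 -e1.
  move/eqP; rewrite (eq_prim_root_expr zp) => /eqP e.
  by rewrite -natrD -(Zp_nat_mod k1) e Zp_nat_mod.
have := hchi (fun g => (n g)%:R) hh; rewrite -mulrnA => /(congr1 val).
rewrite /= (val_Zp_nat k1) => /eqP; rewrite -/(dvdn _ _) -{1}(divnK pk) mulnC dvdn_pmul2r //.
by rewrite divn_gt0 ?prime_gt0 // dvdn_leq.
Qed.

Let crossing_sum (l l' m m' : bool) (n1 n2 b : int) : l = l' \/ m = m' ->
  (m : nat)%:Z * ((~~ l : nat)%:Z - (~~ l' : nat)%:Z) + (n1 - n2 + ((~~ l' && m' : nat)%:Z - (m' : nat)%:Z) - b) =
  (l : nat)%:Z * (m : nat)%:Z + n1 - ((l : nat)%:Z * (m' : nat)%:Z + n2) +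
  ((~~ l && m : nat)%:Z - (m : nat)%:Z) - b.
Proof. by case=> [->|->]; [case: l'|case: m'; case: l]; case: m => //=; try case: m'; try case: l'; rewrite /=; ring. Qed.

Section Crossings.
Variables (c : C) (G : X -> C) (fu fd : C -> C).
Variables (Px Py : nat -> R) (l m : nat) (gp : C -> nat * nat) (ok : X -> Prop).
Hypothesis Uc : ~ U c.
Hypothesis Gc : continuous G.
Hypothesis GX : forall x, G x ^+ k = W x - c.
Hypothesis fuP : root_on k (fun w => w - c) fu (slit_up c).
Hypothesis fdP : root_on k (fun w => w - c) fd (slit_down c).
Hypothesis fright : forall w, complex.Re c < complex.Re w -> fu w = fd w.
Hypothesis fleft : forall w, complex.Re w < complex.Re c -> fu w = zetak R k * fd w.
Hypothesis Pxi : {homo Px : i j / (i < j)%N >-> i < j}.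
Hypothesis Pyi : {homo Py : i j / (i < j)%N >-> i < j}.
Hypothesis cx : Px l <= complex.Re c <= Px l.+1.
Hypothesis cy : Py m <= complex.Im c <= Py m.+1.
Hypothesis gpP : forall x, ok x -> Px (gp (W x)).1 = complex.Re (W x) /\ Py (gp (W x)).2 = complex.Im (W x).
Hypothesis gpx : forall v w, complex.Re v = complex.Re w -> (gp v).1 = (gp w).1.
Hypothesis gpy : forall v w, complex.Im v = complex.Im w -> (gp v).2 = (gp w).2.

Let L (w : C) : bool := ((gp w).1 <= l)%N.
Let mu (w : C) : bool := (m < (gp w).2)%N.
Let rho (w : C) : C := if mu w then fu w else fd w.

Let hL x : ok x -> if L (W x) then complex.Re (W x) <= complex.Re c else complex.Re c <= complex.Re (W x).
Proof.
move=> /gpP[<- _]; rewrite /L; case/andP: cx => c1 c2; case: leqP => [|lt].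
  by rewrite leq_eqVlt => /orP[/eqP ->//|/Pxi/ltW h]; exact: le_trans c1.
apply: le_trans c2 _; move: lt; rewrite leq_eqVlt => /orP[/eqP ->//|/Pxi/ltW //].
Qed.
Let hmu x : ok x -> if mu (W x) then complex.Im c <= complex.Im (W x) else complex.Im (W x) <= complex.Im c.
Proof.
move=> /gpP[_ <-]; rewrite /mu; case/andP: cy => c1 c2; case: ltnP => [lt|].
  apply: le_trans c2 _; move: lt; rewrite leq_eqVlt => /orP[/eqP ->//|/Pyi/ltW //].
by rewrite leq_eqVlt => /orP[/eqP ->//|/Pyi/ltW h]; exact: le_trans c1.
Qed.

Lemma slit_value_neq0 x : ok x -> U (W x) -> rho (W x) != 0.
Proof.
move=> okx Ux; have ne : W x <> c by move=> e; apply: Uc; rewrite -e.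
have nz f V : root_on k (fun w => w - c) f V -> V (W x) -> f (W x) != 0.
  move=> fV /fV[_ e]; apply/eqP => f0; move: e; rewrite f0 expr0n gtn_eqF // => /esym/eqP.
  by rewrite subr_eq0 => /eqP.
have hm := hmu okx; rewrite /rho; case: (mu (W x)) hm => h.
  apply: nz fuP _ => e; rewrite lt_neqAle h andbT; apply/eqP => e'.
  by apply: ne; apply: complex_eq.
apply: nz fdP _ => e; rewrite lt_neqAle h andbT; apply/eqP => e'.
by apply: ne; apply: complex_eq.
Qed.

Let bd (w : C) : int := ((~~ L w && mu w : nat)%:Z - (mu w : nat)%:Z)%R.

(** Along the path the root G is compared with the roots on the slit planes
    at c. By [slit_crossing] the exponent of [zetak] accumulated counts the
    crossings of the horizontal line through c on the left of c, while
    [winding] counts the crossings of a ray going up from the square. The two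
    counts differ by boundary terms [bd], which cancel for closed paths. *)
Lemma winding_crossings x s : path axis_step x s -> U (W x) -> ok x -> (forall y, y \in s -> ok y) ->
  exists N1 N2 : nat,
    G x * rho (W (last x s)) * zetak R k ^+ N1 = G (last x s) * rho (W x) * zetak R k ^+ N2 /\
    winding (gp (W x)) [seq gp (W y) | y <- s] l m = N1%:Z - N2%:Z + bd (W x) - bd (W (last x s)).
Proof.
elim: s x => [|q s IH] x /=; first by move=> _ _ _ _; exists 0%N, 0%N; rewrite !expr0 subrr add0r subrr.
move=> /andP[/asboolP[D [s0 [[oD cD] DU sl [Dx Dq sx sq] ax]]] ps] Ux okx oks.
have okq : ok q by apply: oks; rewrite inE eqxx.
have Uq := DU _ Dq.
have [|N1 [N2 [e1 e2]]] := IH q ps Uq okq; first by move=> y ys; apply: oks; rewrite inE ys orbT.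
have rD : root_on k (fun w => w - c) (G \o s0) D.
  move=> u Du; have [cs Ws] := sl u Du; split; last by rewrite /= GX Ws.
  by constructor; apply: continuous_comp => //; exact: Gc.
have ax' : complex.Re (W x) = complex.Re (W q) \/ (complex.Im (W x) = complex.Im (W q) /\ mu (W x) = mu (W q)).
  by case: ax => e; [left|right; split=> //; rewrite /mu (gpy e)].
have cr := slit_crossing k0 fuP fdP fright fleft cD (fun Dc => Uc (DU _ Dc)) rD Dx Dq (hL okx) (hmu okx) (hmu okq) ax'.
rewrite /= sx sq -/(rho _) -/(rho _) in cr.
exists (L (W x) * mu (W x) + N1)%N, (L (W x) * mu (W q) + N2)%N; split.
  apply: (mulIf (root_neq0 Uc GX Uq)); apply: (mulIf (slit_value_neq0 okq Uq)).
  rewrite !exprD.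
  have -> : G x * rho (W (last q s)) * (zetak R k ^+ (L (W x) * mu (W x)) * zetak R k ^+ N1) * G q * rho (W q)
    = (G x * rho (W q) * zetak R k ^+ (L (W x) * mu (W x))) * (G q * rho (W (last q s)) * zetak R k ^+ N1).
    by move: (zetak R k ^+ _) (zetak R k ^+ N1) => z1 z2; ring.
  rewrite cr e1.
  by move: (zetak R k ^+ _) (zetak R k ^+ N2) => z1 z2; ring.
rewrite e2 /step_winding /bd -/(mu (W x)).
have eL w : (l < (gp w).1)%N = ~~ L w by rewrite /L -ltnNge.
rewrite !eL !PoszD !PoszM.
have LM : L (W x) = L (W q) \/ mu (W x) = mu (W q).
  by case: ax => [/gpx e|/gpy e]; [left; rewrite /L e|right; rewrite /mu e].
by have := crossing_sum N1%:Z N2%:Z (((~~ L (W (last q s)) && mu (W (last q s)) : nat)%:Z - (mu (W (last q s)) : nat)%:Z)) LM.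
Qed.
End Crossings.

(** The heart of the matter. The path from x0 to a x0 becomes a closed path
    on the grid formed by the coordinates of its vertices, with total label
    theta a. In the discrete Stokes formula a square of regular values
    contributes nothing, and the winding number around a square containing a
    non-regular value c is congruent modulo k to the exponent of a character
    at a, hence divisible by p. *)
Theorem planar_divisible (A : zmodType) (theta : selfbij X -> A) (a : selfbij X) p :
  (forall g h, g \in Gam -> h \in Gam -> theta (g * h)%g = theta g + theta h) ->
  (exists x, U (W x)) -> a \in Gam -> prime p -> (p %| k)%N ->
  (forall chi : selfbij X -> 'Z_k, (forall g h, g \in Gam -> h \in Gam -> chi (g * h)%g = chi g + chi h) ->
     chi a *+ (k %/ p) = 0) ->
  exists y, theta a = y *+ p.
Proof.
move=> thM [x0 Ux0] aG pp pk hchi.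
have Uax0 : U (W (a x0)) by rewrite GW.
have [s ps ls] := axis_connected Ux0 Uax0.
have [Px [Nx [Pxi Pxc]]] := grid_coordinates [seq complex.Re (W x) | x <- x0 :: s].
have [Py [Ny [Pyi Pyc]]] := grid_coordinates [seq complex.Im (W x) | x <- x0 :: s].
pose ix t := xget 0%N [set i | (i <= Nx)%N /\ Px i = t].
pose iy t := xget 0%N [set i | (i <= Ny)%N /\ Py i = t].
pose gp (w : C) : nat * nat := (ix (complex.Re w), iy (complex.Im w)).
pose ok x := x \in x0 :: s.
have gpN x : ok x -> [/\ ((gp (W x)).1 <= Nx)%N, ((gp (W x)).2 <= Ny)%N, Px (gp (W x)).1 = complex.Re (W x) &
    Py (gp (W x)).2 = complex.Im (W x)].
  move=> okx; have [|i iN ie] := Pxc (complex.Re (W x)); first by apply/mapP; exists x.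
  have [|j jN je] := Pyc (complex.Im (W x)); first by apply/mapP; exists x.
  have [h1 h2] := @xgetI _ 0%N [set i | (i <= Nx)%N /\ Px i = complex.Re (W x)] i (conj iN ie).
  by have [h3 h4] := @xgetI _ 0%N [set i | (i <= Ny)%N /\ Py i = complex.Im (W x)] j (conj jN je).
pose hp (j i : nat) : A := \sum_(0 <= t < i) label theta x0 (Px t +i* Py j) (Px t.+1 +i* Py j).
pose vp (i j : nat) : A := \sum_(0 <= t < j) label theta x0 (Px i +i* Py t) (Px i +i* Py t.+1).
have gpt x : ok x -> (Px (gp (W x)).1 +i* Py (gp (W x)).2 : C) = W x.
  by move=> /gpN[_ _ e1 e2]; apply: complex_eq.
(* the labels telescope along a path *)
have chain s' : forall x g h, path axis_step x s' -> U (W x) -> ok x -> (forall y, y \in s' -> ok y) ->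
    g \in Gam -> h \in Gam -> x = g (sel x0 (W x)) -> last x s' = h (sel x0 (W (last x s'))) ->
    path_label hp vp (gp (W x)) [seq gp (W y) | y <- s'] = theta h - theta g.
  elim: s' => [|q s' IH] x g h /=.
    move=> _ Ux _ _ gG hG e1 e2; suff -> : g = h by rewrite subrr.
    have : (g^-1 * h)%g = 1%g.
      apply: (@free (sel x0 (W x))); first by rewrite (selP _ Ux).
        by apply: gpredM => //; rewrite gpredV.
      by change (bij_inv g (h (sel x0 (W x))) = sel x0 (W x)); rewrite -e2 {1}e1 bij_funK.
    by move/(congr1 (fun h => g * h)%g); rewrite mulVKg mulg1.
  move=> /andP[/asboolP[D [s0 [[oD cD] DU sl [Dx Dq sx sq] ax]]] ps'] Ux okx oks gG hG e1 e2.
  have okq : ok q by apply: oks; rewrite inE eqxx.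
  have Uq := DU _ Dq; have [f fG fq] := sel_orbit x0 Uq.
  rewrite (IH q f h) //; last by move=> y ys; apply: oks; rewrite inE ys orbT.
  rewrite (grid_step_label (theta := theta) x0 thM Pxi Pyi oD cD DU) ?gpt //; last first.
    by case: ax => e; [left|right]; rewrite /gp /= e.
  rewrite (labelE thM oD cD DU sl Dx Dq gG fG) ?sx ?sq //; zmod.
have [g0 g0G e0] := sel_orbit x0 Ux0.
have oks y : y \in s -> ok y by move=> ys; rewrite /ok inE ys orbT.
have ok0 : ok x0 by rewrite /ok inE eqxx.
have agG : (a * g0)%g \in Gam by exact: gpredM.
have -> : theta a = path_label hp vp (gp (W x0)) [seq gp (W y) | y <- s].
  rewrite (chain s x0 g0 (a * g0)%g) ?thM //; first by zmod.
  by rewrite ls GW //; change (a x0 = a (g0 (sel x0 (W x0)))); rewrite -e0.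
have bN x : ok x -> ((gp (W x)).1 <= maxn Nx Ny)%N && ((gp (W x)).2 <= maxn Nx Ny)%N.
  by move=> /gpN[h1 h2 _ _]; rewrite !leq_max h1 h2 orbT.
have /andP[b1 b2] := bN _ ok0.
rewrite (grid_stokes hp vp b1 b2); first last.
- by rewrite (last_map (fun y => gp (W y))) ls GW.
- by apply/allP => q /mapP[y /oks/bN h ->].
apply: (big_ind (fun t : A => exists y, t = y *+ p)) => [|t t' [y ->] [y' ->]|l _]; first by exists 0; rewrite mul0rn.
  by exists (y + y'); rewrite mulrnDl.
apply: (big_ind (fun t : A => exists y, t = y *+ p)) => [|t t' [y ->] [y' ->]|m _]; first by exists 0; rewrite mul0rn.
  by exists (y + y'); rewrite mulrnDl.
have [sq|] := pselect (forall w, Px l <= complex.Re w <= Px l.+1 -> Py m <= complex.Im w <= Py m.+1 -> U w).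
  by exists 0; rewrite (grid_curvature0 x0 thM Pxi Pyi sq) mul0rz mul0rn.
(* there remain the squares containing some c outside U *)
move=> /existsNP[c /not_implyP[cx /not_implyP[cy Uc]]].
have [G [Gc GX [n pn nP]]] := character_divisible Uc (ex_intro _ x0 Ux0) aG pp pk hchi.
have [fu [fd [fuP fdP fr fl]]] := slit_roots c k0.
have [|||N1 [N2 [e1 ->]]] := @winding_crossings c G fu fd Px Py l m gp ok Uc Gc GX fuP fdP fr fl Pxi Pyi cx cy _ _ _ x0 s ps Ux0 ok0 oks.
- by move=> x /gpN[].
- by move=> v w e; rewrite /gp /= e.
- by move=> v w e; rewrite /gp /= e.
have zp : k.-primitive_root (zetak R k : R[i]) by exact: zetak_prim.
have Gx0 := root_neq0 Uc GX Ux0.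
(* the path ends at a x0, where the root is zeta ^ n times its value at x0 *)
have eN : N1 = n + N2 %[mod k].
  apply/eqP; rewrite -(eq_prim_root_expr zp); apply/eqP.
  move: e1; rewrite ls GW // (nP _ Ux0) exprD.
  set rh : C := if _ then _ else _ => e1.
  have rh0 : rh != 0 by apply: (@slit_value_neq0 c fu fd Px Py m gp ok) => // y /gpN[].
  apply: (mulIf Gx0); apply: (mulIf rh0); move: e1.
  move: (zetak R k ^+ _) (zetak R k ^+ n) (zetak R k ^+ N2) => z1 z2 z3 e1.
  by transitivity (G x0 * rh * z1); [ring|rewrite e1; ring].
have /dvdnP[n' en] := pn; have /dvdnP[k' ek] := pk.
have := divn_eq N1 k; rewrite eN => h1; have := divn_eq (n + N2)%N k => h2.
exists (curvature hp vp l m *~ (n'%:Z + k'%:Z * ((N1 %/ k)%N%:Z - ((n + N2) %/ k)%N%:Z))).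
rewrite ls GW // addrK pmulrn -mulrzA; congr (_ *~ _).
have {}h1 : N1%:Z = (N1 %/ k)%N%:Z * (k'%:Z * p%:Z) + ((n + N2) %% k)%N%:Z by rewrite -!PoszM -PoszD -ek -h1.
have {}h2 : n'%:Z * p%:Z + N2%:Z = ((n + N2) %/ k)%N%:Z * (k'%:Z * p%:Z) + ((n + N2) %% k)%N%:Z.
  by rewrite -!PoszM -!PoszD -ek -en -h2.
have -> : N1%:Z - N2%:Z = N1%:Z - (n'%:Z * p%:Z + N2%:Z) + n'%:Z * p%:Z by ring.
by rewrite h2 h1; ring.
Qed.
End Planar.

(** * Local models of branched maps and rigidity of deck transformations *)

Section Models.
Variable R : realType.
Local Notation C := (R[i]^o).

Lemma connected_locally (X : topologicalType) (Q : X -> Prop) : connected [set: X] ->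
  (forall x, exists2 V, nbhs x V & forall y, V y -> (Q y <-> Q x)) -> forall x y, Q x -> Q y.
Proof.
move=> cX loc x y Qx; suff -> : Q = setT by [].
have oQ (P : set X) : (forall x, exists2 V, nbhs x V & forall y, V y -> (P y <-> P x)) -> open P.
  move=> lP; rewrite openE => z Pz; have [V nV h] := lP z.
  by apply: filterS nV => u /h[_]; apply.
apply: cX; first by exists x.
- by exists Q; [exact: oQ|rewrite setTI].
- exists Q; last by rewrite setTI.
  rewrite -[Q]setCK; apply: open_closedC; apply: oQ => z; have [V nV h] := loc z.
  by exists V => // u /h; rewrite /setC /=; tauto.
Qed.

(** A purely topological normal form: s is a homeomorphism from the disc of
    radius r onto a neighbourhood of x, through which the fibres of W are
    those of v |-> v ^+ n. Only the fibres of W enter. *)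
Definition wmodel (X : topologicalType) (Z : Type) (W : X -> Z) (x : X) (s : C -> X) (r : R) (n : nat) :=
  [/\ 0 < r /\ (0 < n)%N, s 0 = x /\ (forall v v', disc 0 r v -> disc 0 r v' -> s v = s v' -> v = v'),
    forall v, disc 0 r v -> continuous_at v s,
    forall O : set C, open O -> O `<=` disc 0 r -> open (s @` O) &
    forall v v', disc 0 r v -> disc 0 r v' -> (W (s v) = W (s v') <-> v ^+ n = v' ^+ n)].

Lemma wmodel_nbhs (X : topologicalType) (Z : Type) (W : X -> Z) x s r n v (O : set C) : wmodel W x s r n -> disc 0 r v -> nbhs v O ->
  nbhs (s v) (s @` (O `&` disc 0 r)).
Proof.
move=> [_ _ _ sO _] vr /nbhsC[e e0 he].
have : open (s @` (disc v e `&` disc 0 r)).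
  by apply: sO => [|z []//]; apply: openI; exact: open_disc.
move=> o; have : nbhs (s v) (s @` (disc v e `&` disc 0 r)).
  by apply: open_nbhs_nbhs; split=> //; exists v => //; split=> //; exact: disc_center.
by apply: filterS => _ [u [/he Ou ur] <-]; exists u.
Qed.

Lemma unit_disc_rot (om v : C) n r : (0 < n)%N -> om ^+ n = 1 -> disc 0 r v -> disc 0 r (om * v).
Proof.
move=> n0 e; rewrite /disc /= !subr0 nCM.
have -> : nC om = 1.
  by have /eqP := congr1 (fun u : C => nC u) e; rewrite nCX nC1 pexprn_eq1 ?nC_ge0 // gtn_eqF //= => /eqP.
by rewrite mul1r.
Qed.

Section Rigid.
Variables (X : topologicalType) (Z : Type) (W : X -> Z) (G : groupClosed (selfbij X)).
Hypothesis hX : hausdorff_space X.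
Hypothesis cX : connected [set: X].
Hypothesis Gcont : forall g, g \in G -> continuous g.
Hypothesis GW : forall g, g \in G -> forall x, W (g x) = W x.
Hypothesis Gtrans : forall x x', W x = W x' -> exists2 g, g \in G & g x = x'.
Hypothesis models : forall x, exists s r n, wmodel W x s r n.

(** A point x' in the fibre of s v is moved by G to s v, near which the n-th
    power is injective. *)
Lemma wmodel_linj x s r n v x' : wmodel W x s r n -> disc 0 r v -> v != 0 -> W x' = W (s v) ->
  exists2 V, nbhs x' V & forall a b, V a -> V b -> W a = W b -> a = b.
Proof.
move=> M vr v0 /esym/Gtrans[g gG gx]; have [[r0 n0] [_ sinj] sc sO sW] := M.
have [d d0 dinj] := pow_locally_injective n0 v0.
have gV : g^-1%g \in G by rewrite gpredV.
have nV : nbhs (s v) (s @` (disc v d `&` disc 0 r)).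
  by apply: (wmodel_nbhs M vr); apply/nbhsC; exists d.
have ex : bij_inv g x' = s v by rewrite -gx bij_funK.
exists (bij_inv g @^-1` (s @` (disc v d `&` disc 0 r))).
  have cg : continuous_at x' (bij_inv g) by exact: (Gcont gV).
  by apply: cg; rewrite ex.
move=> a b [u [ud ur] ea] [u' [u'd u'r] eb] ab.
have ea' : a = g (s u) by rewrite ea bij_invK.
have eb' : b = g (s u') by rewrite eb bij_invK.
by rewrite ea' eb' (dinj u u') //; apply/(sW u u' ur u'r); rewrite -(GW gG) -ea' ab eb' GW.
Qed.

(** Both f o s and s o (multiplication by v1 / v0) lift W o s, and they agree
    at v0, a point where W is locally injective. *)
Lemma wmodel_rot x s r n f v0 v1 : wmodel W x s r n -> continuous f -> (forall y, W (f y) = W y) ->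
  disc 0 r v0 -> disc 0 r v1 -> v0 != 0 -> f (s v0) = s v1 ->
  exists2 om : C, om ^+ n = 1 & forall v, disc 0 r v -> f (s v) = s (om * v).
Proof.
move=> M fc fW v0r v1r v00 e; have [[r0 n0] [s0 sinj] sc sO sW] := M.
have e1 : v1 ^+ n = v0 ^+ n by apply/(sW _ _ v1r v0r); rewrite -e fW.
have omn : (v1 / v0) ^+ n = 1 by rewrite exprMn exprVn e1 divff // expf_neq0.
have om0 : v1 / v0 * v0 = v1 by rewrite divfK.
exists (v1 / v0) => // v vr.
have rot u : disc 0 r u -> disc 0 r (v1 / v0 * u) by exact: (unit_disc_rot n0 omn).
have dE : discreteC (disc 0 r) [set (0 : C)].
  move=> z zr; have [->|z0] := eqVneq z 0; first by exists 1 => // w _ ->.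
  exists (nC z); first by rewrite nC_gt0.
  by move=> w + w0; rewrite w0 sub0r nCN ltxx.
have linj z x' : disc 0 r z -> ~ [set (0 : C)] z -> W x' = W (s z) ->
    exists2 V, nbhs x' V & forall a b, V a -> V b -> W a = W b -> a = b.
  by move=> zr z0; apply: (wmodel_linj M zr); apply/eqP.
have l1 : lift_on W (fun v => W (s v)) (f \o s) (disc 0 r).
  by move=> u ur; split; [apply: continuous_comp; [exact: sc|exact: fc]|rewrite /= fW].
have l2 : lift_on W (fun v => W (s v)) (s \o (fun u => v1 / v0 * u)) (disc 0 r).
  move=> u ur; split; last by apply/(sW _ _ (rot _ ur) ur); rewrite exprMn omn mul1r.
  apply: continuous_comp; last exact/sc/rot.
  have [] // : ccont (fun z : C => v1 / v0 * z) u.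
  by apply: contM; [exact: contc|exact: conti].
have nE : ~ [set (0 : C)] v0 by move=> h; rewrite h eqxx in v00.
have e2 : (f \o s) v0 = (s \o (fun u => v1 / v0 * u)) v0 by rewrite /= om0.
exact: (lift_eq hX dE linj (@open_disc R 0 r) (@convex_disc R 0 r) (@subset_refl _ _) l1 l2 v0r nE e2 vr).
Qed.

Lemma disc_half (r : R) : 0 < r -> disc (0 : C) r (r / 2)%:C /\ ((r / 2)%:C : C) != 0.
Proof.
move=> r0; have h : 0 < r / 2 by rewrite divr_gt0.
split; first by rewrite /disc /= subr0 nCR gtr0_norm //; lra.
by rewrite eq_complex /= eqxx andbT gt_eqF.
Qed.

Lemma wmodel_fix x s r n f : wmodel W x s r n -> continuous f -> (forall y, W (f y) = W y) -> f x = x ->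
  exists2 om : C, om ^+ n = 1 & forall v, disc 0 r v -> f (s v) = s (om * v).
Proof.
move=> M fc fW fx; have [[r0 n0] [s0 sinj] sc sO sW] := M.
have c0 := disc_center (0 : C) r0.
have cfs : continuous_at (0 : C) (f \o s) by apply: continuous_comp; [exact: sc|exact: fc].
have : nbhs (0 : C) ((f \o s) @^-1` (s @` (setT `&` disc 0 r))).
  apply: cfs; rewrite /= s0 fx -s0; apply: (wmodel_nbhs M c0).
  by apply/nbhsC; exists 1.
move=> /nbhsC[e e0 he]; have m0 : 0 < Num.min e r by rewrite lt_min e0.
have [hm hn] := disc_half m0; set v0 := _%:C in hm hn.
have [me mr] : Num.min e r <= e /\ Num.min e r <= r by split; rewrite ge_min lexx ?orbT.
have [|v1 [_ v1r] e1] := he v0; first exact: lt_le_trans me.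
by apply: (wmodel_rot (v1 := v1) M fc fW) hn _ => //; exact: lt_le_trans mr.
Qed.

(** The set of points near which f is the identity is open. It is also
    closed: on a model meeting it, f is a rotation with a fixed point off the
    centre. *)
Theorem rigid (f : X -> X) (x : X) : continuous f -> (forall y, W (f y) = W y) ->
  (exists2 V, nbhs x V & forall y, V y -> f y = y) -> forall y, f y = y.
Proof.
move=> fc fW; pose Q (x : X) : Prop := exists2 V : set X, nbhs x V & forall y, V y -> f y = y.
move=> Qx y; suff [V nV] : Q y by apply; exact: nbhs_singleton.
apply: (@connected_locally X Q cX _ x y Qx) => {Qx x y} z; have [s [r [n M]]] := models z.
have [[r0 n0] [s0 sinj] sc sO sW] := M.
have all v : disc 0 r v -> Q (s v) -> forall u, disc 0 r u -> f (s u) = s u.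
  move=> vr [V nV fV].
  have /nbhsC[e e0 he] : nbhs v (s @^-1` V) by exact: sc.
  have [e' e'0 he'] := (openC _).1 (@open_disc R 0 r) v vr.
  have m0 : 0 < Num.min e e' by rewrite lt_min e0.
  (* f is the identity at s w, and w is not the centre *)
  have [w] : exists w : C, [/\ nC (w - v) < Num.min e e' & w != 0].
    have [->|v0] := eqVneq v 0.
      by have [h1 h2] := disc_half m0; exists ((Num.min e e' / 2)%:C).
    by exists v; rewrite subrr nC0.
  rewrite lt_min => -[/andP[w1 w2] w0].
  have wr := he' _ w2; have fw : f (s w) = s w by apply: fV; exact: he.
  have [om omn omP] := wmodel_rot M fc fW wr wr w0 fw.
  have om1 : om = 1.
    apply: (mulIf w0); rewrite mul1r; apply: sinj => //; last by rewrite -omP.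
    exact: (unit_disc_rot n0 omn).
  by move=> u ur; rewrite omP // om1 mul1r.
have nb u : disc 0 r u -> nbhs (s u) (s @` (setT `&` disc 0 r)).
  by move=> ur; apply: (wmodel_nbhs M ur); apply/nbhsC; exists 1.
have QQ u v : disc 0 r u -> disc 0 r v -> Q (s u) -> Q (s v).
  move=> ur vr Qu; exists (s @` (setT `&` disc 0 r)); first exact: nb.
  by move=> _ [w [_ wr] <-]; exact: (all u ur Qu).
have c0 := disc_center (0 : C) r0.
exists (s @` (setT `&` disc 0 r)) => [|_ [v [_ vr] <-]]; first by rewrite -s0; exact: nb.
by rewrite -s0; split; exact: QQ.
Qed.

(** Off the centre [wmodel_rot] applies: g acts on the model by a rotation,
    which fixes the centre. *)
Lemma wmodel_meet x s r n g v v' : wmodel W x s r n -> g \in G -> disc 0 r v -> disc 0 r v' ->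
  g (s v) = s v' -> g x = x.
Proof.
move=> M gG vr v'r e; have [[r0 n0] [s0 sinj] sc sO sW] := M.
have c0 := disc_center (0 : C) r0.
have [v0|v0] := eqVneq v 0.
  have : v' ^+ n = v ^+ n by apply/(sW _ _ v'r vr); rewrite -e GW.
  rewrite v0 expr0n gtn_eqF //= => /eqP; rewrite expf_eq0 n0 /= => /eqP v'0.
  by rewrite -s0 -{1}v0 e v'0.
have [om _ omP] := wmodel_rot M (Gcont gG) (GW gG) vr v'r v0 e.
by rewrite -s0 omP // mulr0.
Qed.

Lemma agree_near x s r n g h v : wmodel W x s r n -> g \in G -> h \in G ->
  disc 0 r v -> v != 0 -> (exists2 v', disc 0 r v' & g (s v) = s v') -> g (s v) = h (s v) -> g = h.
Proof.
move=> M gG hG vr v0 [v' v'r e] e'; have [[r0 n0] [s0 sinj] sc sO sW] := M.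
have hV : h^-1%g \in G by rewrite gpredV.
have kG : (h^-1 * g)%g \in G by exact: gpredM.
have ke : (h^-1 * g)%g (s v) = s v by change (bij_inv h (g (s v)) = s v); rewrite e' bij_funK.
have [om omn omP] := wmodel_rot M (Gcont kG) (GW kG) vr vr v0 ke.
have om1 : om = 1.
  apply: (mulIf v0); rewrite mul1r; apply: sinj => //; last by rewrite -omP.
  exact: (unit_disc_rot n0 omn).
suff : (h^-1 * g)%g = 1%g by move/(congr1 (fun k => h * k)%g); rewrite mulVKg mulg1.
apply: bijP => y; apply: (@rigid _ (s v) (Gcont kG) (GW kG)).
exists (s @` (setT `&` disc 0 r)); first by apply: (wmodel_nbhs M vr); apply/nbhsC; exists 1.
by move=> _ [u [_ ur] <-]; rewrite omP // om1 mul1r.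
Qed.

Lemma disc_rot_zeta (n i : nat) r (v : C) : (0 < n)%N -> disc 0 r v -> disc 0 r (zetak R n ^+ i * v).
Proof.
move=> n0; apply: (unit_disc_rot n0).
by rewrite exprAC (prim_expr_order (zetak_prim R n0)) expr1n.
Qed.

(** An element fixing x acts on the model by a rotation of order dividing n,
    and each of these rotations occurs because G is transitive on fibres.
    Thus n depends on the order of the stabilizer only, which is what the
    orbifold structure remembers. *)
Theorem stabilizer_card x s r n : wmodel W x s r n -> ([set g : selfbij X | g \in G /\ g x = x] #= `I_n)%card.
Proof.
move=> M; have [[r0 n0] [s0 sinj] sc sO sW] := M.
have [vr v0] := disc_half r0; set v := _%:C in vr v0.
have zp := zetak_prim R n0.
have /choice[f fP] g : exists i, g \in G /\ g x = x -> (i < n)%N /\ g (s v) = s (zetak R n ^+ i * v).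
  have [[gG gx]|] := pselect (g \in G /\ g x = x); last by exists 0%N.
  have [om omn omP] := wmodel_fix M (Gcont gG) (GW gG) gx.
  by have [i e] := prim_rootP zp omn; exists i => _; rewrite omP // e.
apply/card_set_bijP; exists f; split.
- by move=> g /fP[].
- move=> g h /set_mem sg /set_mem sh e; have [i eg] := fP g sg; have [j eh] := fP h sh.
  apply: (agree_near M sg.1 sh.1 vr v0); last by rewrite eg eh e.
  by exists (zetak R n ^+ f g * v) => //; exact: disc_rot_zeta.
- move=> i ni; have zr := disc_rot_zeta i n0 vr.
  have [|g gG gi] := @Gtrans (s v) (s (zetak R n ^+ i * v)).
    by apply/(sW _ _ vr zr); rewrite exprMn exprAC (prim_expr_order zp) expr1n mul1r.
  have gx := wmodel_meet M gG vr zr gi; exists g; first by [].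
  have [fi eg] := fP g (conj gG gx); have := eg; rewrite gi => /(sinj _ _ zr (disc_rot_zeta _ n0 vr)).
  by move=> /(mulIf v0)/eqP; rewrite (eq_prim_root_expr zp) !modn_small // => /eqP.
Qed.

Lemma wmodel_degree x s r n s' r' n' : wmodel W x s r n -> wmodel W x s' r' n' -> n = n'.
Proof.
by move=> /stabilizer_card M /stabilizer_card M'; apply/card_eq_II; apply: card_eq_trans M'; exact: card_esym.
Qed.

Lemma wmodel_free x s r n : wmodel W x s r n -> (forall g, g \in G -> g x = x -> g = 1%g) -> n = 1%N.
Proof.
move=> M fr; apply/card_eq_II; apply: card_eq_trans (card_esym (stabilizer_card M)) _.
apply/card_set_bijP; exists (fun=> 0%N); split.
- by [].
- by move=> g h /set_mem[gG gx] /set_mem[hG hx] _; rewrite (fr g) // (fr h).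
- by move=> [|//] _; exists 1%g => //; split=> //; exact: gpred1.
Qed.

Lemma stabilizer_off_center x s r n g v : wmodel W x s r n -> disc 0 r v -> v != 0 -> g \in G ->
  g (s v) = s v -> g = 1%g.
Proof.
move=> M vr v0 gG e; have G1 : 1%g \in G by exact: gpred1.
by apply: (agree_near M gG G1 vr v0); rewrite e //; exists v.
Qed.
End Rigid.
End Models.

(** * Charts, normal forms on surfaces, holomorphy in a chart *)

Section SurfaceModels.
Variable R : realType.
Local Notation C := (R[i]^o).

Lemma chart_inverse (X : topologicalType) (c : chart R X) x : is_chart c -> chart_dom c x ->
  exists (sg : C -> X) (r : R), [/\ 0 < r,
    forall v, disc (c x) r v -> [/\ chart_dom c (sg v), c (sg v) = v & continuous_at v sg],
    forall y, chart_dom c y -> sg (c y) = y &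
    forall P : set C, open P -> P `<=` disc (c x) r -> open (sg @` P)].
Proof.
move=> [od ci cc co] dx.
have od' : open (c @` chart_dom c) by apply: co.
have [r r0 hr] := (openC _).1 od' (c x) (ex_intro2 _ _ x dx erefl).
pose sg v := xget x [set y | chart_dom c y /\ c y = v].
have sgP v : disc (c x) r v -> chart_dom c (sg v) /\ c (sg v) = v.
  by move=> /hr[y dy e]; exact: (@xgetI _ x [set y | chart_dom c y /\ c y = v] y (conj dy e)).
have sgK y : chart_dom c y -> sg (c y) = y.
  move=> dy; have [d' e] := @xgetI _ x [set z | chart_dom c z /\ c z = c y] y (conj dy erefl).
  by apply: ci; rewrite ?inE.
exists sg, r; split=> //.
  move=> v vr; have [d e] := sgP v vr; split=> //.
  move=> N /= nN; have [N0 [oN0 Nv NN]] : exists N0, [/\ open N0, N0 (sg v) & N0 `<=` N].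
    by move: nN; rewrite nbhsE => -[N0 [oN0 Nv] NN]; exists N0.
  have o1 : open (c @` (N0 `&` chart_dom c)) by apply: co => [|y []//]; exact: openI.
  have : nbhs v (c @` (N0 `&` chart_dom c)).
    by apply: open_nbhs_nbhs; split=> //; exists (sg v).
  by apply: filterS => _ [y [Ny dy] <-] /=; rewrite sgK //; exact: NN.
move=> P oP Pr; have -> : sg @` P = chart_dom c `&` c @^-1` P.
  apply/seteqP; split=> [_ [v Pv <-]|y [dy Py]].
    by have [d e] := sgP v (Pr _ Pv); split=> //; rewrite /= e.
  by exists (c y) => //; exact: sgK.
rewrite openE => y [dy Py]; apply: filterI; first exact: open_nbhs_nbhs.
by apply: cc => //; exact: open_nbhs_nbhs.
Qed.

Lemma wmodel_of_chart (X : topologicalType) (Z : Type) (W : X -> Z) (z : chart R X) x n : is_chart z ->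
  chart_dom z x -> z x = 0 -> (0 < n)%N ->
  (forall y y', chart_dom z y -> chart_dom z y' -> (W y = W y' <-> (z y : R[i]) ^+ n = (z y' : R[i]) ^+ n)) ->
  exists (s : C -> X) (r : R), wmodel W x s r n.
Proof.
move=> cz dx z0 n0 zW; have [sg [r [r0 sP sK so]]] := chart_inverse cz dx; rewrite z0 in sP so.
exists sg, r; split=> //.
- split=> [|v v' /sP[_ e _] /sP[_ e' _] ee]; first by rewrite -z0 sK.
  by rewrite -e -e' ee.
- by move=> v /sP[].
- by move=> v v' /sP[d e _] /sP[d' e' _]; rewrite zW // e e'.
Qed.

(** The holomorphic normal form: in addition to [wmodel], W is exactly
    v |-> W x + v ^+ n, and s is holomorphic in a chart of the atlas. *)
Definition model (X : surface R) (W : X -> C) (x : X) (s : C -> X) (r : R) (n : nat) :=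
  [/\ wmodel W x s r n, forall v, disc 0 r v -> W (s v) = W x + v ^+ n &
    exists2 c, atlas X c & forall v, disc 0 r v -> chart_dom c (s v) /\ cdiff (c \o s) v].

(** Holomorphy of W near x, on a full disc of a chart; the form in which
    [normal_form] applies. *)
Definition hol_fun_at (X : surface R) (W : X -> C) (x : X) :=
  exists (c : chart R X) (F : C -> C) (r : R), [/\ atlas X c, chart_dom c x, 0 < r,
    (forall v, disc (c x) r v -> cdiff F v) &
    forall y, chart_dom c y -> disc (c x) r (c y) -> W y = F (c y)].

(** The normal form of W in a chart is F (c x) + t ^ n with t a local
    coordinate; s is the inverse of t followed by the inverse of the chart. *)
Theorem model_exists (X : surface R) (W : X -> C) x : (forall c, atlas X c -> is_chart c) ->
  hol_fun_at W x -> ~ (exists2 V, nbhs x V & forall y, V y -> W y = W x) ->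
  exists s r n, model W x s r n.
Proof.
move=> ca [c [F [r2 [ac dx r20 FP WF]]]] nc.
have [sg [r1 [r10 sP sK so]]] := chart_inverse (ca c ac) dx.
have m0 : 0 < Num.min r1 r2 by rewrite lt_min r10.
have [m1 m2] : Num.min r1 r2 <= r1 /\ Num.min r1 r2 <= r2 by split; rewrite ge_min lexx ?orbT.
have FP' z : disc (c x) (Num.min r1 r2) z -> cdiff F z by move=> h; apply: FP; exact: lt_le_trans m2.
have Wx : W x = F (c x) by apply: WF => //; exact: disc_center.
have nc' : ~ exists2 d : R, 0 < d & forall u, disc (c x) d u -> F u = F (c x).
  move=> [d d0 hd]; apply: nc; have [od _ cc _] := ca c ac.
  exists (chart_dom c `&` c @^-1` (disc (c x) (Num.min d r2))).
    apply: filterI; first exact: open_nbhs_nbhs.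
    by apply: cc => //; apply/nbhsC; exists (Num.min d r2) => //; rewrite lt_min d0.
  move=> y [dy]; rewrite /disc /= lt_min => /andP[y1 y2]; rewrite WF // hd //.
have [n [t [d [l [d0 dm tP t0 [tl l0]]]]]] := normal_form m0 FP' nc'.
have [d' [e [tau [d'0 d'd e0 tinj tauP]]]] := local_inverse d0 (fun z zd => (tP z zd).1) tl l0.
have dd' u : disc (c x) d' u -> disc (c x) d u by move=> h; exact: lt_le_trans d'd.
have dr1 u : disc (c x) d' u -> disc (c x) r1 u.
  by move=> /dd' h; apply: lt_le_trans m1; exact: lt_le_trans dm.
have dr2 u : disc (c x) d' u -> disc (c x) r2 u.
  by move=> /dd' h; apply: lt_le_trans m2; exact: lt_le_trans dm.
have tau' w : disc 0 e w -> [/\ disc (c x) d' (tau w), t (tau w) = w & cdiff tau w].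
  by move=> we; apply: tauP; rewrite t0.
have tau0 : tau 0 = c x.
  have [h1 h2 _] := tau' _ (disc_center _ e0).
  by apply: tinj => //; [exact: disc_center|rewrite h2 t0].
have Ws v : disc 0 e v -> W (sg (tau v)) = W x + v ^+ n.+1.
  move=> /tau'[h1 h2 _]; have [d1 d2 _] := sP _ (dr1 _ h1).
  rewrite WF // d2 ?Wx; last exact: dr2.
  by rewrite (tP _ (dd' _ h1)).2 h2.
exists (sg \o tau), e, n.+1; split=> //; last first.
  exists c => // v /tau'[h1 h2 h3]; have [d1 d2 _] := sP _ (dr1 _ h1); split=> //.
  have [ct] := cdiff_cont h3; apply: (cdiff_near _ h3); have /nbhsC[q q0 hq] : nbhs v (tau @^-1` disc (c x) d').
    by apply: ct; apply: open_nbhs_nbhs; split=> //; exact: open_disc.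
  apply/nbhsC; exists q => // u /hq /= hu.
  by have [_ -> _] := sP _ (dr1 _ hu).
split=> //.
- split=> [|v v' /tau'[h1 h2 _] /tau'[h1' h2' _] /= ee]; first by rewrite /= tau0 sK.
  have [_ d2 _] := sP _ (dr1 _ h1); have [_ d2' _] := sP _ (dr1 _ h1').
  by rewrite -h2 -h2'; congr t; rewrite -d2 -d2' ee.
- move=> v /tau'[h1 h2 /cdiff_cont[ct]]; have [_ _ cs] := sP _ (dr1 _ h1).
  exact: continuous_comp.
- move=> O oO Oe; rewrite -(image_comp tau sg O); apply: so; last by move=> _ [w /Oe/tau'[/dr1 h _ _] <-].
  apply/openC => _ [w Ow <-]; have [h1 h2 h3] := tau' _ (Oe _ Ow).
  have [ct] : ccont t (tau w) by apply: cdiff_cont; exact: (tP _ (dd' _ h1)).1.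
  have /nbhsC[q q0 hq] : nbhs (tau w) (t @^-1` O `&` disc (c x) d').
    apply: filterI; first by apply: ct; rewrite h2; exact: open_nbhs_nbhs.
    by apply: open_nbhs_nbhs; split=> //; exact: open_disc.
  exists q => // u /hq[/= Ou hu]; exists (t u) => //.
  by have [k1 k2 _] := tau' _ (Oe _ Ou); apply: tinj.
- by move=> v v' hv hv'; rewrite /= !Ws //; split=> [/addrI//|->].
Qed.
End SurfaceModels.

Section RelativeHolomorphy.
Variable R : realType.
Local Notation C := (R[i]^o).
Variable X : topologicalType.
Implicit Types (c d : chart R X) (f : X -> C) (x y : X).

(** Near x the function f is a holomorphic function of the chart c. Being
    local, it composes better than [holomorphic_through]. *)
Definition hol_rel c f x := chart_dom c x /\ exists2 F : C -> C, cdiff F (c x) & \forall y \near x, f y = F (c y).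

Lemma hol_rel_comp c d f x : hol_rel c d x -> hol_rel d f x -> hol_rel c f x.
Proof.
move=> [cx [F Fc dF]] [dx [G Gd fG]]; split=> //; have e := nbhs_singleton dF.
exists (G \o F); first by apply: cdiff_comp => //; rewrite -e.
by apply: filterS2 dF fG => y dy ->; rewrite dy.
Qed.

Lemma hol_rel_post c f x (G : C -> C) : hol_rel c f x -> cdiff G (f x) -> hol_rel c (G \o f) x.
Proof.
move=> [cx [F Fc fF]] Gd; split=> //; have e := nbhs_singleton fF.
exists (G \o F); first by apply: cdiff_comp => //; rewrite -e.
by apply: filterS fF => y /= ->.
Qed.

Lemma hol_rel_near c f g x : hol_rel c f x -> (\forall y \near x, f y = g y) -> hol_rel c g x.
Proof.
by move=> [cx [F Fc fF]] fg; split=> //; exists F => //; apply: filterS2 fF fg => y -> ->.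
Qed.

Lemma hol_rel_id c x : chart_dom c x -> hol_rel c c x.
Proof. by move=> cx; split=> //; exists id; [exact: cdiff_id|near=> y]. Unshelve. all: end_near. Qed.

Lemma hol_rel_cont c f x : is_chart c -> hol_rel c f x -> continuous_at x f.
Proof.
move=> [_ _ cc _] [cx [F /cdiff_cont[Fc] fF]].
apply: (@continuous_at_near _ _ (F \o c) f x [set y | f y = F (c y)]) => //.
exact: (@continuous_comp _ _ _ c F x (cc x cx) Fc).
Qed.

Lemma through_hol_rel c (D : set X) f x : open D -> D x -> chart_dom c x -> holomorphic_through c D f -> hol_rel c f x.
Proof.
move=> oD Dx cx [F [Fd Ff]]; split=> //; exists F.
  by apply/cdiffP; apply: Fd; exists x.
by apply: filterS (open_nbhs_nbhs (conj oD Dx)) => y /Ff.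
Qed.

(** Injectivity of the chart allows the local expressions to be glued. *)
Lemma hol_rel_through c (D : set X) f : is_chart c -> open D -> D `<=` chart_dom c ->
  (forall x, D x -> hol_rel c f x) -> holomorphic_through c D f.
Proof.
move=> [od ci cc co] oD Dc H.
have [F FP] : exists F : C -> C, forall x, D x -> F (c x) = f x.
  have /choice[F FP] v : exists w, forall x, D x -> c x = v -> f x = w.
    have [[x0 [D0 e0]]|no] := pselect (exists x0, D x0 /\ c x0 = v); last first.
      by exists 0 => x Dx e; exfalso; apply: no; exists x.
    by exists (f x0) => x Dx e; congr f; apply: ci; rewrite ?inE ?e //; exact: Dc.
  by exists F => x Dx; apply/esym/FP.
exists F; split=> // _ [x Dx <-]; apply/cdiffP; have [cx [G Gd fG]] := H x Dx.
apply: cdiff_near Gd; have [N0 [oN0 Nx NN]] : exists N0, [/\ open N0, N0 x & forall y, N0 y -> f y = G (c y)].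
  have : nbhs x [set y | f y = G (c y)] by exact: fG.
  by rewrite nbhsE => -[N0 [oN0 Nx] NN]; exists N0.
have o1 : open (c @` (N0 `&` D)) by apply: co => [|y [_ /Dc]//]; exact: openI.
have : nbhs (c x) (c @` (N0 `&` D)) by apply: open_nbhs_nbhs; split=> //; exists x.
by apply: filterS => _ [y [Ny Dy] <-]; rewrite FP // NN.
Qed.

(** By [hol_injective_inverse]: an injective function which is holomorphic in
    c is a coordinate in which c is holomorphic. *)
Lemma hol_rel_inv c d (D : set X) x : is_chart c -> is_chart d -> open D -> D x -> D `<=` chart_dom c -> D `<=` chart_dom d ->
  (forall y, D y -> hol_rel c d y) -> hol_rel d c x.
Proof.
move=> cc cd oD Dx Dc Dd H; have [F [Fd FP]] := hol_rel_through cc oD Dc H.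
have [odc ci ccc coc] := cc; have [odd di cdd cod] := cd.
have oO : open (c @` D) by apply: coc.
have [g gP] : exists g : C -> C, forall y, D y -> g (d y) = c y.
  have /choice[g gP] v : exists w, forall y, D y -> d y = v -> c y = w.
    have [[x0 [D0 e0]]|no] := pselect (exists x0, D x0 /\ d x0 = v); last first.
      by exists 0 => y Dy e; exfalso; apply: no; exists y.
    by exists (c x0) => y Dy e; congr (c _); apply: di; rewrite ?inE ?e //; exact: Dd.
  by exists g => y Dy; apply/esym/gP.
split; first exact: Dd.
have Fd' z : (c @` D) z -> cdiff F z by move=> h; apply/cdiffP; exact: Fd.
have gF z : (c @` D) z -> g (F z) = z by move=> [y Dy <-]; rewrite FP // gP.
have [_ gd] := hol_injective_inverse oO Fd' gF (ex_intro2 _ _ x Dx erefl).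
exists g; first by rewrite -FP.
by apply: filterS (open_nbhs_nbhs (conj oD Dx)) => y /gP.
Qed.

Lemma hol_rel_compatible c d : is_chart c -> is_chart d ->
  (forall x, chart_dom c x -> chart_dom d x -> hol_rel c d x) -> compatible c d.
Proof.
move=> cc cd H; have oD : open (chart_dom c `&` chart_dom d).
  by case: cc cd => oc _ _ _ [od _ _ _]; exact: openI.
split; apply: hol_rel_through => //.
- by move=> x [cx dx]; exact: H.
- move=> x [cx dx]; apply: (hol_rel_inv cc cd oD) => // y [cy dy]; exact: H.
Qed.

Lemma compatible_hol_rel c d x : is_chart c -> is_chart d -> compatible c d ->
  chart_dom c x -> chart_dom d x -> hol_rel c d x.
Proof.
move=> [oc _ _ _] [od _ _ _] [h _] cx dx.
by apply: (through_hol_rel _ _ _ h) => //; exact: openI.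
Qed.

End RelativeHolomorphy.

Section HolFun.
Variable R : realType.
Local Notation C := (R[i]^o).

Lemma hol_rel_fun_at (X : surface R) (W : X -> C) c (V : set X) x : atlas X c -> is_chart c -> open V -> V x ->
  V `<=` chart_dom c -> (forall y, V y -> hol_rel c W y) -> hol_fun_at W x.
Proof.
move=> ac cc oV Vx Vc H; have [F [Fd FP]] := hol_rel_through cc oV Vc H.
have [od ci ccc co] := cc; have oO : open (c @` V) by apply: co.
have [r r0 hr] := (openC _).1 oO (c x) (ex_intro2 _ _ x Vx erefl).
exists c, F, r; split=> //; first exact: Vc.
- by move=> v /hr cv; apply/cdiffP; exact: Fd.
- move=> y cy /hr[z Vz e]; have -> : y = z by apply: ci; rewrite ?inE //; exact: Vc.
  by rewrite FP.
Qed.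

Lemma model_hol_rel (X : surface R) (W : X -> C) (f : X -> C) x s r n c :
  model W x s r n -> (forall d, atlas X d -> is_chart d) ->
  (forall d e, atlas X d -> atlas X e -> compatible d e) ->
  atlas X c -> forall v, disc 0 r v -> chart_dom c (s v) -> hol_rel c f (s v) -> cdiff (f \o s) v.
Proof.
move=> [[[r0 n0] _ sc _ _] _ [d ad dP]] ac cp acc v vr cv fv.
have [dv ds] := dP v vr.
have [_ [F Fd fF]] : hol_rel d f (s v).
  apply: hol_rel_comp fv; apply: compatible_hol_rel => //; [exact: ac|exact: ac|exact: cp].
apply: (@cdiff_near R (F \o (d \o s))); last exact: cdiff_comp.
have fF' : nbhs (s v) [set y | f y = F (d y)] by exact: fF.
have /nbhsC[q q0 hq] := sc v vr _ fF'.
by apply/nbhsC; exists q => // u /hq /= ->.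
Qed.
End HolFun.

(** * Quotient surfaces, the half-plane, the sphere *)

Lemma hol_rel_map (R : realType) (X Y : topologicalType) (c : chart R X) (d : chart R Y) (g : X -> Y) (f : Y -> R[i]^o) x :
  continuous_at x g -> hol_rel c (d \o g) x -> hol_rel d f (g x) -> hol_rel c (f \o g) x.
Proof.
move=> gc [cx [M Md gM]] [_ [F Fd fF]]; split=> //; have e := nbhs_singleton gM.
exists (F \o M); first by apply: cdiff_comp => //; rewrite -e.
have h : nbhs x (g @^-1` [set y | f y = F (d y)]) by apply: gc; exact: fF.
by apply: filterS2 h gM => y /= -> ->.
Qed.

(** An injective holomorphic function is open, by [hol_injective_inverse]. *)
Lemma is_chart_of_hol (R : realType) (X : topologicalType) (d : chart R X) : open (chart_dom d) -> set_inj (chart_dom d) d ->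
  (forall y, chart_dom d y -> exists v (D : set X), [/\ is_chart v, open D, D y, D `<=` chart_dom v &
     forall z, D z -> chart_dom d z /\ hol_rel v d z]) -> is_chart d.
Proof.
move=> od di H; split=> //.
  move=> y /H[v [D [cv oD Dy Dv DP]]]; exact: hol_rel_cont cv (DP y Dy).2.
move=> U oU Ud; apply/openC => _ [y Uy <-]; have [v [D [cv oD Dy Dv DP]]] := H y (Ud y Uy).
have [_ vi _ cov] := cv; have oUD : open (U `&` D) by exact: openI.
have UDv : U `&` D `<=` chart_dom v by move=> z [_ /Dv].
have [F [Fd FP]] := hol_rel_through cv oUD UDv (fun z h => (DP z h.2).2).
have oO : open (v @` (U `&` D)) by exact: cov.
have [g gP] : exists g : R[i]^o -> R[i]^o, forall z, (v @` (U `&` D)) z -> g (F z) = z.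
  exists (fun u => v (xget y [set z | (U `&` D) z /\ d z = u])) => _ [z zUD <-].
  rewrite FP //; have [h e] := @xgetI _ y [set z' | (U `&` D) z' /\ d z' = d z] z (conj zUD erefl).
  by congr (v _); apply: di => //; rewrite inE; apply: Ud; [exact: h.1|exact: zUD.1].
have Fd' z : (v @` (U `&` D)) z -> cdiff F z by move=> h; apply/cdiffP; exact: Fd.
have vy : (v @` (U `&` D)) (v y) by exists y.
have [nF _] := hol_injective_inverse oO Fd' gP vy.
have := nF; rewrite FP // => /nbhsC[e e0 he]; exists e => // u /he[_ [z [Uz Dz] <-] <-].
by exists z => //; rewrite FP.
Qed.

Section Quotients.
Variables (R : realType) (X : surface R) (N : groupClosed (selfbij X)).
Hypothesis Ncont : forall g, g \in N -> continuous g.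
Local Notation q := (orbit_proj N).

Lemma orbit_projE x y : q x = q y <-> exists2 g, g \in N & g x = y.
Proof.
split=> [/eqquotP/asboolP//|H]; apply/eqquotP; exact/asboolP.
Qed.

Lemma orbit_projN g x : g \in N -> q (g x) = q x.
Proof. by move=> gN; apply/esym/orbit_projE; exists g. Qed.

Lemma orbit_proj_surj (t : orbit_space N) : exists x, q x = t.
Proof. by exists (repr t); rewrite /orbit_proj reprK. Qed.

Lemma orbit_proj_cont : continuous (q : X -> orbit_space N).
Proof. exact: pi_continuous. Qed.

Lemma open_orbit_space (V : set (orbit_space N)) : open (q @^-1` V) -> open V.
Proof. by []. Qed.

Lemma orbit_proj_open (U : set X) : open U -> open (q @` U : set (orbit_space N)).
Proof.
move=> oU; apply: open_orbit_space; rewrite openE => x [u Uu /orbit_projE[g gN ge]].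
have gV : g^-1%g \in N by rewrite gpredV.
have cg : continuous_at x (bij_inv g) by exact: (Ncont gV).
have e : bij_inv g x = u by rewrite -ge bij_funK.
have : nbhs x (bij_inv g @^-1` U) by apply: cg; rewrite e; exact: open_nbhs_nbhs.
apply: filterS => y /= Uy; exists (bij_inv g y) => //.
by rewrite -{2}[y](bij_invK g) orbit_projN.
Qed.

Lemma orbit_proj_nbhs x (V : set X) : nbhs x V -> nbhs (q x : orbit_space N) (q @` V).
Proof.
rewrite nbhsE => -[V0 [oV0 Vx] VV]; have o := orbit_proj_open oV0.
have : nbhs (q x : orbit_space N) (q @` V0) by apply: open_nbhs_nbhs; split=> //; exists x.
by apply: filterS => _ [y /VV Vy <-]; exists y.
Qed.

Lemma orbit_space_connected : connected [set: X] -> connected [set: orbit_space N].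
Proof.
move=> cX; have -> : [set: orbit_space N] = q @` [set: X].
  by apply/seteqP; split=> // t _; have [x <-] := orbit_proj_surj t; exists x.
apply: connected_continuous_connected => //; apply: continuous_subspaceT; exact: orbit_proj_cont.
Qed.

Lemma orbit_factor (Y : Type) (f : X -> Y) : (forall g x, g \in N -> f (g x) = f x) ->
  exists F : orbit_space N -> Y, forall x, F (q x) = f x.
Proof.
move=> fN; exists (fun t => f (repr t)) => x.
have /orbit_projE[g gN <-] : q x = q (repr (q x)) by rewrite /orbit_proj reprK.
by rewrite fN.
Qed.

Lemma orbit_factor_cont (Y : topologicalType) (f : X -> Y) (F : orbit_space N -> Y) :
  (forall x, F (q x) = f x) -> continuous f -> continuous F.
Proof.
move=> Ff fc; apply/quotient_continuous; suff -> : F \o q = f by [].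
by apply/funext => x; exact: Ff.
Qed.

Lemma quotient_bij (g : selfbij X) : (forall h, h \in N -> (g * h * g^-1)%g \in N) ->
  (forall h, h \in N -> (g^-1 * h * g)%g \in N) ->
  exists b : selfbij (quotient_surface N), forall x, b (q x) = q (g x).
Proof.
move=> n1 n2.
have [|F FP] := @orbit_factor _ (fun x => q (g x)).
  move=> h x hN; apply/esym/orbit_projE; exists (g * h * g^-1)%g; first exact: n1.
  by change (g (h (bij_inv g (g x))) = g (h x)); rewrite bij_funK.
have [|F' FP'] := @orbit_factor _ (fun x => q (bij_inv g x)).
  move=> h x hN; apply/esym/orbit_projE; exists (g^-1 * h * g)%g; first exact: n2.
  by change (bij_inv g (h (g (bij_inv g x))) = bij_inv g (h x)); rewrite bij_invK.
have FK : cancel F F' by move=> t; have [x <-] := orbit_proj_surj t; rewrite FP FP' bij_funK.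
have FK' : cancel F' F by move=> t; have [x <-] := orbit_proj_surj t; rewrite FP' FP bij_invK.
by exists (SelfBij FK FK').
Qed.
End Quotients.

Section FactorGroup.
Variables (R : realType) (X : surface R) (G N : groupClosed (selfbij X)).

(** [factor_group] as a boolean predicate, in order to make it a subgroup. *)
Definition factor_pred : {pred selfbij (quotient_surface N)} := fun b => `[< factor_group G N b >].
Fact factor1 : 1%g \in factor_pred.
Proof. by apply/asboolP; exists 1%g => //; exact: gpred1. Qed.
Fact factorM : mulg_closed factor_pred.
Proof.
move=> b b' /asboolP[g gG bg] /asboolP[h hG bh]; apply/asboolP; exists (g * h)%g; first exact: gpredM.
by move=> x; change (b (b' (orbit_proj N x)) = orbit_proj N (g (h x))); rewrite bh bg.
Qed.
Fact factorV : invg_closed factor_pred.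
Proof.
move=> b /asboolP[g gG bg]; apply/asboolP; exists g^-1%g; first by rewrite gpredV.
move=> x; apply: (can_inj (@bij_funK _ b)); rewrite bg.
by change (b (bij_inv b (orbit_proj N x)) = orbit_proj N (g (bij_inv g x))); rewrite !bij_invK.
Qed.
HB.instance Definition _ := isMulClosed.Build _ factor_pred factorM.
HB.instance Definition _ := isMul1Closed.Build _ factor_pred factor1.
HB.instance Definition _ := isInvClosed.Build _ factor_pred factorV.
Definition factor_closed : groupClosed (selfbij (quotient_surface N)) := factor_pred.
Lemma factor_closedP b : b \in factor_closed <-> factor_group G N b.
Proof. by split=> /asboolP. Qed.
End FactorGroup.

Section HalfPlane.
Variable R : realType.
Local Notation C := (R[i]^o).
Local Notation HH := (upper_half_plane R).
Definition halfplane : set C := [set z : C | 0 < complex.Im z].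

Lemma HH_val (x : HH) : halfplane (set_val x).
Proof. by case: x => z hz; exact: (set_mem hz). Qed.

Lemma HH_ex (z : C) : halfplane z -> exists x : HH, set_val x = z.
Proof. by move=> h; exists (exist _ z (mem_set h)). Qed.

Fact halfplane_i : halfplane (0 +i* 1).
Proof. by rewrite /halfplane /= ltr01. Qed.
Definition HHi : HH := exist _ (0 +i* 1 : C) (mem_set halfplane_i).

(** The inverse of the inclusion of the half-plane in C, extended to a total
    function with the value i elsewhere. *)
Definition eta (z : C) : HH := xget HHi [set x : HH | set_val x = z].

Lemma etaK z : halfplane z -> set_val (eta z) = z.
Proof. by move=> /HH_ex[x e]; exact: (@xgetI _ HHi [set x : HH | set_val x = z] x e). Qed.

Lemma HH_val_inj (x y : HH) : set_val x = set_val y -> x = y.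
Proof. exact: val_inj. Qed.

Lemma eta_val (x : HH) : eta (set_val x) = x.
Proof. by apply: HH_val_inj; apply: etaK; exact: HH_val. Qed.

Lemma HH_val_cont : continuous (set_val : HH -> C).
Proof. exact: initial_continuous. Qed.

Lemma HH_openP (U : set HH) : open U -> exists2 V : set C, open V & U = set_val @^-1` V.
Proof. by move=> [V oV <-]; exists V. Qed.

Lemma halfplane_open : open halfplane.
Proof.
apply/openC => z z0; exists (complex.Im z) => // u uz.
have := le_lt_trans (Im_le_nC (u - z)) uz; rewrite ImB ltr_norml => /andP[+ _].
by rewrite /halfplane /=; lra.
Qed.

Lemma halfplane_convex : convexC halfplane.
Proof.
have -> : halfplane = [set w : C | 0 < 0 * complex.Re w + 1 * complex.Im w]; last exact: convex_half.
by apply/seteqP; split=> z; rewrite /halfplane /= mul0r add0r mul1r.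
Qed.

Lemma eta_cont z : halfplane z -> continuous_at z eta.
Proof.
move=> hz N0; rewrite nbhsE => -[U [oU Uz] UN]; have [V oV eU] := HH_openP oU.
have : nbhs z (V `&` halfplane).
  apply: open_nbhs_nbhs; split; first by apply: openI => //; exact: halfplane_open.
  by split=> //; rewrite eU /= etaK in Uz.
by apply: filterS => u [Vu hu]; apply: UN; rewrite eU /= etaK.
Qed.

Lemma HH_image_open (U : set HH) : open U -> open (set_val @` U : set C).
Proof.
move=> /HH_openP[V oV ->]; suff -> : set_val @` (set_val @^-1` V : set HH) = V `&` halfplane.
  by apply: openI => //; exact: halfplane_open.
apply/seteqP; split=> [_ [x Vx <-]|z [Vz hz]]; first by split=> //; exact: HH_val.
by exists (eta z); rewrite /= etaK.
Qed.

Definition chartH : chart R HH := Chart (set_val @^-1` [set: C]) (@id C \o set_val).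
Lemma atlasH (c : chart R HH) : atlas HH c <-> c = chartH.
Proof. by split=> [[d -> ->]|->] //; exists (Chart [set: C] id). Qed.

Lemma is_chartH : is_chart chartH.
Proof.
split.
- exact: openT.
- by move=> x y _ _; exact: HH_val_inj.
- by move=> x _; exact: HH_val_cont.
- by move=> U oU _; exact: HH_image_open.
Qed.

Lemma HH_hausdorff : hausdorff_space HH.
Proof.
apply/hausdorffP => x y xy.
have [A [B [oA oB Ax By AB]]] := (hausdorffP _).1 (@hausdorffC R) (set_val x) (set_val y) (fun e => xy (HH_val_inj e)).
exists (set_val @^-1` A), (set_val @^-1` B); split=> //.
- by exists A.
- by exists B.
- by move=> z; exact: AB.
Qed.

Lemma HH_connected : connected [set: HH].
Proof.
move=> P [x0 Px0] [U oU eU] [V cV eV]; apply/seteqP; split=> // y _.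
rewrite setTI in eU; rewrite setTI in eV.
have lc (Q : set HH) x : open Q -> Q x -> nbhs (set_val x) [set z | halfplane z -> Q (eta z)].
  move=> oQ Qx; have : continuous_at (set_val x) eta by apply: eta_cont; exact: HH_val.
  move=> /(_ Q); rewrite eta_val => /(_ (open_nbhs_nbhs (conj oQ Qx))).
  move=> /nbhsC[e e0 he].
  apply/nbhsC; exists e => // u uw _; exact: (he u uw).
have oP : open P by rewrite eU.
have oPc : open (~` P) by rewrite eV; exact: closed_openC.
have H z : halfplane z -> exists2 e : R, 0 < e & forall w, nC (w - z) < e ->
    ((halfplane w /\ P (eta w)) <-> (halfplane z /\ P (eta z))).
  move=> hz; have /openC/(_ z hz)[e' e'0 he'] := halfplane_open.
  have [Pz|nPz] := pselect (P (eta z)).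
    have := lc _ _ oP Pz; rewrite etaK // => /nbhsC[e e0 he].
    exists (Num.min e e'); first by rewrite lt_min e0.
    move=> w; rewrite lt_min => /andP[/he h /he' hw]; split=> // _; split=> //; exact: h.
  have := lc _ _ oPc nPz; rewrite etaK // => /nbhsC[e e0 he].
  exists (Num.min e e'); first by rewrite lt_min e0.
  move=> w; rewrite lt_min => /andP[/he h /he' hw]; split=> -[_ Pw]; exfalso; [exact: h Pw|exact: nPz].
have := lc_convex halfplane_convex H (HH_val x0) (HH_val y); rewrite !eta_val => -[h _].
by have [] := h (conj (HH_val x0) Px0).
Qed.

Lemma moebius_hol (A : 'M[R]_2) z : \det A = 1 -> halfplane z -> cdiff (moebius A : C -> C) z.
Proof.
move=> dA hz; apply: (@cdiffM R (fun z => (A 0 0)%:C * z + (A 0 1)%:C) (fun z => ((A 1 0)%:C * z + (A 1 1)%:C)^-1)).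
  by apply: cdiffD; [apply: cdiffM; [exact: cdiff_cst|exact: cdiff_id]|exact: cdiff_cst].
apply: (@cdiffV R (fun z => (A 1 0)%:C * z + (A 1 1)%:C)).
  by apply: cdiffD; [apply: cdiffM; [exact: cdiff_cst|exact: cdiff_id]|exact: cdiff_cst].
apply/eqP => e; have eI : A 1 0 * complex.Im z = 0.
  by have := congr1 (fun u : R[i] => complex.Im u) e; case: (z) => a b /=; rewrite mul0r !addr0.
have c0 : A 1 0 = 0 by apply: (mulIf (x := complex.Im z)); rewrite ?mul0r // gt_eqF.
have d0 : A 1 1 = 0.
  by move: e; rewrite c0 mul0r add0r => /(congr1 (fun u : R[i] => complex.Re u)).
have A1 j : A 1 j = 0.
  by case: (unliftP 0 j) => [j'|] -> //; rewrite (ord1 j') -[RHS]d0; congr (A _ _); exact: val_inj.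
move: dA; rewrite (expand_det_row A 1) big1 => [/esym/eqP|j _]; first by rewrite oner_eq0.
by rewrite A1 mul0r.
Qed.

Lemma PSL2_hol (g : selfbij HH) x : PSL2 g -> hol_rel chartH (set_val \o g) x.
Proof.
move=> [A dA gA]; split=> //; exists (moebius A); first by apply: moebius_hol => //; exact: HH_val.
by near=> y; rewrite /= gA.
Unshelve. all: end_near. Qed.

Lemma PSL2_cont (g : selfbij HH) : PSL2 g -> continuous g.
Proof.
move=> gP x; have -> : (g : HH -> HH) = eta \o (set_val \o g) by apply/funext => y /=; rewrite eta_val.
apply: continuous_comp; first exact: (hol_rel_cont is_chartH (PSL2_hol x gP)).
by apply: eta_cont; exact: HH_val.
Qed.

Lemma hol_rel_PSL2 (f : HH -> C) (g : selfbij HH) x : PSL2 g -> hol_rel chartH f (g x) -> hol_rel chartH (f \o g) x.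
Proof.
by move=> gP; apply: hol_rel_map; [exact: PSL2_cont|exact: PSL2_hol].
Qed.
End HalfPlane.

Section Sphere.
Variable R : realType.
Local Notation C := (R[i]^o).
Local Notation sphere := (riemann_sphere R).

Lemma sphere_open0 : open [set x : sphere | x <> None].
Proof.
have -> : [set x : sphere | x <> None] = Some @` [set: C].
  by apply/seteqP; split=> [[z|] //= _|_ [z _ <-] //]; exists z.
exact: (@one_point_compactification_open_some C setT openT).
Qed.

Lemma sphere_openoo : open [set x : sphere | x <> Some 0].
Proof.
rewrite openE => -[z|] /= zx.
  have z0 : z != 0 by apply/eqP => e; apply: zx; rewrite e.
  apply: (@filterS _ (nbhs (Some z : sphere)) _ (Some @` [set u : C | u != 0])).
    by move=> _ [u /eqP u0 <-] [].
  apply: (@one_point_compactification_some_nbhs C); apply/nbhsC; exists (nC z); first by rewrite nC_gt0.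
  by move=> u; apply: contraTneq => ->; rewrite sub0r nCN ltxx.
exists [set (0 : C)]; first by split; [exact: compact_set1|exact: accessible_closed_set1 (hausdorff_accessible (@hausdorffC R)) _].
by move=> x [[u u0 <-] [] //|-> //].
Qed.

Variable B : set sphere.
Variable c0 : sphere.
Hypothesis Bc0 : limit_point B c0.
Local Notation Y := (open_subsurface (~` limit_point B)).

(** The Moebius transformation y |-> 1 / (y - c0), or the identity when c0 is
    the point at infinity: it maps the sphere without c0 onto the plane. *)
Definition to_plane (y : sphere) : C :=
  match c0, y with
  | Some a, Some z => ((z : R[i]) - a)^-1
  | Some _, None => 0
  | None, _ => odflt 0 y
  end.

Lemma to_plane_inj y y' : y <> c0 -> y' <> c0 -> to_plane y = to_plane y' -> y = y'.
Proof.
rewrite /to_plane; case: c0 => [a|]; case: y y' => [z|] [z'|] //= n1 n2.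
- by move=> /invr_inj/addIr ->.
- move/eqP; rewrite invr_eq0 subr_eq0 => /eqP e; by exfalso; apply: n1; rewrite e.
- move/esym/eqP; rewrite invr_eq0 subr_eq0 => /eqP e; by exfalso; apply: n2; rewrite e.
- by move=> ->.
Qed.

(** The coordinate on the base given by [to_plane]; it is defined on all of Y
    because c0 is a limit point of B. *)
Definition planeY (y : Y) : C := to_plane (set_val y).
Lemma Y_neq (y : Y) : set_val y <> c0.
Proof. case: y => y hy e; apply: (set_mem hy); have {}e : y = c0 by exact: e.
by rewrite e. Qed.

Lemma planeY_inj : injective planeY.
Proof. by move=> y y' /to_plane_inj h; apply: val_inj; apply: h; exact: Y_neq. Qed.

Lemma planeY_hol_rel (w : chart R Y) y : holomorphic_chart w -> chart_dom w y -> hol_rel w planeY y.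
Proof.
move=> [cw wd] wy; have [ow _ _ _] := cw.
have [e0|nN] := pselect (set_val y = None).
  pose d := @Chart R Y (set_val @^-1` [set x : sphere | x <> Some 0]) (@sphere_chartoo R \o set_val).
  have ad : atlas Y d by exists (@sphere_chartoo R) => //; right.
  have od : open (chart_dom d) by exists [set x : sphere | x <> Some 0] => //; exact: sphere_openoo.
  have dy : chart_dom d y by rewrite /d /= e0.
  have h : hol_rel w d y by apply: (through_hol_rel _ _ _ (wd d ad).1) => //; exact: openI.
  have nd : nbhs y (chart_dom d) by exact: open_nbhs_nbhs.
  move: (@Y_neq); rewrite /planeY /to_plane; case: c0 => [a|] ne; last by have := ne y; rewrite e0.
  pose G (u : C) : C := (u : R[i]) / (1 - a * u).
  apply: (@hol_rel_near _ _ _ (G \o d)); last first.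
    apply: filterS nd => y'; rewrite /d /G /=; have := ne y'; case: (set_val y') => [z|] za z0 /=.
      have zn : (z : R[i]) != 0 by apply/eqP => e; apply: z0; rewrite e.
      have zan : (z : R[i]) - a != 0 by rewrite subr_eq0; apply/eqP => e; apply: za; rewrite e.
      have -> : 1 - a * (z : R[i])^-1 = (z - a) / z by rewrite mulrBl divff.
      by rewrite invf_div mulrA mulVf // mul1r.
    by rewrite mul0r.
  apply: hol_rel_post h _; have -> : d y = 0 by rewrite /d /= e0.
  apply: (@cdiffM R id (fun u => (1 - a * u)^-1)); first exact: cdiff_id.
  apply: (@cdiffV R (fun u => 1 - a * u)); last by rewrite mulr0 subr0 oner_neq0.
  apply: cdiffD; first exact: cdiff_cst.
  by apply: cdiffN; apply: cdiffM; [exact: cdiff_cst|exact: cdiff_id].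
pose d := @Chart R Y (set_val @^-1` [set x : sphere | x <> None]) (@sphere_chart0 R \o set_val).
have ad : atlas Y d by exists (@sphere_chart0 R) => //; left.
have od : open (chart_dom d) by exists [set x : sphere | x <> None] => //; exact: sphere_open0.
have dy : chart_dom d y by exact: nN.
have h : hol_rel w d y by apply: (through_hol_rel _ _ _ (wd d ad).1) => //; exact: openI.
have nd : nbhs y (chart_dom d) by exact: open_nbhs_nbhs.
move: (@Y_neq); rewrite /planeY /to_plane; case: c0 => [a|] ne; last exact: h.
apply: (@hol_rel_near _ _ _ ((fun u : C => ((u : R[i]) - a)^-1 : C) \o d)); last first.
  by apply: filterS nd => y'; rewrite /d /=; case: (set_val y').
apply: hol_rel_post h _; apply: (@cdiffV R (fun u => u - a)).
  by apply: cdiffD; [exact: cdiff_id|exact: cdiff_cst].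
rewrite subr_eq0; apply/eqP; move: nN (ne y); rewrite /d /=; case: (set_val y) => [z|] //= _ za e.
by apply: za; rewrite e.
Qed.

(** That holomorphic charts cover Y, which a branched covering of Y provides,
    replaces the openness of the complement of the limit points. *)
Lemma planeY_chart (W0 : C) (rho : R) : 0 < rho ->
  (forall y : Y, exists2 w : chart R Y, holomorphic_chart w & chart_dom w y) ->
  @holomorphic_chart R Y (Chart [set y : Y | nC (planeY y - W0) < rho] (fun y => rho^-1%:C * (planeY y - W0) : C)).
Proof.
move=> rho0 charts; set w := Chart _ _.
have rn : (rho^-1%:C : R[i]) != 0 by rewrite eq_complex /= eqxx andbT gt_eqF // invr_gt0.
have hol v y : holomorphic_chart v -> chart_dom v y -> hol_rel v w y.
  move=> hv vy; apply: (@hol_rel_post _ _ _ planeY _ (fun u : C => rho^-1%:C * (u - W0))); first exact: planeY_hol_rel.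
  by apply: cdiffM; [exact: cdiff_cst|apply: cdiffD; [exact: cdiff_id|exact: cdiff_cst]].
have pc : continuous planeY.
  by move=> y; have [v hv vy] := charts y; apply: hol_rel_cont (planeY_hol_rel hv vy); exact: hv.1.
have wc y : continuous_at y w.
  by have [v hv vy] := charts y; apply: hol_rel_cont (hol v y hv vy); exact: hv.1.
have wi : injective w by move=> y y' /= /(mulfI rn)/addIr/planeY_inj.
have ow : open (chart_dom w).
  rewrite openE => y /= wy; have : nbhs (planeY y) (disc W0 rho) by apply: open_nbhs_nbhs; split=> //; exact: open_disc.
  by move=> /(pc y).
have cw : is_chart w.
  apply: is_chart_of_hol => // [y y' _ _|y wy]; first exact: wi.
  have [v hv vy] := charts y; have [ov _ _ _] := hv.1.
  exists v, (chart_dom v `&` chart_dom w); split=> //; [exact: hv.1|exact: openI|].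
  by move=> z [vz wz]; split=> //; exact: hol.
split=> // d ad.
have od : open (chart_dom d).
  by case: ad => d0 [->|->] ->; [exists [set x : sphere | x <> None] => //; exact: sphere_open0|
    exists [set x : sphere | x <> Some 0] => //; exact: sphere_openoo].
have oD : open (chart_dom w `&` chart_dom d) by exact: openI.
have di : set_inj (chart_dom d) d.
  case: ad => d0 [->|->] -> y y' /set_mem /= + /set_mem /= +.
    by case ey : (set_val y) => [z|] //; case ey' : (set_val y') => [z'|] //= _ _ zz;
      apply: val_inj; rewrite [LHS]ey [RHS]ey' zz.
  case ey : (set_val y) => [z|]; case ey' : (set_val y') => [z'|] /= n n' zz; apply: val_inj; rewrite [LHS]ey [RHS]ey' //.
  - by move/invr_inj: zz => ->.
  - by move/eqP: zz; rewrite invr_eq0 => /eqP z0; case: n; rewrite z0.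
  - by move/esym/eqP: zz; rewrite invr_eq0 => /eqP z0; case: n'; rewrite z0.
have vd v y : holomorphic_chart v -> chart_dom v y -> chart_dom d y -> hol_rel v d y.
  move=> hv vy dy; have [ov _ _ _] := hv.1.
  by apply: (through_hol_rel _ _ _ (hv.2 d ad).1) => //; exact: openI.
have cd : is_chart d.
  apply: is_chart_of_hol => // y dy; have [v hv vy] := charts y; have [ov _ _ _] := hv.1.
  exists v, (chart_dom v `&` chart_dom d); split=> //; [exact: hv.1|exact: openI|].
  by move=> z [vz dz]; split=> //; exact: vd.
apply: hol_rel_compatible => // y wy dy; have [v hv vy] := charts y; have [ov _ _ _] := hv.1.
apply: (hol_rel_comp _ (vd v y hv vy dy)); apply: (hol_rel_inv hv.1 cw (D := chart_dom v `&` chart_dom w)) => //.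
- exact: openI.
- by move=> z [vz _]; exact: hol.
Qed.
End Sphere.

(** * The planar coordinate on S and on the half-plane *)

Section Base.
Variables (R : realType) (k : nat).
Local Notation C := (R[i]^o).
Local Notation HH := (upper_half_plane R).
Local Notation sphere := (riemann_sphere R).
Variables (S : surface R) (H : groupClosed (selfbij S)) (Gamma : groupClosed (selfbij HH)).
Variables (B : set sphere) (c0 : sphere).
Local Notation Y := (open_subsurface (~` limit_point B)).
Variables (p : S -> Y) (psi : quotient_surface Gamma -> quotient_surface H).
Hypothesis k1 : (1 < k)%N.
Hypothesis RS : riemann_surface S.
Hypothesis Bc0 : limit_point B c0.
Hypothesis Haut : [set` H] `<=` @aut_surface R S.
Hypothesis pG : galois_branched_covering p [set` H].
Hypothesis pB : branch_values p = set_val @^-1` B.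
Hypothesis pk : forall x, B (set_val (p x)) -> local_degree p x k.
Hypothesis GP : [set` Gamma] `<=` @PSL2 R.
Hypothesis psiB : biholomorphism psi.

Local Notation qG := (orbit_proj Gamma).
Local Notation qH := (orbit_proj H).

Lemma HcontS h : h \in H -> continuous h.
Proof. by move=> /Haut[[]]. Qed.
Lemma GcontH g : g \in Gamma -> continuous g.
Proof. by move=> /GP; exact: PSL2_cont. Qed.

Definition WS (x : S) : C := planeY c0 (p x).

Let atlasS c : atlas S c -> is_chart c. Proof. by case: RS => _ _ + _ _; apply. Qed.

Lemma WS_fibre x x' : WS x = WS x' <-> exists2 h, h \in H & h x = x'.
Proof.
have [pb pd pt] := pG; split=> [/(planeY_inj Bc0)/pt[h hH e]|[h hH <-]]; first by exists h.
have : deck_group p h by rewrite pd.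
by move=> [_ ph]; rewrite /WS ph.
Qed.

Lemma Y_charts (y : Y) : exists2 w : chart R Y, holomorphic_chart w & chart_dom w y.
Proof. by have [[_ _ /(_ y)[w [hw wy _ _ _]]] _ _] := pG; exists w. Qed.

Lemma local_degree_wmodel x n : (0 < n)%N -> local_degree p x n -> exists (s : C -> S) (r : R), wmodel WS x s r n.
Proof.
move=> n0 [z [w [[[cz _] [cw _]] [zx z0] [wx w0] zw]]].
apply: (wmodel_of_chart cz zx z0 n0) => y y' zy zy'.
have [wy ey] := zw y zy; have [wy' ey'] := zw y' zy'; rewrite -ey -ey'.
split=> [/(planeY_inj Bc0) -> //|e]; have [_ wi _ _] := cw.
by rewrite /WS (wi (p y) (p y')) ?inE.
Qed.

Lemma S_branch x : exists z w n, [/\ (0 < n)%N, holomorphic_chart z, chart_dom z x,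
  holomorphic_chart w & forall x', chart_dom z x' -> chart_dom w (p x') /\ w (p x') = (z x' : R[i]) ^+ n] /\
  z x = 0 /\ w (p x) = 0.
Proof.
have [[_ _ /(_ (p x))[w [hw wy w0 _ /(_ x wy)[n [z [n0 hz zd _ zw]]]]]] _ _] := pG.
have zx : chart_dom z x by rewrite zd; apply: connected_component_refl.
exists z, w, n; split; first split=> //.
  by move=> x' zx'; split; [move: zx'; rewrite zd => /connected_component_sub|exact: zw].
split=> //; have := zw x zx; rewrite w0 => /esym/eqP.
by rewrite expf_eq0 n0 /= => /eqP.
Qed.

(** Outside B the local degree is 1 because branch values belong to B. *)
Lemma S_wmodel x : exists (s : C -> S) (r : R) n, wmodel WS x s r n /\
  ((B (set_val (p x)) /\ n = k) \/ (~ B (set_val (p x)) /\ n = 1%N)).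
Proof.
have [bx|nb] := pselect (B (set_val (p x))).
  by have [s [r M]] := local_degree_wmodel (ltnW k1) (pk bx); exists s, r, k; split=> //; left.
have [z [w [n [[n0 hz zx hw zw] [z0 w0]]]]] := S_branch x; have [wx _] := zw x zx.
have ld : local_degree p x n by exists z, w; split.
have [s [r M]] := local_degree_wmodel n0 ld; exists s, r, n; split=> //; right; split=> //.
apply/eqP; rewrite eqn_leq n0 andbT leqNgt; apply/negP => n1; apply: nb.
have : branch_values p (p x) by exists x, n.
by rewrite pB.
Qed.

Let p_cont : continuous p. Proof. by have [[[]]] := pG. Qed.

Lemma WS_hol c x : atlas S c -> chart_dom c x -> hol_rel c WS x.
Proof.
move=> ac cx; have [z [w [n [[n0 hz zx hw zw] [z0 w0]]]]] := S_branch x; have [wx _] := zw x zx.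
have cz : hol_rel c z x.
  have [_ _ _ _ _] := RS; have /hz.2[h1 h2] := ac; have [oz _ _ _] := hz.1; have [oc _ _ _] := atlasS ac.
  by apply: (through_hol_rel _ _ cx h2); [exact: openI|].
apply: (hol_rel_comp cz); apply: (hol_rel_map (d := w)); [exact: p_cont| |exact: (planeY_hol_rel Bc0)].
split=> //; exists (fun u : C => u ^+ n); first by apply: cdiffX; exact: cdiff_id.
have [oz _ _ _] := hz.1.
by apply: filterS (open_nbhs_nbhs (conj oz zx)) => y /zw[].
Qed.

(** [model_exists] applies since W is not constant on any open set, by
    [S_wmodel]. *)
Theorem S_model x : exists s r n, model WS x s r n.
Proof.
have [_ _ _ /(_ x)[c ac cx] _] := RS; have [oc _ _ _] := atlasS ac.
apply: (model_exists atlasS).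
  by apply: (hol_rel_fun_at ac (atlasS ac) oc cx) => // y cy; exact: WS_hol.
move=> [V nV Vc]; have [s [r [n [M _]]]] := S_wmodel x; have [[r0 n0] [s0 _] sc _ sW] := M.
have /nbhsC[e e0 he] : nbhs (0 : C) (s @^-1` V) by apply: sc; [exact: disc_center|rewrite s0].
have m0 : 0 < Num.min e r by rewrite lt_min e0.
have [hm hn] := disc_half m0; have [me mr] : Num.min e r <= e /\ Num.min e r <= r by split; rewrite ge_min lexx ?orbT.
have h1 : disc 0 r (Num.min e r / 2)%:C by exact: lt_le_trans mr.
have c00 := disc_center (0 : C) r0.
have : WS (s (Num.min e r / 2)%:C) = WS (s 0).
  by rewrite s0; apply: Vc; apply: he; exact: lt_le_trans me.
by move/(sW _ _ h1 c00)/eqP; rewrite expr0n gtn_eqF //= expf_eq0 n0 (negPf hn).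
Qed.

Lemma wbar_exists : exists w : quotient_surface H -> C, forall x, w (qH x) = WS x.
Proof. by apply: orbit_factor => h x hH; apply/esym/WS_fibre; exists h. Qed.

(** The planar coordinate on the quotient of S by H. *)
Definition wbar := sval (cid wbar_exists).
Lemma wbarE x : wbar (qH x) = WS x. Proof. exact: (svalP (cid wbar_exists)). Qed.
Lemma wbar_inj : injective wbar.
Proof.
move=> t t'; have [x <-] := orbit_proj_surj t; have [x' <-] := orbit_proj_surj t'.
by rewrite !wbarE => /WS_fibre/orbit_projE.
Qed.

(** The planar coordinate on the half-plane, through the given isomorphism of
    orbifolds. *)
Definition WH (z : HH) : C := wbar (psi (qG z)).

Let psi_inj : injective psi.
Proof. by case: psiB => _ [g [gK _ _]]; exact: can_inj gK. Qed.

Lemma WH_fibre z z' : WH z = WH z' <-> exists2 g, g \in Gamma & g z = z'.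
Proof. by rewrite -orbit_projE; split=> [/wbar_inj/psi_inj|e] //; rewrite /WH e. Qed.

Lemma WHS z x : WH z = WS x <-> psi (qG z) = qH x.
Proof. by rewrite -wbarE; split=> [/wbar_inj|e] //; rewrite /WH e. Qed.

Lemma over_H z : exists x, WS x = WH z.
Proof. by have [x e] := orbit_proj_surj (psi (qG z)); exists x; apply/esym/WHS. Qed.
Lemma over_S x : exists z, WH z = WS x.
Proof.
case: psiB => _ [g [_ gK _]]; have [z e] := orbit_proj_surj (g (qH x)).
by exists z; apply/WHS; rewrite e gK.
Qed.

Lemma nth_root (w : C) n : (0 < n)%N -> exists v : C, v ^+ n = w.
Proof.
case: n => // n _; have [->|w0] := eqVneq w 0; first by exists 0; rewrite expr0n.
have [s [e [e0 sP]]] := root_near n w0; have [h _] := sP w (disc_center _ e0).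
by exists (s w).
Qed.

Lemma disc_pow (v : C) (r : R) n : 0 < r -> (0 < n)%N -> disc 0 (r ^+ n) (v ^+ n) -> disc 0 r v.
Proof.
move=> r0 n0; rewrite /disc /= !subr0 nCX => h; rewrite ltNge; apply/negP => rv.
by move: h; rewrite ltNge le_exp // ltW.
Qed.

(** A chart d of the quotient is, by definition, holomorphic on S, so that
    v |-> d (s v) is holomorphic in a model and factors through v ^+ n. The
    factor f is continuous, and holomorphic off the centre, where n-th roots
    exist; by [removable] it is holomorphic, and [wbar] is its inverse in the
    coordinate d. *)
Lemma wbar_hol d t : atlas (quotient_surface H) d -> chart_dom d t -> hol_rel d wbar t.
Proof.
have [x <-] := orbit_proj_surj t => -[cd hd] dx; have [od di dc _] := cd.
have oD : open (qH @^-1` chart_dom d) by move/continuousP: (@orbit_proj_cont R S H); apply.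
have [s [r [n Mod]]] := S_model x; have [M sW _] := Mod; have [[r0 n0] [s0 sinj] sc sO _] := M.
have /nbhsC[e e0 he] : nbhs (0 : C) (s @^-1` (qH @^-1` chart_dom d)).
  by apply: sc; [exact: disc_center|rewrite s0; exact: open_nbhs_nbhs].
have m0 : 0 < Num.min e r by rewrite lt_min e0.
set r' := Num.min e r in m0 *.
have [me mr] : r' <= e /\ r' <= r by split; rewrite ge_min lexx ?orbT.
have sd v : disc 0 r' v -> chart_dom d (qH (s v)) by move=> h; apply: he; exact: lt_le_trans me.
have sr v : disc 0 r' v -> disc 0 r v by move=> h; exact: lt_le_trans mr.
have [_ _ _ cov cp] := RS.
have dsd v : disc 0 r' v -> cdiff ((d \o qH) \o s) v.
  move=> vr; have [c ac cx] := cov (s v); have [oc _ _ _] := atlasS ac.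
  apply: (model_hol_rel Mod atlasS cp ac (sr _ vr) cx).
  apply: (through_hol_rel (openI oc oD)) (hd c ac) => //; split=> //; exact: sd.
(* f is d as a function of the planar coordinate *)
pose f (u : C) : C := d (qH (xget x [set x' | WS x' = u])).
have fE x' : f (WS x') = d (qH x').
  congr (d _); apply/orbit_projE; apply/WS_fibre.
  exact: (@xgetI _ x [set y | WS y = WS x'] x' erefl).
have fs v : disc 0 r' v -> f (WS x + v ^+ n) = ((d \o qH) \o s) v.
  by move=> vr; rewrite -(sW _ (sr _ vr)) fE.
have rn0 : 0 < r' ^+ n by rewrite exprn_gt0.
have root u : disc (WS x) (r' ^+ n) u -> exists2 v, disc 0 r' v & u = WS x + v ^+ n.
  move=> ur; have [v e'] := nth_root (u - WS x) n0; exists v; last by rewrite e' addrC subrK.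
  by apply: (disc_pow m0 n0); rewrite /disc /= subr0 e'.
(* off the centre f is d o s composed with a local n-th root *)
have foff u : disc (WS x) (r' ^+ n) u -> u <> WS x -> cdiff f u.
  move=> ur ux; have w0 : u - WS x != 0 by rewrite subr_eq0; apply/eqP.
  have [s' [e1 [e10 s'P]]] := root_near n.-1 w0; rewrite prednK // in s'P.
  have near_u : \forall u' \near u, ((d \o qH) \o s) (s' (u' - WS x)) = f u'.
    have [e2 e20 he2] := (openC _).1 (@open_disc R (WS x) (r' ^+ n)) u ur.
    apply/nbhsC; exists (Num.min e1 e2); first by rewrite lt_min e10.
    move=> u'; rewrite lt_min => /andP[h1 h2].
    have [|h3 _] := s'P (u' - WS x).
      by have -> : u' - WS x - (u - WS x) = u' - u by ring.
    rewrite -fs; first by rewrite h3 addrC subrK.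
    by apply: (disc_pow m0 n0); rewrite h3 /disc /= subr0; exact: he2.
  apply: (cdiff_near near_u); have [|h3 h4] := s'P (u - WS x); first by rewrite subrr nC0.
  apply: (@cdiff_comp R (fun u' => s' (u' - WS x)) ((d \o qH) \o s)).
    apply: (@cdiff_comp R (fun u' => u' - WS x) s') => //.
    by apply: cdiffD; [exact: cdiff_id|exact: cdiff_cst].
  by apply: dsd; apply: (disc_pow m0 n0); rewrite h3 /disc /= subr0.
have fcont : ccont f (WS x).
  apply/ccontP => ep ep0; have /ccontP/(_ ep ep0)[dl dl0 hdl] := cdiff_cont (dsd 0 (disc_center _ m0)).
  have m1 : 0 < Num.min dl r' by rewrite lt_min dl0.
  have [md mr'] : Num.min dl r' <= dl /\ Num.min dl r' <= r' by split; rewrite ge_min lexx ?orbT.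
  exists (Num.min dl r' ^+ n); first by rewrite exprn_gt0.
  move=> u ur; have [v e'] := nth_root (u - WS x) n0.
  have vm : disc 0 (Num.min dl r') v by apply: (disc_pow m1 n0); rewrite /disc /= subr0 e'.
  have -> : u = WS x + v ^+ n by rewrite e' addrC subrK.
  rewrite fs; last exact: lt_le_trans mr'.
  have -> : f (WS x) = ((d \o qH) \o s) 0 by rewrite /= s0 fE.
  by apply: hdl; exact: lt_le_trans md.
have fdiff u : disc (WS x) (r' ^+ n) u -> cdiff f u.
  have [->|/eqP ux] := eqVneq u (WS x); last by move=> /foff; apply.
  move=> _; apply: (removable rn0) => // z zr.
  by have [->//|/eqP zx] := eqVneq z (WS x); apply: cdiff_cont; exact: foff.
pose g (v : C) : C := wbar (xget (qH x) [set t | chart_dom d t /\ d t = v]).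
have gE t' : chart_dom d t' -> g (d t') = wbar t'.
  move=> dt; congr wbar; have [h1 h2] := @xgetI _ (qH x) [set t0 | chart_dom d t0 /\ d t0 = d t'] t' (conj dt erefl).
  by apply: di; rewrite ?inE.
have gf u : disc (WS x) (r' ^+ n) u -> g (f u) = u.
  move=> /root[v vr ->]; rewrite fs //= gE ?wbarE ?(sW _ (sr _ vr)) //; exact: sd.
have [_ gd] := hol_injective_inverse (@open_disc R _ _) fdiff gf (disc_center _ rn0).
split=> //; exists g; first by rewrite -fE.
by apply: filterS (open_nbhs_nbhs (conj od dx)) => t' /gE ->.
Qed.

Lemma WH_hol z : hol_rel (chartH R) WH z.
Proof.
case: psiB => -[psc /(_ (qG z))[c [d [[cc hc] ad cz dz cd]]]] _.
have [oc _ _ _] := cc; have od : open (chart_dom d) by case: ad => -[].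
have oD : open (chart_dom c `&` psi @^-1` chart_dom d).
  by apply: openI => //; move/continuousP: psc; apply.
have oq : open (qG @^-1` chart_dom c) by move/continuousP: (@orbit_proj_cont R HH Gamma); apply.
have h1 : hol_rel (chartH R) (c \o qG) z.
  apply: (through_hol_rel _ _ _ (hc _ ((atlasH _).2 erefl))) => //.
  by apply: openI => //; exact: openT.
have h2 : hol_rel c (d \o psi) (qG z) by apply: (through_hol_rel oD _ cz cd).
have h3 : hol_rel d wbar (psi (qG z)) by exact: wbar_hol.
have h4 : hol_rel c (wbar \o psi) (qG z) by apply: hol_rel_map h2 h3; exact: psc.
by apply: (hol_rel_map _ h1 h4); exact: orbit_proj_cont.
Qed.

(** If WH were constant on an open set, this set would lie in a single orbit,
    and its image would be an open point of the quotient; but charts of the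
    quotient have no isolated points. *)
Theorem H_model z : exists (s : C -> HH) (r : R) n, model WH z s r n.
Proof.
apply: model_exists.
- by move=> c /atlasH ->; exact: is_chartH.
- apply: (@hol_rel_fun_at R HH WH (chartH R) setT) => //.
  + exact/atlasH.
  + exact: is_chartH.
  + exact: openT.
  + by move=> y _; exact: WH_hol.
move=> [V nV Vc].
case: psiB => -[psc /(_ (qG z))[c [d [[[oc _ _ cO] hc] ad cz dz cd]]]] _.
have nq : nbhs (qG z : orbit_space Gamma) [set qG z].
  apply: filterS (orbit_proj_nbhs GcontH nV) => _ [y Vy <-].
  by apply/esym/orbit_projE/WH_fibre; rewrite Vc.
have o1 : open [set qG z : orbit_space Gamma] by rewrite openE => _ ->.
have /openC/(_ (c (qG z)))[|e e0 he] : open (c @` [set qG z]).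
- by apply: cO => // _ ->.
- by exists (qG z).
have [w wd wn] := @ex_near_neq R (c (qG z)) e e0.
by apply: wn; have [_ -> <-] := he w wd.
Qed.
End Base.

(** * Lifting the half-plane to S *)

Section GeneratedInd.
Variables (gT : groupType) (P : gT -> Prop).
Hypothesis P1 : P 1%g.
Hypothesis PM : forall x y, P x -> P y -> P (x * y)%g.
Hypothesis PV : forall x, P x -> P x^-1%g.
Definition pred_P : {pred gT} := fun g => `[< P g >].
Fact predP1 : 1%g \in pred_P. Proof. exact/asboolP. Qed.
Fact predPM : mulg_closed pred_P.
Proof. by move=> x y /asboolP Px /asboolP Py; apply/asboolP; exact: PM. Qed.
Fact predPV : invg_closed pred_P.
Proof. by move=> x /asboolP Px; apply/asboolP; exact: PV. Qed.

(** Induction over generated subgroups, needed because membership is defined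
    by quantifying over all the subgroups containing the generators. *)
Lemma generated_ind (A : set gT) g : (forall a, A a -> P a) -> g \in generated_subgroup A -> P g.
Proof.
move=> AP; pose K : groupClosed gT := HB.pack pred_P (isMulClosed.Build gT pred_P predPM)
  (isMul1Closed.Build gT pred_P predP1) (isInvClosed.Build gT pred_P predPV).
move=> /asboolP/(_ K) h; apply/asboolP; apply: h => a /AP Pa; exact/asboolP.
Qed.
End GeneratedInd.

Section CommutatorPower.
Variables (gT : groupType) (k : nat) (G : groupClosed gT).
Local Notation N := (commutator_power_subgroup k G).

Lemma generated_mem (A : set gT) a : A a -> a \in generated_subgroup A.
Proof. by move=> Aa; apply/asboolP => K; apply. Qed.

Lemma commutator_in x y : x \in G -> y \in G -> [~ x, y]%g \in N.
Proof.
by move=> xG yG; apply: generated_mem; left; apply: generated_mem; exists x, y.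
Qed.
Lemma power_in x : x \in G -> (x ^+ k)%g \in N.
Proof. by move=> xG; apply: generated_mem; right; apply: generated_mem; exists x. Qed.

Lemma commutator_power_ind (P : gT -> Prop) g : P 1%g -> (forall x y, P x -> P y -> P (x * y)%g) ->
  (forall x, P x -> P x^-1%g) -> (forall x y, x \in G -> y \in G -> P [~ x, y]%g) ->
  (forall x, x \in G -> P (x ^+ k)%g) -> g \in N -> P g.
Proof.
move=> P1 PM PV Pc Pp; apply: (generated_ind P1 PM PV) => a [].
  by apply: (generated_ind P1 PM PV) => _ [x [y [xG yG ->]]]; exact: Pc.
by apply: (generated_ind P1 PM PV) => _ [x xG ->]; exact: Pp.
Qed.

Lemma commutator_power_sub g : g \in N -> g \in G.
Proof.
apply: (@commutator_power_ind (fun g => g \in G) g) => [|x y|x|x y xG yG|x xG]; [exact: gpred1|exact: gpredM|by rewrite gpredV| |].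
  by rewrite /commg /conjg; do ?[apply: gpredM]; rewrite ?gpredV.
exact: gpredXn.
Qed.

Lemma commutator_power_norm g h : g \in G -> h \in N -> (g * h * g^-1)%g \in N.
Proof.
move=> gG hN; have hG := commutator_power_sub hN.
have -> : (g * h * g^-1 = h * [~ h, g^-1])%g by rewrite /commg /conjg ?mulgA ?mulgV ?mul1g ?invgK ?mulgA ?mulgV ?mul1g.
by apply: gpredM => //; apply: commutator_in => //; rewrite gpredV.
Qed.
End CommutatorPower.

Section ModelCharts.
Variable R : realType.
Local Notation C := (R[i]^o).

Lemma wmodel_inv (X : topologicalType) (Z : Type) (W : X -> Z) x (s : C -> X) r n : wmodel W x s r n ->
  exists2 t : X -> C, (forall v, disc 0 r v -> t (s v) = v) & is_chart (Chart (s @` disc 0 r) t).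
Proof.
move=> M; have [[r0 n0] [s0 sinj] sc sO _] := M.
pose t y := xget 0 [set v | disc 0 r v /\ s v = y].
have tE v : disc 0 r v -> t (s v) = v.
  move=> vr; have [h1 h2] := @xgetI _ 0 [set u | disc 0 r u /\ s u = s v] v (conj vr erefl).
  exact: sinj.
exists t => //; split=> /=.
- by apply: sO => //; exact: open_disc.
- by move=> _ _ /set_mem[v vr <-] /set_mem[v' vr' <-]; rewrite !tE // => ->.
- move=> _ [v vr <-] P /=; rewrite tE // => nP.
  by apply: filterS (wmodel_nbhs M vr nP) => _ [u [Pu ur] <-]; rewrite /= tE.
- move=> U oU Us; apply/openC => _ [y Uy <-]; have [v vr e] := Us y Uy.
  have /nbhsC[e1 e10 he1] : nbhs v (s @^-1` U) by apply: sc => //; rewrite e; exact: open_nbhs_nbhs.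
  have [e2 e20 he2] := (openC _).1 (@open_disc R 0 r) v vr.
  exists (Num.min e1 e2); first by rewrite lt_min e10.
  move=> u; rewrite -e tE // lt_min => /andP[/he1 h1 /he2 h2].
  by exists (s u) => //; exact: tE.
Qed.

Lemma model_chart (X : surface R) (W : X -> C) x s r n : model W x s r n ->
  (forall d, atlas X d -> is_chart d) -> (forall d e, atlas X d -> atlas X e -> compatible d e) ->
  exists z : chart R X, [/\ holomorphic_chart z, chart_dom z = s @` disc 0 r & forall v, disc 0 r v -> z (s v) = v].
Proof.
move=> [M _ [c ac cP]] ca cp; have [t tE ct] := wmodel_inv M; have [[r0 n0] [s0 sinj] sc sO _] := M.
exists (Chart (s @` disc 0 r) t); split=> //; split=> // d ad.
apply: hol_rel_compatible => //; first exact: ca.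
move=> _ [v vr <-] dv; have [cv cs] := cP v vr.
have tc : hol_rel (Chart (s @` disc 0 r) t) c (s v).
  split; first by exists v.
  exists (c \o s); first by rewrite /= tE.
  have nv : nbhs v (disc 0 r) by apply: open_nbhs_nbhs; split=> //; exact: open_disc.
  by apply: filterS (wmodel_nbhs M vr nv) => _ [u [_ ur] <-] /=; rewrite tE.
apply: (hol_rel_comp tc); apply: compatible_hol_rel => //; [exact: ca|exact: ca|exact: cp].
Qed.
End ModelCharts.

Section Lift.
Variables (R : realType) (k : nat).
Local Notation C := (R[i]^o).
Local Notation HH := (upper_half_plane R).
Variables (S : surface R) (H : groupClosed (selfbij S)) (Gamma : groupClosed (selfbij HH)).
Variables (WS : S -> C) (WH : HH -> C).
Hypothesis RS : riemann_surface S.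
Hypothesis Hcont : forall h, h \in H -> continuous h.
Hypothesis GP : [set` Gamma] `<=` @PSL2 R.
Hypothesis WS_fibre : forall x x', WS x = WS x' <-> exists2 h, h \in H & h x = x'.
Hypothesis WH_fibre : forall z z', WH z = WH z' <-> exists2 g, g \in Gamma & g z = z'.
Hypothesis over_H : forall z, exists x, WS x = WH z.
Hypothesis over_S : forall x, exists z, WH z = WS x.
Hypothesis S_model : forall x, exists (s : C -> S) (r : R) n, model WS x s r n.
Hypothesis H_model : forall z, exists (s : C -> HH) (r : R) n, model WH z s r n.
Hypothesis stab : forall z x, WH z = WS x -> (stabilizer Gamma z #= stabilizer H x)%card.
Hypothesis Hab : forall g h, g \in H -> h \in H -> (g * h = h * g)%g.
Hypothesis Hk : forall h, h \in H -> (h ^+ k = 1)%g.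

Lemma Gcont g : g \in Gamma -> continuous g.
Proof. by move=> /GP; exact: PSL2_cont. Qed.
Lemma WHG g : g \in Gamma -> forall z, WH (g z) = WH z.
Proof. by move=> gG z; apply/esym/WH_fibre; exists g. Qed.
Lemma WSH h : h \in H -> forall x, WS (h x) = WS x.
Proof. by move=> hH x; apply/esym/WS_fibre; exists h. Qed.
Let Gtr z z' : WH z = WH z' -> exists2 g, g \in Gamma & g z = z'. Proof. by move/WH_fibre. Qed.
Let Htr x x' : WS x = WS x' -> exists2 h, h \in H & h x = x'. Proof. by move/WS_fibre. Qed.
Let wmH z : exists (s : C -> HH) (r : R) n, wmodel WH z s r n.
Proof. by have [s [r [n []]]] := H_model z; exists s, r, n. Qed.
Let wmS x : exists (s : C -> S) (r : R) n, wmodel WS x s r n.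
Proof. by have [s [r [n []]]] := S_model x; exists s, r, n. Qed.
Let hausS : hausdorff_space S. Proof. by case: RS. Qed.
Let connS : connected [set: S]. Proof. by case: RS. Qed.

(** The degree is the order of the stabilizer, and the isomorphism of
    orbifolds preserves orders. *)
Lemma same_degree z x (s : C -> HH) (r : R) n (s' : C -> S) (r' : R) n' : WH z = WS x -> wmodel WH z s r n -> wmodel WS x s' r' n' -> n = n'.
Proof.
move=> e M M'; apply/card_eq_II.
have h1 := stabilizer_card (@HH_hausdorff R) (@HH_connected R) Gcont WHG Gtr wmH M.
have h2 := stabilizer_card hausS connS Hcont WSH Htr wmS M'.
exact: card_eq_trans (card_esym h1) (card_eq_trans (stab e) h2).
Qed.

(** These are the points at which W has degree 1 ([regular_degree]). *)
Definition regular (z : HH) := forall g, g \in Gamma -> g z = z -> g = 1%g.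

Lemma regular_near z (s : C -> HH) (r : R) n v : wmodel WH z s r n -> disc 0 r v -> v != 0 -> regular (s v).
Proof.
move=> M vr v0 g gG; exact: (stabilizer_off_center (@HH_hausdorff R) (@HH_connected R) Gcont WHG Gtr wmH M vr v0 gG).
Qed.

Lemma regular_orbit z z' : WH z = WH z' -> regular z -> regular z'.
Proof.
move=> /WH_fibre[g gG <-] rz h hG e.
have : (g^-1 * h * g)%g = 1%g.
  apply: rz; first by do ?[apply: gpredM]; rewrite ?gpredV.
  by change (bij_inv g (h (g z)) = z); rewrite e bij_funK.
by move/(congr1 (fun f => g * f * g^-1)%g); rewrite mulg1 mulgV mulgA mulgK mulVKg.
Qed.

Lemma regular_degree z (s : C -> HH) (r : R) n : wmodel WH z s r n -> regular z -> n = 1%N.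
Proof.
move=> M rz; exact: (wmodel_free (@HH_hausdorff R) (@HH_connected R) Gcont WHG Gtr wmH M rz).
Qed.

Let sing : set C := [set z | ~ regular (eta z)].

(** In a model only the centre can be singular. *)
Lemma singular_discrete : discreteC (@halfplane R) sing.
Proof.
move=> z hz; have [s [r [n M]]] := wmH (eta z); have [[r0 n0] [s0 sinj] sc sO _] := M.
have c0 := disc_center (0 : C) r0.
have nb : nbhs (eta z) (s @` (setT `&` disc 0 r)).
  by rewrite -s0; apply: (wmodel_nbhs M c0); apply/nbhsC; exists 1.
have [hal h0 hc] := (openC _).1 (@halfplane_open R) z hz.
have /nbhsC[e e0 he] := eta_cont hz nb.
exists (Num.min e hal); first by rewrite lt_min e0.
move=> w; rewrite lt_min => /andP[/he/= [v [_ vr] ev] /hc hw] sw.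
have [v0|v0] := eqVneq v 0; last by case: sw; rewrite -ev; exact: regular_near M vr v0.
by rewrite -(etaK hw) -ev v0 s0 etaK.
Qed.

Lemma regular_exists : exists z, regular z.
Proof.
have [s [r [n M]]] := wmH (HHi R); have [[r0 _] _ _ _ _] := M.
by have [h1 h2] := disc_half r0; eexists; exact: (regular_near M h1 h2).
Qed.

Lemma WS_linj z x : regular z -> WS x = WH z ->
  exists2 U, nbhs x U & forall a b, U a -> U b -> WS a = WS b -> a = b.
Proof.
move=> rz e; have [s [r [n M]]] := wmS x; have [[r0 n0] [s0 sinj] sc sO sW] := M.
have [s1 [r1 [n1 M1]]] := wmH z.
have n1' : n = 1%N by rewrite -(same_degree (esym e) M1 M); exact: regular_degree M1 rz.
exists (s @` (setT `&` disc 0 r)).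
  by rewrite -s0; apply: (wmodel_nbhs M (disc_center _ r0)); apply/nbhsC; exists 1.
by move=> _ _ [v [_ vr] <-] [v' [_ vr'] <-] /(sW _ _ vr vr'); rewrite n1' !expr1 => ->.
Qed.

Let Hs : set (S -> S) := [set f : S -> S | exists2 h : selfbij S, h \in H & f = bij_fun h].
Let Hs_cont f : Hs f -> continuous f. Proof. by move=> [h /Hcont hc ->]. Qed.
Let Hs_W f : Hs f -> forall x, WS (f x) = WS x. Proof. by move=> [h /WSH hW ->]. Qed.
Let Hs_tr x x' : WS x = WS x' -> exists2 f, Hs f & f x = x'.
Proof. by move=> /Htr[h hH e]; exists h => //; exists h. Qed.
Let linj (z : C) (x : S) : halfplane z -> ~ sing z -> WS x = (WH \o @eta R) z ->
  exists2 U, nbhs x U & forall a b, U a -> U b -> WS a = WS b -> a = b.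
Proof. by move=> _ /contrapT; exact: WS_linj. Qed.

(** Locally, models of equal degree on both sides give a lift; [lift_star]
    makes it global, singular points forming the exceptional set. *)
Theorem lift_exists : exists2 F : HH -> S, continuous F & forall z, WS (F z) = WH z.
Proof.
have loc z : halfplane z -> exists2 e : R, 0 < e & exists f, lift_on WS (WH \o @eta R) f (disc z e).
  move=> hz; have [s [r [n Mod]]] := H_model (eta z); have [x ex] := over_H (eta z).
  have [s' [r' [n' Mod']]] := S_model x; have [M sW _] := Mod; have [M' sW' _] := Mod'.
  have en := same_degree (esym ex) M M'; subst n'.
  have [t tE [ot _ tc _]] := wmodel_inv M; have [[r0 n0] [s0 sinj] sc sO _] := M.
  have [[r'0 _] [s'0 _] sc' sO' _] := M'.
  have m0 : 0 < Num.min r r' by rewrite lt_min r0.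
  have [mr mr'] : Num.min r r' <= r /\ Num.min r r' <= r' by split; rewrite ge_min lexx ?orbT.
  have nm : nbhs (0 : C) (disc 0 (Num.min r r')) by apply/nbhsC; exists (Num.min r r') => // u; rewrite subr0.
  have nb := wmodel_nbhs M (disc_center _ r0) nm; rewrite s0 in nb.
  have [hal h0 hc] := (openC _).1 (@halfplane_open R) z hz.
  have /nbhsC[e e0 he] := eta_cont hz nb.
  exists (Num.min e hal); first by rewrite lt_min e0.
  exists (s' \o t \o @eta R) => u; rewrite /disc /= lt_min => /andP[/he/= [v [vm vr] ev] /hc hu].
  have vr' : disc 0 r' v by exact: lt_le_trans mr'.
  rewrite -ev tE // sW' // sW // ex; split=> //.
  apply: continuous_comp; first exact: eta_cont.
  rewrite -ev; apply: continuous_comp; first by apply: tc; exists v.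
  by rewrite tE //; exact: sc'.
have [e e0 [f0 f0P]] := loc _ (@halfplane_i R).
have [f [fP _]] := lift_star hausS Hs_cont Hs_W Hs_tr singular_discrete linj (@halfplane_open R)
  (halfplane_convex (@halfplane_i R)) loc e0 f0P.
exists (f \o set_val) => [z|z]; last by rewrite /= (fP _ (HH_val z)).2 /= eta_val.
by apply: continuous_comp; [exact: HH_val_cont|exact: (fP _ (HH_val z)).1].
Qed.

Lemma lift_unique (f f' : HH -> S) z : continuous f -> continuous f' -> (forall z, WS (f z) = WH z) ->
  (forall z, WS (f' z) = WH z) -> regular z -> f z = f' z -> f =1 f'.
Proof.
move=> fc f'c fW f'W rz e z'.
have l g : continuous g -> (forall z, WS (g z) = WH z) -> lift_on WS (WH \o @eta R) (g \o @eta R) (@halfplane R).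
  by move=> gc gW u hu; split; [apply: continuous_comp; [exact: eta_cont|exact: gc]|rewrite /= gW].
have nz : ~ sing (set_val z) by rewrite /sing /= eta_val.
have e' : (f \o @eta R) (set_val z) = (f' \o @eta R) (set_val z) by rewrite /= eta_val.
have := lift_eq hausS singular_discrete linj (@halfplane_open R) (@halfplane_convex R) (@subset_refl _ _)
  (l f fc fW) (l f' f'c f'W) (HH_val z) nz e' (HH_val z').
by rewrite /= eta_val.
Qed.

Lemma regular_dense (z : HH) (V : set HH) : nbhs z V -> exists2 z', V z' & regular z'.
Proof.
have [s [r [n M]]] := wmH z; have [[r0 n0] [s0 sinj] sc sO _] := M.
rewrite -{1}s0 => /(sc 0 (disc_center _ r0))/nbhsC[e e0 he].
have m0 : 0 < Num.min e r by rewrite lt_min e0.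
have [me mr] : Num.min e r <= e /\ Num.min e r <= r by split; rewrite ge_min lexx ?orbT.
have [h1 h2] := disc_half m0; exists (s (Num.min e r / 2)%:C); first by apply: he; exact: lt_le_trans me.
by apply: (regular_near M _ h2); exact: lt_le_trans mr.
Qed.

Lemma H_free_regular (z : HH) (x : S) (h : selfbij S) : regular z -> WS x = WH z -> h \in H -> h x = x -> h = 1%g.
Proof.
move=> rz e hH hx; have [U nU Ui] := WS_linj rz e.
apply: bijP => y; apply: (rigid hausS connS Hcont WSH Htr wmS (Hcont hH) (WSH hH) (x := x)).
have ch : continuous_at x h by exact: (Hcont hH).
exists (U `&` h @^-1` U); first by apply: filterI => //; apply: ch; rewrite hx.
by move=> y' [Uy Uhy]; apply: Ui => //; rewrite WSH.
Qed.

Section Theta.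
Variable F : HH -> S.
Hypothesis Fc : continuous F.
Hypothesis FW : forall z, WS (F z) = WH z.

Lemma deck_unique (z : HH) (h h' : selfbij S) : regular z -> h \in H -> h' \in H -> h (F z) = h' (F z) -> h = h'.
Proof.
move=> rz hH hH' e; have kH : (h^-1 * h')%g \in H by apply: gpredM => //; rewrite gpredV.
have : (h^-1 * h')%g = 1%g.
  by apply: (H_free_regular rz (FW z)) => //; change (bij_inv h (h' (F z)) = F z); rewrite -e bij_funK.
by move/(congr1 (fun f => h * f)%g); rewrite mulVKg mulg1.
Qed.

(** F o g is another lift of WH, so it differs from F by an element of H. *)
Lemma deck_image g : g \in Gamma -> exists2 h, h \in H & forall z, F (g z) = h (F z).
Proof.
move=> gG; have [z0 rz] := regular_exists.
have [|h hH e] := @Htr (F z0) (F (g z0)); first by rewrite !FW WHG.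
exists h => // z; apply: (lift_unique (f := F \o g) (f' := h \o F) (z := z0)) => //.
- by move=> y; apply: continuous_comp; [exact: Gcont|exact: Fc].
- by move=> y; apply: continuous_comp; [exact: Fc|exact: Hcont].
- by move=> y; rewrite /= FW WHG.
- by move=> y; rewrite /= WSH // FW.
Qed.

(** In models on both sides F lifts v |-> v ^+ n through v |-> v ^+ n with
    the same n, hence it is a rotation. *)
Lemma lift_local z (s : C -> HH) (r : R) n (s' : C -> S) (r' : R) : model WH z s r n -> model WS (F z) s' r' n ->
  exists om (rho : R), [/\ om ^+ n = 1, 0 < rho, rho <= r, rho <= r' &
    forall v, disc 0 rho v -> F (s v) = s' (om * v)].
Proof.
move=> [M sW _] [M' sW' _]; have [[r0 n0] [s0 sinj] sc sO _] := M; have [[r'0 _] [s'0 s'inj] sc' sO' _] := M'.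
have cFs : continuous_at (0 : C) (F \o s).
  by apply: continuous_comp; [apply: sc; exact: disc_center|exact: Fc].
have /nbhsC[e e0 he] : nbhs (0 : C) ((F \o s) @^-1` (s' @` (setT `&` disc 0 r'))).
  apply: cFs; rewrite /= s0 -s'0; apply: (wmodel_nbhs M'); first exact: disc_center.
  by apply/nbhsC; exists 1.
pose rho := Num.min e (Num.min r r').
have rho0 : 0 < rho by rewrite !lt_min e0 r0.
have [re rr rr'] : [/\ rho <= e, rho <= r & rho <= r'] by split; rewrite /rho !ge_min lexx ?orbT.
have [h1 v00] := disc_half rho0; set v0 := _%:C in h1 v00.
have sub t v : rho <= t -> disc 0 rho v -> disc 0 t v by move=> rt h; exact: lt_le_trans rt.
have [v1 [_ v1r] ev1] : (s' @` (setT `&` disc 0 r')) (F (s v0)) by apply: he; exact: (sub e).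
have e1 : v1 ^+ n = v0 ^+ n.
  by apply: (addrI (WS (F z))); rewrite -sW' // ev1 !FW sW //; exact: (sub r).
have omn : (v1 / v0) ^+ n = 1 by rewrite exprMn exprVn e1 divff // expf_neq0.
have om0 : v1 / v0 * v0 = v1 by rewrite divfK.
exists (v1 / v0), rho; split=> // v vr.
have rot u : disc 0 rho u -> disc 0 r' (v1 / v0 * u) by move=> h; apply: (unit_disc_rot n0 omn); exact: (sub r').
have dE : discreteC (disc 0 rho) [set (0 : C)].
  move=> w wr; have [->|w0] := eqVneq w 0; first by exists 1 => // u _ ->.
  exists (nC w); first by rewrite nC_gt0.
  by move=> u + u0; rewrite u0 sub0r nCN ltxx.
have li w x' : disc 0 rho w -> ~ [set (0 : C)] w -> WS x' = WH (s w) ->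
    exists2 V, nbhs x' V & forall a b, V a -> V b -> WS a = WS b -> a = b.
  move=> wr w0 ex; apply: (WS_linj (z := s w)) => //; apply: (regular_near M); first exact: (sub r).
  exact/eqP.
have l1 : lift_on WS (fun v => WH (s v)) (F \o s) (disc 0 rho).
  move=> u ur; split; last by rewrite /= FW.
  by apply: continuous_comp; [apply: sc; exact: (sub r)|exact: Fc].
have l2 : lift_on WS (fun v => WH (s v)) (s' \o (fun u => v1 / v0 * u)) (disc 0 rho).
  move=> u ur; split; last first.
    by rewrite /= sW' ?sW ?FW //; [rewrite exprMn omn mul1r|exact: (sub r)|exact: rot].
  apply: continuous_comp; last exact/sc'/rot.
  have [] // : ccont (fun w : C => v1 / v0 * w) u by apply: contM; [exact: contc|exact: conti].
have nE : ~ [set (0 : C)] v0 by move=> h; rewrite h eqxx in v00.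
have e2 : (F \o s) v0 = (s' \o (fun u => v1 / v0 * u)) v0 by rewrite /= om0 ev1.
exact: (lift_eq hausS dE li (@open_disc R 0 rho) (@convex_disc R 0 rho) (@subset_refl _ _) l1 l2 h1 nE e2 vr).
Qed.

Lemma lift_models z : exists (s : C -> HH) (r : R) n (s' : C -> S) (r' : R),
  model WH z s r n /\ model WS (F z) s' r' n.
Proof.
have [s [r [n M]]] := H_model z; have [s' [r' [n' M']]] := S_model (F z).
have en : n = n' by have [m _ _] := M; have [m' _ _] := M'; exact: same_degree (esym (FW z)) m m'.
by subst n'; exists s, r, n, s', r'.
Qed.

(** If g fixes z, it acts on a model at z by a rotation; as F is injective
    there by [lift_local], F o g = F forces this rotation to be trivial. *)
Theorem kernel_free g z : g \in Gamma -> (forall z, F (g z) = F z) -> g z = z -> g = 1%g.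
Proof.
move=> gG Fg gz; have [s [r [n [s' [r' [Mo Mo']]]]]] := lift_models z.
have [om [rho [omn rho0 rr rr' Fs]]] := lift_local Mo Mo'.
have [M _ _] := Mo; have [M' _ _] := Mo'; have [[r0 n0] _ _ _ _] := M; have [_ [_ s'inj] _ _ _] := M'.
have [zt ztn gs] := wmodel_fix (@HH_hausdorff R) Gcont WHG Gtr M (Gcont gG) (WHG gG) gz.
have [h1 v0] := disc_half rho0; set v := _%:C in h1 v0.
have vr : disc 0 r v by exact: lt_le_trans rr.
have zv := unit_disc_rot n0 ztn h1.
have omN0 : om != 0 by apply/eqP => o0; have := @oner_neq0 R[i]; rewrite -omn o0 expr0n gtn_eqF // eqxx.
have dr' u : disc 0 rho u -> disc 0 r' (om * u).
  by move=> h; apply: (unit_disc_rot n0 omn); exact: lt_le_trans rr'.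
have : s' (om * (zt * v)) = s' (om * v) by rewrite -!Fs // -gs // Fg.
move=> /(s'inj _ _ (dr' _ zv) (dr' _ h1))/(mulfI omN0) e.
apply: (stabilizer_off_center (@HH_hausdorff R) (@HH_connected R) Gcont WHG Gtr wmH M vr v0 gG).
by rewrite gs // e.
Qed.

Lemma lift_open (z : HH) : nbhs (F z) (F @` setT).
Proof.
have [s [r [n [s' [r' [Mo Mo']]]]]] := lift_models z.
have [om [rho [omn rho0 rr rr' Fs]]] := lift_local Mo Mo'.
have [M _ _] := Mo; have [M' _ _] := Mo'; have [[r0 n0] _ _ _ _] := M; have [[r'0 _] [s'0 s'inj] _ _ _] := M'.
have nm : nbhs (0 : C) (disc 0 rho) by apply/nbhsC; exists rho => // u; rewrite subr0.
have nb := wmodel_nbhs M' (disc_center _ r'0) nm; rewrite s'0 in nb.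
apply: filterS nb => _ [u [ur _] <-]; exists (s (om^-1 * u)) => //.
have omN0 : om != 0 by apply/eqP => o0; have := @oner_neq0 R[i]; rewrite -omn o0 expr0n gtn_eqF // eqxx.
rewrite Fs ?mulVKf //; apply: (unit_disc_rot n0) => //.
by rewrite exprVn omn invr1.
Qed.

(** The image of F is open, and so are its translates by H, which cover S. If
    two of them meet, they meet over a regular value, and then they coincide;
    connectedness leaves only one. *)
Theorem lift_surj (x : S) : exists z, F z = x.
Proof.
apply: (@connected_locally S (fun x => exists z, F z = x) connS _ (F (HHi R))); last by exists (HHi R).
move=> {}x; have [Qx|nQ] := pselect (exists z, F z = x).
  have [z ez] := Qx; exists (F @` setT); first by rewrite -ez; exact: lift_open.
  by move=> y [z' _ e]; split=> // _; exists z'.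
have [z ez] := over_S x; have [|h hH hx] := @Htr (F z) x; first by rewrite FW.
have hV : h^-1%g \in H by rewrite gpredV.
have nh y : (exists z1, h (F z1) = y) -> nbhs y (bij_inv h @^-1` (F @` setT)).
  move=> [z1 e]; have ch : continuous_at y (bij_inv h) by exact: (Hcont hV).
  by apply: ch; rewrite -e bij_funK; exact: lift_open.
exists (bij_inv h @^-1` (F @` setT)); first by apply: nh; exists z.
move=> y [z1 _ e1]; split=> // -[z2 e2]; exfalso; apply: nQ.
have hy : h (F z1) = y by rewrite e1 bij_invK.
(* z2 may be moved to a regular point, where h is determined by its value *)
have : nbhs z2 (F @^-1` (bij_inv h @^-1` (F @` setT))) by apply: Fc; rewrite e2; apply: nh; exists z1.
move=> /regular_dense[z3 [z4 _ e4] rz3].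
have hz4 : h (F z4) = F z3 by rewrite e4 bij_invK.
have W34 : WH z4 = WH z3 by rewrite -!FW -hz4 WSH.
have [g gG eg] := Gtr W34; have [h' h'H h'P] := deck_image gG.
have rz4 : regular z4 by apply: regular_orbit rz3.
have eh : h = h' by apply: (deck_unique rz4) => //; rewrite hz4 -h'P eg.
by exists (g z); rewrite h'P -eh.
Qed.

Theorem deck_onto h : h \in H -> exists2 g, g \in Gamma & forall z, F (g z) = h (F z).
Proof.
move=> hH; have [z0 rz] := regular_exists; have [z1 e1] := lift_surj (h (F z0)).
have [|g gG eg] := @Gtr z0 z1; first by rewrite -!FW e1 WSH.
have [h' h'H h'P] := deck_image gG; exists g => // z; rewrite h'P.
by rewrite (deck_unique rz h'H hH) // -h'P eg.
Qed.

End Theta.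

(** A map equivariant with respect to a homomorphism to H is invariant under
    commutators and k-th powers, as H is abelian of exponent k. It is applied
    to F and, later, to the lift through S / J. *)
Lemma commutator_power_invariant (F : HH -> S) : (forall g, g \in Gamma -> exists2 h, h \in H & forall z, F (g z) = h (F z)) ->
  forall g, g \in commutator_power_subgroup k Gamma -> forall z, F (g z) = F z.
Proof.
move=> eqv g; apply: (@commutator_power_ind _ k Gamma (fun g => forall z, F (g z) = F z) g) => [//|x y Px Py z|x Px z|x y xG yG z|x xG z].
- by change (F (x (y z)) = F z); rewrite Px Py.
- by change (F (bij_inv x z) = F z); rewrite -Px bij_invK.
- have [hx hxH xP] := eqv x xG; have [hy hyH yP] := eqv y yG.
  change (F (bij_inv x (bij_inv y (x (y z)))) = F z).
  apply: (can_inj (@bij_funK _ hx)); rewrite -xP bij_invK.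
  apply: (can_inj (@bij_funK _ hy)); rewrite -yP bij_invK xP yP.
  by change ((hx * hy)%g (F z) = (hy * hx)%g (F z)); rewrite Hab.
- have [h hH xP] := eqv x xG.
  have pw m : F ((x ^+ m)%g z) = (h ^+ m)%g (F z).
    elim: m z => [//|m IH] z; rewrite !expgS.
    by change (F (x ((x ^+ m)%g z)) = h ((h ^+ m)%g (F z))); rewrite xP IH.
  by rewrite pw Hk.
Qed.
End Lift.

(** * The surface H^2 / Gamma_k and its covering of the base *)

Lemma connected_convex_image (R : realType) (X : topologicalType) (V : set R[i]^o) (f : R[i]^o -> X) :
  convexC V -> open V -> (forall v, V v -> continuous_at v f) -> connected (f @` V).
Proof.
move=> cV oV fc P [x0 Px0] [U oU eU] [K cK eK]; apply/seteqP; split=> [x|_ [v Vv <-]].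
  by rewrite eU => -[].
have [v0 Vv0 e0] : (f @` V) x0 by move: Px0; rewrite eU => -[].
have oKc : open (~` K) by exact: closed_openC.
have H z : V z -> exists2 e : R, 0 < e & forall w, nC (w - z) < e -> ((V w /\ P (f w)) <-> (V z /\ P (f z))).
  move=> Vz; have [e' e'0 he'] := (openC _).1 oV z Vz.
  have [Pz|nPz] := pselect (P (f z)).
    have Uz : U (f z) by move: Pz; rewrite eU => -[].
    have /nbhsC[e e0' he] := fc z Vz U (open_nbhs_nbhs (conj oU Uz)).
    exists (Num.min e e'); first by rewrite lt_min e0'.
    move=> w; rewrite lt_min => /andP[/he h /he' hw]; split=> // _; split=> //.
    by rewrite eU; split=> //; exists w.
  have nK : (~` K) (f z) by move=> Kz; apply: nPz; rewrite eK; split=> //; exists z.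
  have /nbhsC[e e0' he] := fc z Vz _ (open_nbhs_nbhs (conj oKc nK)).
  exists (Num.min e e'); first by rewrite lt_min e0'.
  move=> w; rewrite lt_min => /andP[/he h /he' hw]; split=> -[_ Pw]; exfalso; last exact: nPz Pw.
  by apply: h; move: Pw; rewrite eK => -[].
have [h _] := lc_convex cV H Vv0 Vv.
by rewrite e0 in h; have [] := h (conj Vv0 Px0).
Qed.

Lemma orbit_projP (R : realType) (X : surface R) (N : groupClosed (selfbij X)) (x y : X) :
  orbit_proj N x = orbit_proj N y -> exists2 g : selfbij X, g \in N & g x = y.
Proof. by move=> e; apply/orbit_projE. Qed.

Lemma compatible_sym (R : realType) (X : topologicalType) (c d : chart R X) : compatible c d -> compatible d c.
Proof. by rewrite /compatible setIC => -[]. Qed.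

Lemma hol_rel_eq (R : realType) (X : topologicalType) (c : chart R X) (f g : X -> R[i]^o) x :
  f =1 g -> hol_rel c f x -> hol_rel c g x.
Proof. by move=> /funext ->. Qed.

Section Cover.
Variables (R : realType).
Local Notation C := (R[i]^o).
Local Notation HH := (upper_half_plane R).
Variables (Gamma N : groupClosed (selfbij HH)) (WH : HH -> C).
Hypothesis GP : [set` Gamma] `<=` @PSL2 R.
Hypothesis NG : forall g, g \in N -> g \in Gamma.
Hypothesis Nnorm : forall g h, g \in Gamma -> h \in N -> (g * h * g^-1)%g \in N.
Hypothesis Nfree : forall g z, g \in N -> g z = z -> g = 1%g.
Hypothesis WH_fibre : forall z z', WH z = WH z' <-> exists2 g, g \in Gamma & g z = z'.
Hypothesis H_model : forall z, exists (s : C -> HH) (r : R) n, model WH z s r n.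
Hypothesis WH_hol : forall z, hol_rel (chartH R) WH z.
Local Notation T := (quotient_surface N).
Local Notation qT := (orbit_proj N).
Local Notation G := (factor_closed Gamma N).

Let Gcont g : g \in Gamma -> continuous g. Proof. by move=> /GP; exact: PSL2_cont. Qed.
Let Ncont g : g \in N -> continuous g. Proof. by move=> /NG/Gcont. Qed.
Let WHG g : g \in Gamma -> forall z, WH (g z) = WH z.
Proof. by move=> gG z; apply/esym/WH_fibre; exists g. Qed.
Let Gtr z z' : WH z = WH z' -> exists2 g, g \in Gamma & g z = z'. Proof. by move/WH_fibre. Qed.
Let wmH z : exists (s : C -> HH) (r : R) n, wmodel WH z s r n.
Proof. by have [s [r [n []]]] := H_model z; exists s, r, n. Qed.
Let atlHH c : atlas HH c -> is_chart c. Proof. by move=> /atlasH ->; exact: is_chartH. Qed.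
Let compHH c d : atlas HH c -> atlas HH d -> compatible c d.
Proof.
move=> /atlasH -> /atlasH ->; apply: hol_rel_compatible; [exact: is_chartH|exact: is_chartH|].
by move=> x _ _; exact: hol_rel_id.
Qed.

Lemma cover_plane_exists : exists w : T -> C, forall z, w (qT z) = WH z.
Proof. by apply: orbit_factor => h x hN; apply/esym/WH_fibre; exists h => //; exact: NG. Qed.

(** The planar coordinate on T, for any normal subgroup N of Gamma which acts
    freely; T is the quotient by N. *)
Definition WT := sval (cid cover_plane_exists).
Lemma WTE z : WT (qT z) = WH z. Proof. exact: (svalP (cid cover_plane_exists)). Qed.

Lemma atlasT_hol c z : atlas T c -> chart_dom c (qT z) -> hol_rel (chartH R) (c \o qT) z.
Proof.
move=> [cc hc] cz; have [oc _ _ _] := cc.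
have oq : open (qT @^-1` chart_dom c) by move/continuousP: (@orbit_proj_cont R HH N); apply.
apply: (through_hol_rel _ _ _ (hc _ ((atlasH _).2 erefl))) => //.
by apply: openI => //; exact: openT.
Qed.

Lemma atlasT_intro (c : chart R T) : is_chart c -> (forall z, chart_dom c (qT z) -> hol_rel (chartH R) (c \o qT) z) -> atlas T c.
Proof.
move=> cc H; split=> // d /atlasH ->; have [oc _ _ _] := cc.
have oq : open (qT @^-1` chart_dom c) by move/continuousP: (@orbit_proj_cont R HH N); apply.
apply: hol_rel_through => //; first exact: is_chartH.
  by apply: openI => //; exact: openT.
by move=> z [_ /H].
Qed.

Lemma model_translate z (s : C -> HH) (r : R) n g : g \in Gamma -> model WH z s r n -> model WH (g z) (g \o s) r n.
Proof.
move=> gG Mo; have [M sW [c ac cP]] := Mo; have [[r0 n0] [s0 sinj] sc sO sWW] := M.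
have gV : g^-1%g \in Gamma by rewrite gpredV.
split.
- split=> //.
  + by split=> [|v v' vr v'r /(can_inj (@bij_funK _ g))]; [rewrite /= s0|exact: sinj].
  + by move=> v vr; apply: continuous_comp; [exact: sc|exact: Gcont].
  + move=> U oU Ur; have -> : (g \o s) @` U = bij_inv g @^-1` (s @` U).
      apply/seteqP; split=> [_ [v Uv <-]|y [v Uv e]]; first by exists v; rewrite //= bij_funK.
      by exists v => //=; rewrite e bij_invK.
    by move/continuousP: (Gcont gV); apply; exact: sO.
  + by move=> v v' vr v'r; rewrite /= !WHG //; exact: sWW.
- by move=> v vr; rewrite /= !WHG // sW.
- exists (chartH R); first exact/atlasH.
  move=> v vr; split=> //.
  have cv : hol_rel (chartH R) (set_val \o g) (s v) by apply: PSL2_hol; exact: GP.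
  exact: (model_hol_rel Mo atlHH compHH ((atlasH _).2 erefl) vr _ cv).
Qed.

(** A model at z projects injectively to T: an element of N identifying two
    of its points fixes z by [wmodel_meet], and is trivial. So T has models
    of the same degrees as the half-plane. *)
Lemma T_wmodel z (s : C -> HH) (r : R) n : wmodel WH z s r n -> wmodel WT (qT z) (qT \o s) r n.
Proof.
move=> M; have [[r0 n0] [s0 sinj] sc sO sW] := M; split=> //.
- split=> [|v v' vr v'r /= /(@orbit_projP R HH N _ _)[g gN e]]; first by rewrite /= s0.
  have gz := wmodel_meet (@HH_hausdorff R) Gcont WHG Gtr M (NG gN) vr v'r e.
  by apply: sinj => //; rewrite -e (Nfree gN gz).
- by move=> v vr; apply: continuous_comp; [exact: sc|exact: orbit_proj_cont].
- by move=> U oU Ur; rewrite -(image_comp s qT U); apply: orbit_proj_open => //; exact: sO.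
- by move=> v v' vr v'r; rewrite /= !WTE; exact: sW.
Qed.

Lemma T_chart z (s : C -> HH) (r : R) n : model WH z s r n ->
  exists c : chart R T, [/\ atlas T c, chart_dom c = (qT \o s) @` disc 0 r & forall v, disc 0 r v -> c (qT (s v)) = v].
Proof.
move=> Mo; have [M _ _] := Mo; have [t tE ct] := wmodel_inv (T_wmodel M).
exists (Chart ((qT \o s) @` disc 0 r) t); split=> //.
apply: atlasT_intro => // y [v vr /= /(@orbit_projP R HH N _ _)[g gN e]].
have [cz [[hz hcz] dz zE]] := model_chart Mo atlHH compHH.
have gV : g^-1%g \in Gamma by rewrite gpredV; exact: NG.
have eg : (g^-1)%g y = s v by rewrite -e; exact: (bij_funK g).
have h1 : hol_rel (chartH R) (t \o qT) (s v).
  have dv : chart_dom cz (s v) by rewrite dz; exists v.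
  have h0 := compatible_hol_rel (@is_chartH R) hz (compatible_sym (hcz _ ((atlasH _).2 erefl))) I dv.
  apply: (hol_rel_near h0); have [oz _ _ _] := hz.
  apply: filterS (open_nbhs_nbhs (conj oz dv)) => y'; rewrite dz => -[u ur <-].
  by rewrite zE //; apply/esym; exact: (tE u ur).
have h2 : hol_rel (chartH R) ((t \o qT) \o (g^-1)%g) y.
  by apply: hol_rel_PSL2; [exact: GP|rewrite eg].
apply: (hol_rel_eq _ h2) => y' /=; congr t.
by apply: (@orbit_projN R HH N g^-1%g y'); rewrite gpredV.
Qed.

(** Holomorphy on T can be tested on the half-plane. *)
Lemma T_hol_rel c (f : T -> C) z : atlas T c -> chart_dom c (qT z) -> hol_rel (chartH R) (f \o qT) z ->
  hol_rel c f (qT z).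
Proof.
move=> ac cz fz; have [s [r [n Mo]]] := H_model z; have [M _ _] := Mo.
have [[r0 n0] [s0 sinj] sc sO sW] := M.
have [c1 [[cc1 ac1] dc1 c1E]] := T_chart Mo; have [cc _] := ac.
have key (h : T -> C) v : disc 0 r v -> hol_rel (chartH R) (h \o qT) (s v) -> hol_rel c1 h (qT (s v)).
  move=> vr hv; have dv : chart_dom c1 (qT (s v)) by rewrite dc1; exists v.
  split=> //; exists ((h \o qT) \o s).
    by rewrite c1E //; apply: (model_hol_rel Mo atlHH compHH ((atlasH _).2 erefl) vr).
  have [oc1 _ _ _] := cc1.
  by apply: filterS (open_nbhs_nbhs (conj oc1 dv)) => y; rewrite dc1 => -[u ur <-] /=; rewrite c1E.
have d0 := disc_center (0 : C) r0; rewrite -s0 in cz fz *.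
apply: (hol_rel_comp _ (key f 0 d0 fz)).
have [oc1 _ _ _] := cc1; have [oc _ _ _] := cc.
apply: (hol_rel_inv cc1 cc (D := chart_dom c1 `&` chart_dom c)) => //.
- exact: openI.
- by split=> //; rewrite dc1; exists 0.
- move=> y [+ cy]; rewrite dc1 => -[v vr ev]; rewrite -ev in cy *.
  by apply: key => //; exact: atlasT_hol.
Qed.

(** Points with different values of W are separated by W. For two points in
    one fibre, use the projections of a model at z and of its translate at
    z'. *)
Lemma T_hausdorff : hausdorff_space T.
Proof.
apply/hausdorffP => t t' tt'; have [z ez] := orbit_proj_surj t; have [z' ez'] := orbit_proj_surj t'; subst t t'.
have Wc : continuous WH by move=> y; exact: hol_rel_cont (@is_chartH R) (WH_hol y).
have WTc : continuous WT by apply: (@orbit_factor_cont R HH N C WH WT WTE).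
have [/Gtr[g gG eg]|/eqP nW] := eqVneq (WH z) (WH z'); last first.
  have [A [B [oA oB Ax By AB]]] := (hausdorffP _).1 (@hausdorffC R) _ _ nW.
  exists (WT @^-1` A), (WT @^-1` B); split.
  - by move/continuousP: WTc; apply.
  - by move/continuousP: WTc; apply.
  - by rewrite /= WTE.
  - by rewrite /= WTE.
  - by move=> y; exact: AB.
have [s [r [n Mo]]] := H_model z; have [M _ _] := Mo; have [M' _ _] := model_translate gG Mo.
have [[r0 n0] [s0 sinj] sc sO sW] := M; have [_ [_ _] _ _ _] := M'.
have [_ _ _ o1 _] := T_wmodel M; have [_ _ _ o2 _] := T_wmodel M'.
have od := @open_disc R 0 r.
exists ((qT \o s) @` disc 0 r), ((qT \o (g \o s)) @` disc 0 r); split.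
- exact: o1.
- exact: o2.
- by exists 0; [exact: disc_center|rewrite /= s0].
- by exists 0; [exact: disc_center|rewrite /= s0 eg].
- move=> _ [v vr <-] [v' v'r /= /(@orbit_projP R HH N _ _)[h hN e]]; apply: tt'.
  have hgG : (h * g)%g \in Gamma by apply: gpredM => //; exact: NG.
  have := wmodel_meet (@HH_hausdorff R) Gcont WHG Gtr M hgG v'r vr e.
  move=> /= e'; have e2 : h (g z) = z by exact: e'.
  by rewrite -[in LHS]e2 orbit_projN // eg.
Qed.

Theorem T_riemann : riemann_surface T.
Proof.
split.
- exact: T_hausdorff.
- by apply: orbit_space_connected; exact: HH_connected.
- by move=> c [].
- move=> t; have [z <-] := orbit_proj_surj t; have [s [r [n Mo]]] := H_model z.
  have [[[r0 _] [s0 _] _ _ _] _ _] := Mo; have [c [ac dc _]] := T_chart Mo.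
  by exists c => //; rewrite dc; exists 0; [exact: disc_center|rewrite /= s0].
- move=> c d ac ad; apply: hol_rel_compatible; [by case: ac|by case: ad|].
  move=> t; have [z <-] := orbit_proj_surj t => cz dz.
  by apply: T_hol_rel => //; exact: atlasT_hol.
Qed.

Lemma T_holomorphic (X : surface R) (f : T -> X) : continuous f ->
  (forall x : X, exists2 d, atlas X d & chart_dom d x) -> (forall d, atlas X d -> open (chart_dom d)) ->
  (forall d z, atlas X d -> chart_dom d (f (qT z)) -> hol_rel (chartH R) (d \o f \o qT) z) -> holomorphic f.
Proof.
move=> fc cov od H; split=> // t; have [z <-] := orbit_proj_surj t.
have [_ _ ca /(_ (qT z))[c ac cz] _] := T_riemann; have [d ad dz] := cov (f (qT z)).
exists c, d; split=> //; have [oc _ _ _] := ca c ac.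
apply: hol_rel_through; [exact: ca| |by move=> y []|].
  by apply: openI => //; move/continuousP: fc; apply; exact: od.
move=> y [cy dy]; have [z' ez'] := orbit_proj_surj y; rewrite -ez' in cy dy *.
by apply: T_hol_rel => //; exact: H.
Qed.

Lemma T_lift_bij g : g \in Gamma -> exists2 b, b \in G & forall z, b (qT z) = qT (g z).
Proof.
move=> gG; have gV : g^-1%g \in Gamma by rewrite gpredV.
have [|b bP] := @quotient_bij R HH N g (fun h => Nnorm gG).
  by move=> h hN; have := Nnorm gV hN; rewrite invgK.
by exists b => //; apply/factor_closedP; exists g.
Qed.

Lemma T_bij_cont b : b \in G -> continuous b.
Proof.
move=> /factor_closedP[g gG bg]; apply: (@orbit_factor_cont R HH N _ (qT \o g) b bg).
by move=> z; apply: continuous_comp; [exact: Gcont|exact: orbit_proj_cont].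
Qed.

Lemma T_bij_hol b : b \in G -> holomorphic (b : T -> T).
Proof.
move=> bG; have [_ _ ca cov _] := T_riemann; apply: T_holomorphic => //.
- exact: T_bij_cont.
- by move=> d /ca[].
move=> d z ad dz; have /factor_closedP[g gG bg] := bG.
have -> : (d \o b) \o qT = (d \o qT) \o g by apply/funext => y /=; rewrite bg.
apply: hol_rel_PSL2; first exact: GP.
by apply: atlasT_hol => //; rewrite -bg.
Qed.

Lemma T_aut : [set` G] `<=` @aut_surface R T.
Proof.
move=> b bG; split; first exact: T_bij_hol.
exists (b^-1)%g; split; [exact: bij_funK|exact: bij_invK|].
by apply: T_bij_hol; rewrite gpredV.
Qed.

Lemma WTG b : b \in G -> forall t, WT (b t) = WT t.
Proof.
move=> /factor_closedP[g gG bg] t; have [z <-] := orbit_proj_surj t.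
by rewrite bg !WTE WHG.
Qed.

Lemma WT_trans t t' : WT t = WT t' -> exists2 b, b \in G & b t = t'.
Proof.
have [z <-] := orbit_proj_surj t; have [z' <-] := orbit_proj_surj t'; rewrite !WTE => /Gtr[g gG <-].
by have [b bG bg] := T_lift_bij gG; exists b.
Qed.

Lemma T_wmodels t : exists (s : C -> T) (r : R) n, wmodel WT t s r n.
Proof.
have [z <-] := orbit_proj_surj t; have [s [r [n [M _ _]]]] := H_model z.
by exists (qT \o s), r, n; exact: T_wmodel.
Qed.

(** The sheets over a disc, projected to T, are equal or disjoint; this
    identifies them as connected components in [pT_branched]. *)
Lemma sheets_meet z (s : C -> HH) (r : R) n g g' v v' : model WH z s r n -> g \in Gamma -> g' \in Gamma ->
  disc 0 r v -> disc 0 r v' -> qT (g' (s v')) = qT (g (s v)) ->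
  (qT \o (g' \o s)) @` disc 0 r `<=` (qT \o (g \o s)) @` disc 0 r.
Proof.
move=> [M _ _] gG g'G vr v'r /(@orbit_projP R HH N _ _)[h hN e] _ [u ur <-].
have [[r0 n0] [s0 sinj] sc sO sW] := M.
have dG : (g^-1 * (h * g'))%g \in Gamma.
  by do ?[apply: gpredM]; rewrite ?gpredV //; exact: NG.
have de : (g^-1 * (h * g'))%g (s v') = s v by change (bij_inv g (h (g' (s v'))) = s v); rewrite e bij_funK.
have dz := wmodel_meet (@HH_hausdorff R) Gcont WHG Gtr M dG v'r vr de.
have [om omn omP] := wmodel_fix (@HH_hausdorff R) Gcont WHG Gtr M (Gcont dG) (WHG dG) dz.
exists (om * u); first exact: (unit_disc_rot n0 omn).
rewrite /= -omP //; change (qT (g (bij_inv g (h (g' (s u))))) = qT (g' (s u))).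
by rewrite bij_invK orbit_projN.
Qed.

Section Fermat.
Local Notation sphere := (riemann_sphere R).
Variables (k : nat) (B : set sphere) (c0 : sphere).
Local Notation Y := (open_subsurface (~` limit_point B)).
Variable P : HH -> Y.
Hypothesis k1 : (1 < k)%N.
Hypothesis Bc0 : limit_point B c0.
Hypothesis charts : forall y : Y, exists2 w : chart R Y, holomorphic_chart w & chart_dom w y.
Hypothesis Pc : continuous P.
Hypothesis Psurj : forall y, exists z, P z = y.
Hypothesis PW : forall z, planeY c0 (P z) = WH z.
Hypothesis degB : forall z (s : C -> HH) (r : R) n, model WH z s r n -> B (set_val (P z)) -> n = k.
Hypothesis degN : forall z (s : C -> HH) (r : R) n, model WH z s r n -> ~ B (set_val (P z)) -> n = 1%N.

Lemma pT_exists : exists pT : T -> Y, forall z, pT (qT z) = P z.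
Proof.
apply: orbit_factor => g z gN; apply: (planeY_inj Bc0); rewrite !PW WHG //; exact: NG.
Qed.

(** The branched covering of the base by T, through which P, the projection
    of the half-plane, factors. *)
Definition pT := sval (cid pT_exists).
Lemma pTE z : pT (qT z) = P z. Proof. exact: (svalP (cid pT_exists)). Qed.
Lemma planeT t : planeY c0 (pT t) = WT t.
Proof. by have [z <-] := orbit_proj_surj t; rewrite pTE PW WTE. Qed.

Lemma pT_cont : continuous pT.
Proof. by apply: (@orbit_factor_cont R HH N Y P pT pTE). Qed.

Lemma Y_dom_open d : atlas Y d -> open (chart_dom d).
Proof.
case=> d0 [->|->] ->.
  by exists [set x : sphere | x <> None] => //; exact: sphere_open0.
by exists [set x : sphere | x <> Some 0] => //; exact: sphere_openoo.
Qed.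

Lemma Y_cover (y : Y) : exists2 d, atlas Y d & chart_dom d y.
Proof.
have [e|ne] := pselect (set_val y = None).
  exists (@Chart R Y (set_val @^-1` [set x : sphere | x <> Some 0]) (@sphere_chartoo R \o set_val)).
    by exists (@sphere_chartoo R) => //; right.
  by rewrite /= e.
exists (@Chart R Y (set_val @^-1` [set x : sphere | x <> None]) (@sphere_chart0 R \o set_val)) => //.
by exists (@sphere_chart0 R) => //; left.
Qed.

Lemma pT_hol : holomorphic pT.
Proof.
apply: (T_holomorphic pT_cont Y_cover Y_dom_open) => d z ad dz.
have hw := planeY_chart Bc0 (WH z) (@ltr01 R) charts; set w := Chart _ _ in hw.
have wy : chart_dom w (P z) by rewrite /= PW subrr nC0 ltr01.
rewrite pTE in dz; have [ow _ _ _] := hw.1.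
have h1 : hol_rel w d (P z).
  by apply: (through_hol_rel _ _ wy (hw.2 d ad).1) => //; apply: openI => //; exact: Y_dom_open.
have h2 : hol_rel (chartH R) (w \o P) z.
  apply: (@hol_rel_eq R HH _ ((fun u : C => 1^-1%:C * (u - WH z) : C) \o WH)); first by move=> y; rewrite /= PW.
  apply: hol_rel_post; first exact: WH_hol.
  by apply: cdiffM; [exact: cdiff_cst|apply: cdiffD; [exact: cdiff_id|exact: cdiff_cst]].
apply: (@hol_rel_eq R HH _ (d \o P)); first by move=> y; rewrite /= pTE.
by apply: hol_rel_map h2 h1; exact: Pc.
Qed.

Lemma atlasT_holomorphic c : atlas T c -> holomorphic_chart c.
Proof. by have [_ _ ca _ cp] := T_riemann => ac; split=> [|d ad]; [exact: ca|exact: cp]. Qed.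

Definition disc_coord (z : HH) (rho : R) : chart R Y :=
  Chart [set y : Y | nC (planeY c0 y - WH z) < rho] (fun y => rho^-1%:C * (planeY c0 y - WH z) : C).

Lemma disc_pow_lt (v : C) (r : R) n : (0 < n)%N -> disc 0 r v -> nC v ^+ n < r ^+ n.
Proof.
move=> n0; rewrite /disc /= subr0 => vr; have r0 : 0 < r by exact: le_lt_trans (nC_ge0 v) vr.
by rewrite ltrXn2r ?nC_ge0 // -lt0n.
Qed.

(** Rescaling the model by the radius r makes both discs unit discs. *)
Lemma T_local_form z (s : C -> HH) (r : R) n g : model WH z s r n -> g \in Gamma ->
  exists c : chart R T, [/\ atlas T c, chart_dom c = (qT \o (g \o s)) @` disc 0 r,
    forall v, disc 0 r v -> c (qT (g (s v))) = r^-1%:C * v &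
    forall t, chart_dom c t -> chart_dom (disc_coord z (r ^+ n)) (pT t) /\ disc_coord z (r ^+ n) (pT t) = (c t : R[i]) ^+ n].
Proof.
move=> Mo gG; have Mg := model_translate gG Mo; have [c [ac dc cE]] := T_chart Mg.
have [M sW _] := Mo; have [[r0 n0] [s0 sinj] sc sO _] := M.
have rn : (r^-1%:C : R[i]) != 0 by rewrite eq_complex /= eqxx andbT gt_eqF // invr_gt0.
have cc : is_chart c by exact: (atlasT_holomorphic ac).1.
have [oc ci _ _] := cc.
exists (Chart (chart_dom c) (fun t => r^-1%:C * c t : C)); split=> //.
- have post (f : T -> C) t : hol_rel c f t -> hol_rel c (fun t => r^-1%:C * f t : C) t.
    move=> h; apply: (@hol_rel_post R T c f t (fun u : C => r^-1%:C * u : C)) => //.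
    by apply: cdiffM; [exact: cdiff_cst|exact: cdiff_id].
  apply: atlasT_intro => [|y cy].
    apply: is_chart_of_hol => // [t t' ht ht' /= /(mulfI rn)|t ht]; first exact: ci.
    exists c, (chart_dom c); split=> // t' ct'; split=> //; apply: post; exact: hol_rel_id.
  apply: (@hol_rel_post R HH (chartH R) (c \o qT) y (fun u : C => r^-1%:C * u : C)); first exact: atlasT_hol.
  by apply: cdiffM; [exact: cdiff_cst|exact: cdiff_id].
- by move=> v vr /=; rewrite cE.
- move=> t /=; rewrite dc => -[v vr <-] /=; rewrite planeT WTE WHG // sW // addrAC subrr add0r nCX.
  split; first exact: disc_pow_lt.
  by rewrite (cE v vr) exprMn; congr (_ * _); rewrite -rcX exprVn.
Qed.

Lemma T_local_degree z (s : C -> HH) (r : R) n : model WH z s r n -> local_degree pT (qT z) n.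
Proof.
move=> Mo; have G1 : 1%g \in Gamma by exact: gpred1.
have [c [ac dc cE cw]] := T_local_form Mo G1.
have [M sW _] := Mo; have [[r0 n0] [s0 sinj] sc sO _] := M.
have d0 := disc_center (0 : C) r0.
have cz : chart_dom c (qT z) by rewrite dc; exists 0 => //=; rewrite s0.
have c0E : c (qT z) = 0 by have := cE 0 d0; rewrite s0 mulr0.
have hw : holomorphic_chart (disc_coord z (r ^+ n)) by apply: planeY_chart => //; rewrite exprn_gt0.
exists c, (disc_coord z (r ^+ n)); split.
- by split=> //; exact: atlasT_holomorphic.
- by [].
- by have [h1 h2] := cw _ cz; rewrite h2 c0E expr0n gtn_eqF.
- exact: cw.
Qed.

Lemma unit_discP (u : C) : unit_disc u <-> nC u < 1.
Proof. by rewrite /unit_disc /= normrC; split; rewrite ltcR. Qed.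

(** Over a disc of radius r ^ n around W z0, every point is a translate of a
    point of the model at z0, so the preimage is the union of the projected
    translates of the model. They are open and connected, and pairwise equal
    or disjoint, hence they are the components. *)
Theorem pT_branched : branched_covering pT.
Proof.
split; first exact: pT_hol.
  by move=> y _; have [z <-] := Psurj y; exists (qT z) => //; rewrite pTE.
move=> y; have [z0 ez0] := Psurj y; have [s [r [n Mo]]] := H_model z0.
have [M sW _] := Mo; have [[r0 n0] [s0 sinj] sc sO _] := M.
have rn0 : 0 < r ^+ n by rewrite exprn_gt0.
have rho0 : (r ^+ n)^-1 * r ^+ n = 1 by rewrite mulVf // gt_eqF.
have rC : ((r ^+ n)^-1%:C : R[i]) * (r ^+ n)%:C = 1 by rewrite -rcM rho0.
have hw : holomorphic_chart (disc_coord z0 (r ^+ n)) by exact: planeY_chart.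
have preim t : chart_dom (disc_coord z0 (r ^+ n)) (pT t) -> exists g v, [/\ g \in Gamma, disc 0 r v & t = qT (g (s v))].
  have [z1 <-] := orbit_proj_surj t; rewrite /= planeT WTE => h.
  have [v ev] := nth_root (WH z1 - WH z0) n0.
  have vr : disc 0 r v by apply: (disc_pow r0 n0); rewrite /disc /= subr0 ev.
  have [|g gG eg] := @Gtr (s v) z1; first by rewrite sW // ev addrC subrK.
  by exists g, v; split=> //; rewrite eg.
exists (disc_coord z0 (r ^+ n)); split=> //.
- by rewrite /= -ez0 PW subrr nC0.
- by rewrite /= -ez0 PW subrr mulr0.
- apply/seteqP; split=> [_ [y' hy' <-]|u /unit_discP u1].
    apply/unit_discP; rewrite /= nCM nCR gtr0_norm ?invr_gt0 // -rho0 ltr_pM2l ?invr_gt0 //.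
  have [v ev] := nth_root ((r ^+ n)%:C * u : C) n0.
  have vr : disc 0 r v.
    apply: (disc_pow r0 n0); rewrite /disc /= subr0 ev nCM nCR gtr0_norm // -[ltRHS]mulr1.
    by rewrite ltr_pM2l.
  have e : planeY c0 (P (s v)) - WH z0 = v ^+ n by rewrite PW sW // addrAC subrr add0r.
  exists (P (s v)); first by rewrite /= e nCX; exact: disc_pow_lt.
  by rewrite /= e ev mulrA rC mul1r.
move=> t /preim[g [v [gG vr et]]]; have [c [ac dc cE cw]] := T_local_form Mo gG.
exists n, c; split=> //.
- exact: atlasT_holomorphic.
- have ct : chart_dom c t by rewrite dc et; exists v.
  have oI g' : g' \in Gamma -> open ((qT \o (g' \o s)) @` disc 0 r).
    move=> g'G; have [M' _ _] := model_translate g'G Mo; have [_ _ _ o' _] := T_wmodel M'.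
    by apply: o' => //; exact: open_disc.
  apply/seteqP; split.
    apply: connected_component_max => //; first by move=> t' /cw[].
    rewrite dc; apply: connected_convex_image; [exact: convex_disc|exact: open_disc|].
    by have [[_ _ c' _ _] _ _] := model_translate gG Mo; move=> u ur; apply: continuous_comp; [exact: c'|exact: orbit_proj_cont].
  set A := connected_component _ _.
  (* the sheets disjoint from the sheet of t; their union is the complement
     of this sheet in the preimage of the disc *)
  pose O' : set T := \bigcup_(g' in [set g' | g' \in Gamma /\ forall t', chart_dom c t' -> ~ ((qT \o (g' \o s)) @` disc 0 r) t'])
    ((qT \o (g' \o s)) @` disc 0 r).
  have oO' : open O' by apply: bigcup_open => g' [g'G _]; exact: oI.
  have AO : A `&` chart_dom c = A `&` ~` O'.
    apply/seteqP; split=> t' [At' ht']; split=> //.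
      by move=> [g' [g'G nm] h]; exact: nm ht' h.
    have /preim[g' [v' [g'G v'r et']]] := connected_component_sub At'.
    apply: contrapT => nc; apply: ht'; exists g'; last by exists v'.
    split=> // t2; rewrite dc => -[u ur <-] [u' u'r e2]; apply: nc; rewrite dc.
    by apply: (sheets_meet Mo gG g'G ur u'r e2); exists v'.
  suff <- : A `&` chart_dom c = A by move=> ? [].
  apply: component_connected.
  - by exists t; split=> //; apply: connected_component_refl; exact: (cw t ct).1.
  - by exists (chart_dom c) => //; rewrite dc; exact: oI.
  - by exists (~` O') => //; exact: open_closedC.
- apply/seteqP; split=> [_ [t' + <-]|u /unit_discP u1].
    rewrite dc => -[v' v'r <-]; apply/unit_discP; rewrite /= cE // nCM nCR gtr0_norm ?invr_gt0 //.
    by rewrite mulrC ltr_pdivrMr // mul1r; move: v'r; rewrite /disc /= subr0.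
  have rr : (r^-1%:C : R[i]) * r%:C = 1 by rewrite -rcM mulVf // gt_eqF.
  have ur : disc 0 r (r%:C * u).
    by rewrite /disc /= subr0 nCM nCR gtr0_norm // -[ltRHS]mulr1 ltr_pM2l.
  exists (qT (g (s (r%:C * u)))); first by rewrite dc; exists (r%:C * u).
  by rewrite cE // mulrA rr mul1r.
- by move=> t' /cw[].
Qed.

(** A deck transformation agrees at a point off the centre of a model with an
    element of Gamma / N, and then everywhere by rigidity. *)
Theorem pT_galois : galois_branched_covering pT [set` G].
Proof.
have pTW t t' : pT t = pT t' <-> WT t = WT t'.
  by rewrite -!planeT; split=> [->//|/(planeY_inj Bc0)].
split; first exact: pT_branched.
- apply/seteqP; split=> [f [fa fp]|b bG]; last first.
    by split; [exact: T_aut|move=> t; apply/pTW; exact: WTG].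
  have fc : continuous f by case: fa => -[].
  have [s [r [n Mo]]] := H_model (HHi R); have [M _ _] := Mo; have TM := T_wmodel M.
  have [[r0 n0] [s0 _] _ _ _] := TM; have [h1 v0] := disc_half r0; set v := _%:C in h1 v0.
  have [b bG bf] := WT_trans (esym ((pTW _ _).1 (fp (qT (s v))))).
  have bV : b^-1%g \in G by rewrite gpredV.
  pose f' := (b^-1 * f)%g.
  have f'c : continuous f'.
    by move=> t; apply: (@continuous_comp _ _ _ f (b^-1)%g); [exact: fc|exact: T_bij_cont].
  have f'W t : WT (f' t) = WT t.
    by change (WT ((b^-1)%g (f t)) = WT t); rewrite WTG //; apply/pTW.
  have f'v : f' (qT (s v)) = qT (s v).
    by change (bij_inv b (f (qT (s v))) = qT (s v)); rewrite -bf bij_funK.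
  have f1 : f' = 1%g.
    have [om omn omP] := wmodel_rot T_hausdorff T_bij_cont WTG WT_trans TM f'c f'W h1 h1 v0 f'v.
    have om1 : om = 1.
      have [_ [_ inj] _ _ _] := TM.
      by apply: (mulIf v0); rewrite mul1r; apply: inj => //; [exact: (unit_disc_rot n0 omn)|rewrite -omP].
    apply: bijP => t; apply: (rigid T_hausdorff (let: And5 _ cT _ _ _ := T_riemann in cT) T_bij_cont WTG WT_trans T_wmodels f'c f'W (x := qT (s v))).
    exists ((qT \o s) @` (setT `&` disc 0 r)).
      by apply: (wmodel_nbhs TM h1); apply/nbhsC; exists 1.
    by move=> _ [u [_ ur] <-]; rewrite omP // om1 mul1r.
  have e : (b * f')%g = f by rewrite /f' mulVKg.
  by rewrite -e f1 mulg1.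
- move=> t t' /pTW/WT_trans[b bG e]; by exists b.
Qed.

Lemma local_degree_T_wmodel t n : (0 < n)%N -> local_degree pT t n -> exists (s : C -> T) (r : R), wmodel WT t s r n.
Proof.
move=> n0 [z [w [[[cz _] [cw _]] [zx z0] [wx w0] zw]]].
apply: (wmodel_of_chart cz zx z0 n0) => y y' zy zy'.
have [wy ey] := zw y zy; have [wy' ey'] := zw y' zy'; rewrite -ey -ey' -!planeT.
split=> [/(planeY_inj Bc0) -> //|e]; have [_ wi _ _] := cw.
by rewrite (wi (pT y) (pT y')) ?inE.
Qed.

Theorem pT_branch_values : branch_values pT = set_val @^-1` B.
Proof.
have [_ cT _ _ _] := T_riemann.
apply/seteqP; split=> [_ [t [n [<- n1 ld]]]|y By].
  have [z ez] := orbit_proj_surj t; subst t; rewrite /= pTE; apply: contrapT => nB.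
  have [s [r M]] := local_degree_T_wmodel (ltnW n1) ld; have [s' [r' [n' Mo]]] := H_model z.
  have n'1 := degN Mo nB; have [M' _ _] := Mo.
  have := wmodel_degree T_hausdorff cT T_bij_cont WTG WT_trans T_wmodels M (T_wmodel M').
  by move=> e; move: n1; rewrite e n'1.
have [z ez] := Psurj y; have [s [r [n Mo]]] := H_model z.
have nk : n = k by apply: degB Mo _; rewrite ez.
by exists (qT z), n; split; [rewrite pTE|rewrite nk|exact: T_local_degree Mo].
Qed.

Theorem pT_degree t : B (set_val (pT t)) -> local_degree pT t k.
Proof.
have [z <-] := orbit_proj_surj t; rewrite pTE => Bz; have [s [r [n Mo]]] := H_model z.
by rewrite -(degB Mo Bz); exact: T_local_degree Mo.
Qed.
End Fermat.
End Cover.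

(** * Gamma / Gamma_k is free over Z/k *)

Section PlanarOrbifold.
Variables (R : realType) (k : nat).
Local Notation C := (R[i]^o).
Local Notation HH := (upper_half_plane R).
Variables (Gamma : groupClosed (selfbij HH)) (WH : HH -> C).
Hypothesis k1 : (1 < k)%N.
Hypothesis GP : [set` Gamma] `<=` @PSL2 R.
Hypothesis WH_fibre : forall z z', WH z = WH z' <-> exists2 g, g \in Gamma & g z = z'.
Hypothesis H_model : forall z, exists (s : C -> HH) (r : R) n, model WH z s r n.
Hypothesis WH_hol : forall z, hol_rel (chartH R) WH z.
Hypothesis deg : forall z (s : C -> HH) (r : R) n, model WH z s r n -> n = 1%N \/ n = k.

Let Gcont g : g \in Gamma -> continuous g. Proof. by move=> /GP; exact: PSL2_cont. Qed.
Let WHG g : g \in Gamma -> forall z, WH (g z) = WH z.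
Proof. by move=> gG z; apply/esym/WH_fibre; exists g. Qed.
Let Gtr z z' : WH z = WH z' -> exists2 g, g \in Gamma & g z = z'. Proof. by move/WH_fibre. Qed.
Let wmH z : exists (s : C -> HH) (r : R) n, wmodel WH z s r n.
Proof. by have [s [r [n []]]] := H_model z; exists s, r, n. Qed.
Let reg := regular Gamma.
Let WHc : continuous WH. Proof. by move=> y; exact: hol_rel_cont (@is_chartH R) (WH_hol y). Qed.

(** The values of W at points with trivial stabilizer; this is the planar
    domain in which the paths of [planar_divisible] move. *)
Definition regular_image : set C := [set w | exists2 z, reg z & WH z = w].

Lemma regular_imageP z : regular_image (WH z) <-> reg z.
Proof.
split=> [[z' rz' e]|rz]; last by exists z.
exact: (regular_orbit WH_fibre e rz').
Qed.

Lemma regular_model z : reg z -> exists (s : C -> HH) (r : R), model WH z s r 1.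
Proof.
move=> rz; have [s [r [n Mo]]] := H_model z; have [M _ _] := Mo.
by have n1 := regular_degree GP WH_fibre H_model M rz; exists s, r; rewrite -n1.
Qed.

Lemma degree1_regular z (s : C -> HH) (r : R) : model WH z s r 1 -> reg z.
Proof.
move=> [M _ _] g gG gz; have [[r0 _] _ _ _ _] := M; have [h1 v0] := disc_half r0.
have [om om1 omP] := wmodel_fix (@HH_hausdorff R) Gcont WHG Gtr M (Gcont gG) (WHG gG) gz.
apply: (stabilizer_off_center (@HH_hausdorff R) (@HH_connected R) Gcont WHG Gtr wmH M h1 v0 gG).
by rewrite omP // -[om]expr1 om1 mul1r.
Qed.

Lemma regular_image_open : open regular_image.
Proof.
apply/openC => _ [z rz <-]; have [s [r [M sW _]]] := regular_model rz.
have [[r0 _] [s0 _] _ _ _] := M; exists r => // u ur.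
have ur' : disc 0 r (u - WH z) by rewrite /disc /= subr0.
exists (s (u - WH z)); last by rewrite sW // expr1 addrC subrK.
have [->|v0] := eqVneq (u - WH z) 0; first by rewrite s0.
exact: (regular_near GP WH_fibre H_model M ur' v0).
Qed.

(** Near a point over c the function W - c is a k-th power v ^+ k, for every
    such point has degree k; elsewhere it does not vanish. The half-plane is
    star-shaped, so the local roots extend to a global one. *)
Lemma orbifold_roots c : ~ regular_image c -> exists2 G : HH -> C, continuous G & forall z, G z ^+ k = WH z - c.
Proof.
move=> Uc; pose Psi (u : C) : C := WH (eta u) - c.
have k0 : (0 < k)%N by exact: ltnW.
have Psic u : halfplane u -> ccont Psi u.
  move=> hu; apply: contB; last exact: contc.
  by constructor; apply: continuous_comp; [exact: eta_cont|exact: WHc].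
have dE : discreteC (@halfplane R) [set u | Psi u = 0].
  move=> z hz; have [P0|Pn] := eqVneq (Psi z) 0; last first.
    have /ccontP/(_ (nC (Psi z)))[|e e0 he] := Psic z hz; first by rewrite nC_gt0.
    by exists e => // w /he + w0; rewrite w0 sub0r nCN ltxx.
  have [s [r [n [M sW _]]]] := H_model (eta z); have [[r0 n0] [s0 sinj] sc sO _] := M.
  have nb : nbhs (eta z) (s @` (setT `&` disc 0 r)).
    by rewrite -s0; apply: (wmodel_nbhs M (disc_center _ r0)); apply/nbhsC; exists 1.
  have [hal h0 hc] := (openC _).1 (@halfplane_open R) z hz.
  have /nbhsC[e e0 he] := eta_cont hz nb.
  exists (Num.min e hal); first by rewrite lt_min e0.
  move=> w; rewrite lt_min => /andP[/he/= [v [_ vr] ev] /hc hw] w0.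
  have v0 : v = 0.
    have : v ^+ n = 0.
      apply: (addrI (WH (eta z))); rewrite -sW // addr0 ev.
      by apply: (addIr (- c)); rewrite [LHS]w0 -[LHS]P0.
    by move/eqP; rewrite expf_eq0 n0 /= => /eqP.
  by rewrite -(etaK hw) -ev v0 s0 etaK.
have nz z : halfplane z -> ~ [set u | Psi u = 0] z -> Psi z != 0 by move=> _ /eqP.
have loc z : halfplane z -> exists2 e : R, 0 < e & exists f, root_on k Psi f (disc z e).
  move=> hz; have [hal h0 hc] := (openC _).1 (@halfplane_open R) z hz.
  have [P0|Pn] := eqVneq (Psi z) 0; last first.
    by apply: root_near_cont => //; exists hal => // u /hc; exact: Psic.
  have Wc : WH (eta z) = c by apply/eqP; rewrite -subr_eq0; apply/eqP.
  have [s [r [n Mo]]] := H_model (eta z); have [M sW _] := Mo; have [[r0 n0] [s0 sinj] sc sO _] := M.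
  have nk : n = k.
    case: (deg Mo) => // n1; exfalso; apply: Uc; rewrite -Wc; apply/regular_imageP.
    by apply: (@degree1_regular _ s r); rewrite -n1.
  have [t tE [ot _ tc _]] := wmodel_inv M.
  have nb : nbhs (eta z) (s @` (setT `&` disc 0 r)).
    by rewrite -s0; apply: (wmodel_nbhs M (disc_center _ r0)); apply/nbhsC; exists 1.
  have /nbhsC[e e0 he] := eta_cont hz nb.
  exists (Num.min e hal); first by rewrite lt_min e0.
  exists (t \o @eta R) => u; rewrite /disc /= lt_min => /andP[/he/= [v [_ vr] ev] /hc hu].
  split; last by rewrite -ev tE // /Psi -ev sW // Wc -nk addrAC subrr add0r.
  constructor; apply: continuous_comp; first exact: eta_cont.
  by rewrite -ev; apply: tc; exists v.
have [f fP] := root_exists k0 (@halfplane_open R) dE nz (halfplane_convex (@halfplane_i R)) loc.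
exists (f \o set_val) => [z|z]; last by rewrite /= (fP _ (HH_val z)).2 /Psi eta_val.
apply: continuous_comp; first exact: HH_val_cont.
by case: (fP _ (HH_val z)).1.
Qed.

(** [planar_divisible] for the action of Gamma on the half-plane. Points
    outside the discrete singular set are connected by [lc_discrete]. *)
Theorem divisible_of_characters (A : zmodType) (theta : selfbij HH -> A) (a : selfbij HH) p :
  (forall g h, g \in Gamma -> h \in Gamma -> theta (g * h)%g = theta g + theta h) ->
  a \in Gamma -> prime p -> (p %| k)%N ->
  (forall chi : selfbij HH -> 'Z_k, (forall g h, g \in Gamma -> h \in Gamma -> chi (g * h)%g = chi g + chi h) ->
     chi a *+ (k %/ p) = 0) ->
  exists y, theta a = y *+ p.
Proof.
move=> thM aG pp pk hchi; have [zr rzr] := regular_exists GP WH_fibre H_model.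
apply: (@planar_divisible R HH Gamma WH regular_image k k1 (@HH_hausdorff R) Gcont WHG Gtr regular_image_open
  WHc _ _ _ _ _ orbifold_roots A theta a p thM _ aG pp pk hchi).
- by move=> x g /regular_imageP rx; exact: rx.
- move=> x /regular_imageP/regular_model[s [r [M sW _]]]; have [[r0 _] [s0 _] sc _ sWW] := M.
  exists (s @` (setT `&` disc 0 r)).
    by rewrite -s0; apply: (wmodel_nbhs M (disc_center _ r0)); apply/nbhsC; exists 1.
  by move=> _ _ [v [_ vr] <-] [v' [_ vr'] <-] /(sWW _ _ vr vr'); rewrite !expr1 => ->.
- move=> x /regular_imageP/regular_model[s [r [M sW _]]]; have [[r0 _] [s0 _] sc _ sWW] := M.
  exists r => //; exists (fun w => s (w - WH x)); last by rewrite subrr s0.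
  move=> u ur; have ur' : disc 0 r (u - WH x) by rewrite /disc /= subr0.
  split; last by rewrite sW // expr1 addrC subrK.
  apply: (@continuous_comp _ _ _ (fun w : C => w - WH x) s); last exact: sc.
  have [] // : ccont (fun w : C => w - WH x) u by apply: contB; [exact: conti|exact: contc].
- by move=> w [z _ <-]; exists z.
- move=> Q lc x y /regular_imageP rx /regular_imageP ry Qx.
  have dS := singular_discrete GP WH_fibre H_model.
  have H z : halfplane z -> ~ [set z | ~ reg (eta z)] z ->
      exists2 e : R, 0 < e & forall w, nC (w - z) < e -> (Q (eta w) <-> Q (eta z)).
    move=> hz /contrapT rz; have [V nV VP] := lc _ ((regular_imageP (eta z)).2 rz).
    have [hal h0 hc] := (openC _).1 (@halfplane_open R) z hz.
    have /nbhsC[e1 e10 he1] := eta_cont hz nV.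
    have /nbhsC[e2 e20 he2] : nbhs z (@eta R @^-1` (WH @^-1` regular_image)).
      apply: (eta_cont hz); apply: WHc; apply: open_nbhs_nbhs; split; first exact: regular_image_open.
      exact/regular_imageP.
    exists (Num.min e1 e2); first by rewrite lt_min e10.
    by move=> w; rewrite lt_min => /andP[/he1 w1 /he2 w2]; apply: VP.
  have ns y' : reg y' -> ~ [set z | ~ reg (eta z)] (set_val y') by rewrite /= eta_val => h n; exact: n h.
  have := lc_discrete (@halfplane_open R) (@halfplane_convex R) dS H (HH_val x) (ns _ rx) (HH_val y) (ns _ ry).
  by rewrite !eta_val => -[+ _]; apply.
- by exists zr; exact/regular_imageP.
Qed.

(** The translates of a small disc around a regular point are disjoint open
    sets, and each of them contains a point with rational coordinates. *)
Theorem countable_deck : exists e : nat -> selfbij HH, forall g, g \in Gamma -> exists n, e n = g.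
Proof.
have [z rz] := regular_exists GP WH_fibre H_model; have [s [r [n [M _ _]]]] := H_model z.
have [[r0 n0] [s0 sinj] sc sO _] := M.
pose V (g : selfbij HH) : set HH := g @` (s @` disc 0 r).
have Vu g h y : g \in Gamma -> h \in Gamma -> V g y -> V h y -> g = h.
  move=> gG hG [_ [v vr <-] <-] [_ [v' v'r <-] e].
  have dG : (g^-1 * h)%g \in Gamma by apply: gpredM => //; rewrite gpredV.
  have d1 : (g^-1 * h)%g = 1%g.
    apply: rz => //; apply: (wmodel_meet (@HH_hausdorff R) Gcont WHG Gtr M dG v'r vr).
    by change (bij_inv g (h (s v')) = s v); rewrite e bij_funK.
  by move: d1 => /(congr1 (fun f => g * f)%g); rewrite mulVKg mulg1 => ->.
have oV g : g \in Gamma -> open (V g).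
  move=> gG; have gV : g^-1%g \in Gamma by rewrite gpredV.
  have -> : V g = bij_inv g @^-1` (s @` disc 0 r).
    apply/seteqP; split=> [_ [y Vy <-]|y Vy]; first by rewrite /= bij_funK.
    by exists (bij_inv g y) => //; rewrite bij_invK.
  by move/continuousP: (Gcont gV); apply; apply: sO => //; exact: open_disc.
pose pt (ab : rat * rat) : C := ratr ab.1 +i* ratr ab.2.
pose e m := if unpickle m is Some ab then xget 1%g [set g | g \in Gamma /\ V g (eta (pt ab))] else 1%g.
exists e => g gG; have oI := HH_image_open (oV g gG).
have Vz : V g (g z) by exists z => //; exists 0; [exact: disc_center|].
have [rho rho0 hr] := (openC _).1 oI (set_val (g z)) (ex_intro2 _ _ _ Vz erefl).
set w := set_val (g z) in hr.
have r20 : 0 < rho / 2 by rewrite divr_gt0.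
have [|a] := @rat_in_itvoo R (complex.Re w - rho / 2) (complex.Re w + rho / 2); first by lra.
have [|b] := @rat_in_itvoo R (complex.Im w - rho / 2) (complex.Im w + rho / 2); first by lra.
rewrite !in_itv /= => /andP[b1 b2] /andP[a1 a2].
have [y Vy ey] : (set_val @` V g) (pt (a, b)).
  apply: hr; apply: le_lt_trans (nC_ReIm _) _; rewrite ReB ImB /=.
  have : `|ratr a - complex.Re w| < rho / 2 by rewrite ltr_norml; lra.
  have : `|ratr b - complex.Im w| < rho / 2 by rewrite ltr_norml; lra.
  lra.
have ye : eta (pt (a, b)) = y by rewrite -ey eta_val.
exists (pickle (a, b)); rewrite /e pickleK; rewrite -ye in Vy.
have [h1 h2] := @xgetI _ 1%g [set g | g \in Gamma /\ V g (eta (pt (a, b)))] g (conj gG Vy).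
exact: Vu h1 gG h2 Vy.
Qed.
End PlanarOrbifold.

Section AbelianSubgroup.
Variables (gT : groupType) (G : groupClosed gT).
Hypothesis ab : forall x y, x \in G -> y \in G -> (x * y = y * x)%g.
Definition absub : Type := {x : gT | x \in G}.
HB.instance Definition _ := Choice.copy absub {x : gT | x \in G}.
Definition absub_add (x y : absub) : absub := exist _ (val x * val y)%g (gpredM _ _ (valP x) (valP y)).
Definition absub_opp (x : absub) : absub := exist _ (val x)^-1%g (etrans (gpredV _ _) (valP x)).
Fact absub_one : 1%g \in G. Proof. exact: gpred1. Qed.
Definition absub_zero : absub := exist _ 1%g absub_one.
Fact absub_addA : associative absub_add.
Proof. by move=> x y z; apply: val_inj; rewrite /= mulgA. Qed.
Fact absub_addC : commutative absub_add.
Proof. by move=> x y; apply: val_inj; apply: ab; exact: valP. Qed.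
Fact absub_add0 : left_id absub_zero absub_add.
Proof. by move=> x; apply: val_inj; rewrite /= mul1g. Qed.
Fact absub_addN : left_inverse absub_zero absub_opp absub_add.
Proof. by move=> x; apply: val_inj; rewrite /= mulVg. Qed.

(** The additive group structure cannot be a canonical instance, since it
    depends on the proof of commutativity. *)
Definition absub_zmod : zmodType :=
  HB.pack absub (GRing.isZmodule.Build absub absub_addA absub_addC absub_add0 absub_addN).
End AbelianSubgroup.

Section FreeQuotient.
Variables (gT hT : groupType) (k : nat) (Gam : groupClosed gT) (G : groupClosed hT) (pi : gT -> hT).
Hypothesis k1 : (1 < k)%N.
Hypothesis piM : forall g h, g \in Gam -> h \in Gam -> pi (g * h)%g = (pi g * pi h)%g.
Hypothesis piG : forall g, g \in Gam -> pi g \in G.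
Hypothesis pi_onto : forall b, b \in G -> exists2 g, g \in Gam & pi g = b.
Hypothesis pi_ker : forall g, g \in Gam -> pi g = 1%g -> g \in commutator_power_subgroup k Gam.
Hypothesis Gab : forall x y, x \in G -> y \in G -> (x * y = y * x)%g.
Hypothesis Gk : forall x, x \in G -> (x ^+ k = 1)%g.
Hypothesis cnt : exists e : nat -> gT, forall g, g \in Gam -> exists n, e n = g.
Let hom_char (chi : gT -> 'Z_k) := forall g h, g \in Gam -> h \in Gam -> chi (g * h)%g = chi g + chi h.
Hypothesis div : forall (A : zmodType) (theta : gT -> A) a p,
  (forall g h, g \in Gam -> h \in Gam -> theta (g * h)%g = theta g + theta h) ->
  a \in Gam -> prime p -> (p %| k)%N -> (forall chi, hom_char chi -> chi a *+ (k %/ p) = 0) ->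
  exists y, theta a = y *+ p.
Hypothesis dual : exists (ga : nat -> gT) (chi : nat -> gT -> 'Z_k),
  [/\ forall i, ga i \in Gam, forall j, hom_char (chi j) & forall i j, chi j (ga i) = (i == j)%:R].

Let A := absub_zmod Gab.
Let val_A (x : A) : hT := val (x : absub G).
Let val_AD x y : val_A (x + y) = (val_A x * val_A y)%g. Proof. by []. Qed.
Let val_A0 : val_A 0 = 1%g. Proof. by []. Qed.
Let val_AG x : val_A x \in G. Proof. exact: valP. Qed.
Let val_A_inj : injective val_A. Proof. by move=> x y h; exact: val_inj. Qed.
Let val_AX x n : val_A (x *+ n) = (val_A x ^+ n)%g.
Proof. by elim: n => [|n IH]; rewrite ?mulr0n ?expg0 // mulrS expgS -IH. Qed.
Let cls (b : hT) : A := insubd (absub_zero G : absub G) b.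
Let val_cls b : b \in G -> val_A (cls b) = b. Proof. by move=> bG; rewrite /val_A /cls insubdK. Qed.

Let char_one chi : hom_char chi -> chi 1%g = 0.
Proof.
move=> hc; have G1 : 1%g \in Gam by exact: gpred1.
by apply: (addrI (chi 1%g)); rewrite -hc // mulg1 addr0.
Qed.
Let char_inv chi g : hom_char chi -> g \in Gam -> chi g^-1%g = - chi g.
Proof.
move=> hc gG; have gV : g^-1%g \in Gam by rewrite gpredV.
by apply: (addrI (chi g)); rewrite -hc // mulgV subrr char_one.
Qed.

Lemma char_kills chi g : hom_char chi -> g \in commutator_power_subgroup k Gam -> chi g = 0.
Proof.
move=> hc gN; suff [] : g \in Gam /\ chi g = 0 by [].
apply: (@commutator_power_ind _ k Gam (fun g => g \in Gam /\ chi g = 0) g) gN.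
- by split; [exact: gpred1|exact: char_one].
- by move=> x y [xG x0] [yG y0]; split; [exact: gpredM|rewrite hc // x0 y0 addr0].
- by move=> x [xG x0]; split; [rewrite gpredV|rewrite char_inv // x0 oppr0].
- move=> x y xG yG; have xV : x^-1%g \in Gam by rewrite gpredV.
  have yV : y^-1%g \in Gam by rewrite gpredV.
  split; first exact: gpredR.
  rewrite /commg /conjg hc //; last by do ?[apply: gpredM].
  rewrite hc //; last exact: gpredM.
  by rewrite hc // !char_inv // [X in - chi x + X]addrCA addKr addrC -[LHS]addr0; zmod.
- move=> x xG; split; first exact: gpredXn.
  have pw m : chi (x ^+ m)%g = chi x *+ m.
    by elim: m => [|m IH]; [rewrite expg0 mulr0n char_one|rewrite expgS mulrS hc ?IH //; exact: gpredXn].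
  by rewrite pw -[chi x]natr_Zp -mulrnA mulnC mulrnA pchar_Zp // mul0rn.
Qed.

(** A character of Gam kills commutators and k-th powers, so it factors
    through the quotient; this transfers [div] and [dual] from Gam to A. *)
Lemma char_descend chi : hom_char chi -> exists chi' : A -> 'Z_k, additive_char chi' /\
  forall g, g \in Gam -> chi' (cls (pi g)) = chi g.
Proof.
move=> hc; have same g h : g \in Gam -> h \in Gam -> pi g = pi h -> chi g = chi h.
  move=> gG hG e; have hV : h^-1%g \in Gam by rewrite gpredV.
  have hgG : (h^-1 * g)%g \in Gam by exact: gpredM.
  have p1 : pi (h^-1 * g)%g = 1%g.
    have := piM hG hgG; rewrite mulVKg e => /(congr1 (fun z => (pi h)^-1 * z)%g).
    by rewrite mulVg mulKg => <-.
  have := char_kills hc (pi_ker hgG p1); rewrite hc // char_inv // addrC => /eqP.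
  by rewrite subr_eq0 => /eqP.
have /choice[pre preP] (x : A) : exists g, g \in Gam /\ pi g = val_A x.
  by have [g gG e] := pi_onto (val_AG x); exists g.
exists (fun x => chi (pre x)); split=> [x y|g gG].
  have [xG xe] := preP x; have [yG ye] := preP y; have [xyG xye] := preP (x + y).
  rewrite -hc //; apply: same => //; first exact: gpredM.
  by rewrite piM // xye xe ye.
have [pG pe] := preP (cls (pi g)); apply: same => //.
by rewrite pe val_cls //; exact: piG.
Qed.

(** Abstract form of the conclusion: G is the quotient of Gam by commutators
    and k-th powers, [div] is the divisibility property of planar groups, and
    [dual] expresses infinite rank by a sequence of elements dual to
    characters. *)
Theorem free_quotient : isog_Zk_sum k G.
Proof.
have expA (x : A) : x *+ k = 0.
  by apply: val_A_inj; rewrite val_AX val_A0; apply: Gk; exact: val_AG.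
have divA p (x : A) : prime p -> (p %| k)%N -> (forall chi : A -> 'Z_k, additive_char chi -> chi x *+ (k %/ p) = 0) ->
    exists y, x = y *+ p.
  move=> pp pk hx; have [g gG eg] := pi_onto (val_AG x).
  have xe : x = cls (pi g) by apply: val_A_inj; rewrite val_cls ?piG // eg.
  have [|chi hc|y ye] := @div A (fun g => cls (pi g)) g p _ gG pp pk.
  - move=> a b aG bG; apply: val_A_inj; rewrite val_AD !val_cls ?piG ?piM //.
    exact: gpredM.
  - have [chi' [ac ce]] := char_descend hc.
    by have := hx chi' ac; rewrite xe ce.
  - by exists y; rewrite xe.
have cntA : exists e : nat -> A, forall x, exists n, e n = x.
  have [e eP] := cnt; exists (fun n => cls (pi (e n))) => x.
  have [g gG eg] := pi_onto (val_AG x); have [n en] := eP g gG; exists n.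
  by apply: val_A_inj; rewrite en val_cls ?piG // eg.
have rankA : exists a : nat -> A, forall i j, (i < j)%N -> full_order k (a j - a i).
  have [ga [chi [gaG chiP dl]]] := dual; exists (fun i => cls (pi (ga i))) => i j ij p pp pk.
  have [chi' [ac ce]] := char_descend (chiP j).
  apply/eqP => /(congr1 chi'); rewrite (charMn _ _ ac) (char0 ac) (charB _ _ ac) !ce // !dl eqxx.
  rewrite ltn_eqF //= subr0 => /(congr1 val); rewrite /= (val_Zp_nat k1) => /eqP.
  rewrite -/(dvdn _ _) => /dvdn_leq; rewrite divn_gt0 ?prime_gt0 // dvdn_leq //; last exact: ltnW.
  by move=> /(_ isT); rewrite leqNgt ltn_Pdiv ?prime_gt1 //; exact: ltnW.
have [f [[f1 f2 f3] fD]] := free_countable_module k1 expA divA cntA rankA.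
exists (fun a => val_A (f a)); split; last first.
  by move=> a b fa fb; rewrite fD.
split.
- by move=> a fa; exact: val_AG.
- by move=> a b ha hb /val_A_inj; exact: f2.
- move=> b bG; have [|a fa ea] := f3 (cls b); first by [].
  by exists a => //; rewrite ea val_cls.
Qed.
End FreeQuotient.

(** * The universal lift and the isomorphism *)

Section ZkSum.
Variables (gT : groupType) (k : nat) (G : groupClosed gT).
Hypothesis k1 : (1 < k)%N.
Hypothesis GZ : isog_Zk_sum k G.
Let fin (a : nat -> 'Z_k) := finite_set [set n | a n != 0].

Let finD (a b : nat -> 'Z_k) : fin a -> fin b -> fin (fun n => a n + b n).
Proof.
move=> fa fb; apply: (@sub_finite_set _ _ ([set n | a n != 0] `|` [set n | b n != 0])).
  move=> n /= h; have [a0|a0] := eqVneq (a n) 0; last by left.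
  by right; rewrite /= ; move: h; rewrite a0 add0r.
by rewrite finite_setU.
Qed.
Let fin0 : fin (fun=> 0).
Proof. by apply: (@sub_finite_set _ _ set0) => [n /=|]; [rewrite ?eqxx|exact: finite_set0]. Qed.
Let finM (a : nat -> 'Z_k) m : fin a -> fin (fun n => a n *+ m).
Proof.
move=> fa; apply: sub_finite_set fa => n /=; apply: contra => /eqP ->.
by rewrite mul0rn.
Qed.
Let delta (i n : nat) : 'Z_k := (n == i)%:R.
Let finE i : fin (delta i).
Proof.
apply: (@sub_finite_set _ _ [set i]) => [n /=|]; last exact: finite_set1.
by rewrite /delta; have [->//|ni] := eqVneq n i; move=> /eqP[].
Qed.

(** What is needed of a direct sum of copies of Z/k: besides the identities,
    the standard basis with its coordinate characters. *)
Lemma Zk_sum_facts : [/\ forall x y, x \in G -> y \in G -> (x * y = y * x)%g,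
  forall x, x \in G -> (x ^+ k = 1)%g &
  exists (ga : nat -> gT) (chi : nat -> gT -> 'Z_k), [/\ forall i, ga i \in G,
    forall j g h, g \in G -> h \in G -> chi j (g * h)%g = chi j g + chi j h &
    forall i j, chi j (ga i) = (i == j)%:R]].
Proof.
have [f [[f1 f2 f3] fD]] := GZ.
have f0 : f (fun=> 0) = 1%g.
  have := fD _ _ fin0 fin0; under eq_fun do rewrite addr0.
  by move=> /(congr1 (fun x => (f (fun=> 0))^-1 * x)%g); rewrite mulKg mulVg.
split.
- move=> _ _ /f3[a fa <-] /f3[b fb <-]; rewrite -!fD //.
  by congr f; apply/funext => n; rewrite addrC.
- move=> _ /f3[a fa <-]; have pw m : f (fun n => a n *+ m) = (f a ^+ m)%g.
    elim: m => [|m IH]; first by rewrite expg0 -f0; congr f.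
    rewrite expgS -IH -fD //; last exact: finM.
    by congr f; apply/funext => n; rewrite mulrS.
  rewrite -pw -f0; congr f; apply/funext => n.
  by rewrite -[a n]natr_Zp -mulrnA mulnC mulrnA pchar_Zp // mul0rn.
pose inv (h : gT) : nat -> 'Z_k := xget (fun=> 0) [set a | fin a /\ f a = h].
have invP h : h \in G -> fin (inv h) /\ f (inv h) = h.
  by move=> /f3[a fa e]; exact: (@xgetI _ (fun=> 0) [set a | fin a /\ f a = h] a (conj fa e)).
exists (fun i => f (delta i)), (fun j h => inv h j); split.
- by move=> i; exact: f1 (finE i).
- move=> j g h gG hG; have [ig eg] := invP g gG; have [ih eh] := invP h hG.
  have ghG : (g * h)%g \in G by exact: gpredM.
  have [igh egh] := invP _ ghG.
  have -> : inv (g * h)%g = (fun n => inv g n + inv h n).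
    by apply: f2; rewrite ?inE //; [exact: finD|rewrite fD // egh eg eh].
  by [].
- move=> i j; have [ii ei] := invP _ (f1 _ (finE i)).
  have -> : inv (f (delta i)) = delta i by apply: f2; rewrite ?inE //; exact: finE.
  by rewrite /delta eq_sym.
Qed.
End ZkSum.

Section UniversalLift.
Variables (R : realType) (k : nat).
Local Notation C := (R[i]^o).
Local Notation HH := (upper_half_plane R).
Variables (S : surface R) (H : groupClosed (selfbij S)) (Gamma : groupClosed (selfbij HH)).
Variables (WS : S -> C) (WH : HH -> C).
Local Notation N := (commutator_power_subgroup k Gamma).
Local Notation T := (quotient_surface N).
Local Notation qT := (orbit_proj N).
Hypothesis RS : riemann_surface S.
Hypothesis Hcont : forall h, h \in H -> continuous h.
Hypothesis GP : [set` Gamma] `<=` @PSL2 R.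
Hypothesis WS_fibre : forall x x', WS x = WS x' <-> exists2 h, h \in H & h x = x'.
Hypothesis WH_fibre : forall z z', WH z = WH z' <-> exists2 g, g \in Gamma & g z = z'.
Hypothesis S_model : forall x, exists (s : C -> S) (r : R) n, model WS x s r n.
Hypothesis H_model : forall z, exists (s : C -> HH) (r : R) n, model WH z s r n.
Hypothesis WH_hol : forall z, hol_rel (chartH R) WH z.
Hypothesis Nfree : forall g z, g \in N -> g z = z -> g = 1%g.
Hypothesis Hab : forall g h, g \in H -> h \in H -> (g * h = h * g)%g.
Hypothesis Hk : forall h, h \in H -> (h ^+ k = 1)%g.
Variables (J : groupClosed (selfbij S)) (f : T -> quotient_surface J).
Hypothesis JH : {subset J <= H}.
Hypothesis Jfree : acts_freely J.
Hypothesis fB : biholomorphism f.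
Hypothesis fconj : conj_group f [set` factor_closed Gamma N] = factor_group H J.
Local Notation qJ := (orbit_proj J).

Let NG g : g \in N -> g \in Gamma. Proof. exact: commutator_power_sub. Qed.
Let Nnorm g h : g \in Gamma -> h \in N -> (g * h * g^-1)%g \in N. Proof. exact: commutator_power_norm. Qed.
Let Gcont g : g \in Gamma -> continuous g. Proof. by move=> /GP; exact: PSL2_cont. Qed.
Let Jcont j : j \in J -> continuous j. Proof. by move=> /JH/Hcont. Qed.
Let WSH h : h \in H -> forall x, WS (h x) = WS x.
Proof. by move=> hH x; apply/esym/WS_fibre; exists h. Qed.
Let Htr x x' : WS x = WS x' -> exists2 h, h \in H & h x = x'. Proof. by move/WS_fibre. Qed.
Let hausS : hausdorff_space S. Proof. by case: RS. Qed.
Let connS : connected [set: S]. Proof. by case: RS. Qed.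
Let atlasS c : atlas S c -> is_chart c. Proof. by case: RS => _ _ + _ _; apply. Qed.
Let f_cont : continuous f. Proof. by case: fB => -[]. Qed.
Let f_inj : injective f. Proof. by case: fB => _ [g [gK _ _]]; exact: can_inj gK. Qed.
Let f_surj y : exists t, f t = y. Proof. by case: fB => _ [g [_ gK _]]; exists (g y). Qed.
Let f_open (U : set T) : open U -> open (f @` U).
Proof.
case: fB => _ [g [fK gK [gc _]]] oU; have -> : f @` U = g @^-1` U.
  by apply/seteqP; split=> [_ [t Ut <-]|y Uy]; [rewrite /= fK|exists (g y)].
by move/continuousP: gc; apply.
Qed.
Let q_cont : continuous (qT : HH -> T). Proof. exact: orbit_proj_cont. Qed.
Let qJ_cont : continuous (qJ : S -> quotient_surface J). Proof. exact: orbit_proj_cont. Qed.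

(** J acts freely, so the projection to S / J is a covering even where S is
    branched over the base. *)
Lemma proj_injective x : exists V : set S, [/\ open V, V x & forall a b, V a -> V b -> qJ a = qJ b -> a = b].
Proof.
have [s [r [n [M _ _]]]] := S_model x; have [[r0 n0] [s0 sinj] sc sO sW] := M.
exists (s @` disc 0 r); split.
- by apply: sO => //; exact: open_disc.
- by exists 0 => //; exact: disc_center.
move=> _ _ [v vr <-] [v' v'r <-] /(@orbit_projP R S J _ _)[j jJ e].
have jx := wmodel_meet hausS Hcont WSH Htr M (JH jJ) vr v'r e.
by rewrite -e (Jfree jJ jx).
Qed.

Let Js : set (S -> S) := [set h : S -> S | exists2 j : selfbij S, j \in J & h = bij_fun j].
Let Js_cont h : Js h -> continuous h. Proof. by move=> [j /Jcont jc ->]. Qed.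
Let Js_q h : Js h -> forall x, qJ (h x) = qJ x. Proof. by move=> [j jJ ->] x; exact: orbit_projN. Qed.
Let Js_tr x x' : qJ x = qJ x' -> exists2 h, Js h & h x = x'.
Proof. by move=> /(@orbit_projP R S J _ _)[j jJ e]; exists j => //; exists j. Qed.
Let dE : discreteC (@halfplane R) (set0 : set C). Proof. by move=> z _; exists 1. Qed.
Let Psi (z : C) : quotient_surface J := f (qT (eta z)).
Let linj (z : C) (x : S) : halfplane z -> ~ (set0 : set C) z -> qJ x = Psi z ->
  exists2 U, nbhs x U & forall a b, U a -> U b -> qJ a = qJ b -> a = b.
Proof. by move=> _ _ _; have [V [oV Vx Vi]] := proj_injective x; exists V => //; exact: open_nbhs_nbhs. Qed.

(** The projection from S to S / J has no branch points, so [lift_star]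
    applies with an empty exceptional set. *)
Theorem universal_lift : exists2 E : HH -> S, continuous E & forall z, qJ (E z) = f (qT z).
Proof.
have loc z : halfplane z -> exists2 e : R, 0 < e & exists g, lift_on (qJ : S -> quotient_surface J) Psi g (disc z e).
  move=> hz; have [x ex] := orbit_proj_surj (Psi z); have [V [oV Vx Vi]] := proj_injective x.
  pose sg y := xget x [set x' | V x' /\ qJ x' = y].
  have sgP y : (qJ @` V) y -> V (sg y) /\ qJ (sg y) = y.
    by move=> [x' Vx' e]; exact: (@xgetI _ x [set x' | V x' /\ qJ x' = y] x' (conj Vx' e)).
  have sg_cont y : (qJ @` V) y -> continuous_at (y : quotient_surface J) sg.
    move=> Vy; have [V1 e1] := sgP y Vy; move=> P nP.
    have : nbhs (qJ (sg y) : quotient_surface J) (qJ @` (P `&` V)).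
      by apply: (orbit_proj_nbhs Jcont); apply: filterI => //; exact: open_nbhs_nbhs.
    rewrite e1; apply: filterS => _ [u [Pu Vu] <-] /=.
    have [V2 e2] := sgP (qJ u) (ex_intro2 _ _ u Vu erefl).
    by rewrite (Vi _ _ V2 Vu e2).
  have oqV : open (qJ @` V : set (quotient_surface J)) by exact: (orbit_proj_open Jcont).
  have Pc u : halfplane u -> continuous_at u Psi.
    move=> hu; apply: (@continuous_comp _ _ _ (@eta R) (f \o qT)); first exact: eta_cont.
    by apply: continuous_comp; [exact: q_cont|exact: f_cont].
  have nz : nbhs (Psi z) (qJ @` V) by apply: open_nbhs_nbhs; split=> //; exists x.
  have /nbhsC[e e0 he] := Pc z hz _ nz.
  have [hal h0 hc] := (openC _).1 (@halfplane_open R) z hz.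
  exists (Num.min e hal); first by rewrite lt_min e0.
  exists (sg \o Psi) => u; rewrite /disc /= lt_min => /andP[/he Vu /hc hu].
  split; last by have [] := sgP _ Vu.
  by apply: continuous_comp; [exact: Pc|exact: sg_cont].
have [e e0 [f0 f0P]] := loc _ (@halfplane_i R).
have [g [gP _]] := lift_star hausS Js_cont Js_q Js_tr dE linj (@halfplane_open R)
  (halfplane_convex (@halfplane_i R)) loc e0 f0P.
exists (g \o set_val) => [z|z]; last by rewrite /= (gP _ (HH_val z)).2 /Psi eta_val.
by apply: continuous_comp; [exact: HH_val_cont|exact: (gP _ (HH_val z)).1].
Qed.

Section WithLift.
Variable E : HH -> S.
Hypothesis Ec : continuous E.
Hypothesis Eq : forall z, qJ (E z) = f (qT z).

(** The element of Gamma / Gamma_k induced by g corresponds under f to the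
    action on S / J of some h in H; up to an element of J, E o g and h o E
    then agree at one point, hence everywhere. *)
Lemma lift_equivariant g : g \in Gamma -> exists2 h, h \in H & forall z, E (g z) = h (E z).
Proof.
move=> gG; have [b bG bP] := T_lift_bij Nnorm gG; have [fi [fK fiK _]] := fB.2.
have cK : cancel (f \o b \o fi) (f \o bij_inv b \o fi) by move=> y; rewrite /= fK bij_funK fiK.
have cK' : cancel (f \o bij_inv b \o fi) (f \o b \o fi) by move=> y; rewrite /= fK bij_invK fiK.
pose b' : selfbij (quotient_surface J) := SelfBij cK cK'.
have : conj_group f [set` factor_closed Gamma N] b' by exists b => // t; rewrite /= fK.
rewrite fconj => -[h hH hP].
have base z : qJ (h (E z)) = qJ (E (g z)).
  by rewrite -hP Eq Eq -bP /= fK.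
have [j [j' jJ ->] ej] := Js_tr (base (HHi R)).
exists (j' * h)%g; first by apply: gpredM => //; exact: JH.
have l (F : HH -> S) : continuous F -> (forall z, qJ (F z) = qJ (E (g z))) ->
    lift_on (qJ : S -> quotient_surface J) (fun u => qJ (E (g (eta u)))) (F \o @eta R) (@halfplane R).
  by move=> Fc FP u hu; split; [apply: continuous_comp; [exact: eta_cont|exact: Fc]|rewrite /= FP].
have li (z : C) (x : S) : halfplane z -> ~ (set0 : set C) z -> qJ x = qJ (E (g (eta z))) ->
    exists2 U, nbhs x U & forall a b, U a -> U b -> qJ a = qJ b -> a = b.
  by move=> _ _ _; have [V [oV Vx Vi]] := proj_injective x; exists V => //; exact: open_nbhs_nbhs.
have c1 : continuous (E \o g) by move=> z; apply: continuous_comp; [exact: Gcont|exact: Ec].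
have c2 : continuous ((j' * h)%g \o E).
  by move=> z; apply: continuous_comp; [exact: Ec|apply: Hcont; apply: gpredM => //; exact: JH].
have q2 z : qJ (((j' * h)%g \o E) z) = qJ (E (g z)).
  by change (qJ (j' (h (E z))) = qJ (E (g z))); rewrite orbit_projN.
have e0 : ((E \o g) \o @eta R) (set_val (HHi R)) = (((j' * h)%g \o E) \o @eta R) (set_val (HHi R)).
  by change (E (g (eta (set_val (HHi R)))) = j' (h (E (eta (set_val (HHi R)))))); rewrite eta_val ej.
move=> z; have := lift_eq hausS dE li (@halfplane_open R) (@halfplane_convex R) (@subset_refl _ _)
  (l _ c1 (fun=> erefl)) (l _ c2 q2) (HH_val (HHi R)) (fun h => h) e0 (HH_val z).
by rewrite /= eta_val.
Qed.

(** E is constant on orbits of Gamma_k because it is equivariant; conversely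
    f is injective. *)
Lemma lift_kernel z z' : E z = E z' <-> qT z = qT z'.
Proof.
split=> [e|/(@orbit_projP R HH N _ _)[g gN <-]]; first by apply: f_inj; rewrite -!Eq e.
by rewrite (commutator_power_invariant Hab Hk lift_equivariant).
Qed.

Lemma lift_local_open (z : HH) (U : set HH) : nbhs z U -> nbhs (E z) (E @` U).
Proof.
move=> nU; have [V [oV Vx Vi]] := proj_injective (E z).
have nUV : nbhs z (U `&` E @^-1` V) by apply: filterI => //; apply: Ec; exact: open_nbhs_nbhs.
have [U0 [oU0 Uz] UU] : exists2 U0, open_nbhs z U0 & U0 `<=` U `&` E @^-1` V by move: nUV; rewrite nbhsE.
have o1 : open (f @` (qT @` U0)) by apply: f_open; apply: orbit_proj_open => // g /NG/Gcont.
have : nbhs (E z) (V `&` qJ @^-1` (f @` (qT @` U0))).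
  apply: filterI; first exact: open_nbhs_nbhs.
  apply: qJ_cont; apply: open_nbhs_nbhs; split=> //.
  by exists (qT z); [exists z|rewrite Eq].
apply: filterS => y [Vy [_ [u U0u <-] e]]; have [Uu Vu] := UU _ U0u.
by exists u => //; apply: Vi => //; rewrite Eq e.
Qed.

(** The translates of the image of E by J cover S and are open. If the image
    and its translate by j meet, then j fixes a point by [lift_kernel], so
    j = 1. By connectedness the image is everything. *)
Theorem universal_lift_surj x : exists z, E z = x.
Proof.
apply: (@connected_locally S (fun x => exists z, E z = x) connS _ (E (HHi R))); last by exists (HHi R).
move=> {}x; have nT (z : HH) : nbhs (E z) (E @` setT) by apply: lift_local_open; exact: filterT.
have [Qx|nQ] := pselect (exists z, E z = x).
  have [z ez] := Qx; exists (E @` setT); first by rewrite -ez.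
  by move=> y [z' _ e]; split=> // _; exists z'.
have [t et] := f_surj (qJ x); have [z ez] := orbit_proj_surj t.
have [j' [j jJ ->] ej] : exists2 h, Js h & h (E z) = x by apply: Js_tr; rewrite Eq ez et.
have jV : j^-1%g \in J by rewrite gpredV.
exists (bij_inv j @^-1` (E @` setT)).
  have ch : continuous_at x (bij_inv j) by exact: (Jcont jV).
  by apply: ch; rewrite -ej bij_funK.
move=> y [z1 _ e1]; split=> // -[z2 e2]; exfalso; apply: nQ.
have hy : j (E z1) = E z2 by rewrite e1 bij_invK.
have e12 : E z1 = E z2.
  by apply/lift_kernel; apply: f_inj; rewrite -!Eq -hy orbit_projN.
have j1 : j = 1%g by apply: (Jfree jJ (x := E z1)); rewrite hy e12.
by exists z; rewrite -ej j1.
Qed.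

(** The projection to S / J is locally injective, so a chart of S / J pulls
    back to a chart of S, in which E is the composite of f and the projection
    of the half-plane. *)
Lemma lift_hol d z : atlas S d -> chart_dom d (E z) -> hol_rel (chartH R) (d \o E) z.
Proof.
move=> ad dEz; have [c [d' [ac [cd' hd'] cz dz cd]]] := fB.1.2 (qT z).
have [[oc _ _ _] _] := ac; have [od' d'i _ _] := cd'; have cd0 := atlasS ad; have [od _ _ _] := cd0.
have h1 := atlasT_hol ac cz.
have h2 : hol_rel c (d' \o f) (qT z).
  apply: (through_hol_rel _ _ cz cd) => //; apply: openI => //.
  by move/continuousP: f_cont; apply.
have h3 : hol_rel (chartH R) ((d' \o f) \o qT) z by apply: hol_rel_map h1 h2; exact: q_cont.
have [V [oV Vx Vi]] := proj_injective (E z).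
have oq : open (qJ @^-1` chart_dom d') by move/continuousP: qJ_cont; apply.
pose cJ : chart R S := Chart (V `&` (qJ @^-1` chart_dom d' `&` chart_dom d)) (d' \o qJ).
have oD : open (chart_dom cJ) by apply: openI => //; exact: openI.
have DEz : chart_dom cJ (E z) by split=> //; split=> //=; rewrite Eq.
have dJ y : chart_dom cJ y -> hol_rel d cJ y.
  by move=> [Vy [d'y dy]]; apply: (through_hol_rel _ _ dy (hd' d ad)); [exact: openI|].
have cJc : is_chart cJ.
  apply: is_chart_of_hol => // [y y' /set_mem[Vy [dy _]] /set_mem[Vy' [dy' _]] e|y Dy].
    by apply: Vi => //; apply: d'i => //; rewrite inE.
  exists d, (chart_dom cJ); split=> // [y' [_ []]|y' Dy'] //.
  by split=> //; exact: dJ.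
have h4 : hol_rel cJ d (E z).
  by apply: (hol_rel_inv cd0 cJc oD DEz) => // y [_ []].
have h5 : hol_rel (chartH R) (cJ \o E) z.
  by apply: (hol_rel_eq _ h3) => y; rewrite /= Eq.
by apply: (hol_rel_map _ h5 h4); exact: Ec.
Qed.

(** E induces a bijection from T to S, holomorphic both ways. As E is onto,
    its image meets its translates by J, so J is trivial; conjugation by f is
    then conjugation by the inverse of the induced bijection. *)
Theorem universal_isomorphism : exists2 phi : S -> T, biholomorphism phi &
  conj_group phi [set` H] = factor_group Gamma N.
Proof.
have [_ _ _ covS _] := RS.
have TR := T_riemann GP NG Nfree WH_fibre H_model WH_hol; have [_ _ caT covT cpT] := TR.
have [Eb EbE] : exists F : T -> S, forall z, F (qT z) = E z.
  by apply: orbit_factor => g z gN; apply/lift_kernel; exact: orbit_projN.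
have Ebc : continuous Eb by apply: (@orbit_factor_cont R HH N S E Eb EbE).
have /choice[pre preP] x : exists z, E z = x by exact: universal_lift_surj.
pose phi x : T := qT (pre x).
have phiE z : phi (E z) = qT z by apply/lift_kernel; exact: preP.
have phiK : cancel phi Eb by move=> x; rewrite EbE preP.
have EbK : cancel Eb phi by move=> t; have [z <-] := orbit_proj_surj t; rewrite EbE phiE.
have phic : continuous phi.
  move=> x P nP; rewrite -(preP x) phiE in nP *.
  apply: filterS (lift_local_open (q_cont nP)) => _ [u Pu <-].
  by rewrite /= phiE.
have Ebh : holomorphic Eb.
  apply: (T_holomorphic GP NG Nfree WH_fibre H_model WH_hol Ebc covS) => [d /atlasS[]//|d z ad dz].
  rewrite EbE in dz; apply: (hol_rel_eq _ (lift_hol ad dz)) => y.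
  by rewrite /= EbE.
have phih : holomorphic phi.
  split=> // x; have [d ad dx] := covS x; have [c ac cx] := covT (phi x).
  have cd0 := atlasS ad; have [od di _ _] := cd0; have cc0 := caT c ac; have [oc _ _ _] := cc0.
  exists d, c; split=> //; apply: hol_rel_through => //.
    by apply: openI => //; move/continuousP: phic; apply.
  move=> y [dy cy].
  pose cE : chart R T := Chart (chart_dom c `&` Eb @^-1` chart_dom d) (d \o Eb).
  have oD : open (chart_dom cE) by apply: openI => //; move/continuousP: Ebc; apply.
  have Dy : chart_dom cE (phi y) by split=> //=; rewrite phiK.
  have hD t : chart_dom cE t -> hol_rel c cE t.
    have [z <-] := orbit_proj_surj t => -[cz dz]; rewrite /= EbE in dz.
    apply: (T_hol_rel GP NG Nfree WH_fibre H_model ac cz).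
    by apply: (hol_rel_eq _ (lift_hol ad dz)) => u; rewrite /= EbE.
  have cEc : is_chart cE.
    apply: is_chart_of_hol => // [t t' /set_mem[_ dt] /set_mem[_ dt'] e|t Dt].
      by apply: (can_inj EbK); apply: di => //; rewrite inE.
    by exists c, (chart_dom cE); split=> // [t' []|t' Dt'] //; split=> //; exact: hD.
  have [_ [F Fd FP]] : hol_rel cE c (phi y).
    by apply: (hol_rel_inv cc0 cEc oD Dy) => // t [].
  split=> //; exists F; first by rewrite -[y in d y]phiK.
  have h : nbhs y (phi @^-1` [set t | c t = F (cE t)]) by apply: phic; exact: FP.
  by apply: filterS h => y' /= ->; rewrite phiK.
exists phi; first by split=> //; exists Eb.
have jtriv j : j \in J -> j = 1%g.
  move=> jJ; have [z ez] := universal_lift_surj (j (E (HHi R))).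
  apply: (Jfree jJ (x := E (HHi R))); rewrite -ez; apply/lift_kernel; apply: f_inj.
  by rewrite -!Eq ez orbit_projN.
have qJi x y : qJ x = qJ y -> x = y by move=> /(@orbit_projP R S J _ _)[j /jtriv -> <-].
apply/seteqP; split=> [b [h hH hP]|b [g gG gP]]; last first.
  have [h hH hE] := lift_equivariant gG; exists h => // x.
  by rewrite -(preP x) phiE gP -phiE hE.
have [||bJ bJP] := @quotient_bij R S J h.
- by move=> j /jtriv ->; rewrite mulg1 mulgV; exact: gpred1.
- by move=> j /jtriv ->; rewrite mulg1 mulVg; exact: gpred1.
have : factor_group H J bJ by exists h.
rewrite -fconj => -[a /factor_closedP[g gG ga] aP].
exists g => // z; rewrite -phiE hP -phiE; congr phi; apply: qJi.
by rewrite -bJP !Eq aP ga.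
Qed.
End WithLift.
End UniversalLift.

Theorem theorem4 (R : realType) (k : nat) (hk : (2 <= k)%N)
    (S : surface R) (H : groupClosed (selfbij S))
    (hSH : generalized_fermat_pair k H)
    (Gamma : groupClosed (selfbij (upper_half_plane R)))
    (hGamma : fuchsian Gamma)
    (hquot : orbifold_isomorphic Gamma H) :
  exists2 phi : S -> quotient_surface (commutator_power_subgroup k Gamma),
    biholomorphism phi &
    conj_group phi [set` H]%classic =
      factor_group Gamma (commutator_power_subgroup k Gamma).
Proof.
have [RS _ [B [[_ _ [c0 Bc0] _] [Haut HZ [p [pG pB pk]]] maxi]]] := hSH.
have [psi psiB psistab] := hquot; have [GP _] := hGamma.
have [Hab Hk [gaH [chiH [gaHP chiHP dualH]]]] := Zk_sum_facts hk HZ.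
pose W1 := WS c0 p; pose W2 := WH psi Bc0 pG.
have Hcont := HcontS Haut.
have WSf : forall x x', W1 x = W1 x' <-> exists2 h, h \in H & h x = x' by exact: (WS_fibre Bc0 pG).
have WHf : forall z z', W2 z = W2 z' <-> exists2 g, g \in Gamma & g z = z' by exact: (WH_fibre Bc0 pG psiB).
have oH : forall z, exists x, W1 x = W2 z by exact: over_H.
have oS : forall x, exists z, W2 z = W1 x by exact: (over_S Bc0 pG psiB).
have mS : forall x, exists (s : R[i]^o -> S) (r : R) n, model W1 x s r n by exact: (S_model hk RS Bc0 pG pB pk).
have mH : forall z, exists (s : R[i]^o -> upper_half_plane R) (r : R) n, model W2 z s r n.
  exact: (H_model hk RS Bc0 pG pB pk GP psiB).
have hH : forall z, hol_rel (chartH R) W2 z by exact: (WH_hol hk RS Bc0 pG pB pk psiB).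
have stb z x : W2 z = W1 x -> (stabilizer Gamma z #= stabilizer H x)%card.
  by move=> /(WHS psi Bc0 pG); exact: psistab.
have [F Fc FW] := lift_exists RS Hcont GP WSf WHf oH mS mH stb.
pose N := commutator_power_subgroup k Gamma.
have NG g : g \in N -> g \in Gamma by exact: commutator_power_sub.
have Nn g h : g \in Gamma -> h \in N -> (g * h * g^-1)%g \in N by exact: commutator_power_norm.
have eqvF := deck_image RS Hcont GP WSf WHf mS mH stb Fc FW.
have Nfree g z : g \in N -> g z = z -> g = 1%g.
  move=> gN; apply: (kernel_free RS Hcont GP WSf WHf mS mH stb Fc FW (NG g gN)).
  exact: (commutator_power_invariant Hab Hk eqvF gN).
have degree z (s : R[i]^o -> upper_half_plane R) (r : R) n : model W2 z s r n ->
    (B (set_val (p (F z))) /\ n = k) \/ (~ B (set_val (p (F z))) /\ n = 1%N).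
  move=> [M _ _]; have [s' [r' [n' [M' h]]]] := S_wmodel hk Bc0 pG pB pk (F z).
  by rewrite (same_degree RS Hcont GP WSf WHf mS mH stb (esym (FW z)) M M').
have deg z (s : R[i]^o -> upper_half_plane R) (r : R) n : model W2 z s r n -> n = 1%N \/ n = k.
  by move=> /degree[[_ ->]|[_ ->]]; [right|left].
have [zr rzr] := regular_exists GP WHf mH.
pose G := factor_closed Gamma N.
have fermatT : fermat_covering k B G.
  split; first exact: (T_aut GP NG Nfree WHf mH hH).
  (* pi is the projection from Gamma to its quotient, th the homomorphism
     to H *)
  - have /choice[pi piP] (g : selfbij (upper_half_plane R)) : exists b : selfbij (quotient_surface N),
        g \in Gamma -> b \in G /\ forall z, b (orbit_proj N z) = orbit_proj N (g z).
      case: (boolP (g \in Gamma)) => [gG|_]; last by exists 1%g.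
      by have [b bG bP] := T_lift_bij Nn gG; exists b.
    have /choice[th thP] (g : selfbij (upper_half_plane R)) : exists h : selfbij S,
        g \in Gamma -> h \in H /\ forall z, F (g z) = h (F z).
      case: (boolP (g \in Gamma)) => [gG|_]; last by exists 1%g.
      by have [h hH' hP] := eqvF g gG; exists h.
    have ext (b b' : selfbij (quotient_surface N)) : (forall z, b (orbit_proj N z) = b' (orbit_proj N z)) -> b = b'.
      by move=> e; apply: bijP => t; have [z <-] := orbit_proj_surj t.
    have commN g h : g \in Gamma -> h \in Gamma -> forall z, orbit_proj N (g (h z)) = orbit_proj N (h (g z)).
      move=> gG hG z; apply/orbit_projE; exists [~ g^-1, h^-1]%g^-1%g.
        by rewrite gpredV; apply: commutator_in; rewrite gpredV.
      have -> : ([~ g^-1, h^-1]^-1 = h * g * h^-1 * g^-1)%g.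
        by rewrite /commg /conjg !invgM !invgK ?mulgA.
      by change (h (g (bij_inv h (bij_inv g (g (h z))))) = h (g z)); rewrite !bij_funK.
    have powN g m z : g \in Gamma -> (pi g ^+ m)%g (orbit_proj N z) = orbit_proj N ((g ^+ m)%g z).
      move=> gG; elim: m z => [//|m IH] z; rewrite !expgS.
      change (pi g ((pi g ^+ m)%g (orbit_proj N z)) = orbit_proj N (g ((g ^+ m)%g z))).
      by rewrite IH (piP g gG).2.
    have onto b : b \in G -> exists2 g, g \in Gamma & pi g = b.
      move=> /factor_closedP[g gG gb]; exists g => //; apply: ext => z.
      by rewrite (piP g gG).2 gb.
    apply: (@free_quotient _ _ k Gamma G pi hk _ _ onto).
    + move=> g h gG hG; apply: ext => z; have ghG : (g * h)%g \in Gamma by exact: gpredM.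
      rewrite (piP _ ghG).2.
      by change (orbit_proj N (g (h z)) = pi g (pi h (orbit_proj N z))); rewrite (piP h hG).2 (piP g gG).2.
    + by move=> g gG; exact: (piP g gG).1.
    + move=> g gG pg; have e : orbit_proj N zr = orbit_proj N (g zr) by rewrite -(piP g gG).2 pg.
      have [h hN hz] := orbit_projP e; suff -> : g = h by [].
      have hG := NG h hN; have : (h^-1 * g)%g = 1%g.
        apply: rzr; first by apply: gpredM => //; rewrite gpredV.
        by change (bij_inv h (g zr) = zr); rewrite -hz bij_funK.
      by move/(congr1 (fun x => h * x)%g); rewrite mulVKg mulg1.
    + move=> _ _ /onto[g gG <-] /onto[h hG <-]; apply: ext => z.
      change (pi g (pi h (orbit_proj N z)) = pi h (pi g (orbit_proj N z))).
      by rewrite (piP h hG).2 !(piP g gG).2 (piP h hG).2 commN.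
    + move=> _ /onto[g gG <-]; apply: ext => z; rewrite powN //.
      by apply: orbit_projN; exact: power_in.
    + exact: (countable_deck GP WHf mH).
    + by move=> A theta a q; exact: (divisible_of_characters hk GP WHf mH hH deg).
    + have /choice[ga gaP] i : exists g, g \in Gamma /\ forall z, F (g z) = gaH i (F z).
        by have [g gG gE] := deck_onto RS Hcont GP WSf WHf oS mS mH stb Fc FW (gaHP i); exists g.
      have thM g h : g \in Gamma -> h \in Gamma -> th (g * h)%g = (th g * th h)%g.
        move=> gG hG; have ghG : (g * h)%g \in Gamma by exact: gpredM.
        have [tg eg] := thP g gG; have [tt et] := thP h hG; have [tgh egh] := thP _ ghG.
        apply: (deck_unique RS Hcont GP WSf WHf mS mH stb FW rzr) => //; first exact: gpredM.
        rewrite -egh; change (F (g (h zr)) = th g (th h (F zr))).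
        by rewrite eg et.
      exists ga, (fun j g => chiH j (th g)); split.
      * by move=> i; have [] := gaP i.
      * by move=> j g h gG hG; rewrite thM // chiHP //; [exact: (thP g gG).1|exact: (thP h hG).1].
      * move=> i j; have [giG gie] := gaP i; have [tg eg] := thP _ giG.
        rewrite -dualH; congr (chiH j _).
        by apply: (deck_unique RS Hcont GP WSf WHf mS mH stb FW rzr) => //; rewrite -eg gie.
  - have PW z : planeY c0 (p (F z)) = W2 z by exact: FW.
    have ch := Y_charts pG.
    have [[[pc _] ps _] _ _] := pG.
    have Pc : continuous (p \o F) by move=> z; apply: continuous_comp; [exact: Fc|exact: pc].
    have Psurj y : exists z, (p \o F) z = y.
      have [x _ <-] := ps y I; have [z <-] := lift_surj RS Hcont GP WSf WHf oS mS mH stb Fc FW x.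
      by exists z.
    have degB z s r n : model W2 z s r n -> B (set_val ((p \o F) z)) -> n = k by move=> /degree[[]|[]].
    have degN z s r n : model W2 z s r n -> ~ B (set_val ((p \o F) z)) -> n = 1%N by move=> /degree[[]|[]].
    exists (pT NG WHf (P := p \o F) Bc0 PW); split.
    + exact: (pT_galois GP NG Nn Nfree WHf mH hH Bc0 ch Pc Psurj PW).
    + exact: (pT_branch_values GP NG Nn Nfree WHf mH hH hk Bc0 ch Psurj PW degB degN).
    + by move=> t; exact: (pT_degree GP Nfree mH hH ch degB).
have RT := T_riemann GP NG Nfree WHf mH hH.
have [J [JH Jfree [f fB fconj]]] := maxi _ G RT fermatT.
have [E Ec Eq] := universal_lift RS Hcont WSf mS JH Jfree fB.
exact: (universal_isomorphism RS Hcont GP WSf WHf mS mH hH Nfree Hab Hk JH Jfree fB fconj Ec Eq).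
Qed.
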